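(* Let $R$ be a local complete intersection ring of codimension $c$, and let $M$ and $N$ be nonzero finitely generated $R$-modules. Let $n$ be a nonnegative integer and assume that $M\otimes_{R}N$ satisfies Serre's condition $(S_{n+c})$ (equivalently, $M\otimes_{R}N$ is an $(n+c)$th syzygy of some finitely generated $R$-module). If $\operatorname{Tor}^{R}_{i}(M,N)=0$ for all $i>0$, then both $M$ and $N$ satisfy $(S_{n})$.
   Context: A local ring is a commutative Noetherian ring $R$ with a unique maximal ideal $\mathfrak{m}$ and residue field $k=R/\mathfrak{m}$. $R$ is a (local) complete intersection if the defining ideal of some (equivalently every) Cohen presentation of the $\mathfrak{m}$-adic completion $\widehat{R}$ can be generated by a regular sequence; that is, $\widehat{R}\cong Q/(\underline{x})$ where $\underline{x}$ is a $Q$-regular sequence and $Q$ is a ring of formal power series over $k$ or over a complete discrete valuation ring with residue field $k$. The codimension of $R$ is the nonnegative integer $\dim_k(\mathfrak{m}/\mathfrak{m}^2)-\dim(R)$. A finitely generated $R$-module $M$ satisfies Serre's condition $(S_n)$ if $\operatorname{depth}_{R_p}(M_p)\geq\min\{n,\operatorname{height}(p)\}$ for all $p\in\operatorname{Supp}(M)$, where $\operatorname{height}(p)$ is the height of $p$ in $R$. (Convention: $\operatorname{depth}(0)=\infty$.) A finitely generated module $X$ is an $m$th syzygy of some finitely generated module if there is an exact sequence $0\to X\to F_{m-1}\to\cdots\to F_0$ with each $F_i$ a finitely generated free $R$-module (no condition if $m=0$). *)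

(* Defs.v *)
From HB Require Import structures.
From mathcomp Require Import all_boot all_order all_algebra.
From mathcomp Require Import boolp classical_sets functions.
From mathcomp Require Import ring.

Set Implicit Arguments.
Unset Strict Implicit.
Unset Printing Implicit Defensive.

Import GRing.Theory.
Local Open Scope quotient_scope.
Local Open Scope classical_set_scope.
Local Open Scope ring_scope.

(* Rings are [comPzRingType]s, i.e. commutative rings in which 1 = 0 is not
   excluded, so that quotients and localizations are total constructions;
   local rings are nonzero because their maximal ideal is proper. *)

(* N together with infinity, the latter being None *)
Definition enat := option nat.

Definition ele (x y : enat) : bool :=
  match x, y with
  | _, None => true
  | None, Some _ => false
  | Some a, Some b => (a <= b)%N
  end.

Definition emin (x y : enat) : enat := if ele x y then x else y.

Definition is_nsup (P : set nat) (b : nat) : Prop :=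
  (forall k, P k -> (k <= b)%N) /\
  (forall b', (forall k, P k -> (k <= b')%N) -> (b <= b')%N).

Definition nsup (P : set nat) : enat :=
  if pselect (exists b, is_nsup P b) is left h then Some (projT1 (cid h))
  else None.

Section Ideals.
Variable R : comPzRingType.
Implicit Types (I J : set R) (M : lmodType R).

Definition is_ideal I : Prop :=
  [/\ I 0, forall x y, I x -> I y -> I (x + y) & forall a x, I x -> I (a * x)].

Definition is_prime I : Prop :=
  [/\ is_ideal I, ~ I 1 & forall x y, I (x * y) -> I x \/ I y].

Definition is_maximal I : Prop :=
  [/\ is_ideal I, ~ I 1 & forall J, is_ideal J -> ~ J 1 -> I `<=` J -> J = I].

Record prime_ideal := PrimeIdeal {
  prime_set :> set R;
  prime_setP : is_prime prime_set }.

(* [smul I M] is the submodule (I)M of M; the set I need not be an ideal. *)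
Definition smul I M : set M :=
  [set y | exists2 s : seq (R * M), (forall t, t \in s -> I t.1) &
             y = \sum_(t <- s) t.1 *: t.2].
Arguments smul I M : clear implicits.

Definition ideal_gen I : set R := smul I R^o.

(* I^k is generated by the k-fold products of elements of I; I^0 = R. *)
Definition ideal_exp I (k : nat) : set R :=
  ideal_gen [set x | exists s : seq R,
    [/\ size s = k, forall a, a \in s -> I a & x = \prod_(a <- s) a]].

Definition seq_set (x : seq R) : set R := [set a | a \in x].

Definition noetherian : Prop :=
  forall I, is_ideal I -> exists x : seq R, I = ideal_gen (seq_set x).

Definition local_ring (m : set R) : Prop :=
  [/\ noetherian, is_maximal m & forall m', is_maximal m' -> m' = m].

(* A chain of length l has the l + 1 members c 0, ..., c l; the other values
   of c are irrelevant. *)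
Definition prime_chain (c : nat -> prime_ideal) (l : nat) : Prop :=
  forall i, (i < l)%N -> c i `<` c i.+1.

Definition height (p : prime_ideal) : enat :=
  nsup [set l | exists2 c, prime_chain c l & prime_set (c l) = p].

Definition krull_dim : enat :=
  nsup [set l | exists c, prime_chain c l].

(* dim_k (m / m^2) = e, for k = R / m: the classes of x_1, ..., x_e are
   a k-basis of m / m^2. *)
Definition embdim_eq (m : set R) (e : nat) : Prop :=
  exists x : 'I_e -> R,
  [/\ forall i, m (x i),
      forall y, m y ->
        exists a : 'I_e -> R, ideal_exp m 2 (y - \sum_i a i * x i) &
      forall a : 'I_e -> R, ideal_exp m 2 (\sum_i a i * x i) ->
        forall i, m (a i)].

Definition codim_eq (m : set R) (c : nat) : Prop :=
  exists e d, [/\ embdim_eq m e, krull_dim = Some d & e = (c + d)%N].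

Lemma smulD I M (x y : M) : smul I M x -> smul I M y -> smul I M (x + y).
Proof.
move=> [s sI ->] [t tI ->]; exists (s ++ t); last by rewrite big_cat.
by move=> u; rewrite mem_cat => /orP[/sI|/tI].
Qed.

Lemma smulZ I M a (x : M) : smul I M x -> smul I M (a *: x).
Proof.
move=> [s sI ->]; exists [seq (t.1, a *: t.2) | t <- s].
  by move=> _ /mapP[t /sI tI ->].
rewrite big_map scaler_sumr; apply: eq_bigr => t _ /=.
by rewrite !scalerA mulrC.
Qed.

Lemma smul0 I M : smul I M 0.
Proof. by exists [::]; rewrite ?big_nil. Qed.

Lemma ideal_genP I : is_ideal (ideal_gen I).
Proof.
split; [exact: smul0 | by move=> x y; exact: (@smulD I R^o) |].
by move=> a x; exact: (@smulZ I R^o).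
Qed.

Lemma ideal_gen_sub I J : is_ideal J -> I `<=` J -> ideal_gen I `<=` J.
Proof.
move=> [J0 JD JM] IJ _ [s sI ->].
elim: s sI => [|t s IH] sI; first by rewrite big_nil.
rewrite big_cons; apply: JD; last by apply: IH => u us; apply: sI; rewrite inE us orbT.
by rewrite /GRing.scale /= mulrC; apply: JM; apply/IJ/sI/mem_head.
Qed.

Lemma sub_ideal_gen I : I `<=` ideal_gen I.
Proof.
move=> x Ix; exists [:: (x, 1)] => [t|]; first by rewrite inE => /eqP ->.
by rewrite big_seq1 /GRing.scale /= mulr1.
Qed.

End Ideals.

Arguments smul {R} I M _.
Arguments noetherian R : clear implicits.
Arguments krull_dim R : clear implicits.

Section QuotientRing.
Variables (R : comPzRingType) (I : set R).

Definition quot_rel (x y : R) : bool := `[< ideal_gen I (x - y) >].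

Fact quot_rel_refl : reflexive quot_rel.
Proof. by move=> x; apply/asboolP; rewrite subrr; exact: smul0. Qed.

Fact quot_rel_sym : symmetric quot_rel.
Proof.
suff h x y : quot_rel x y -> quot_rel y x by move=> x y; apply/idP/idP => /h.
move=> /asboolP h; apply/asboolP; rewrite -opprB -mulN1r.
by case: (ideal_genP I) => _ _; exact.
Qed.

Fact quot_rel_trans : transitive quot_rel.
Proof.
move=> y x z /asboolP xy /asboolP yz; apply/asboolP.
have -> : x - z = (x - y) + (y - z) by rewrite addrA subrK.
by case: (ideal_genP I) => _ h _; exact: h.
Qed.

Canonical quot_equiv := EquivRel quot_rel quot_rel_refl quot_rel_sym
  quot_rel_trans.

(* R / (I); the set I need not be an ideal *)
Definition quot_ring := {eq_quot quot_equiv}.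
HB.instance Definition _ := Choice.on quot_ring.
HB.instance Definition _ := EqQuotient.on quot_ring.

Definition quot_class (x : R) : quot_ring := \pi_quot_ring x.

Lemma quot_classP x y : quot_class x = quot_class y <-> ideal_gen I (x - y).
Proof. by split=> [/eqmodP /asboolP|h]; last by apply/eqmodP/asboolP. Qed.

Lemma quot_classW (P : quot_ring -> Prop) :
  (forall x, P (quot_class x)) -> forall x, P x.
Proof. by move=> h; exact: quotW. Qed.

Let op (f : R -> R -> R) (x y : quot_ring) : quot_ring :=
  quot_class (f (repr x) (repr y)).

Let opE f : (forall x x' y y', ideal_gen I (x - x') -> ideal_gen I (y - y') ->
    ideal_gen I (f x y - f x' y')) ->
  forall x y, op f (quot_class x) (quot_class y) = quot_class (f x y).
Proof.
by move=> h x y; apply/quot_classP/h; apply/quot_classP; rewrite /quot_class reprK.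
Qed.

Definition quot_add := op +%R.
Definition quot_mul := op *%R.
Definition quot_opp := op (fun x _ => - x) ^~ (quot_class 0).

Lemma quot_addE x y :
  quot_add (quot_class x) (quot_class y) = quot_class (x + y).
Proof.
apply: opE => {}x x' {}y y' hx hy; rewrite opprD addrACA.
by case: (ideal_genP I) => _ h _; exact: h.
Qed.

Lemma quot_mulE x y :
  quot_mul (quot_class x) (quot_class y) = quot_class (x * y).
Proof.
apply: opE => {}x x' {}y y' hx hy; case: (ideal_genP I) => _ hD hM.
have -> : x * y - x' * y' = y * (x - x') + x' * (y - y') by ring.
by apply: hD; apply: hM.
Qed.

Lemma quot_oppE x : quot_opp (quot_class x) = quot_class (- x).
Proof.
apply: (@opE (fun x _ => - x)) => {}x x' y y' hx _; rewrite -opprD -mulN1r.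
by case: (ideal_genP I) => _ _; exact.
Qed.

Fact quot_addA : associative quot_add.
Proof.
elim/quot_classW=> x; elim/quot_classW=> y; elim/quot_classW=> z.
by rewrite !quot_addE addrA.
Qed.

Fact quot_addC : commutative quot_add.
Proof.
by elim/quot_classW=> x; elim/quot_classW=> y; rewrite !quot_addE addrC.
Qed.

Fact quot_add0 : left_id (quot_class 0) quot_add.
Proof. by elim/quot_classW=> x; rewrite quot_addE add0r. Qed.

Fact quot_addN : left_inverse (quot_class 0) quot_opp quot_add.
Proof. by elim/quot_classW=> x; rewrite quot_oppE quot_addE addNr. Qed.

HB.instance Definition _ :=
  GRing.isZmodule.Build quot_ring quot_addA quot_addC quot_add0 quot_addN.

Fact quot_mulA : associative quot_mul.
Proof.
elim/quot_classW=> x; elim/quot_classW=> y; elim/quot_classW=> z.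
by rewrite !quot_mulE mulrA.
Qed.

Fact quot_mulC : commutative quot_mul.
Proof.
by elim/quot_classW=> x; elim/quot_classW=> y; rewrite !quot_mulE mulrC.
Qed.

Fact quot_mul1 : left_id (quot_class 1) quot_mul.
Proof. by elim/quot_classW=> x; rewrite quot_mulE mul1r. Qed.

Fact quot_mulDl : left_distributive quot_mul +%R.
Proof.
elim/quot_classW=> x; elim/quot_classW=> y; elim/quot_classW=> z.
by rewrite [_ + _]quot_addE !quot_mulE [RHS]quot_addE mulrDl.
Qed.

HB.instance Definition _ := GRing.Zmodule_isComPzRing.Build quot_ring
  quot_mulA quot_mulC quot_mul1 quot_mulDl.

Fact quot_class_is_zmod_morphism : zmod_morphism quot_class.
Proof. by move=> x y; rewrite -quot_addE -quot_oppE. Qed.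

Fact quot_class_is_monoid_morphism : monoid_morphism quot_class.
Proof. by split=> // x y; rewrite -quot_mulE. Qed.

HB.instance Definition _ := GRing.isZmodMorphism.Build R quot_ring quot_class
  quot_class_is_zmod_morphism.
HB.instance Definition _ := GRing.isMonoidMorphism.Build R quot_ring quot_class
  quot_class_is_monoid_morphism.

End QuotientRing.

Definition ring_iso (A B : comPzRingType) : Prop :=
  exists f : {rmorphism A -> B}, bijective f.

Section Completion.
Variables (R : comPzRingType) (I : set R).

(* (x_n mod I^n)_n is a compatible family, i.e. an element of lim R / I^n *)
Definition cauchy (x : nat -> R) : bool :=
  `[< forall n, ideal_exp I n (x n.+1 - x n) >].

Fact cauchy_subring : subring_closed cauchy.
Proof.
have hI n := ideal_genP [set x | exists s : seq R,
    [/\ size s = n, forall a, a \in s -> I a & x = \prod_(a <- s) a]].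
split.
- by apply/asboolP => n; rewrite subrr; case: (hI n).
- move=> x y /asboolP hx /asboolP hy; apply/asboolP => n.
  case: (hI n) => _ hD hM.
  have e : (x n.+1 - y n.+1) - (x n - y n) =
    (x n.+1 - x n) + -1 * (y n.+1 - y n) by ring.
  by rewrite [X in ideal_exp _ _ X]e; exact: hD (hx n) (hM _ _ (hy n)).
- move=> x y /asboolP hx /asboolP hy; apply/asboolP => n.
  case: (hI n) => _ hD hM.
  have e : x n.+1 * y n.+1 - x n * y n =
    y n.+1 * (x n.+1 - x n) + x n * (y n.+1 - y n) by ring.
  by rewrite [X in ideal_exp _ _ X]e; exact: hD (hM _ _ (hx n)) (hM _ _ (hy n)).
Qed.

HB.instance Definition _ :=
  GRing.isSubringClosed.Build (nat -> R) cauchy cauchy_subring.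

Definition cauchy_seq := {x : nat -> R | cauchy x}.
HB.instance Definition _ := SubChoice.on cauchy_seq.
HB.instance Definition _ := GRing.SubChoice_isSubComPzRing.Build
  (nat -> R) cauchy cauchy_seq cauchy_subring.

Definition null_seq : set cauchy_seq :=
  [set x | forall n, ideal_exp I n (val x n)].

(* lim R / I^n, as Cauchy sequences modulo null sequences *)
Definition completion : comPzRingType := quot_ring null_seq.

Fact cauchy_cst (a : R) : cauchy (fun=> a).
Proof.
by apply/asboolP => n; rewrite subrr; exact: smul0.
Qed.

Definition to_completion (a : R) : completion :=
  quot_class null_seq (exist _ (fun=> a) (cauchy_cst a)).

End Completion.

Section PowerSeries.
Variable A : comPzRingType.

Definition powser := nat -> A.
HB.instance Definition _ := GRing.Zmodule.copy powser (nat -> A).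

Definition powser_one : powser := fun k => (k == 0)%:R.
Definition powser_mul (f g : powser) : powser :=
  fun k => \sum_(i < k.+1) f i * g (k - i)%N.

Fact powser_mulC : commutative powser_mul.
Proof.
move=> f g; apply: funext => k; rewrite /powser_mul.
rewrite (reindex_inj rev_ord_inj) /=; apply: eq_bigr => i _.
by rewrite subSS subKn ?leq_ord// mulrC.
Qed.

Fact powser_mulA : associative powser_mul.
Proof.
move=> f g h; apply: funext => k; rewrite (powser_mulC (_ f g)).
rewrite [LHS]/powser_mul [RHS]/powser_mul.
transitivity (\sum_(j < k.+1) \sum_(l < k.+1 | (l <= k - j)%N)
    f j * (g (k - j - l)%N * h l)).
  apply: eq_bigr => /= j _; rewrite -/(powser_mul g h (k - j)) powser_mulC.
  rewrite /powser_mul mulr_sumr (big_ord_narrow_leq (leq_subr _ _)) /=.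
  by apply: eq_bigr => l _; rewrite [h l * _]mulrC.
rewrite (exchange_big_dep predT) //=; apply: eq_bigr => l _.
transitivity (\sum_(j < k.+1 | (j <= k - l)%N) f j * (g (k - j - l)%N * h l)).
  apply: eq_bigl => j; rewrite -ltnS -(ltnS j) -!subSn ?leq_ord //.
  by rewrite -subn_gt0 -(subn_gt0 j) -!subnDA addnC.
rewrite (big_ord_narrow_leq (leq_subr _ _)) mulr_sumr /=.
by apply: eq_bigr => j _; rewrite -!subnDA addnC mulrA [RHS]mulrC.
Qed.

Fact powser_mul1 : left_id powser_one powser_mul.
Proof.
move=> f; apply: funext => k; rewrite /powser_mul big_ord_recl /= subn0.
by rewrite mul1r big1 ?addr0 // => i _; rewrite /powser_one /= mul0r.
Qed.

Fact powser_mulDl : left_distributive powser_mul +%R.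
Proof.
move=> f g h; apply: funext => k; rewrite /powser_mul.
transitivity (\sum_(i < k.+1) (f i * h (k - i)%N + g i * h (k - i)%N)).
  by apply: eq_bigr => i _; rewrite -mulrDl.
by rewrite big_split.
Qed.

HB.instance Definition _ := GRing.Zmodule_isComPzRing.Build powser
  powser_mulA powser_mulC powser_mul1 powser_mulDl.

End PowerSeries.

(* A[[X_1, ..., X_d]] = A[[X_1]]...[[X_d]] *)
Fixpoint power_series (A : comPzRingType) (d : nat) : comPzRingType :=
  if d is d'.+1 then powser (power_series A d') : comPzRingType else A.

Section Depth.
Variables (R : comPzRingType) (M : lmodType R).

Definition regular_seq (x : seq R) : Prop :=
  (forall i, (i < size x)%N -> forall y : M,
     smul (seq_set (take i x)) M (x`_i *: y) ->
     smul (seq_set (take i x)) M y) /\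
  (exists y : M, ~ smul (seq_set x) M y).

(* The supremum of the lengths of the M-regular sequences in I, and
   infinity if M = 0; for R local with maximal ideal I it is depth_R(M). *)
Definition depth (I : set R) : enat :=
  if `[< forall y : M, y = 0 >] then None
  else nsup [set l | exists x : seq R,
    [/\ size x = l, forall a, a \in x -> I a & regular_seq x]].

End Depth.

Arguments regular_seq {R} M x.
Arguments depth {R} M I.

Definition is_dvr (V : comPzRingType) (n : set V) : Prop :=
  [/\ local_ring n,
      forall x y : V, x * y = 0 -> x = 0 \/ y = 0,
      forall I : set V, is_ideal I -> exists a, I = ideal_gen [set a] &
      exists2 x, n x & x != 0].

Definition is_complete_dvr (V : comPzRingType) (n : set V) : Prop :=
  is_dvr n /\ bijective (to_completion n).

Definition cohen_coefficients (k A : comPzRingType) : Prop :=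
  ring_iso A k \/
  exists n : set A, is_complete_dvr n /\ ring_iso (quot_ring n) k.

Definition complete_intersection (R : comPzRingType) (m : set R) : Prop :=
  exists (A : comPzRingType) (d : nat) (x : seq (power_series A d)),
  [/\ cohen_coefficients (quot_ring m) A,
      regular_seq (power_series A d)^o x &
      ring_iso (quot_ring (seq_set x)) (completion m)].

Section Localization.
Variables (R : comPzRingType) (p : prime_ideal R).

Definition outside (s : R) : bool := ~~ `[< prime_set p s >].
Definition denom := {s : R | outside s}.
HB.instance Definition _ := SubChoice.on denom.

Definition den (s : denom) : R := val s.

Lemma denomP (s : denom) : ~ prime_set p (den s).
Proof. exact/asboolPn/(valP s). Qed.

Fact denom1_subproof : outside 1.
Proof. by apply/asboolPn; case: (prime_setP p). Qed.

Fact denomM_subproof (s t : denom) : outside (den s * den t).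
Proof.
by apply/asboolPn; case: (prime_setP p) => _ _ h /h[]; exact: denomP.
Qed.

Definition denom1 : denom := exist outside 1 denom1_subproof.
Definition denomM (s t : denom) : denom := exist outside _ (denomM_subproof s t).

Lemma den1 : den denom1 = 1. Proof. by []. Qed.
Lemma denM s t : den (denomM s t) = den s * den t. Proof. by []. Qed.

Local Arguments den : simpl never.

Section LocalizedModule.
Variable M : lmodType R.

Definition frac := (M * denom)%type.
HB.instance Definition _ := Choice.on frac.

Definition frac_rel (x y : frac) : bool :=
  `[< exists u : denom, den u *: (den y.2 *: x.1) = den u *: (den x.2 *: y.1) >].

Fact frac_rel_refl : reflexive frac_rel.
Proof. by move=> x; apply/asboolP; exists denom1. Qed.

Fact frac_rel_sym : symmetric frac_rel.
Proof.
suff h x y : frac_rel x y -> frac_rel y x by move=> x y; apply/idP/idP => /h.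
by move=> /asboolP[u hu]; apply/asboolP; exists u.
Qed.

Fact frac_rel_trans : transitive frac_rel.
Proof.
move=> y x z /asboolP[u hu] /asboolP[v hv]; apply/asboolP.
exists (denomM (denomM u v) y.2); rewrite !denM.
transitivity ((den v * den z.2) *: (den u *: (den y.2 *: x.1))).
  by rewrite !scalerA; congr (_ *: _); ring.
transitivity ((den u * den x.2) *: (den v *: (den z.2 *: y.1))).
  by rewrite hu !scalerA; congr (_ *: _); ring.
by rewrite hv !scalerA; congr (_ *: _); ring.
Qed.

Canonical frac_equiv := EquivRel frac_rel frac_rel_refl frac_rel_sym
  frac_rel_trans.

(* The localization M_p: fractions m / s with s outside p *)
Definition loc := {eq_quot frac_equiv}.
HB.instance Definition _ := Choice.on loc.
HB.instance Definition _ := EqQuotient.on loc.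

Definition loc_frac (m : M) (s : denom) : loc := \pi_loc ((m, s) : frac).

Lemma loc_fracP m s m' s' : loc_frac m s = loc_frac m' s' <->
  exists u : denom, den u *: (den s' *: m) = den u *: (den s *: m').
Proof. by split=> [/eqmodP /asboolP|h]; last by apply/eqmodP/asboolP. Qed.

Lemma loc_fracW (P : loc -> Prop) :
  (forall m s, P (loc_frac m s)) -> forall x, P x.
Proof. by move=> h; apply: quotW => -[m s]; exact: h. Qed.

Lemma loc_frac_repr (x : loc) : loc_frac (repr x).1 (repr x).2 = x.
Proof. by rewrite /loc_frac -surjective_pairing reprK. Qed.

Definition loc_add (x y : loc) : loc :=
  loc_frac (den (repr y).2 *: (repr x).1 + den (repr x).2 *: (repr y).1)
    (denomM (repr x).2 (repr y).2).

Definition loc_opp (x : loc) : loc := loc_frac (- (repr x).1) (repr x).2.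

Definition loc_zero : loc := loc_frac 0 denom1.

Lemma loc_addE m s m' s' : loc_add (loc_frac m s) (loc_frac m' s') =
  loc_frac (den s' *: m + den s *: m') (denomM s s').
Proof.
rewrite /loc_add; have := loc_frac_repr (loc_frac m s).
have := loc_frac_repr (loc_frac m' s').
case: (repr _) => n' t'; case: (repr _) => n t /=.
move=> /loc_fracP[u hu] /loc_fracP[v hv]; apply/loc_fracP.
exists (denomM u v); rewrite !denM !scalerDr; congr (_ + _).
  transitivity ((den u * den t' * den s') *: (den v *: (den s *: n))).
    by rewrite !scalerA; congr (_ *: _); ring.
  by rewrite hv !scalerA; congr (_ *: _); ring.
transitivity ((den v * den t * den s) *: (den u *: (den s' *: n'))).
  by rewrite !scalerA; congr (_ *: _); ring.
by rewrite hu !scalerA; congr (_ *: _); ring.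
Qed.

Lemma loc_oppE m s : loc_opp (loc_frac m s) = loc_frac (- m) s.
Proof.
rewrite /loc_opp; have := loc_frac_repr (loc_frac m s).
case: (repr _) => n t /= /loc_fracP[u hu]; apply/loc_fracP.
by exists u; rewrite !scalerN hu.
Qed.

Fact loc_addA : associative loc_add.
Proof.
elim/loc_fracW=> m s; elim/loc_fracW=> n t; elim/loc_fracW=> q w.
rewrite !loc_addE; apply/loc_fracP; exists denom1; congr (_ *: _); rewrite ?denM ?den1.
by rewrite !scalerDr !scalerA addrA; congr (_ *: _ + _ *: _ + _ *: _); ring.
Qed.

Fact loc_addC : commutative loc_add.
Proof.
elim/loc_fracW=> m s; elim/loc_fracW=> n t.
rewrite !loc_addE; apply/loc_fracP; exists denom1; congr (_ *: _); rewrite ?denM ?den1.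
by rewrite addrC [den s * _]mulrC.
Qed.

Fact loc_add0 : left_id loc_zero loc_add.
Proof.
elim/loc_fracW=> m s.
rewrite !loc_addE; apply/loc_fracP; exists denom1; congr (_ *: _); rewrite ?denM ?den1.
by rewrite scaler0 add0r scale1r mul1r.
Qed.

Fact loc_addN : left_inverse loc_zero loc_opp loc_add.
Proof.
elim/loc_fracW=> m s.
rewrite loc_oppE loc_addE; apply/loc_fracP; exists denom1; congr (_ *: _); rewrite ?denM ?den1.
by rewrite scalerN addNr !scaler0.
Qed.

HB.instance Definition _ :=
  GRing.isZmodule.Build loc loc_addA loc_addC loc_add0 loc_addN.

End LocalizedModule.

Definition loc_ring := loc R^o.
HB.instance Definition _ := GRing.Zmodule.on loc_ring.

Definition rfrac (a : R) (s : denom) : loc_ring := @loc_frac R^o a s.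

Section Scale.
Variable M : lmodType R.

Definition loc_scale (a : loc_ring) (x : loc M) : loc M :=
  loc_frac (((repr a).1 : R) *: (repr x).1) (denomM (repr a).2 (repr x).2).

Lemma loc_scaleE a s m t :
  loc_scale (rfrac a s) (loc_frac m t) = loc_frac (a *: m) (denomM s t).
Proof.
rewrite /loc_scale /rfrac; have := @loc_frac_repr R^o (@loc_frac R^o a s).
have := loc_frac_repr (loc_frac m t).
case: (repr _) => m' t'; case: (repr _) => a' s' /=.
move=> /loc_fracP[u hu] /loc_fracP[v]; rewrite /GRing.scale /= => hv.
apply/loc_fracP; exists (denomM u v); rewrite !denM.
transitivity ((den v * (den s * a')) *: (den u *: (den t *: m'))).
  by rewrite !scalerA; congr (_ *: _); ring.
by rewrite hv hu !scalerA; congr (_ *: _); ring.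
Qed.

End Scale.

Let mulE (a b : R) s t : @loc_scale R^o (rfrac a s) (rfrac b t) =
  rfrac (a * b) (denomM s t).
Proof. exact: (@loc_scaleE R^o). Qed.

Let fracE (M : lmodType R) (m n : M) (s t : denom) :
  den t *: m = den s *: n -> loc_frac m s = loc_frac n t.
Proof. by move=> e; apply/loc_fracP; exists denom1; rewrite e. Qed.

Fact loc_scaleA (M : lmodType R) a b (x : loc M) :
  loc_scale a (loc_scale b x) = loc_scale (@loc_scale R^o a b) x.
Proof.
elim/(@loc_fracW R^o): a => a s; elim/(@loc_fracW R^o): b => b t.
elim/loc_fracW: x => m w; rewrite -/(rfrac a s) -/(rfrac b t) mulE !loc_scaleE.
by apply: fracE; rewrite ?denM ?den1; rewrite !scalerA; congr (_ *: _); ring.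
Qed.

Fact loc_scale1 (M : lmodType R) (x : loc M) : loc_scale (rfrac 1 denom1) x = x.
Proof.
elim/loc_fracW: x => m w; rewrite loc_scaleE.
by apply: fracE; rewrite ?denM ?den1; rewrite scale1r mul1r.
Qed.

Fact loc_scaleDr (M : lmodType R) a (x y : loc M) :
  loc_scale a (x + y) = loc_scale a x + loc_scale a y.
Proof.
elim/(@loc_fracW R^o): a => a s; rewrite -/(rfrac a s).
elim/loc_fracW: x => m t; elim/loc_fracW: y => n w.
rewrite [_ + _]loc_addE !loc_scaleE [RHS]loc_addE.
apply: fracE; rewrite ?denM ?den1; rewrite !scalerDr !scalerA.
by congr (_ *: _ + _ *: _); ring.
Qed.

Fact loc_scaleDl (M : lmodType R) (x : loc M) (a b : loc_ring) :
  loc_scale (a + b) x = loc_scale a x + loc_scale b x.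
Proof.
elim/(@loc_fracW R^o): a => a s; elim/(@loc_fracW R^o): b => b t.
elim/loc_fracW: x => m w; rewrite [_ + _](@loc_addE R^o).
rewrite -/(rfrac _ _) -/(rfrac a s) -/(rfrac b t) !loc_scaleE [RHS]loc_addE.
apply: fracE; rewrite ?denM ?den1.
rewrite [X in _ *: (X *: m)](_ : _ = den t * a + den s * b) //.
rewrite scalerDl !scalerDr !scalerA.
by congr (_ *: _ + _ *: _); ring.
Qed.

Fact loc_mulC : commutative (@loc_scale R^o).
Proof.
elim/(@loc_fracW R^o)=> a s; elim/(@loc_fracW R^o)=> b t.
rewrite -/(rfrac a s) -/(rfrac b t) !mulE.
by apply: fracE; rewrite ?denM ?den1; rewrite /GRing.scale /=; ring.
Qed.

HB.instance Definition _ := GRing.Zmodule_isComPzRing.Build loc_ring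
  (@loc_scaleA R^o) loc_mulC (@loc_scale1 R^o)
  (fun a b x => @loc_scaleDl R^o x a b).

HB.instance Definition _ (M : lmodType R) :=
  GRing.Zmodule_isLmodule.Build loc_ring (loc M)
    (@loc_scaleA M) (@loc_scale1 M) (@loc_scaleDr M) (@loc_scaleDl M).

Definition loc_ideal : set loc_ring :=
  [set x | exists a s, prime_set p a /\ x = rfrac a s].

End Localization.

Arguments loc {R} p M.
Arguments loc_ideal {R} p _.

Section Serre.
Variables (R : comPzRingType) (M : lmodType R).

Definition finitely_generated : Prop :=
  exists x : seq M, forall y, exists a : nat -> R,
    y = \sum_(i < size x) a i *: x`_i.

Definition support : set (prime_ideal R) :=
  [set p | exists x : loc p M, x != 0].

Definition serre (n : nat) : Prop :=
  forall p, support p ->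
    ele (emin (Some n) (height p)) (depth (loc p M) (loc_ideal p)).

End Serre.

Arguments finitely_generated {R} M.
Arguments support {R} M _.
Arguments serre {R} M n.

Definition exact (R : comPzRingType) (A B C : lmodType R)
    (f : {linear A -> B}) (g : {linear B -> C}) : Prop :=
  forall y, g y = 0 <-> exists x, f x = y.

(* 0 -> X -> F_{m-1} -> ... -> F_0 exact with F_{m-1-j} = R^(k j) *)
Definition is_syzygy (R : comPzRingType) (m : nat) (X : lmodType R) : Prop :=
  (0 < m)%N ->
  exists (k : nat -> nat) (f : {linear X -> 'rV[R]_(k 0%N)})
         (d : forall j, {linear 'rV[R]_(k j) -> 'rV[R]_(k j.+1)}),
  [/\ injective f,
      (1 < m)%N -> exact f (d 0%N) &
      forall j, (j.+2 < m)%N -> exact (d j) (d j.+1)].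

Section UniversalModule.
Variables (R : comPzRingType) (X : choiceType).
Variable C : forall P : lmodType R, (X -> P) -> Prop.

Definition formal_eval (P : lmodType R) (f : X -> P) (s : seq (R * X)) : P :=
  \sum_(t <- s) t.1 *: f t.2.

(* The module generated by X that is universal for the maps satisfying C:
   formal combinations are identified when every map satisfying C, into any
   module, gives them the same value. *)
Definition umod_rel (s t : seq (R * X)) : bool :=
  `[< forall (P : lmodType R) (f : X -> P),
        C f -> formal_eval f s = formal_eval f t >].

Fact umod_rel_refl : reflexive umod_rel.
Proof. by move=> s; apply/asboolP. Qed.

Fact umod_rel_sym : symmetric umod_rel.
Proof.
suff h s t : umod_rel s t -> umod_rel t s by move=> s t; apply/idP/idP => /h.
by move=> /asboolP h; apply/asboolP => P f Cf; rewrite h.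
Qed.

Fact umod_rel_trans : transitive umod_rel.
Proof.
by move=> s t u /asboolP h /asboolP k; apply/asboolP => P f Cf; rewrite h ?k.
Qed.

Canonical umod_equiv := EquivRel umod_rel umod_rel_refl umod_rel_sym
  umod_rel_trans.

Definition umod := {eq_quot umod_equiv}.
HB.instance Definition _ := Choice.on umod.
HB.instance Definition _ := EqQuotient.on umod.

Definition umod_class (s : seq (R * X)) : umod := \pi_umod s.
Definition umod_gen (x : X) : umod := umod_class [:: (1, x)].

Definition umod_lift (P : lmodType R) (f : X -> P) (x : umod) : P :=
  formal_eval f (repr x).

Lemma umod_lift_class (P : lmodType R) (f : X -> P) s :
  C f -> umod_lift f (umod_class s) = formal_eval f s.
Proof.
move=> Cf; suff /asboolP h : umod_rel (repr (umod_class s)) s by exact: h.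
by apply/eqmodP; rewrite reprK.
Qed.

Lemma umod_ext (x y : umod) :
  (forall (P : lmodType R) (f : X -> P), C f -> umod_lift f x = umod_lift f y) ->
  x = y.
Proof.
move=> h; rewrite -(reprK x) -(reprK y); apply/eqmodP/asboolP => P f Cf.
exact: h.
Qed.

Definition umod_add (x y : umod) : umod := umod_class (repr x ++ repr y).
Definition umod_scale (a : R) (x : umod) : umod :=
  umod_class [seq (a * t.1, t.2) | t <- repr x].
Definition umod_opp (x : umod) : umod := umod_scale (-1) x.
Definition umod_zero : umod := umod_class [::].

Let addE (P : lmodType R) (f : X -> P) x y : C f ->
  umod_lift f (umod_add x y) = umod_lift f x + umod_lift f y.
Proof.
by move=> Cf; rewrite umod_lift_class // /formal_eval big_cat.
Qed.

Let scaleE (P : lmodType R) (f : X -> P) a x : C f ->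
  umod_lift f (umod_scale a x) = a *: umod_lift f x.
Proof.
move=> Cf; rewrite umod_lift_class // /formal_eval big_map scaler_sumr.
by apply: eq_bigr => t _; rewrite scalerA.
Qed.

Let zeroE (P : lmodType R) (f : X -> P) : C f -> umod_lift f umod_zero = 0.
Proof. by move=> Cf; rewrite umod_lift_class // /formal_eval big_nil. Qed.

Fact umod_addA : associative umod_add.
Proof. by move=> x y z; apply: umod_ext => P f Cf; rewrite !addE // addrA. Qed.

Fact umod_addC : commutative umod_add.
Proof. by move=> x y; apply: umod_ext => P f Cf; rewrite !addE // addrC. Qed.

Fact umod_add0 : left_id umod_zero umod_add.
Proof.
by move=> x; apply: umod_ext => P f Cf; rewrite addE // zeroE // add0r.
Qed.

Fact umod_addN : left_inverse umod_zero umod_opp umod_add.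
Proof.
move=> x; apply: umod_ext => P f Cf.
by rewrite addE // scaleE // zeroE // scaleN1r addNr.
Qed.

HB.instance Definition _ :=
  GRing.isZmodule.Build umod umod_addA umod_addC umod_add0 umod_addN.

Fact umod_scaleA a b x : umod_scale a (umod_scale b x) = umod_scale (a * b) x.
Proof. by apply: umod_ext => P f Cf; rewrite !scaleE // scalerA. Qed.

Fact umod_scale1 : left_id 1 umod_scale.
Proof. by move=> x; apply: umod_ext => P f Cf; rewrite scaleE // scale1r. Qed.

Fact umod_scaleDr : right_distributive umod_scale +%R.
Proof.
move=> a x y; apply: umod_ext => P f Cf.
by rewrite scaleE // addE // [RHS]addE // !scaleE // scalerDr.
Qed.

Fact umod_scaleDl x : {morph umod_scale^~ x : a b / a + b}.
Proof.
move=> a b; apply: umod_ext => P f Cf.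
by rewrite scaleE // [RHS]addE // !scaleE // scalerDl.
Qed.

HB.instance Definition _ := GRing.Zmodule_isLmodule.Build R umod
  umod_scaleA umod_scale1 umod_scaleDr umod_scaleDl.

Lemma umod_lift_linear (P : lmodType R) (f : X -> P) :
  C f -> linear (umod_lift f).
Proof. by move=> Cf a x y; rewrite [LHS]addE // scaleE. Qed.

Lemma umod_lift_gen (P : lmodType R) (f : X -> P) x :
  C f -> umod_lift f (umod_gen x) = f x.
Proof.
by move=> Cf; rewrite umod_lift_class // /formal_eval big_seq1 scale1r.
Qed.

Lemma umod_classE s : umod_class s = formal_eval umod_gen s.
Proof.
apply: umod_ext => P f Cf; rewrite umod_lift_class //.
elim: s => [|t s IH]; first by rewrite /formal_eval !big_nil zeroE.
rewrite /formal_eval !big_cons addE // scaleE // umod_lift_gen //.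
by congr (_ + _); rewrite -IH.
Qed.

End UniversalModule.

Section Tensor.
Variable R : comPzRingType.

Definition bilinear_map (M N P : lmodType R) (f : M * N -> P) : Prop :=
  (forall n, linear (fun m => f (m, n))) /\ (forall m, linear (fun n => f (m, n))).

Definition tensor (M N : lmodType R) : lmodType R := umod (@bilinear_map M N).

Definition tens (M N : lmodType R) (m : M) (n : N) : tensor M N :=
  umod_gen (@bilinear_map M N) (m, n).

Lemma tens_bilinear (M N : lmodType R) :
  bilinear_map (fun mn : M * N => tens mn.1 mn.2).
Proof.
split=> x a y z; apply: umod_ext => P f Cf; rewrite umod_lift_linear //.
  by rewrite !umod_lift_gen //=; case: Cf => h _; exact: h.
by rewrite !umod_lift_gen //=; case: Cf => _ h; exact: h.
Qed.

Lemma tensor_universal (M N P : lmodType R) (f : M * N -> P) :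
  bilinear_map f ->
  exists2 g : {linear tensor M N -> P}, (forall m n, g (tens m n) = f (m, n)) &
    forall h : {linear tensor M N -> P},
      (forall m n, h (tens m n) = f (m, n)) -> h =1 g.
Proof.
move=> Cf; pose g := umod_lift (C := @bilinear_map M N) f.
pose gL := GRing.isLinear.Build _ _ _ _ g (umod_lift_linear Cf).
pose gl : {linear tensor M N -> P} := HB.pack g gL.
exists gl => [m n|h hf x]; first exact: umod_lift_gen.
have -> : x = umod_class (@bilinear_map M N) (repr x) by rewrite /umod_class reprK.
rewrite [RHS]umod_lift_class // umod_classE /formal_eval raddf_sum.
apply: eq_bigr => -[a [m n]] _.
by rewrite -[LHS]/(h (a *: tens m n)) linearZ hf.
Qed.

Section TensorMap.
Variables (F G N : lmodType R) (d : {linear F -> G}).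

Fact tensor_map_bilinear :
  bilinear_map (fun mn : F * N => tens (d mn.1) mn.2).
Proof.
have [hl hr] := tens_bilinear G N; split=> [n|m] a x y /=.
  by rewrite linearP; exact: hl.
exact: hr.
Qed.

Definition tensor_map : tensor F N -> tensor G N :=
  umod_lift (C := @bilinear_map F N) (fun mn => tens (d mn.1) mn.2).

HB.instance Definition _ := GRing.isLinear.Build R (tensor F N) (tensor G N) _
  tensor_map (umod_lift_linear tensor_map_bilinear).

Lemma tensor_mapE m n : tensor_map (tens m n) = tens (d m) n.
Proof. exact: umod_lift_gen tensor_map_bilinear. Qed.

End TensorMap.

Definition projective (P : lmodType R) : Prop :=
  forall (A B : lmodType R) (g : {linear A -> B}) (f : {linear P -> B}),
    (forall y, exists x, g x = y) ->
    exists h : {linear P -> A}, forall x, g (h x) = f x.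

Definition projective_resolution (M : lmodType R) (P : nat -> lmodType R)
    (d : forall i, {linear P i.+1 -> P i}) (e : {linear P 0%N -> M}) : Prop :=
  [/\ forall i, projective (P i),
      forall y, exists x, e x = y,
      exact (d 0%N) e &
      forall i, exact (d i.+1) (d i)].

End Tensor.

Arguments tensor_map {R F G} N d.

(* Tor_i(M, N) = H_i(P (x) N) for a projective resolution P of M; up to
   isomorphism it does not depend on P. *)
Definition tor_eq0 (R : comPzRingType) (i : nat) (M N : lmodType R) : Prop :=
  forall (P : nat -> lmodType R) (d : forall i, {linear P i.+1 -> P i})
         (e : {linear P 0%N -> M}),
  projective_resolution d e ->
  match i with
  | 0 => forall y, exists x, tensor_map N (d 0%N) x = y
  | j.+1 => exact (tensor_map N (d j.+1)) (tensor_map N (d j))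
  end.

Section FreeCover.
Variables (R : comPzRingType) (M : lmodType R).

Let any (P : lmodType R) (f : M -> P) : Prop := True.

Definition free_cover : lmodType R := umod any.

Definition free_cover_map : free_cover -> M := umod_lift (C := any) id.

HB.instance Definition _ := GRing.isLinear.Build R free_cover M _
  free_cover_map (@umod_lift_linear R M any M id I).

Lemma free_cover_surj y : exists x, free_cover_map x = y.
Proof. by exists (umod_gen any y); exact: (@umod_lift_gen R M any). Qed.

Lemma free_cover_projective : projective free_cover.
Proof.
move=> A B g f /choice[s gs]; pose h0 x := s (f (umod_gen any x)).
have hL : linear (umod_lift (C := any) h0) by exact: umod_lift_linear.
pose hM := GRing.isLinear.Build _ _ _ _ _ hL.
pose h : {linear free_cover -> A} := HB.pack (umod_lift (C := any) h0) hM.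
exists h => x.
have -> : x = umod_class any (repr x) by rewrite /umod_class reprK.
rewrite /h /= umod_lift_class // umod_classE /formal_eval !raddf_sum.
apply: eq_bigr => t _.
rewrite -[LHS]/(g (t.1 *: h0 t.2)) linearZ /= gs.
by rewrite -[RHS]/(f (t.1 *: umod_gen any t.2 : free_cover)) linearZ.
Qed.

Definition cover_ker_pred (x : free_cover) : bool := free_cover_map x == 0.

Fact cover_ker_closed : submod_closed cover_ker_pred.
Proof.
split; first by apply/eqP; exact: linear0.
by move=> a x y /eqP hx /eqP hy; apply/eqP; rewrite linearP /= hx hy scaler0 addr0.
Qed.

HB.instance Definition _ :=
  GRing.isSubmodClosed.Build R free_cover cover_ker_pred cover_ker_closed.

Definition cover_ker := {x : free_cover | cover_ker_pred x}.
HB.instance Definition _ := SubChoice.on cover_ker.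
HB.instance Definition _ := GRing.SubChoice_isSubLmodule.Build
  R free_cover cover_ker_pred cover_ker cover_ker_closed.

End FreeCover.

Lemma projective_resolution_exists (R : comPzRingType) (M : lmodType R) :
  exists (P : nat -> lmodType R) (d : forall i, {linear P i.+1 -> P i})
         (e : {linear P 0%N -> M}),
  projective_resolution d e.
Proof.
pose K := fix K i : lmodType R := if i is j.+1 then cover_ker (K j) else M.
pose P i := free_cover (K i).
pose d i : {linear P i.+1 -> P i} :=
  (val : cover_ker (K i) -> P i) \o @free_cover_map R (K i.+1).
exists P, d, (@free_cover_map R M).
have ex i : forall y, free_cover_map y = 0 :> K i <-> exists x, d i x = y.
  move=> y; split=> [h|[x <-]]; last exact/eqP/(valP (free_cover_map x : cover_ker (K i))).
  have hy : cover_ker_pred y by apply/eqP.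
  have [x hx] := free_cover_surj (exist _ y hy : K i.+1).
  by exists x; rewrite /d /= hx.
split; [by move=> i; exact: free_cover_projective | exact: free_cover_surj |
        exact: (ex 0%N) |].
move=> i y; rewrite -(ex i.+1) /d /=.
have v0 : val (0 : cover_ker (K i)) = 0 by exact: raddf0.
by split=> [h|->]; [apply/val_inj; rewrite v0|].
Qed.

(* Main.v *)
(* Let X = M (x) N and let p be a prime. An associated prime p' of X has height 0
   by (S_{n+c}), and some prime q over p + p' is reached from p by chains of
   length at most c: this follows from Serre's inequality
   dim C/P + dim C/P' <= edim C in the completion C, proved by reduction to the
   diagonal over power series, with a vanishing Euler characteristic in the
   ramified case. As Tor vanishes, depth X_q <= depth M_q, by a chase along a
   finite free resolution of M over the regular ring presenting C; hence
   depth M_q >= min(n+c, ht q). Along a chain of length h from p to q the depth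
   drops by at most h <= c, so depth M_p >= min(n, ht p).

   Depth is read off "testers": complexes on which the prime acts by zero up to
   homotopy. Finitely generated modules and their maps are handled as matrices
   acting on vectors. *)
Require Import Defs.
From HB Require Import structures.
From mathcomp Require Import all_boot all_order all_algebra.
From mathcomp Require Import boolp classical_sets functions.
From mathcomp Require Import ring zify.

Set Implicit Arguments.
Unset Strict Implicit.
Unset Printing Implicit Defensive.

Import GRing.Theory.
Local Open Scope quotient_scope.
Local Open Scope classical_set_scope.
Local Open Scope ring_scope.

Local Notation ring := comPzRingType.
Local Notation lmod := lmodType.
Local Notation finT := finType.
Local Notation surj g := (forall y, exists x, g x = y).
Local Notation domain R := (forall x z : R, x * z = 0 -> x = 0 \/ z = 0).

Local Notation "A ~~> B" := {rmorphism A -> B} (at level 70).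
Implicit Types R : ring.

(** At a prime [p] in the support of [N], the vanishing of Tor compares the depths of [X_p] and
    [M_p] directly. The obstacle is a prime outside it: there [X_p] is zero and the hypothesis on
    [X] says nothing about [M_p]. This forces the detour through a larger prime [q] in the support
    of [X], and the way back from [q] to [p] is what the summand [c] pays for. It costs at most edim
    - dim: [R] is Cohen-Macaulay, so a prime [p'] of height 0 has dim R/p' = dim R, and Serre's
    inequality bounds what dim R/p loses modulo [p'] by edim R - dim R.

    The inequality comes from the diagonal: over series with coefficients in C/P' it is cut out by
    one equation [X_i - y_i] per generator [y_i] of the maximal ideal. A uniformizer [pi] outside
    [P'] spoils the count by one. If [pi] is not in the square of the maximal ideal, it replaces a
    generator. If it is, [C] is a quotient of a ramified regular hypersurface, and equality in the
    weaker bound would make an Euler characteristic positive that vanishes because its complex is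
    doubled. *)

Lemma ffapp (I : finT) (T : Type) (x : I) (u v : {ffun I -> T}) : u = v -> u x = v x.
by move->. Qed.

Definition mklin R (A B : lmod R) (f : A -> B)
  (h : linear f) : {linear A -> B} :=
  HB.pack f (GRing.isLinear.Build R A B _ f h).

(** * Submodules and quotient modules as types *)

Definition submod R (M : lmod R) (S : set M) : Prop :=
  [/\ S 0, forall x y, S x -> S y -> S (x + y) & forall a x, S x -> S (a *: x)].

Section SubmoduleType.
Variables (R : ring) (M : lmod R) (S : set M) (hS : submod S).

(** The proof is an argument of the predicate so that the module structure on the subtype can be
    inferred from the type. *)
Definition smod_pred & submod S : pred M := fun x => `[< S x >].

Fact smod_closed : submod_closed (smod_pred hS).
case: hS => h0 hD hZ; split; first exact/asboolP.
by move=> a x y /asboolP hx /asboolP hy; apply/asboolP/hD => //; exact: hZ.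
Qed.

HB.instance Definition _ :=
  GRing.isSubmodClosed.Build R M (smod_pred hS) smod_closed.

Definition smod := {x : M | smod_pred hS x}.
HB.instance Definition _ := SubChoice.on smod.
HB.instance Definition _ := GRing.SubChoice_isSubLmodule.Build
  R M (smod_pred hS) smod smod_closed.

Definition smod_of x (hx : S x) : smod := exist _ x (asboolT hx : smod_pred hS x).

Lemma smodP (x : smod) : S (val x).
exact/asboolP/(valP x). Qed.

Definition smod_val : {linear smod -> M} := (val : smod -> M).

Lemma smod_val_inj : injective smod_val. exact: val_inj. Qed.

Lemma smod_valP y : S y -> exists x, smod_val x = y.
by move=> hy; exists (smod_of hy). Qed.
End SubmoduleType.

Section QuotientModule.
Variables (R : ring) (M : lmod R) (S : set M) (hS : submod S).

Definition qmod_rel & submod S : rel M := fun x y => `[< S (x - y) >].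
Local Notation qrel := (qmod_rel hS).

Lemma submodN x : S x -> S (- x).
by case: hS => _ _ h /(h (-1)); rewrite scaleN1r. Qed.

Lemma submodB x y : S x -> S y -> S (x - y).
by move=> hx /submodN; case: hS => _ h _; exact: h. Qed.

Lemma submod_sum (I : Type) (r : seq I) (P : pred I) (F : I -> M) :
  (forall i, P i -> S (F i)) -> S (\sum_(i <- r | P i) F i).
by case: hS => h0 hD _ h; elim/big_ind: _. Qed.

Fact qmod_refl : reflexive qrel.
by move=> x; apply/asboolP; rewrite subrr; case: hS. Qed.

Fact qmod_sym : symmetric qrel.
suff h x y : qrel x y -> qrel y x by move=> x y; apply/idP/idP => /h.
by move=> /asboolP /submodN; rewrite opprB => h; apply/asboolP.
Qed.

Fact qmod_trans : transitive qrel.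
move=> y x z /asboolP xy /asboolP yz; apply/asboolP.
by have := (let: And3 _ h _ := hS in h) _ _ xy yz; rewrite addrA subrK.
Qed.

Canonical qmod_equiv := EquivRel qrel qmod_refl qmod_sym qmod_trans.

Definition qmod := {eq_quot qmod_equiv}.
HB.instance Definition _ := Choice.on qmod.
HB.instance Definition _ := EqQuotient.on qmod.

Definition qcls (x : M) : qmod := \pi_qmod x.

Lemma qclsP x y : qcls x = qcls y <-> S (x - y).
by split=> [/eqmodP /asboolP|h]; last by apply/eqmodP/asboolP. Qed.

Lemma qclsK (x : qmod) : qcls (repr x) = x. exact: reprK. Qed.

Lemma qcls_repr x : S (repr (qcls x) - x).
by apply/qclsP; rewrite qclsK. Qed.

Definition qmod_add (x y : qmod) := qcls (repr x + repr y).
Definition qmod_opp (x : qmod) := qcls (- repr x).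
Definition qmod_scale a (x : qmod) := qcls (a *: repr x).

Let addE x y : qmod_add (qcls x) (qcls y) = qcls (x + y).
apply/qclsP; rewrite opprD addrACA.
by case: hS => _ h _; apply: h; exact: qcls_repr.
Qed.

Let oppE x : qmod_opp (qcls x) = qcls (- x).
by apply/qclsP; rewrite -opprD; apply/submodN/qcls_repr. Qed.

Let scaleE a x : qmod_scale a (qcls x) = qcls (a *: x).
by apply/qclsP; rewrite -scalerBr; case: hS => _ _ h; apply/h/qcls_repr.
Qed.

Lemma qclsW (P : qmod -> Prop) : (forall x, P (qcls x)) -> forall x, P x.
by move=> h; exact: quotW. Qed.

Fact qmod_addA : associative qmod_add.
by elim/qclsW=> x; elim/qclsW=> y; elim/qclsW=> z; rewrite !addE addrA.
Qed.
Fact qmod_addC : commutative qmod_add.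
by elim/qclsW=> x; elim/qclsW=> y; rewrite !addE addrC. Qed.
Fact qmod_add0 : left_id (qcls 0) qmod_add.
by elim/qclsW=> x; rewrite addE add0r. Qed.
Fact qmod_addN : left_inverse (qcls 0) qmod_opp qmod_add.
by elim/qclsW=> x; rewrite oppE addE addNr. Qed.

HB.instance Definition _ :=
  GRing.isZmodule.Build qmod qmod_addA qmod_addC qmod_add0 qmod_addN.

Fact qmod_scaleA a b x : qmod_scale a (qmod_scale b x) = qmod_scale (a * b) x.
by elim/qclsW: x => x; rewrite !scaleE scalerA. Qed.
Fact qmod_scale1 : left_id 1 qmod_scale.
by elim/qclsW=> x; rewrite scaleE scale1r. Qed.
Fact qmod_scaleDr : right_distributive qmod_scale +%R.
move=> a; elim/qclsW=> x; elim/qclsW=> y.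
by rewrite [_ + _]addE !scaleE [RHS]addE scalerDr.
Qed.
Fact qmod_scaleDl x : {morph qmod_scale^~ x : a b / a + b}.
by elim/qclsW: x => x a b; rewrite !scaleE [RHS]addE scalerDl. Qed.

HB.instance Definition _ := GRing.Zmodule_isLmodule.Build R qmod
  qmod_scaleA qmod_scale1 qmod_scaleDr qmod_scaleDl.

Fact qcls_linear : linear qcls.
by move=> a x y; rewrite -addE -scaleE. Qed.

HB.instance Definition _ := GRing.isLinear.Build R M qmod _ qcls qcls_linear.

Definition qmod_pi : {linear M -> qmod} := qcls.

Lemma qmodS y : exists x, qmod_pi x = y.
by exists (repr y); exact: qclsK. Qed.

Lemma qmod_pi0 x : qmod_pi x = 0 <-> S x.
by rewrite -(linear0 qmod_pi) /qmod_pi /= qclsP subr0. Qed.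
End QuotientModule.

Lemma sum_unit (V : nmodType) (F : unit -> V) : \sum_i F i = F tt.
by rewrite (big_pred1 tt) // => -[]. Qed.

(** * Finite spans and Noetherian modules *)

Section Span.
Variables (R : ring) (M : lmod R).

Definition fspan (I : finT) (x : I -> M) : set M :=
  [set m | exists c : I -> R, m = \sum_i c i *: x i].

Lemma fspanS (I : finT) (x : I -> M) : submod (fspan x).
split.
- by exists (fun=> 0); rewrite big1 // => i _; rewrite scale0r.
- move=> _ _ [c ->] [d ->]; exists (fun i => c i + d i).
  by rewrite -big_split; apply: eq_bigr => i _; rewrite scalerDl.
- move=> a _ [c ->]; exists (fun i => a * c i).
  by rewrite scaler_sumr; apply: eq_bigr => i _; rewrite scalerA.
Qed.

Lemma span_mem (I : finT) (x : I -> M) i : fspan x (x i).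
exists (fun j => (j == i)%:R); rewrite (bigD1 i) //= eqxx scale1r big1 ?addr0 //.
by move=> j /negbTE ->; rewrite scale0r.
Qed.

Lemma fspan_sub (I : finT) (x : I -> M) (S : set M) :
  submod S -> (forall i, S (x i)) -> fspan x `<=` S.
by move=> hS h _ [c ->]; apply: submod_sum => // i _; case: hS => _ _; exact.
Qed.

Definition noethM : Prop :=
  forall S : set M, submod S -> exists (I : finT) (x : I -> M), S = fspan x.

Definition fg : Prop := exists (I : finT) (x : I -> M), forall m, fspan x m.

Lemma submodT : submod [set: M]. by []. Qed.

Lemma submod0 : submod [set 0 : M].
by split=> [//|x y -> ->|a x ->]; [exact: addr0|exact: scaler0].
Qed.

Lemma submodI (S T : set M) : submod S -> submod T -> submod (S `&` T).
move=> [s0 sD sZ] [t0 tD tZ]; split=> //.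
  by move=> x y [? ?] [? ?]; split; [exact: sD|exact: tD].
by move=> a x [? ?]; split; [exact: sZ|exact: tZ].
Qed.

Definition addS (S T : set M) : set M :=
  [set m | exists x y, [/\ S x, T y & m = x + y]].

Lemma addSS (S T : set M) :
  submod S -> submod T -> submod (addS S T).
move=> [s0 sD sZ] [t0 tD tZ]; split.
- by exists 0, 0; rewrite addr0.
- move=> _ _ [x [y [hx hy ->]]] [x' [y' [hx' hy' ->]]].
  by exists (x + x'), (y + y'); rewrite addrACA; split; [exact: sD|exact: tD|].
- move=> a _ [x [y [hx hy ->]]].
  by exists (a *: x), (a *: y); rewrite scalerDr; split; [exact: sZ|exact: tZ|].
Qed.

Lemma addSl (S T : set M) : submod T -> S `<=` addS S T.
by move=> [t0 _ _] x hx; exists x, 0; rewrite addr0. Qed.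

Lemma addSr (S T : set M) : submod S -> T `<=` addS S T.
by move=> [t0 _ _] x hx; exists 0, x; rewrite add0r. Qed.

Lemma addS_min (S T U : set M) : submod U -> S `<=` U -> T `<=` U ->
  addS S T `<=` U.
by move=> [_ uD _] su tu _ [x [y [/su hx /tu hy ->]]]; exact: uD. Qed.
End Span.

Arguments noethM {R} M.
Arguments fg {R} M.

Lemma submod_preim R (A B : lmod R) (f : {linear A -> B})
  (S : set B) : submod S -> submod (f @^-1` S).
move=> [s0 sD sZ]; split; rewrite /preimage /=.
- by rewrite linear0.
- by move=> x y hx hy; rewrite linearD; exact: sD.
- by move=> a x hx; rewrite linearZ; exact: sZ.
Qed.

Lemma submod_im R (A B : lmod R) (f : {linear A -> B})
  (S : set A) : submod S -> submod (f @` S).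
move=> [s0 sD sZ]; split.
- by exists 0; rewrite // linear0.
- by move=> _ _ [x hx <-] [y hy <-]; exists (x + y); rewrite ?linearD //; exact: sD.
- by move=> a _ [x hx <-]; exists (a *: x); rewrite ?linearZ //; exact: sZ.
Qed.

Section Noether.
Variable R : ring.
Implicit Types A B C M : lmod R.

Lemma noethM_surj B C (g : {linear B -> C}) :
  surj g -> noethM B -> noethM C.
move=> sg nB S hS; have [I [x xE]] := nB _ (submod_preim g hS).
exists I, (g \o x); apply/seteqP; split.
  move=> c hc; have [b bE] := sg c.
  have : (g @^-1` S) b by rewrite /preimage /= bE.
  rewrite xE -bE => -[d ->]; exists d; rewrite linear_sum.
  by apply: eq_bigr => i _; rewrite linearZ.
apply: fspan_sub => // i; have : (g @^-1` S) (x i) by rewrite xE; exact: span_mem.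
by [].
Qed.

Lemma noethM_inj A B (f : {linear A -> B}) :
  injective f -> noethM B -> noethM A.
move=> injf nB S hS; have [I [x xE]] := nB _ (submod_im f hS).
have /choice[s hs] : forall i, exists s, S s /\ f s = x i.
  move=> i; have : (f @` S) (x i) by rewrite xE; exact: span_mem.
  by case=> s hs <-; exists s.
exists I, s; apply/seteqP; split; last first.
  by apply: fspan_sub => // i; have [] := hs i.
move=> a ha; have : (f @` S) (f a) by exists a.
rewrite xE => -[d dE]; exists d; apply: injf; rewrite dE linear_sum.
by apply: eq_bigr => i _; rewrite linearZ /=; have [_ ->] := hs i.
Qed.

Lemma noethM_fg M : noethM M -> fg M.
move=> /(_ _ (@submodT R M))[I [x xE]]; exists I, x => m.
by rewrite -xE.
Qed.
End Noether.

(** * Matrices acting on vectors with entries in a module *)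

Section Vectors.
Variable R : ring.
Implicit Types M : lmod R.

Definition mact M (I J : finT) (A : I -> J -> R) (v : {ffun I -> M}) :
  {ffun J -> M} := [ffun j => \sum_i A i j *: v i].

Fact mact_linear M (I J : finT) (A : I -> J -> R) : linear (@mact M I J A).
move=> a u v; apply/ffunP => j; rewrite !ffunE scaler_sumr -big_split.
by apply: eq_bigr => i _; rewrite !ffunE scalerDr !scalerA mulrC.
Qed.

HB.instance Definition _ M (I J : finT) (A : I -> J -> R) :=
  GRing.isLinear.Build R _ _ _ (@mact M I J A) (mact_linear A).

Lemma mactE M (I J : finT) (A : I -> J -> R) (v : {ffun I -> M}) j :
  mact A v j = \sum_i A i j *: v i.
by rewrite ffunE. Qed.

Definition mulm (I J K : finT) (A : I -> J -> R) (B : J -> K -> R) :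
  I -> K -> R := fun i k => \sum_j A i j * B j k.

Lemma mact_mulm M (I J K : finT) (A : I -> J -> R) (B : J -> K -> R)
  (v : {ffun I -> M}) : mact B (mact A v) = mact (mulm A B) v.
apply/ffunP => k; rewrite !ffunE.
transitivity (\sum_j \sum_i (A i j * B j k) *: v i).
  apply: eq_bigr => j _; rewrite ffunE scaler_sumr; apply: eq_bigr => i _.
  by rewrite scalerA mulrC.
by rewrite exchange_big; apply: eq_bigr => i _; rewrite -scaler_suml.
Qed.

Fact coord_linear M (I : finT) (i : I) :
  linear (fun v : {ffun I -> M} => v i).
by move=> a u v; rewrite !ffunE. Qed.

Definition coord M (I : finT) (i : I) : {linear {ffun I -> M} -> M} :=
  mklin (@coord_linear M I i).

Definition unitv M (I : finT) (i : I) (x : M) : {ffun I -> M} :=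
  [ffun j => if j == i then x else 0].

Lemma sum_unitv M (I : finT) (v : {ffun I -> M}) :
  v = \sum_i unitv i (v i).
apply/ffunP => j; rewrite sum_ffunE (bigD1 j) //= ffunE eqxx big1 ?addr0 //.
by move=> i hi; rewrite ffunE eq_sym (negbTE hi).
Qed.

(** Induction on the coordinates at which vectors of [S] may be nonzero: lifts to [S] of generators
    of its [i]-th coordinate module are joined to generators of the part of [S] vanishing at [i]. *)
Lemma noethM_vec M (I : finT) : noethM M -> noethM {ffun I -> M}.
move=> nM.
suff h (s : seq I) (S : set {ffun I -> M}) : submod S ->
  (forall v, S v -> forall i, i \notin s -> v i = 0) ->
  exists (K : finT) (x : K -> {ffun I -> M}), S = fspan x.
  move=> S hS; apply: (h (enum I)) => // v _ i; by rewrite mem_enum.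
elim: s S => [|i s IH] S hS hv.
  exists 'I_0, (fun=> 0); apply/seteqP; split; last first.
  by apply: fspan_sub => // -[].
  move=> v /hv h; exists (fun=> 0); rewrite big1 => [|k _]; last exact: scaler0.
  by apply/ffunP => j; rewrite h // ffunE.
have [J [y yE]] := nM _ (submod_im (coord M i) hS).
have /choice[u hu] : forall j, exists u, S u /\ u i = y j.
  move=> j; have : (coord M i @` S) (y j) by rewrite yE; exact: span_mem.
  by case=> u ? <-; exists u.
have hS0 := submodI hS (submod_preim (coord M i) (submod0 M)).
have [|K [x xE]] := IH _ hS0.
  move=> v [hv1 hv2] j hj; have [->|ji] := eqVneq j i; first exact: hv2.
  by apply: (hv v) => //; rewrite inE negb_or ji.
exists (K + J)%type, (fun k => match k with inl k => x k | inr j => u j end).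
apply/seteqP; split; last first.
  apply: fspan_sub => // -[k|j]; last by have [] := hu j.
  have : fspan x (x k) by exact: span_mem.
  by rewrite -xE => -[].
move=> v hvS; have : (coord M i @` S) (v i) by exists v.
rewrite yE => -[c cE].
have : fspan x (v - \sum_j c j *: u j).
  rewrite -xE; split.
  apply: submodB => //; apply: submod_sum => // j _.
  by case: hS => _ _; apply; have [] := hu j.
  apply/eqP; rewrite -[X in X == _]/(coord M i _) linearB linear_sum.
  rewrite [coord M i v]cE subr_eq0; apply/eqP/eq_bigr => j _.
  by rewrite linearZ /=; have [_ ->] := hu j.
move=> [d dE].
exists (fun k : K + J => match k with inl k => d k | inr j => c j end).
by rewrite big_sumType /= -dE subrK.
Qed.

Definition comb M (I : finT) (x : I -> M) (c : {ffun I -> R^o}) : M :=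
  \sum_i (c i : R) *: x i.

Fact comb_linear M (I : finT) (x : I -> M) : linear (@comb M I x).
move=> a u v; rewrite /comb scaler_sumr -big_split; apply: eq_bigr => i _.
rewrite !ffunE scalerA; exact: (scalerDl (x i) (a * (u i : R)) (v i : R)).
Qed.

HB.instance Definition _ M (I : finT) (x : I -> M) :=
  GRing.isLinear.Build R _ _ _ (@comb M I x) (comb_linear x).

Lemma fspanP M (I : finT) (x : I -> M) m :
  fspan x m <-> exists c, comb x c = m.
split=> [[c ->]|[c <-]]; last by exists c.
exists [ffun i => c i : R^o]; rewrite /comb; apply: eq_bigr => i _.
by rewrite ffunE.
Qed.

Lemma fg_noeth M : noethM (R^o : lmod R) -> fg M -> noethM M.
move=> nR [I [x hx]].
apply: (@noethM_surj _ _ _ (comb x)) => [m|]; first exact/fspanP.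
exact: noethM_vec.
Qed.

Lemma fg_vec M (I : finT) : fg M -> fg {ffun I -> M}.
move=> [J [x hx]]; exists (I * J)%type, (fun k => unitv k.1 (x k.2)) => v.
have /choice[c hc] : forall i, exists c, v i = \sum_j c j *: x j.
  by move=> i; have [c ->] := hx (v i); exists c.
exists (fun k => c k.1 k.2); rewrite [LHS]sum_unitv.
transitivity (\sum_i \sum_j c i j *: unitv i (x j)); last first.
  by rewrite pair_big.
apply: eq_bigr => i _; apply/ffunP => l; rewrite ffunE sum_ffunE.
case: (eqVneq l i) => [->|/negbTE h].
  by rewrite hc; apply: eq_bigr => j _; rewrite !ffunE eqxx.
by rewrite big1 // => j _; rewrite !ffunE h scaler0.
Qed.

Lemma fg_surj M (N : lmod R) (g : {linear M -> N}) :
  surj g -> fg M -> fg N.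
move=> sg [I [x hx]]; exists I, (g \o x) => y; have [m <-] := sg y.
have [c ->] := hx m; exists c; rewrite linear_sum.
by apply: eq_bigr => i _; rewrite linearZ.
Qed.

Lemma fg_ring : fg (R^o : lmod R).
exists unit, (fun=> 1 : R^o) => a; exists (fun=> a).
by rewrite sum_unit /GRing.scale /= mulr1.
Qed.
End Vectors.

(** * Noetherian induction and Nakayama's lemma *)

Section NoetherianInduction.
Variables (R : ring) (M : lmod R) (nM : noethM M).

Lemma noeth_acc (S : nat -> set M) : (forall i, submod (S i)) ->
  (forall i, S i `<=` S i.+1) -> exists k, forall i, S i `<=` S k.
move=> hS inc.
have mono i j : (i <= j)%N -> S i `<=` S j.
  elim: j => [|j IH]; first by rewrite leqn0 => /eqP ->.
  rewrite leq_eqVlt => /orP[/eqP -> //|/IH h]; exact: subset_trans (inc j).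
have hU : submod [set m | exists i, S i m].
  split; first by exists 0%N; case: (hS 0%N).
  move=> x y [i hx] [j hy]; exists (maxn i j); case: (hS (maxn i j)) => _ h _.
  by apply: h; [apply: mono hx; exact: leq_maxl|apply: mono hy; exact: leq_maxr].
  by move=> a x [i hx]; exists i; case: (hS i) => _ _; exact.
have [I [x xE]] := nM hU.
have /choice[f hf] : forall i, exists k, S k (x i).
  move=> i; have : fspan x (x i) by exact: span_mem.
  by rewrite -xE.
exists (\max_i f i) => i m hm; have : [set m | exists i, S i m] m by exists i.
rewrite xE; apply: fspan_sub => // j; apply: mono (hf j); exact: leq_bigmax.
Qed.

Lemma noeth_max (C : set (set M)) S0 : (forall S, C S -> submod S) -> C S0 ->
  exists K, [/\ C K, S0 `<=` K & forall T, C T -> K `<=` T -> T `<=` K].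
move=> hC C0; apply: contrapT => no.
pose X := {S : set M | C S /\ S0 `<=` S}.
have step (S : X) : {T : X | sval S `<=` sval T /\ ~ sval T `<=` sval S}.
  apply: cid; apply: contrapT => h; apply: no; exists (sval S).
  have [h1 h2] := svalP S; split=> // T CT ST; apply: contrapT => TS; apply: h.
  by exists (exist _ T (conj CT (subset_trans h2 ST))).
have [f [_ hf]] := dependent_choice step (exist _ S0 (conj C0 (@subset_refl _ S0))).
have [k hk] := @noeth_acc (fun i => sval (f i))
  (fun i => hC _ (proj1 (svalP (f i)))) (fun i => proj1 (hf i)).
by have [_] := hf k; apply; exact: hk.
Qed.

Lemma noeth_ind (P : set M -> Prop) :
  (forall S, submod S -> (forall T, submod T -> S `<=` T -> ~ T `<=` S -> P T)
  -> P S) ->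
  forall S, submod S -> P S.
move=> step S hS; apply: contrapT => nP.
have [K [[hK nK] _ maxK]] := @noeth_max [set T | submod T /\ ~ P T] S
  (fun T h => proj1 h) (conj hS nP).
apply: nK; apply: step => // T hT KT TK; apply: contrapT => nT.
by apply: TK; exact: maxK.
Qed.

(** Here [X] is any set, and the generators are found in [X] itself: a maximal span of finite
    families from [X] absorbs all of [X]. *)
Lemma noeth_finite_span (X : set M) : exists (I : finT) (x : I -> M),
  (forall i, X (x i)) /\ X `<=` fspan x.
pose C := [set S | exists (I : finT) (x : I -> M), (forall i, X (x i)) /\ S = fspan x].
have hC S : C S -> submod S by case=> I [x [_ ->]]; exact: fspanS.
have C0 : C (fspan (fun i : 'I_0 => 0 : M)).
  by exists 'I_0, (fun=> 0); split=> [[]|].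
have [_ [[I [x [hx ->]]] _ maxK]] := noeth_max hC C0.
exists I, x; split=> // m hm.
pose y (k : I + unit) := if k is inl i then x i else m.
have hy : C (fspan y) by exists (I + unit)%type, y; split=> [[i|[]]|] //=.
apply: (maxK _ hy); last exact: (span_mem y (inr tt)).
apply: fspan_sub; first exact: fspanS.
by move=> i; exact: (span_mem y (inl i)).
Qed.

(* Nakayama: [U <= S + J U] implies [U <= S]; the submodule [S + J U] enters
   through the submodules [N] that contain it. *)
Lemma nakayama (J : set R) (S U : set M) : submod S -> submod U ->
  (forall a, J a -> forall b, exists c, c * (1 - b * a) = 1) ->
  (forall N, submod N -> S `<=` N ->
  (forall a u, J a -> U u -> N (a *: u)) -> U `<=` N) ->
  U `<=` S.
move=> hS hU rad h; apply: contrapT => nUS.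
have [N [[hN SN UN] _ maxN]] := @noeth_max
  [set N | [/\ submod N, S `<=` N & ~ U `<=` N]] S
  (fun T h => let: And3 a _ _ := h in a) (And3 hS (@subset_refl _ S) nUS).
apply: UN; apply: h => // a u Ja Uu; apply: contrapT => nau.
pose L := addS N (fspan (fun=> a *: u : M) (I := unit)).
have hL : submod L by apply: addSS => //; exact: fspanS.
have NL : N `<=` L by apply: addSl; exact: fspanS.
have Lau : L (a *: u) by apply: addSr => //; exact: (span_mem (fun=> a *: u) tt).
have UL : U `<=` L.
  apply: contrapT => nUL; apply: nau; apply: (maxN L) => //; split=> //.
  exact: subset_trans SN NL.
have [x [_ [Nx [c ->]]]] := UL _ Uu.
rewrite sum_unit scalerA => uE.
have [d dE] := rad a Ja (c tt).
have : N (d *: (u - (c tt * a) *: u)).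
  by case: hN => _ _ hZ; apply: hZ; rewrite {1}uE addrK.
rewrite -[X in _ *: (X - _)]scale1r -scalerBl scalerA dE scale1r => Nu.
by apply: nau; case: hN => _ _; exact.
Qed.
End NoetherianInduction.

(** * Ideals and primes of Noetherian rings *)

Section Ideals2.
Variable R : ring.
Implicit Types (I J P Q : set R).

Lemma idealS I : is_ideal I <-> @submod R R^o I.
by []. Qed.

Lemma primeI P : is_prime P -> is_ideal P. by case. Qed.

Lemma ideal_genE (x : seq R) :
  ideal_gen (seq_set x) = @fspan R R^o 'I_(size x) (fun i => x`_i).
apply/seteqP; split.
  apply: ideal_gen_sub; first exact: (@fspanS R R^o).
  move=> a /= /(nthP 0)[i hi <-].
  exact: (@span_mem R R^o _ (fun i : 'I_(size x) => x`_i) (Ordinal hi)).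
apply: (@fspan_sub R R^o); first exact: ideal_genP.
by move=> i; apply: sub_ideal_gen; exact: mem_nth.
Qed.

Lemma noetherianP : noetherian R <-> noethM (R^o : lmod R).
split=> [h S hS|h I hI].
  by have [x ->] := h S hS; rewrite ideal_genE; eexists; eexists; reflexivity.
have [K [x ->]] := h I hI; exists [seq x i | i <- enum K].
apply/seteqP; split.
  apply: (@fspan_sub R R^o); first exact: ideal_genP.
  by move=> i; apply: sub_ideal_gen; apply: map_f; rewrite mem_enum.
apply: ideal_gen_sub; first exact: (@fspanS R R^o).
by move=> _ /mapP[i _ ->]; exact: (@span_mem R R^o).
Qed.

Lemma ideal_gen_id I : is_ideal I -> ideal_gen I = I.
by move=> hI; apply/seteqP; split; [exact: ideal_gen_sub|exact: sub_ideal_gen].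
Qed.

Lemma idealM I a b : is_ideal I -> I a -> I (a * b).
by case=> _ _ h Ia; rewrite mulrC; exact: h. Qed.

Lemma idealMl I a b : is_ideal I -> I b -> I (a * b).
by case=> _ _; exact. Qed.

Lemma idealB I a b : is_ideal I -> I a -> I b -> I (a - b).
by move=> h; exact: (@submodB R R^o I h). Qed.

Lemma idealN I a : is_ideal I -> I a -> I (- a).
by move=> h; exact: (@submodN R R^o I h). Qed.

Lemma ideal_sum I (T : Type) (r : seq T) (p : pred T) (F : T -> R) :
  is_ideal I -> (forall i, p i -> I (F i)) -> I (\sum_(i <- r | p i) F i).
by move=> h; exact: (@submod_sum R R^o I h). Qed.

Lemma primeX P a k : is_prime P -> P (a ^+ k) -> P a.
case=> _ P1 h; elim: k => [/P1 //|k IH]; rewrite exprS => /h[//|]; exact: IH.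
Qed.

Definition addI I (a : R) : set R := @addS R R^o I (@fspan R R^o unit (fun=> a)).

Lemma addIP I a x : addI I a x <-> exists y b, I y /\ x = y + b * a.
split=> [[y [_ [Iy [c ->] ->]]]|[y [b [Iy ->]]]].
  by exists y, (c tt); rewrite sum_unit.
exists y, (b * a); split=> //; exists (fun=> b).
by rewrite sum_unit.
Qed.

Lemma addI_ideal I a : is_ideal I -> is_ideal (addI I a).
by move=> hI; apply: (@addSS R R^o) => //; exact: fspanS. Qed.

Lemma addI_sub I a : I `<=` addI I a.
by apply: (@addSl R R^o); exact: fspanS. Qed.

Lemma addI_mem I a : is_ideal I -> addI I a a.
by case=> I0 _ _; apply/addIP; exists 0, 1; rewrite mul1r add0r. Qed.

Lemma addI_min I a J : is_ideal J -> I `<=` J -> J a -> addI I a `<=` J.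
move=> hJ IJ Ja _ /addIP[y [b [/IJ Jy ->]]].
by case: hJ => _ hD hM; apply: hD => //; exact: hM.
Qed.

(** An ideal maximal among those that contain [I] and avoid the multiplicative set [W] is prime. *)
Lemma prime_avoiding I (W : set R) : noetherian R -> is_ideal I -> W 1 ->
  (forall a b, W a -> W b -> W (a * b)) -> (forall a, I a -> ~ W a) ->
  exists P, [/\ is_prime P, I `<=` P & forall a, P a -> ~ W a].
move=> /noetherianP nR hI W1 WM IW.
have [P [[hP PW] IP maxP]] := @noeth_max R R^o nR
  [set J | is_ideal J /\ forall a, J a -> ~ W a] I (fun T h => proj1 h) (conj hI IW).
exists P; split=> //; split=> //; first by move=> /PW; exact.
have step a : ~ P a -> exists w, W w /\ addI P a w.
  move=> nPa; apply: contrapT => h; apply: nPa.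
  apply: (maxP (addI P a)); last exact: addI_mem; last exact: addI_sub.
  split; first exact: addI_ideal.
  by move=> w hw Ww; apply: h; exists w.
move=> x y Pxy; apply: contrapT => /not_orP[/step[u [Wu /addIP[p [b [Pp uE]]]]]].
move=> /step[v [Wv /addIP[q [c [Pq vE]]]]].
apply: (PW (u * v)); last exact: WM.
have -> : u * v = p * v + (b * x) * q + (b * c) * (x * y) by rewrite uE vE; ring.
case: hP => _ hD hM; apply: (hD _ _); last exact: hM.
by apply: hD; [rewrite mulrC|]; exact: hM.
Qed.

Lemma ideal_expS J a k : J a -> ideal_exp J k (a ^+ k).
move=> Ja; apply: sub_ideal_gen; exists (nseq k a); split; rewrite ?size_nseq //.
  by move=> b; rewrite mem_nseq => /andP[_ /eqP ->].
by rewrite big_nseq -Monoid.iteropE.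
Qed.

Lemma ideal_exp_ideal J k : is_ideal (ideal_exp J k).
exact: ideal_genP. Qed.

Lemma ideal_gen_prod J K I : is_ideal I -> (forall a b, J a -> K b -> I (a * b)) ->
  forall a b, ideal_gen J a -> ideal_gen K b -> I (a * b).
move=> hI h.
have h1 a : J a -> ideal_gen K `<=` [set b | I (a * b)].
  move=> Ja; apply: ideal_gen_sub; last by move=> b; exact: h.
  case: hI => I0 ID IM; split=> [|x y hx hy|c x hx]; rewrite /= ?mulr0 //.
  by rewrite mulrDr; exact: ID.
  by rewrite mulrCA; exact: IM.
move=> a b ha hb; move: a ha; apply: ideal_gen_sub => [|a Ja]; last exact: h1.
case: hI => I0 ID IM; split=> [|x y hx hy|c x hx]; rewrite /= ?mul0r //.
  by rewrite mulrDl; exact: ID.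
by rewrite -mulrA; exact: IM.
Qed.

Lemma ideal_expD J k l I : is_ideal I ->
  (forall a b, ideal_exp J k a -> ideal_exp J l b -> I (a * b)) ->
  ideal_exp J (k + l) `<=` I.
move=> hI h; apply: ideal_gen_sub => // _ [s [ss sJ ->]].
rewrite -(cat_take_drop k s) big_cat; apply: h; apply: sub_ideal_gen.
  exists (take k s); split=> //; last by move=> a /mem_take; exact: sJ.
  by rewrite size_takel // ss leq_addr.
exists (drop k s); split=> //; last by move=> a /mem_drop; exact: sJ.
by rewrite size_drop ss addKn.
Qed.

Lemma ideal_exp1 J : is_ideal J -> ideal_exp J 1 = J.
move=> hJ; apply/seteqP; split; last first.
  by move=> x Jx; rewrite -[x]expr1; exact: ideal_expS.
apply: ideal_gen_sub => // _ [[|a [|b s]] [// _ h ->]].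
by rewrite big_seq1; apply: h; rewrite mem_head.
Qed.

Lemma ideal_exp0 J : ideal_exp J 0 = setT.
apply/seteqP; split=> // x _; rewrite -[x]mulr1.
by apply: (idealMl _ (ideal_exp_ideal _ _)); rewrite -(expr0 0); apply: sub_ideal_gen; exists [::]; rewrite big_nil.
Qed.

Lemma ideal_exp_le J k l : is_ideal J -> (k <= l)%N ->
  ideal_exp J l `<=` ideal_exp J k.
move=> hJ /subnKC <-; apply: ideal_expD; first exact: ideal_exp_ideal.
by move=> a b ha _; apply: idealM => //; exact: ideal_exp_ideal.
Qed.

(** An ideal that is neither prime nor the whole ring contains a product [x * y] of two elements
    outside it; Noetherian induction applies to the larger ideals obtained by adjoining [x] and
    [y]. *)
Lemma noeth_prime_ind (Pr : set R -> Prop) : noetherian R -> Pr setT ->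
  (forall P, is_prime P -> Pr P) ->
  (forall I x y, is_ideal I -> I (x * y) -> Pr (addI I x) -> Pr (addI I y) -> Pr I) ->
  forall I, is_ideal I -> Pr I.
move=> /noetherianP nR PT Pp step I.
apply: (@noeth_ind R R^o nR Pr) => {}I hI IH.
have [I1|I1] := pselect (I 1).
  suff -> : I = setT by [].
  by apply/seteqP; split=> // x _; rewrite -[x]mulr1; case: hI => _ _; exact.
have [pI|npI] := pselect (forall x y, I (x * y) -> I x \/ I y).
  by apply: Pp; split.
move/existsNP: npI => [x /existsNP[y /not_implyP[Ixy /not_orP[nx ny]]]].
apply: (step I x y) => //; apply: IH; [exact: addI_ideal|exact: addI_sub| |
   exact: addI_ideal|exact: addI_sub|].
- by move=> h; apply: nx; apply: h; exact: addI_mem.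
- by move=> h; apply: ny; apply: h; exact: addI_mem.
Qed.

(** In the inductive step the exponents add up, since [addI I x] times [addI I y] lies in [I]. *)
Lemma ideal_exp_primes J I : noetherian R -> is_ideal I ->
  (forall P, is_prime P -> I `<=` P -> J `<=` P) ->
  exists N, ideal_exp J N `<=` I.
move=> nR; move: I; apply: noeth_prime_ind => //.
- by exists 0%N.
- move=> P pP /(_ P pP (@subset_refl _ P)) JP; exists 1%N.
  apply: ideal_gen_sub; first exact: primeI.
  move=> _ [[|a [|b s]] [// _ h ->]].
  by rewrite big_seq1; apply/JP/h; rewrite mem_head.
- move=> I x y hI Ixy IHx IHy h.
  have [a ha] : exists N, ideal_exp J N `<=` addI I x.
  by apply: IHx => P pP hP; apply: h => //; apply: subset_trans hP; exact: addI_sub.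
  have [b hb] : exists N, ideal_exp J N `<=` addI I y.
  by apply: IHy => P pP hP; apply: h => //; apply: subset_trans hP; exact: addI_sub.
  exists (a + b)%N; apply: ideal_expD => // u v /ha /addIP[p [c [Ip ->]]].
  move=> /hb /addIP[q [d [Iq ->]]].
  have -> : (p + c * x) * (q + d * y) = (q + d * y) * p + (c * x) * q + (c * d) * (x * y).
  by ring.
  case: hI => _ hD hM; apply: (hD _ _); last exact: hM.
  by apply: hD; exact: hM.
Qed.

(** The family may be redundant; [minimal_below] later extracts the minimal primes from it. *)
Lemma finite_primes I : noetherian R -> is_ideal I ->
  exists (K : finT) (P : K -> set R),
   (forall k, is_prime (P k) /\ I `<=` P k) /\
   forall Q, is_prime Q -> I `<=` Q -> exists k, P k `<=` Q.
move=> nR; move: I; apply: noeth_prime_ind => //.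
- exists 'I_0, (fun=> set0); split=> [[]//|Q [_ Q1 _] h].
  by case: Q1; exact: h.
- by move=> P pP; exists unit, (fun=> P); split=> [_|Q _ hQ]; [split|exists tt].
- move=> I x y hI Ixy [K [P [hP1 hP2]]] [L [Q [hQ1 hQ2]]].
  exists (K + L)%type, (fun k => match k with inl k => P k | inr l => Q l end).
  split=> [[k|l]|T pT IT].
  + by have [h1 h2] := hP1 k; split=> //; apply: subset_trans h2; exact: addI_sub.
  + by have [h1 h2] := hQ1 l; split=> //; apply: subset_trans h2; exact: addI_sub.
  have hT := primeI pT.
  have [_ _ /(_ x y (IT _ Ixy))[hx|hy]] := pT.
  by have [k hk] := hP2 T pT (addI_min hT IT hx); exists (inl k).
  by have [k hk] := hQ2 T pT (addI_min hT IT hy); exists (inr k).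
Qed.

Lemma minimal_below (K : finT) (P : K -> set R) (A : set R) (k0 : K) :
  P k0 `<=` A -> exists k, P k `<=` A /\ forall l, P l `<=` P k -> P k `<=` P l.
move=> h0; pose lt k l := `[< P k `<=` P l /\ ~ P l `<=` P k >].
have [n] := ubnP #|[pred l | lt l k0]|; elim: n => // n IH in k0 h0 *.
rewrite ltnS => hn.
have [h|/existsNP[l /not_implyP[lk nkl]]] :=
  pselect (forall l, P l `<=` P k0 -> P k0 `<=` P l); first by exists k0.
apply: (IH l); first exact: subset_trans h0.
apply: leq_trans hn; apply: proper_card; apply/properP; split.
  apply/fintype.subsetP => i; rewrite !inE => -[il nli]; split.
  exact: subset_trans il lk.
  by move=> ki; apply: nkl; exact: subset_trans ki il.
by exists l; rewrite !inE; [|apply/asboolPn => -[]].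
Qed.

Lemma minimal_prime I Q : noetherian R -> is_ideal I -> is_prime Q -> I `<=` Q ->
  exists P, [/\ is_prime P, I `<=` P, P `<=` Q &
  forall P', is_prime P' -> I `<=` P' -> P' `<=` P -> P' = P].
move=> nR hI pQ IQ; have [K [P [h1 h2]]] := finite_primes nR hI.
have [k0 hk0] := h2 _ pQ IQ; have [k [kQ kmin]] := minimal_below hk0.
have [pk Ik] := h1 k; exists (P k); split=> // P' pP' IP' P'k.
apply/seteqP; split=> //; have [l hl] := h2 _ pP' IP'.
apply: (@subset_trans _ (P l)) => //; apply: kmin; exact: subset_trans P'k.
Qed.

Lemma prime_prod P (T : Type) (r : seq T) (p : pred T) (F : T -> R) :
  is_prime P -> P (\prod_(i <- r | p i) F i) -> exists i, p i /\ P (F i).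
case=> _ P1 PM; elim: r => [|i r IH]; first by rewrite big_nil.
rewrite big_cons; case: ifP => pi; last exact: IH.
by move=> /PM[h|/IH //]; exists i.
Qed.

Lemma prime_avoidance (n : nat) (P : 'I_n -> set R) J : is_ideal J ->
  (forall k, is_prime (P k)) -> (forall k, ~ J `<=` P k) ->
  exists x, J x /\ forall k, ~ P k x.
move=> hJ; elim: n P => [|n IH] P pP JP.
  by exists 0; split=> [|[]//]; case: hJ.
have [x [Jx hx]] := IH (fun k => P (lift ord0 k)) (fun k => pP _) (fun k => JP _).
have [Px|Px] := pselect (P ord0 x); last first.
  exists x; split=> // k; case: (unliftP ord0 k) => [j ->|->] //; exact: hx.
have /existsNP[z /not_implyP[Jz Pz]] := JP ord0.
have /choice[w hw] : forall k : 'I_n, exists w,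
  P (lift ord0 k) `<=` P ord0 \/ P (lift ord0 k) w /\ ~ P ord0 w.
  move=> k; have [?|/existsNP[w /not_implyP ?]] :=
  pselect (P (lift ord0 k) `<=` P ord0); first by exists 0; left.
  by exists w; right.
(* [y] is outside [P ord0] but in every other prime not contained in [P ord0]; adding [y * z] to [x]
   moves [x] out of [P ord0] without moving it into the others. *)
pose y := \prod_(k | ~~ `[< P (lift ord0 k) `<=` P ord0 >]) w k.
have Py : ~ P ord0 y.
  move=> /(prime_prod (pP _))[k [/asboolPn nk]]; by case: (hw k) => [//|[]].
have J2 := hJ; case: J2 => _ JD JM.
exists (x + y * z); split; first by apply: JD => //; exact: JM.
move=> k; have [pI _ _] := pP ord0; have [_ _ pM] := pP ord0.
have key : ~ P ord0 (x + y * z).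
  move=> h; have : P ord0 (y * z) by rewrite -[y * z](addKr x) addrC; exact: idealB.
  by move=> /pM[].
case: (unliftP ord0 k) => [j ->|->] //.
case: (pselect (P (lift ord0 j) `<=` P ord0)) => [h /h //|h] hP.
apply: (hx j); have hI := primeI (pP (lift ord0 j)).
rewrite -[x](addrK (y * z)); apply: idealB => //; rewrite mulrC.
apply: idealMl => //; rewrite /y (bigD1 j) /=; last exact/asboolPn.
by apply: idealM => //; case: (hw j) => [/h //|[]].
Qed.

Lemma addI_prod_avoid J (K : finT) (P : K -> set R) : is_ideal J ->
  (forall k, is_prime (P k)) -> (forall x, J x -> exists k, P k x) ->
  exists k, J `<=` P k.
move=> hJ pP h; apply: contrapT => no.
have [|x [Jx hx]] := @prime_avoidance _ (fun i : 'I_#|K| => P (enum_val i)) J hJ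
  (fun i => pP _).
  by move=> i hi; apply: no; exists (enum_val i).
by have [k hk] := h x Jx; apply: (hx (enum_rank k)); rewrite enum_rankK.
Qed.
End Ideals2.

Definition ann R (M : lmod R) (m : M) : set R :=
  [set a | a *: m = 0].

(** * Associated primes and zero divisors *)

Section Associated.
Variables (R : ring) (M : lmod R).
Hypothesis nR : noetherian R.

Lemma ann_ideal (m : M) : is_ideal (ann m).
split; rewrite /ann /=; first exact: scale0r.
- by move=> x y hx hy; rewrite scalerDl hx hy addr0.
- by move=> a x hx; rewrite -scalerA hx scaler0.
Qed.

Lemma ann_maximal_prime (m : M) : m <> 0 ->
  (forall m' : M, m' <> 0 -> ann m `<=` ann m' -> ann m' `<=` ann m) -> is_prime (ann m).
move=> m0 hmax; split; [exact: ann_ideal|by rewrite /ann /= scale1r|].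
move=> x y; rewrite /ann /= => hxy; have [->|ny] := pselect (y *: m = 0); first by right.
left; apply: (hmax _ ny); last by rewrite /ann /= scalerA.
by move=> a; rewrite /ann /= scalerA mulrC -scalerA => ->; rewrite scaler0.
Qed.

Lemma ann_maximal_above (m : M) : m <> 0 -> exists m' : M, [/\ m' <> 0, ann m `<=` ann m' &
  forall m'' : M, m'' <> 0 -> ann m' `<=` ann m'' -> ann m'' `<=` ann m'].
move=> m0; have nM : noethM (R^o : lmod R) by exact/noetherianP.
have [_ [[m' [m'0 ->]] h1 h2]] := @noeth_max R R^o nM
  [set I | exists m' : M, m' <> 0 /\ I = ann m'] (ann m)
  (fun T h => let: ex_intro m' (conj _ e) := h in
  eq_ind_r (@submod R R^o) (ann_ideal m') e) (ex_intro _ m (conj m0 erefl)).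
by exists m'; split=> // m'' n0 h; apply: h2 => //; exists m''.
Qed.

Lemma ass_above (m : M) : m <> 0 ->
  exists m' : M, [/\ m' <> 0, ann m `<=` ann m' & is_prime (ann m')].
move=> /ann_maximal_above[m' [m'0 h1 h2]]; exists m'; split=> //.
exact: ann_maximal_prime.
Qed.

(** The elements with maximal annihilator span a submodule generated by finitely many of them, the
    [x k], and each maximal annihilator contains some [ann (x k)]. Prime avoidance thus meets only
    finitely many primes. *)
Lemma zero_divisors_ass (J : set R) : fg M -> is_ideal J ->
  (forall a, J a -> exists m : M, m <> 0 /\ a *: m = 0) ->
  exists m : M, [/\ m <> 0, is_prime (ann m) & J `<=` ann m].
move=> fM hJ hz; have nM : noethM M by apply: fg_noeth => //; exact/noetherianP.
pose X := [set m : M | m <> 0 /\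
  forall m' : M, m' <> 0 -> ann m `<=` ann m' -> ann m' `<=` ann m].
have [K [x [hx Xx]]] := noeth_finite_span nM X.
have px k : is_prime (ann (x k)) by have [? ?] := hx k; exact: ann_maximal_prime.
have [|k hk] := @addI_prod_avoid R J K (fun k => ann (x k)) hJ px; last first.
  by exists (x k); split=> //; have [] := hx k.
move=> a /hz[m [/ann_maximal_above[m' [m'0 mm' maxm']] am]].
have : X m' by [].
move=> /Xx[c m'E].
have pm' := ann_maximal_prime m'0 maxm'.
suff [k hk] : exists k, ann (x k) `<=` ann m'.
  by exists k; have [xk0 xkm] := hx k; apply: (xkm m') => //; exact: mm'.
apply: contrapT => no.
have /choice[y hy] : forall k, exists y, ann (x k) y /\ ~ ann m' y.
  by move=> k; apply: contrapT => h; apply: no; exists k => z hz1;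
  apply: contrapT => hz2; apply: h; exists z.
suff : ann m' (\prod_k y k) by move=> /(prime_prod pm')[k [_]]; have [] := hy k.
rewrite /ann /= m'E scaler_sumr big1 // => k _.
have [hk _] := hy k; rewrite (bigD1 k) //= scalerA -mulrA mulrC -scalerA.
by rewrite [_ *: x k]hk scaler0.
Qed.
End Associated.

(** * Artin-Rees and Krull's intersection theorem *)

Section Krull.
Variables (R : ring) (M : lmod R).
Hypotheses (nR : noetherian R) (fM : fg M).

Let nM : noethM M. by apply: fg_noeth => //; exact/noetherianP. Qed.

(** The product [J U], as the intersection of the submodules containing all [a *: u]: inclusions are
    then proved without writing sums. *)
Definition smulS (J : set R) (U : set M) : set M :=
  [set m | forall N, submod N -> (forall a u, J a -> U u -> N (a *: u)) -> N m].

Lemma smulS_submod J U : submod (smulS J U).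
split=> [N [] //|x y hx hy N hN h|a x hx N hN h].
  by have [_ hD _] := hN; apply: hD; [exact: hx|exact: hy].
by have [_ _ hZ] := hN; apply: hZ; exact: hx.
Qed.

(** A submodule [K] maximal among those that contain [W], the product [J^b U], and meet [U] inside
    it has a quotient on which each element of [J] is nilpotent; hence a power of [J] sends the
    whole module into [K]. *)
Lemma weak_artin_rees (J : set R) (U : set M) b : is_ideal J -> submod U ->
  exists b', smulS (ideal_exp J b') setT `&` U `<=` smulS (ideal_exp J b) U.
move=> hJ hU; set W := smulS _ U.
have hW : submod W by exact: smulS_submod.
have [K [[hK WK KU] _ maxK]] := @noeth_max R M nM
  [set K | [/\ submod K, W `<=` K & K `&` U `<=` W]] W
  (fun T h => let: And3 a _ _ := h in a) (And3 hW (@subset_refl _ W) (@subIsetl _ W U)).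
have nilK a : J a -> exists k, forall m, K (a ^+ k *: m).
  move=> Ja; pose L k : set M := [set m | K (a ^+ k *: m)].
  have hL k : submod (L k).
  case: hK => K0 KD KZ; split; rewrite /L /=; first by rewrite scaler0.
  by move=> x y hx hy; rewrite scalerDr; exact: KD.
  by move=> c x hx; rewrite scalerA mulrC -scalerA; exact: KZ.
  have Linc k : L k `<=` L k.+1.
  by move=> m hm; rewrite /L /= exprS -scalerA; case: hK => _ _; exact.
  have [k hk] := noeth_acc nM hL Linc; exists k => m.
  (* Once the kernels of the powers of [a] on the quotient by [K] are stationary at [k], the
     submodule [K + a^k M] still meets [U] inside [W], so it lies in [K] by maximality. *)
  pose T := addS K [set a ^+ k *: m' | m' in setT].
  have hak : submod [set a ^+ k *: m' | m' in @setT M].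
  split; first by exists 0 => //; rewrite scaler0.
  by move=> _ _ [x _ <-] [y _ <-]; exists (x + y) => //; rewrite scalerDr.
  by move=> c _ [x _ <-]; exists (c *: x) => //; rewrite !scalerA mulrC.
  apply: (maxK T); [split|by apply: addSl|by apply: addSr => //; exists m].
  - exact: addSS.
  - by apply: subset_trans WK _; exact: addSl.
  move=> _ [[x [_ [Kx [m' _ <-] ->]]] Uu]; apply: KU; split=> //.
  have hb : K (a ^+ b *: (x + a ^+ k *: m')).
  by apply: WK => N hN; apply=> //; exact: ideal_expS.
  have [_ KD KZ] := hK; apply: KD => //; apply: (hk (k + b)%N).
  have := submodB hK hb (KZ (a ^+ b) _ Kx).
  by rewrite scalerDr addrC addKr scalerA -exprD addnC.
pose C : set R := [set a | forall m, K (a *: m)].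
have hC : is_ideal C.
  case: hK => K0 KD KZ; split; rewrite /C /=; first by move=> m; rewrite scale0r.
  by move=> x y hx hy m; rewrite scalerDl; exact: KD.
  by move=> a x hx m; rewrite -scalerA; exact: KZ.
have [N hN] : exists N, ideal_exp J N `<=` C.
  apply: ideal_exp_primes => // P pP CP a Ja.
  by have [k hk] := nilK a Ja; apply: (primeX pP (k := k)); exact: CP.
exists N => u [uN Uu]; apply: KU; split=> //; apply: uN => // a m /hN; exact.
Qed.
End Krull.

Lemma smulS_im R (A B : lmod R) (f : {linear A -> B})
  (J : set R) (U : set A) m : smulS J U m -> smulS J (f @` U) (f m).
move=> h N hN hJ; apply: (h _ (submod_preim f hN)) => a u Ja Uu.
by rewrite /preimage /= linearZ; apply: hJ => //; exists u.
Qed.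

(** Modulo [S], the cyclic submodule [U] generated by the element satisfies [U <= J U] by the
    Artin-Rees inclusion, and Nakayama's lemma kills it. *)
Lemma krull_intersection R (M : lmod R) (J : set R) (S : set M) :
  noetherian R -> fg M -> is_ideal J ->
  (forall a, J a -> forall b, exists c, c * (1 - b * a) = 1) -> submod S ->
  forall m, (forall k, addS S (smulS (ideal_exp J k) setT) m) -> S m.
move=> nR fM hJ rad hS m hm.
have fQ : fg (qmod hS) by apply: (fg_surj (g := qmod_pi hS)) => //; exact: qmodS.
have nQ : noethM (qmod hS) by apply: fg_noeth => //; exact/noetherianP.
apply/(@qmod_pi0 _ _ _ hS); set z := qmod_pi hS m.
have hz k : smulS (ideal_exp J k) setT z.
  have [x [y [Sx hy mE]]] := hm k.
  rewrite /z mE linearD (_ : qmod_pi hS x = 0) ?add0r; last exact/qmod_pi0.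
  move=> N hN hN2; apply: (smulS_im (f := qmod_pi hS) hy hN) => a u Ja _.
  exact: hN2.
pose U := fspan (fun=> z : qmod hS) (I := unit).
have hU : submod U by exact: fspanS.
have Uz : U z by exact: (span_mem (fun=> z) tt).
have [b' hb'] := weak_artin_rees nR fQ 1 hJ hU.
suff : U `<=` [set 0] by move=> /(_ _ Uz).
apply: (nakayama nQ (J := J)) => //; first exact: submod0.
move=> N hN _ hJN; apply: fspan_sub => // -[].
apply: (hb' z) => // a u; rewrite ideal_exp1 //; exact: hJN.
Qed.

(** * Matrix complexes along short exact sequences of modules *)

Section ExactSequences.
Variable R : ring.
Implicit Types A B C M : lmod R.

Definition vmap A B (f : A -> B) (I : finT) (v : {ffun I -> A}) :
  {ffun I -> B} := [ffun i => f (v i)].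

Fact vmap_linear A B (f : {linear A -> B}) (I : finT) : linear (@vmap A B f I).
by move=> a u v; apply/ffunP => i; rewrite !ffunE linearP. Qed.

HB.instance Definition _ A B (f : {linear A -> B}) (I : finT) :=
  GRing.isLinear.Build R _ _ _ (@vmap A B f I) (@vmap_linear A B f I).

Lemma vmap_mact A B (f : {linear A -> B}) (I J : finT) (P : I -> J -> R) v :
  vmap f (mact P v) = mact P (vmap f v).
apply/ffunP => j; rewrite !ffunE linear_sum; apply: eq_bigr => i _.
by rewrite linearZ ffunE.
Qed.

Lemma mact0 M (I J : finT) (P : I -> J -> R) : mact P (0 : {ffun I -> M}) = 0.
exact: linear0. Qed.
Lemma mactD M (I J : finT) (P : I -> J -> R) (u v : {ffun I -> M}) :
  mact P (u + v) = mact P u + mact P v.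
exact: linearD. Qed.
Lemma mactB M (I J : finT) (P : I -> J -> R) (u v : {ffun I -> M}) :
  mact P (u - v) = mact P u - mact P v.
exact: linearB. Qed.
Lemma mactZ M (I J : finT) (P : I -> J -> R) a (v : {ffun I -> M}) :
  mact P (a *: v) = a *: mact P v.
exact: linearZ. Qed.
Lemma vmap0 A B (f : {linear A -> B}) (I : finT) :
  vmap f (0 : {ffun I -> A}) = 0.
exact: linear0. Qed.
Lemma vmapD A B (f : {linear A -> B}) (I : finT) (u v : {ffun I -> A}) :
  vmap f (u + v) = vmap f u + vmap f v.
exact: linearD. Qed.
Lemma vmapB A B (f : {linear A -> B}) (I : finT) (u v : {ffun I -> A}) :
  vmap f (u - v) = vmap f u - vmap f v.
exact: linearB. Qed.
Lemma vmapZ A B (f : {linear A -> B}) (I : finT) a (v : {ffun I -> A}) :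
  vmap f (a *: v) = a *: vmap f v.
exact: linearZ. Qed.

Definition ses A B C (f : {linear A -> B}) (g : {linear B -> C}) : Prop :=
  [/\ injective f, surj g &
  forall b, g b = 0 <-> exists a, f a = b].

Lemma inj0 A B (f : {linear A -> B}) : (forall a, f a = 0 -> a = 0) -> injective f.
move=> h x y e; apply/eqP; rewrite -subr_eq0; apply/eqP/h.
by rewrite linearB e subrr.
Qed.

Lemma ses_vecP A B C (f : {linear A -> B}) (g : {linear B -> C}) (I : finT) :
  ses f g -> [/\ injective (@vmap A B f I),
  forall c : {ffun I -> C}, exists b : {ffun I -> B}, vmap g b = c &
  forall b : {ffun I -> B}, vmap g b = 0 <-> exists a, vmap f a = b].
move=> [fi gs ex]; split.
- by move=> u v /ffunP h; apply/ffunP => i; apply: fi; have := h i; rewrite !ffunE.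
- move=> c; have /choice[b hb] : forall i, exists b, g b = c i by move=> i.
  by exists (finfun b); apply/ffunP => i; rewrite !ffunE.
move=> b; split=> [/ffunP h|[a <-]].
  have /choice[a ha] : forall i, exists a, f a = b i.
  by move=> i; apply/ex; have := h i; rewrite !ffunE.
  by exists (finfun a); apply/ffunP => i; rewrite !ffunE.
by apply/ffunP => i; rewrite !ffunE; apply/ex; exists (a i).
Qed.

(** Only the inclusion of the kernel in the image is asked; the other inclusion is [mcpx]. *)
Definition mex (I J K : finT) (P : I -> J -> R) (Q : J -> K -> R) M : Prop :=
  forall v : {ffun J -> M}, mact Q v = 0 -> exists u, v = mact P u.

Definition mcpx (I J K : finT) (P : I -> J -> R) (Q : J -> K -> R) M : Prop :=
  forall v : {ffun I -> M}, mact Q (mact P v) = 0.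

Section Les.
Variables (A B C : lmod R) (f : {linear A -> B}) (g : {linear B -> C}).
Hypothesis hfg : ses f g.
Variables (I J K L : finT) (O : I -> J -> R) (P : J -> K -> R) (Q : K -> L -> R).

(** Injectivity of the map induced by [f] on homology at the target of [P]: the connecting map into
    it starts from the homology of [C] one place earlier, which vanishes. *)
Lemma les_inj : mcpx O P B -> mex O P C -> forall (v : {ffun K -> A}) w,
  vmap f v = mact P w -> exists u, v = mact P u.
move=> cB eC v w e.
have [fiK _ exK] := ses_vecP K hfg; have [_ gsI _] := ses_vecP I hfg.
have [_ _ exJ] := ses_vecP J hfg.
have [|c hc] := eC (vmap g w).
  by rewrite -vmap_mact -e; apply/exK; exists v.
have [b hb] := gsI c.
have [|a ha] := (exJ (w - mact O b)).1.
  by rewrite vmapB hc -hb vmap_mact subrr.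
by exists a; apply: fiK; rewrite vmap_mact ha mactB cB subr0 e.
Qed.

Lemma les_sub : mcpx O P B -> mex O P C -> mex P Q B -> mex P Q A.
move=> cB eC eB v hv; have [|w hw] := eB (vmap f v).
  by rewrite -vmap_mact hv raddf0.
exact: les_inj hw.
Qed.

Lemma les_quo : mcpx P Q B -> mex O P B -> mex P Q A -> mex O P C.
move=> cB eB eA c hc.
have [_ gsJ exJ] := ses_vecP J hfg; have [fiK _ exK] := ses_vecP K hfg.
have [fiL _ _] := ses_vecP L hfg.
have [b hb] := gsJ c.
have [|a ha] := (exK (mact P b)).1; first by rewrite vmap_mact hb.
have [|a1 ha1] := eA a; first by apply: fiL; rewrite vmap_mact ha cB raddf0.
have [|b0 hb0] := eB (b - vmap f a1).
  by rewrite mactB -vmap_mact -ha1 ha subrr.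
exists (vmap g b0); rewrite -vmap_mact -hb0 vmapB hb.
by rewrite (_ : vmap g (vmap f a1) = 0) ?subr0 //; apply/exJ; exists a1.
Qed.
End Les.

Lemma mex_iso A B (f : {linear A -> B}) (g : {linear B -> A})
  (I J K : finT) (P : I -> J -> R) (Q : J -> K -> R) :
  cancel f g -> mex P Q B -> mex P Q A.
move=> fg eB v hv; have [|w hw] := eB (vmap f v).
  by rewrite -vmap_mact hv raddf0.
exists (vmap g w); rewrite -vmap_mact -hw.
by apply/ffunP => i; rewrite !ffunE fg.
Qed.

Lemma mex_vec A (L I J K : finT) (P : I -> J -> R) (Q : J -> K -> R) :
  mex P Q A -> mex P Q {ffun L -> A}.
move=> eA v hv.
have /choice[u hu] : forall l, exists u, vmap (coord A l) v = mact P u.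
  by move=> l; apply: eA; rewrite -vmap_mact hv raddf0.
exists [ffun i => [ffun l => u l i]]; apply/ffunP => j; apply/ffunP => l.
have /ffunP/(_ j) := hu l; rewrite !ffunE /= => ->; rewrite sum_ffunE.
by apply: eq_bigr => i _; rewrite !ffunE.
Qed.

Lemma mcpx_mulm (I J K : finT) (P : I -> J -> R) (Q : J -> K -> R) M :
  (forall i k, mulm P Q i k = 0) -> mcpx P Q M.
move=> h v; rewrite mact_mulm; apply/ffunP => k; rewrite !ffunE big1 // => i _.
by rewrite h scale0r.
Qed.

Lemma smod_ses M (S : set M) (hS : submod S) : ses (smod_val hS) (qmod_pi hS).
split; [exact: smod_val_inj|exact: qmodS|move=> b].
rewrite qmod_pi0; split=> [/(smod_valP hS) //|[a <-]]; exact: smodP.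
Qed.
End ExactSequences.

Record coch R := Coch {
  ck :> nat -> finT; cd : forall i, ck i -> ck i.+1 -> R }.

(** * Depth through testers *)

Section Testers.
Variable R : ring.
Implicit Types (E : coch R) (M : lmod R) (J : set R).

(** Degree [i] sits at [E i.+1]. A tester has [E 0] empty, so that degree 0, the kernel of the map
    leaving [E 1], is also an instance of exactness in the middle. *)
Definition cex E M i : Prop := mex (@cd R E i) (@cd R E i.+1) M.

Definition htpy E (a : R) : Prop :=
  exists s : forall i, E i.+1 -> E i -> R, forall i (x y : E i.+1),
  mulm (@cd R E i.+1) (s i.+1) x y + mulm (s i) (@cd R E i) x y
  = a * (x == y)%:R.

(* A Koszul-like complex: [H^0(E; M)] is the [J]-torsion of [M], and the
   elements of [J] act on it by maps that are homotopic to zero. *)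
Definition tester E J : Prop :=
  [/\ forall i x z, mulm (@cd R E i) (@cd R E i.+1) x z = 0,
  E 0%N -> False, exists x : E 1%N, True,
  forall x y, J (@cd R E 1 x y) & forall a, J a -> htpy E a].

Lemma tester_cpx E J M i : tester E J -> mcpx (@cd R E i) (@cd R E i.+1) M.
by case=> h _ _ _ _; exact: mcpx_mulm. Qed.

Lemma htpy_ideal E : is_ideal [set a | htpy E a].
split; rewrite /htpy /=.
- exists (fun _ _ _ => 0) => i x y; rewrite mul0r /mulm !big1 ?addr0 // => j _.
  by rewrite mul0r.
  by rewrite mulr0.
- move=> a b [s hs] [t ht]; exists (fun i x y => s i x y + t i x y) => i x y.
  rewrite mulrDl -hs -ht addrACA /mulm -!big_split; congr (_ + _).
  by apply: eq_bigr => j _; rewrite mulrDr.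
  by apply: eq_bigr => j _; rewrite mulrDl.
- move=> a b [s hs]; exists (fun i x y => a * s i x y) => i x y.
  rewrite -mulrA -hs mulrDr /mulm !mulr_sumr; congr (_ + _).
  by apply: eq_bigr => j _; rewrite mulrCA.
  by apply: eq_bigr => j _; rewrite mulrA.
Qed.

Lemma mulm_id_act M (I : finT) (A : I -> I -> R) a (v : {ffun I -> M}) :
  (forall x y, A x y = a * (x == y)%:R) -> mact A v = a *: v.
move=> h; apply/ffunP => y; rewrite !ffunE (bigD1 y) //= h eqxx mulr1.
by rewrite big1 ?addr0 // => x /negbTE xy; rewrite h xy mulr0 scale0r.
Qed.

Lemma htpy_act E a M : htpy E a -> forall i (v : {ffun E i.+1 -> M}),
  mact (@cd R E i.+1) v = 0 -> exists u, a *: v = mact (@cd R E i) u.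
move=> [s hs] i v hv; exists (mact (s i) v).
rewrite -(mulm_id_act v (hs i)).
have -> : mact (fun x y => mulm (cd (i:=i.+1)) (s i.+1) x y + mulm (s i) (cd (i:=i)) x y) v =
   mact (s i.+1) (mact (cd (i:=i.+1)) v) + mact (cd (i:=i)) (mact (s i) v).
  rewrite !mact_mulm; apply/ffunP => y; rewrite !ffunE -big_split.
  by apply: eq_bigr => x _; rewrite scalerDl.
by rewrite hv raddf0 add0r.
Qed.

(** One direction uses that the entries of [cd 1] lie in [J], the other that [J] acts by zero up to
    homotopy. *)
Lemma cex0P E J M : tester E J ->
  (cex E M 0 <-> forall m : M, (forall a, J a -> a *: m = 0) -> m = 0).
move=> tE; have [_ E0 [x _] hJ hE] := tE; split=> [ex m hm|h v hv].
  have [|u /ffunP/(_ x)] := ex (unitv x m).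
  apply/ffunP => y; rewrite !ffunE (bigD1 x) //= ffunE eqxx hm // big1 ?add0r //.
  by move=> z /negbTE zx; rewrite ffunE zx scaler0.
  by rewrite !ffunE eqxx => ->; rewrite big1.
exists [ffun i => 0]; apply/ffunP => y; rewrite !ffunE big1 => [|/E0 //].
apply: h => a /hE /htpy_act /(_ _ _ hv)[u /ffunP/(_ y)].
by rewrite !ffunE => ->; rewrite big1 // => /E0.
Qed.

(** Depth at least [t], as vanishing of cohomology below degree [t]. *)
Definition van E M t : Prop := forall i, (i < t)%N -> cex E M i.

Lemma van_le E M s t : (s <= t)%N -> van E M t -> van E M s.
by move=> st h i is_; apply: h; exact: leq_trans st. Qed.

Definition nzd (y : R) M : Prop := forall m : M, y *: m = 0 -> m = 0.

Definition yset (y : R) M : set M := [set y *: m | m in setT].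

Lemma yset_submod y M : submod (@yset y M).
split; first by exists 0; rewrite // scaler0.
  by move=> _ _ [u _ <-] [v _ <-]; exists (u + v); rewrite // scalerDr.
by move=> a _ [u _ <-]; exists (a *: u); rewrite // !scalerA mulrC.
Qed.

Definition ymod (y : R) M : lmod R := qmod (@yset_submod y M).

Definition ymod_pi y M : {linear M -> ymod y M} := qmod_pi (@yset_submod y M).

Fact scale_linear y M : linear (fun m : M => y *: m).
by move=> a u v; rewrite scalerDr !scalerA mulrC. Qed.

Definition yscale y M : {linear M -> M} := mklin (@scale_linear y M).

Lemma ymod_ses y M : nzd y M -> ses (yscale y M) (ymod_pi y M).
move=> hy; split; [exact: inj0|exact: qmodS|move=> b].
rewrite qmod_pi0; split; first by move=> [m _ <-]; exists m.
by move=> [m <-]; exists m.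
Qed.

Lemma ymod_kills y M (z : ymod y M) : y *: z = 0.
have [m <-] := qmodS z; rewrite -linearZ; apply/qmod_pi0.
by exists m.
Qed.

Lemma fg_ymod y M : fg M -> fg (ymod y M).
by apply: (fg_surj (g := ymod_pi y M)); exact: qmodS. Qed.

Lemma vscale (I : finT) y M (v : {ffun I -> M}) : vmap (yscale y M) v = y *: v.
by apply/ffunP => i; rewrite !ffunE. Qed.

(** In the long exact sequence of multiplication by [y], that multiplication is zero on cohomology
    because [y] is homotopic to zero on [E]; the sequence therefore breaks into short ones. *)
Lemma van_ymod E J M y t : tester E J -> J y -> nzd y M ->
  (van E M t.+1 <-> van E (ymod y M) t).
move=> tE Jy hy; have hs := ymod_ses hy; split=> h i it.
  apply: (les_quo hs (Q := @cd R E i.+2)); first exact: tester_cpx tE.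
  by apply: h; rewrite ltnW.
  exact: h.
case: i it => [_|i it].
  by apply/(cex0P _ tE) => m hm; apply: hy; exact: hm.
move=> v hv; have [_ _ _ _ /(_ y Jy)hE] := tE.
have [u hu] := htpy_act hE hv.
exact: (les_inj hs (tester_cpx tE) (h i it) (etrans (vscale y v) hu)).
Qed.

Lemma exists_nzd E J M : noetherian R -> fg M -> is_ideal J -> tester E J ->
  cex E M 0 -> exists y, J y /\ nzd y M.
move=> nR fM hJ tE /(cex0P _ tE) h; apply: contrapT => no.
have [|m [m0 _ hm]] := zero_divisors_ass nR fM hJ; last by apply: m0; exact: h.
move=> a Ja; apply: contrapT => ha; apply: no; exists a; split=> // m am.
by apply: contrapT => m0; apply: ha; exists m.
Qed.

(** Vanishing in degree 0 depends only on the radical of the ideal, and dividing by a nonzerodivisor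
    of the smaller ideal lowers both sides by one. *)
Lemma van_indep E J E' J' M t : noetherian R -> fg M -> is_ideal J -> is_ideal J' ->
  tester E J -> tester E' J' -> J `<=` J' ->
  (forall b, J' b -> exists k, J (b ^+ k)) -> van E M t <-> van E' M t.
move=> nR fM hJ hJ' tE tE' JJ' hrad.
have c0 N : cex E N 0 <-> cex E' N 0.
  rewrite (cex0P _ tE) (cex0P _ tE'); split=> h m hm.
  by apply: h => a /JJ'; exact: hm.
  apply: contrapT => /(ass_above nR)[m' [m'0 mm' pm]]; apply: m'0.
  apply: h => b /hrad[k Jk]; apply: (primeX pm (k := k)); apply: mm'; exact: hm.
elim: t M fM => [|t IH] M fM; first by split.
split=> h; have h0 := h 0%N isT.
  have [y [Jy hy]] := exists_nzd nR fM hJ tE h0.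
  apply/(van_ymod _ tE' (JJ' _ Jy) hy)/IH; first exact: fg_ymod.
  exact/(van_ymod _ tE Jy hy).
have [y [Jy hy]] := exists_nzd nR fM hJ tE ((c0 M).2 h0).
apply/(van_ymod _ tE Jy hy)/IH; first exact: fg_ymod.
exact/(van_ymod _ tE' (JJ' _ Jy) hy).
Qed.
End Testers.

Record cplx R := Cplx {
  rk :> nat -> finT; dm : forall i, rk i.+1 -> rk i -> R }.

Local Notation dx c i := (@dm _ c i).

Section QuotientMaps.
Variable R : ring.
Implicit Types A B C : lmod R.

Section Qmap.
Variables (A B : lmod R) (S : set A) (T : set B).
Variables (hS : submod S) (hT : submod T) (f : {linear A -> B}).
Hypothesis fST : forall x, S x -> T (f x).

Definition qmap_fun (x : qmod hS) : qmod hT := qmod_pi hT (f (repr x)).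

Lemma qmap_funE x : qmap_fun (qmod_pi hS x) = qmod_pi hT (f x).
apply/eqP; rewrite -subr_eq0 -linearB; apply/eqP/qmod_pi0.
by rewrite -linearB; apply: fST; exact: qcls_repr.
Qed.

Fact qmap_linear : linear qmap_fun.
move=> a x y; have [u <-] := qmodS x; have [v <-] := qmodS y.
by rewrite -linearP !qmap_funE -linearP -linearP.
Qed.

Definition qmap : {linear qmod hS -> qmod hT} := mklin qmap_linear.

Lemma qmapE x : qmap (qmod_pi hS x) = qmod_pi hT (f x).
exact: qmap_funE. Qed.
End Qmap.

Definition dsum A B C (f : {linear A -> C}) (g : {linear B -> C}) : Prop :=
  (forall a b, f a + g b = 0 -> a = 0 /\ b = 0) /\
  (forall c, exists a b, c = f a + g b).

Lemma dsum_vec A B C (f : {linear A -> C}) (g : {linear B -> C}) (I : finT) :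
  dsum f g ->
  (forall (a : {ffun I -> A}) (b : {ffun I -> B}),
  vmap f a + vmap g b = 0 -> a = 0 /\ b = 0) /\
  (forall c : {ffun I -> C}, exists a b, c = vmap f a + vmap g b).
move=> [h1 h2]; split=> [a b /ffunP h|c].
  have k i : a i = 0 /\ b i = 0 by apply: h1; have := h i; rewrite !ffunE.
  by split; apply/ffunP => i; rewrite ffunE; have [] := k i.
have /choice[a ha] : forall i, exists a, exists b, c i = f a + g b by move=> i.
have /choice[b hb] := ha; exists (finfun a), (finfun b).
by apply/ffunP => i; rewrite !ffunE.
Qed.

Lemma mex_dsum A B C (f : {linear A -> C}) (g : {linear B -> C})
  (I J K : finT) (P : I -> J -> R) (Q : J -> K -> R) :
  dsum f g -> mex P Q A -> mex P Q B -> mex P Q C.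
move=> h eA eB v; have [hK _] := dsum_vec K h; have [_ hJ] := dsum_vec J h.
have [a [b ->]] := hJ v; rewrite mactD -!vmap_mact => /hK[/eA[a' ->] /eB[b' ->]].
by exists (vmap f a' + vmap g b'); rewrite mactD -!vmap_mact.
Qed.

Lemma rng_sub (I J : finT) (P : I -> J -> R) A :
  submod [set mact P v | v in @setT {ffun I -> A}].
exact: (submod_im (@mact R A I J P) (@submodT R _)). Qed.
End QuotientMaps.

(** * Tensoring with a module given by a presentation *)

Section Phi.
Variables (R : ring) (H : cplx R).
Implicit Types A B C K : lmod R.

(* [K (x) N] for a module [N] presented by the first matrix of [H] *)
Definition phi K : lmod R := qmod (@rng_sub R _ _ (dx H 0) K).

(** When [H] resolves [N], this is the vanishing of all higher Tor of [K] and [N]. *)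
Definition hac K : Prop := forall i, mex (dx H i.+1) (dx H i) K.

Fact phi_map_subproof A B (f : {linear A -> B}) (x : {ffun H 0%N -> A}) :
  [set mact (dx H 0) v | v in setT] x ->
  [set mact (dx H 0) v | v in setT] (vmap f x).
by move=> [v _ <-]; exists (vmap f v); rewrite ?vmap_mact. Qed.

Definition phi_map A B (f : {linear A -> B}) : {linear phi A -> phi B} :=
  qmap _ _ (@phi_map_subproof A B f).

Lemma phi_mapE A B (f : {linear A -> B}) x :
  phi_map f (qmod_pi _ x) = qmod_pi _ (vmap f x).
exact: qmapE. Qed.

(** Right exactness is general; injectivity on the left comes from the vanishing of the first Tor of
    [C]. *)
Lemma phi_ses A B C (f : {linear A -> B}) (g : {linear B -> C}) :
  mcpx (dx H 1) (dx H 0) B -> mex (dx H 1) (dx H 0) C ->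
  ses f g -> ses (phi_map f) (phi_map g).
move=> cB eC hfg; have [fi gs ex] := ses_vecP (H 0%N) hfg.
have [_ gs1 _] := ses_vecP (H 1%N) hfg.
split.
- apply: inj0 => z; have [a <-] := qmodS z; rewrite phi_mapE => /qmod_pi0.
  move=> [w _ /esym e]; have [u ->] := les_inj hfg cB eC e.
  by apply/qmod_pi0; exists u.
- move=> z; have [c <-] := qmodS z; have [b <-] := gs c.
  by exists (qmod_pi _ b); rewrite phi_mapE.
move=> z; split=> [|[y <-]]; last first.
  have [a <-] := qmodS y; rewrite !phi_mapE (_ : vmap g _ = 0) ?linear0 //.
  by apply/ex; exists a.
have [b <-] := qmodS z; rewrite phi_mapE => /qmod_pi0[c _ e].
have [b1 hb1] := gs1 c.
have [|a ha] := (ex (b - mact (dx H 0) b1)).1.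
  by rewrite vmapB vmap_mact hb1 e subrr.
exists (qmod_pi _ a); rewrite phi_mapE ha linearB (_ : qmod_pi _ (mact _ _) = 0) ?subr0 //.
by apply/qmod_pi0; exists b1.
Qed.

Lemma phi_dsum A B C (f : {linear A -> C}) (g : {linear B -> C}) :
  dsum f g -> dsum (phi_map f) (phi_map g).
move=> h; have [h1 h2] := dsum_vec (H 0%N) h; have [_ k2] := dsum_vec (H 1%N) h.
split=> [z w|z].
  have [a <-] := qmodS z; have [b <-] := qmodS w.
  rewrite !phi_mapE -linearD => /qmod_pi0[c _]; have [a' [b' ->]] := k2 c.
  rewrite mactD -!vmap_mact => e.
  have [|] := h1 (a - mact (dx H 0) a') (b - mact (dx H 0) b').
  by rewrite !vmapB addrACA -e -opprD subrr.
  move=> /eqP; rewrite subr_eq0 => /eqP -> /eqP; rewrite subr_eq0 => /eqP ->.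
  by split; apply/qmod_pi0; [exists a'|exists b'].
have [c <-] := qmodS z; have [a [b ->]] := h2 c.
by exists (qmod_pi _ a), (qmod_pi _ b); rewrite !phi_mapE linearD.
Qed.

Lemma hac_sub A B C (f : {linear A -> B}) (g : {linear B -> C}) :
  (forall i, mcpx (dx H i.+1) (dx H i) B) -> ses f g ->
  hac B -> hac C -> hac A.
by move=> cB h aB aC i; apply: (les_sub h (cB i.+1)); [exact: aC|exact: aB]. Qed.

Lemma hac_triv K : (forall k : K, k = 0) -> hac K.
move=> h i v _; exists 0; rewrite mact0; apply/ffunP => j; rewrite ffunE; exact: h.
Qed.

Lemma phi_triv K : (forall k : K, k = 0) -> forall z : phi K, z = 0.
move=> h z; have [v <-] := qmodS z; rewrite (_ : v = 0) ?linear0 //.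
by apply/ffunP => i; rewrite ffunE; exact: h.
Qed.
End Phi.

(** * Homology of complexes and reduction modulo a nonzerodivisor *)

Section Homology.
Variables (R : ring) (G : cplx R).
Implicit Types K : lmod R.

Definition zset i K : set {ffun G i.+1 -> K} := [set v | mact (dx G i) v = 0].

Lemma zset_submod i K : submod (@zset i K).
split; rewrite /zset /=; first exact: mact0.
  by move=> u v hu hv; rewrite mactD hu hv addr0.
by move=> a v hv; rewrite mactZ hv scaler0.
Qed.

Definition zmod i K : lmod R := smod (@zset_submod i K).
Definition bmod i K : lmod R := smod (@rng_sub R _ _ (dx G i) K).

Definition bset i K : set (zmod i K) :=
  (@smod_val _ _ _ (@zset_submod i K)) @^-1`
  [set mact (dx G i.+1) v | v in setT].

Lemma bset_submod i K : submod (@bset i K).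
exact: (submod_preim _ (@rng_sub R _ _ (dx G i.+1) K)). Qed.

(** Homology at [G i.+1]; for the doubly shifted resolutions used later it is Tor in degree
    [i - 1]. *)
Definition hmod i K : lmod R := qmod (@bset_submod i K).

Definition zcls i K (v : {ffun G i.+1 -> K}) (hv : mact (dx G i) v = 0) :
  hmod i K := qmod_pi _ (smod_of (@zset_submod i K) hv).

Lemma hmodW i K (z : hmod i K) : exists v (hv : mact (dx G i) v = 0), z = zcls hv.
have [x <-] := qmodS z; exists (val x), (smodP x).
by rewrite /zcls; congr (qmod_pi _ _); apply: val_inj.
Qed.

Lemma zcls0 i K v (hv : mact (dx G i) v = 0) :
  zcls hv = 0 :> hmod i K <-> exists u, v = mact (dx G i.+1) u.
rewrite qmod_pi0; split=> [[u _ e]|[u e]]; first by exists u; exact: esym e.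
by exists u; rewrite //= -e.
Qed.

Section Induced.
Variables (i j : nat) (K L : lmod R).
Variable f : {linear {ffun G i.+1 -> K} -> {ffun G j.+1 -> L}}.
Hypotheses (fz : forall v, mact (dx G i) v = 0 -> mact (dx G j) (f v) = 0)
  (fb : forall u, exists w,
  f (mact (dx G i.+1) u) = mact (dx G j.+1) w).

Definition hind_z (z : zmod i K) : zmod j L :=
  smod_of (@zset_submod j L) (fz (smodP z)).

Fact hind_z_linear : linear hind_z.
by move=> a u v; apply: val_inj => /=; rewrite linearP. Qed.

Fact hind_subproof (z : zmod i K) : @bset i K z -> @bset j L (mklin hind_z_linear z).
by move=> [u _ e]; have [w hw] := fb u; exists w => //=; rewrite -hw e.
Qed.

Definition hind : {linear hmod i K -> hmod j L} := qmap _ _ hind_subproof.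

Lemma hindE v (hv : mact (dx G i) v = 0) : hind (zcls hv) = zcls (fz hv).
rewrite /hind /zcls qmapE /=; congr (qmod_pi _ _); apply: val_inj => /=.
by congr (f _).
Qed.
End Induced.

(* Multiplication by [y] on [G] is homotopic to zero; then
   [H_(i+1)(K / y K) = H_(i+1)(K) + H_i(K)]. *)
Definition chtpy (y : R) (s : forall i, G i.+1 -> G i.+2 -> R) : Prop :=
  forall i (v : {ffun G i.+2 -> R^o}),
  mact (dx G i.+2) (mact (s i.+1) v) + mact (s i) (mact (dx G i.+1) v) = y *: v.

(** A matrix is recovered from its action on unit vectors; identities checked over [R^o] thus hold
    over every module. *)
Lemma mact_ext_ring (I J : finT) (P Q : I -> J -> R) :
  (forall v : {ffun I -> R^o}, mact P v = mact Q v) -> P =2 Q.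
move=> h i j; have /ffunP/(_ j) := h (unitv i (1 : R^o)); rewrite !ffunE.
rewrite (bigD1 i) //= (bigD1 i (F := fun k => Q k j *: _)) //=.
rewrite !big1 ?addr0; try by move=> k /negbTE ki; rewrite ffunE ki scaler0.
by rewrite !ffunE eqxx /GRing.scale /= !mulr1.
Qed.

Lemma chtpy_mulm y s i : chtpy y s ->
  (fun a b => mulm (s i.+1) (dx G i.+2) a b + mulm (dx G i.+1) (s i) a b)
  =2 (fun a b => y * (a == b)%:R).
move=> h; apply: mact_ext_ring => w.
rewrite (_ : mact (fun a b => y * _) w = y *: w); last exact: mulm_id_act.
rewrite -h !mact_mulm.
by apply/ffunP => b; rewrite !ffunE -big_split; apply: eq_bigr => a _; rewrite scalerDl.
Qed.

Lemma chtpyE y s K i (v : {ffun G i.+2 -> K}) : chtpy y s ->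
  mact (dx G i.+2) (mact (s i.+1) v) + mact (s i) (mact (dx G i.+1) v) = y *: v.
move=> h; rewrite !mact_mulm -(mulm_id_act v (chtpy_mulm (i := i) h)).
apply/ffunP => b; rewrite !ffunE -big_split.
by apply: eq_bigr => a _; rewrite scalerDl.
Qed.

Lemma chtpyB y s K i (v : {ffun G i.+2 -> K}) : chtpy y s ->
  mact (s i) (mact (dx G i.+1) v) =
  y *: v - mact (dx G i.+2) (mact (s i.+1) v).
by move=> h; rewrite -(chtpyE v h) addrAC subrr add0r. Qed.

Section HomologyQuotient.
Variables (y : R) (s : forall i, G i.+1 -> G i.+2 -> R) (K : lmod R).
Hypotheses (hs : chtpy y s) (hy : nzd y K).
Hypotheses (G1 : G 1%N -> False)
  (dd : forall i (M : lmod R), mcpx (dx G i.+1) (dx G i) M).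

Let L := ymod y K.
Let p : {linear K -> L} := ymod_pi y K.

Fact hpi_z i (v : {ffun G i.+1 -> K}) :
  mact (dx G i) v = 0 -> mact (dx G i) (vmap p v) = 0.
by move=> hv; rewrite -vmap_mact hv vmap0. Qed.

Fact hpi_b i (u : {ffun G i.+2 -> K}) : exists w,
  vmap p (mact (dx G i.+1) u) = mact (dx G i.+1) w.
by exists (vmap p u); rewrite vmap_mact. Qed.

Definition hpi i : {linear hmod i K -> hmod i L} :=
  @hind i i K L (@vmap R K L p (G i.+1)) (@hpi_z i) (@hpi_b i).

Lemma hpiE i v (hv : mact (dx G i) v = 0) : hpi i (zcls hv) = zcls (hpi_z hv).
exact: hindE. Qed.

Let ysig i (v : {ffun G i.+1 -> K}) : mact (dx G i) v = 0 ->
  mact (dx G i.+1) (mact (@s i) v) = y *: v.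
case: i v => [|i] v hv; last by rewrite -(chtpyE v hs) hv mact0 addr0.
by apply/ffunP => x; case: (G1 x).
Qed.

Let vp0 (I : finT) (v : {ffun I -> K}) : vmap p (y *: v) = 0.
by rewrite vmapZ; apply/ffunP => i; rewrite !ffunE ymod_kills. Qed.

Let vpK (I : finT) (v : {ffun I -> K}) : vmap p v = 0 -> exists u, v = y *: u.
have [_ _ ex] := ses_vecP I (ymod_ses hy).
by move=> /ex[u <-]; exists u; rewrite vscale.
Qed.

Let yinj (I : finT) (u v : {ffun I -> K}) : y *: u = y *: v -> u = v.
move=> /ffunP e; apply/ffunP => i; apply/eqP; rewrite -subr_eq0; apply/eqP/hy.
by rewrite scalerBr; have := e i; rewrite !ffunE => ->; rewrite subrr.
Qed.

Fact sig_linear i : linear (fun v : {ffun G i.+1 -> K} => vmap p (mact (@s i) v)).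
by move=> a u v; rewrite mactD mactZ vmapD vmapZ. Qed.

Fact sig_z i (v : {ffun G i.+1 -> K}) : mact (dx G i) v = 0 ->
  mact (dx G i.+1) (vmap p (mact (@s i) v)) = 0.
by move=> hv; rewrite -vmap_mact ysig // vp0. Qed.

Fact sig_b i (u : {ffun G i.+2 -> K}) : exists w,
  vmap p (mact (@s i) (mact (dx G i.+1) u)) = mact (dx G i.+2) w.
exists (- vmap p (mact (@s i.+1) u)).
by rewrite (chtpyB u hs) vmapB vp0 sub0r (linearN (mact _)) vmap_mact.
Qed.

(** On a cycle [v], [d (s v) = y v], so [s v] is a cycle modulo [y]. This map splits the connecting
    map from degree [i + 1] of [K / y K] to degree [i] of [K]. *)
Definition hsig i : {linear hmod i K -> hmod i.+1 L} :=
  @hind i i.+1 K L (mklin (@sig_linear i)) (@sig_z i) (@sig_b i).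

Lemma hsigE i v (hv : mact (dx G i) v = 0) : hsig i (zcls hv) = zcls (sig_z hv).
exact: hindE. Qed.

Lemma hmod_ymod i : dsum (hpi i.+1) (hsig i).
split=> [z w|z].
  have [v [hv ->]] := hmodW z; have [u [hu ->]] := hmodW w.
  rewrite !(hpiE, hsigE) => e.
  have hvu : mact (dx G i.+1) (vmap p (v + mact (@s i) u)) = 0.
  by rewrite -vmap_mact mactD hv add0r ysig // vp0.
  have : zcls hvu = 0 :> hmod i.+1 L.
  rewrite -e /zcls -linearD; congr (qmod_pi _ _); apply: val_inj => /=.
  by rewrite vmapD.
  move=> /zcls0[t ht]; have [_ st _] := ses_vecP (G i.+3) (ymod_ses hy).
  have [b hb] := st t.
  have [|c hc] := @vpK _ (v + mact (@s i) u - mact (dx G i.+2) b).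
  by rewrite vmapB vmap_mact hb ht subrr.
  have uE : u = mact (dx G i.+1) c.
  apply: yinj; rewrite -mactZ -hc mactB mactD hv add0r ysig // dd subr0 //.
  split; last by apply/zcls0; exists c.
  apply/zcls0; exists (b + mact (@s i.+1) c); rewrite mactD.
  rewrite -[LHS](addrK (mact (@s i) u)) -[v + _](subrK (mact (dx G i.+2) b)) hc.
  rewrite [in - mact _ _]uE (chtpyB c hs) opprB [y *: c + _]addrC -addrA.
  by rewrite [y *: c + _]addrC subrK.
have [v [hv ->]] := hmodW z.
have [_ st _] := ses_vecP (G i.+2) (ymod_ses hy); have [b hb] := st v.
have [|c hc] := @vpK _ (mact (dx G i.+1) b).
  by rewrite vmap_mact hb.
have hc0 : mact (dx G i) c = 0.
  by apply: yinj; rewrite -mactZ -hc dd scaler0.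
have ha : mact (dx G i.+1) (b - mact (@s i) c) = 0.
  by rewrite mactB ysig // hc subrr.
exists (zcls ha), (zcls hc0); rewrite !(hpiE, hsigE) /zcls -linearD.
congr (qmod_pi _ _); apply: val_inj => /=; rewrite -vmapD subrK //.
Qed.
End HomologyQuotient.

Definition ymods (xs : seq R) K : lmod R := foldl (fun L y => ymod y L) K xs.

Fixpoint regs (xs : seq R) K : Prop :=
  if xs is y :: ys then nzd y K /\ regs ys (ymod y K) else True.

(** By induction on [xs], the homology over [K / xs K] is built by direct sums from the homology
    over [K]; it inherits any property [Pn] stable under them, and each element of [xs] raises the
    top degree by at most one. *)
Lemma hmod_ymods (Pn : lmod R -> Prop) (xs : seq R) K (e : nat) :
  (forall (A B C : lmod R) (f : {linear A -> C}) (g : {linear B -> C}), dsum f g ->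
  Pn A -> Pn B -> Pn C) ->
  (G 1%N -> False) ->
  (forall i (M : lmod R), mcpx (dx G i.+1) (dx G i) M) ->
  (forall x, x \in xs -> exists s, chtpy x s) ->
  (forall L : lmod R, (forall z : L, z = 0) -> Pn L) ->
  regs xs K -> (forall i, Pn (hmod i K)) ->
  (forall i, (e < i)%N -> forall z : hmod i K, z = 0) ->
  (forall i, Pn (hmod i (ymods xs K))) /\
  (forall i, (e + size xs < i)%N -> forall z : hmod i (ymods xs K), z = 0).
move=> hP G1 dd hx Ptriv; elim: xs K e hx => [|x xs IH] K e hx /=.
  by move=> _ h1 h2; rewrite addn0.
move=> [hy hreg] h1 h2; rewrite addnS -addSn.
have [s hs] := hx x (mem_head _ _).
have ds := hmod_ymod hs hy G1 dd.
apply: IH => //.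
- by move=> z hz; apply: hx; rewrite inE hz orbT.
- case=> [|i]; last exact: (hP _ _ _ _ _ (ds i)).
  apply: Ptriv => z; have [v [hv ->]] := hmodW z; apply/zcls0; exists 0.
  by apply/ffunP => t; case: (G1 t).
- case=> [//|i]; rewrite ltnS => ei z; have [_ /(_ z)[a [b ->]]] := ds i.
  by rewrite (h2 i.+1 (ltnW _) a) ?(h2 i ei b) ?linear0 ?addr0 // ltnS.
Qed.
End Homology.

(** * Tools for the diagram chase *)

Section ChaseTools.
Variable R : ring.
Implicit Types A B C M : lmod R.

Lemma qmod_piZ M (S : set M) (hS : submod S) a x :
  qmod_pi hS (a *: x) = a *: qmod_pi hS x.
exact: linearZ. Qed.

Lemma mex_triv (I J K : finT) (P : I -> J -> R) (Q : J -> K -> R) M :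
  (forall m : M, m = 0) -> mex P Q M.
by move=> h v _; exists 0; rewrite mact0; apply/ffunP => j; rewrite ffunE.
Qed.

Lemma mcpx_inj A B (f : {linear A -> B}) (I J K : finT) (P : I -> J -> R)
  (Q : J -> K -> R) : injective f -> mcpx P Q B -> mcpx P Q A.
move=> fi h v; apply/ffunP => k; apply: fi; have /ffunP/(_ k) := h (vmap f v).
by rewrite -!vmap_mact !ffunE linear0.
Qed.

Lemma mcpx_vec A (L I J K : finT) (P : I -> J -> R) (Q : J -> K -> R) :
  mcpx P Q A -> mcpx P Q {ffun L -> A}.
move=> h v; apply/ffunP => k; apply/ffunP => l.
have /ffunP/(_ k) := h (vmap (coord A l) v); rewrite -!vmap_mact !ffunE /= => ->.
by [].
Qed.

Fact unitv_linear A (L : finT) (l : L) : linear (@unitv R A L l).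
by move=> a u v; apply/ffunP => i; rewrite !ffunE; case: eqP; rewrite ?scaler0 ?addr0.
Qed.

Definition unitl A (L : finT) (l : L) : {linear A -> {ffun L -> A}} :=
  mklin (@unitv_linear A L l).

Lemma mex_retract A C (L : finT) (f : L -> {linear A -> C})
  (g : L -> {linear C -> A}) (I J K : finT) (P : I -> J -> R) (Q : J -> K -> R) :
  (forall c, \sum_l f l (g l c) = c) -> mex P Q A -> mex P Q C.
move=> fg eA v hv.
have /choice[u hu] : forall l, exists u, vmap (g l) v = mact P u.
  by move=> l; apply: eA; rewrite -vmap_mact hv vmap0.
exists (\sum_l vmap (f l) (u l)); rewrite linear_sum.
rewrite (eq_bigr (fun l => vmap (f l) (vmap (g l) v))); last first.
  by move=> l _; rewrite hu vmap_mact.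
by apply/ffunP => j; rewrite sum_ffunE -[LHS]fg; apply: eq_bigr => l _; rewrite !ffunE.
Qed.

Lemma cex_inj A B C (f : {linear A -> B}) (g : {linear B -> C}) (E : coch R) n j :
  tester E n -> ses f g -> (forall j', j = j'.+1 -> cex E C j') ->
  forall (v : {ffun E j.+1 -> A}) w, vmap f v = mact (@cd R E j) w ->
  exists u, v = mact (@cd R E j) u.
move=> tE hfg; case: j => [|j] h v w e; last first.
  by apply: (les_inj hfg (tester_cpx tE) (h j erefl) e).
have [_ E0 _ _ _] := tE.
(* Degree 0 has no term before [E 0]; a zero matrix out of [void] stands in for it. *)
apply: (les_inj hfg (O := fun (_ : void) (_ : E 0%N) => 0) _ _ e).
  by move=> z; rewrite (_ : mact _ z = 0) ?mact0 //; apply/ffunP => x; case: (E0 x).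
by move=> z _; exists 0; apply/ffunP => x; case: (E0 x).
Qed.

Lemma cex_sub A B C (f : {linear A -> B}) (g : {linear B -> C}) (E : coch R) n j :
  tester E n -> ses f g -> cex E B j -> (forall j', j = j'.+1 -> cex E C j') ->
  cex E A j.
move=> tE hfg eB h v hv; have [|w hw] := eB (vmap f v).
  by rewrite -vmap_mact hv vmap0.
exact: (cex_inj tE hfg h hw).
Qed.
End ChaseTools.

Section PhiTools.
Variables (R : ring) (H : cplx R).
Implicit Types A B C : lmod R.

Lemma phi_map_comp A B C (f : {linear A -> B}) (g : {linear B -> C})
  (h : {linear A -> C}) z : (forall x, g (f x) = h x) ->
  phi_map H g (phi_map H f z) = phi_map H h z.
move=> e; have [v <-] := qmodS z; rewrite !phi_mapE.
by congr (qmod_pi _ _); apply/ffunP => i; rewrite !ffunE.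
Qed.

Lemma phi_map_sum A C (L : finT) (f : L -> {linear A -> C}) (h : {linear A -> C}) z :
  (forall x, \sum_l f l x = h x) -> \sum_l phi_map H (f l) z = phi_map H h z.
move=> e; have [v <-] := qmodS z; rewrite phi_mapE.
rewrite (eq_bigr (fun l => qmod_pi _ (vmap (f l) v))); last by move=> l _; rewrite phi_mapE.
rewrite -linear_sum; congr (qmod_pi _ _); apply/ffunP => i; rewrite sum_ffunE ffunE -e.
by apply: eq_bigr => l _; rewrite ffunE.
Qed.

Lemma mex_phi_vec A (L I J K : finT) (P : I -> J -> R) (Q : J -> K -> R) :
  mex P Q (phi H A) -> mex P Q (phi H {ffun L -> A}).
apply: (mex_retract (f := fun l => phi_map H (unitl A l)) (g := fun l => phi_map H (coord A l))).
move=> z; transitivity (\sum_l phi_map H (mklin (linearP (unitl A l \o coord A l))) z).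
  by apply: eq_bigr => l _; apply: phi_map_comp.
rewrite (phi_map_sum (h := idfun)); last by move=> x; rewrite [RHS]sum_unitv.
have [v <-] := qmodS z; rewrite phi_mapE; congr (qmod_pi _ _).
by apply/ffunP => i; rewrite ffunE.
Qed.
End PhiTools.

(** * The chase that compares depths *)

Section Chase.
Variables (R : ring) (H G : cplx R) (E : coch R) (n : set R) (T : lmod R).
Variables (e t xi nu : nat).
Hypotheses (tE : tester E n)
  (dH : forall i, mcpx (dx H i.+1) (dx H i) T)
  (dG : forall i (M : lmod R), mcpx (dx G i.+1) (dx G i) M)
  (G1 : G 1%N -> False)
  (hT : hac H T)
  (hH : forall i, hac H (hmod G i T) /\ van E (phi H (hmod G i T)) xi)
  (hz : forall i, (e < i)%N -> forall z : hmod G i T, z = 0)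
  (Gs : G t.+3 -> False).
Variable x0 : G t.+2.
Hypotheses (es : (e <= t)%N)
  (hn : forall y, n (dx G t.+1 x0 y))
  (vT : van E (phi H T) nu)
  (ineq : (nu + e < xi + t.+1)%N).

Let zm i := zmod G i T.
Let bm i := bmod G i T.
Let zval i : {linear zm i -> {ffun G i.+1 -> T}} := smod_val (@zset_submod R G i T).

Fact bmap_linear i : linear (fun v : {ffun G i.+1 -> T} =>
  smod_of (@rng_sub R _ _ (dx G i) T) (ex_intro2 _ _ v Logic.I erefl) : bm i).
by move=> a u v; apply: val_inj; rewrite /= mactD mactZ. Qed.

Let bmap i : {linear {ffun G i.+1 -> T} -> bm i} := mklin (@bmap_linear i).

Let ses_zb i : ses (zval i) (bmap i).
split; first exact: smod_val_inj.
  by move=> c; have [v _ hv] := smodP c; exists v; apply: val_inj.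
move=> v; split=> [/(congr1 val) /= hv|[z <-]]; first by exists (smod_of (@zset_submod R G i T) hv).
by apply: val_inj; exact: (@smodP _ _ _ (@zset_submod R G i T) z).
Qed.

Fact binc_subproof i (w : bm i.+1) : @zset R G i T (val w).
by have [v _ <-] := smodP w; exact: dG. Qed.

Fact binc_linear i : linear (fun w : bm i.+1 =>
  smod_of (@zset_submod R G i T) (binc_subproof w) : zm i).
by move=> a u v; apply: val_inj. Qed.

Let binc i : {linear bm i.+1 -> zm i} := mklin (@binc_linear i).

Let hpr i : {linear zm i -> hmod G i T} := qmod_pi _.

Let ses_bz i : ses (binc i) (hpr i).
split.
- by move=> u v /(congr1 val) /= h; apply: val_inj.
- exact: qmodS.
move=> z; rewrite qmod_pi0; split=> [[v _ hv]|[w <-]].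
  exists (smod_of (@rng_sub R _ _ (dx G i.+1) T) (ex_intro2 _ _ v Logic.I erefl)).
  by apply: val_inj.
by have [v _ hv] := smodP w; exists v.
Qed.

Let dHC (L : finT) i : mcpx (dx H i.+1) (dx H i) {ffun L -> T}.
exact: mcpx_vec. Qed.

Let dHZ j i : mcpx (dx H i.+1) (dx H i) (zm j).
by apply: (mcpx_inj (f := zval j)); [exact: smod_val_inj|exact: dHC]. Qed.

Let hC (L : finT) : hac H {ffun L -> T}.
by move=> i; apply: mex_vec. Qed.

(** A lower bound on the depth of [phi H A] that grows with [i], cut off at [nu]: the boundaries in
    place [i] satisfy [P i], and each step up the complex gains one degree. *)
Let P i (A : lmod R) := hac H A /\
  forall j, (j < nu)%N -> (j + t.+1 <= nu + i)%N -> cex E (phi H A) j.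

Let Ptriv i (A : lmod R) : (forall a : A, a = 0) -> P i A.
move=> h; split; first exact: hac_triv.
by move=> j _ _; apply: mex_triv; exact: phi_triv.
Qed.

Let bm0 (a : bm 0) : a = 0.
have [v _ hv] := smodP a; apply: val_inj => /=; rewrite -hv.
by apply/ffunP => x; rewrite !ffunE big1 // => y _; case: (G1 y).
Qed.

Let stepZ i : P i (bm i) -> P i.+1 (zm i).
move=> [h1 h2]; have hs := phi_ses (dHC (L := _) (i := 0)) (h1 0%N) (ses_zb i).
split; first exact: (hac_sub (dHC (L := _)) (ses_zb i)).
move=> j jn js; apply: (cex_sub tE hs); first exact/mex_phi_vec/vT.
by move=> j' jE; apply: h2; lia.
Qed.

Let stepB i : P i.+1 (zm i) -> P i.+1 (bm i.+1).
move=> [h1 h2]; have [k1 k2] := hH i.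
have hs := phi_ses (@dHZ i 0) (k1 0%N) (ses_bz i).
split; first exact: (hac_sub (@dHZ i) (ses_bz i)).
move=> j jn js; apply: (cex_sub tE hs); first exact: h2.
move=> j' jE; have [ei|ie] := ltnP e i.
  by apply: mex_triv; apply: phi_triv; exact: hz.
by apply: k2; lia.
Qed.

Let PB i : P i (bm i).
by elim: i => [|i /stepZ /stepB //]; apply: Ptriv; exact: bm0. Qed.

Let zm_triv (z : zm t.+1) : z = 0.
have /qmod_pi0[v _ hv] : hpr t.+1 z = 0 by exact: hz.
apply: val_inj; rewrite /= -[LHS]hv.
by apply/ffunP => x; rewrite !ffunE big1 // => y _; case: (Gs y).
Qed.

(** The row [x0] of the last matrix acts by zero on cohomology, its entries being in [n]. The last
    map is also injective on cohomology of degree [nu], by the depth bounds on boundaries and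
    homology. Hence every class of degree [nu] vanishes. *)
Lemma chase : cex E (phi H T) nu.
move=> v hv.
(* [v] is placed in coordinate [x0]. The last matrix turns it into the multiples
   [dx G t.+1 x0 y *: v], which are coboundaries. *)
pose w := vmap (phi_map H (unitl T x0)) v.
have [W hW] : exists W,
  vmap (phi_map H (mklin (linearP (@mact R T _ _ (dx G t.+1))))) w = mact (@cd R E nu) W.
  have /choice[u hu] : forall y, exists u, dx G t.+1 x0 y *: vmap (phi_map H (unitl T y)) v
  = mact (@cd R E nu) u.
  move=> y; have [_ _ _ _ /(_ _ (hn y))hE] := tE.
  by apply: (htpy_act hE); rewrite -vmap_mact hv vmap0.
  exists (\sum_y u y); rewrite linear_sum -(eq_bigr _ (fun y _ => hu y)).
  apply/ffunP => k; rewrite sum_ffunE !ffunE.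
  pose f y := mklin (linearP (dx G t.+1 x0 y \*: unitl T y)).
  rewrite (eq_bigr (fun y => phi_map H (f y) (v k))); last first.
  move=> y _; rewrite !ffunE; have [z <-] := qmodS (v k).
  rewrite !phi_mapE (_ : vmap (f y) z = dx G t.+1 x0 y *: vmap (unitl T y) z).
  by rewrite qmod_piZ.
  by apply/ffunP => i; rewrite !ffunE.
  rewrite (phi_map_sum (h := mklin (linearP (@mact R T _ _ (dx G t.+1) \o unitl T x0)))).
  exact: phi_map_comp.
  move=> x /=; apply/ffunP => y; rewrite sum_ffunE !ffunE (bigD1 y) //=.
  rewrite !ffunE eqxx big1 ?addr0; last first.
  by move=> y' /negbTE h; rewrite !ffunE eq_sym h scaler0.
  rewrite (bigD1 x0) //= ffunE eqxx big1 ?addr0 // => z /negbTE h.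
  by rewrite ffunE h scaler0.
(* Projecting back to coordinate [x0] returns [v], so it is enough that [w] is a coboundary. *)
suff [u hu] : exists u, w = mact (@cd R E nu) u.
  exists (vmap (phi_map H (coord T x0)) u); rewrite -vmap_mact -hu.
  apply/ffunP => k; rewrite !ffunE.
  rewrite (phi_map_comp (h := idfun)); last by move=> x; rewrite /= ffunE eqxx.
  have [z <-] := qmodS (v k); rewrite phi_mapE; congr (qmod_pi _ _).
  by apply/ffunP => i; rewrite ffunE.
(* The last map factors through its boundaries, the cycles [zm t] and the vectors on [G t.+1]. The
   first arrow is injective because [zm t.+1] is zero, the other two are so on cohomology of degree
   [nu]. *)
have hs1 := phi_ses (dHC (L := _) (i := 0)) ((PB t.+1).1 0%N) (ses_zb t.+1).
suff [u' hu'] : exists u', vmap (phi_map H (bmap t.+1)) w = mact (@cd R E nu) u'.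
  have [_ sg _] := ses_vecP (E nu) hs1; have [u hu] := sg u'.
  exists u; apply/eqP; rewrite -subr_eq0; apply/eqP/ffunP => k; rewrite [RHS]ffunE.
  have : vmap (phi_map H (bmap t.+1)) (w - mact (@cd R E nu) u) = 0.
  by rewrite vmapB vmap_mact hu hu' subrr.
  move=> /ffunP/(_ k); rewrite ffunE [RHS]ffunE; have [_ _ ex] := hs1.
  by move=> /ex[z]; rewrite (phi_triv zm_triv z) linear0 => <-.
have hs2 := phi_ses (dHC (L := _) (i := 0)) ((PB t).1 0%N) (ses_zb t).
have hs3 := phi_ses (@dHZ t 0) ((hH t).1 0%N) (ses_bz t).
have [||u1 hu1] := cex_inj tE hs2 (j := nu) _ (w := W)
  (v := vmap (phi_map H (binc t)) (vmap (phi_map H (bmap t.+1)) w)).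
- by move=> j' jE; apply: (PB t).2; lia.
- rewrite -hW; apply/ffunP => k; rewrite !ffunE.
  rewrite (phi_map_comp (h := zval t \o binc t)) // (phi_map_comp (h := mklin
  (linearP (@mact R T _ _ (dx G t.+1))))) //.
have [|u2 hu2] := cex_inj tE hs3 (j := nu) _ hu1; last by exists u2.
move=> j' jE; have [et|te] := ltnP e t.
  by apply: mex_triv; apply: phi_triv; exact: hz.
by apply: (hH t).2; lia.
Qed.
End Chase.

Lemma dependent_choice (T : nat -> Type) (P : forall i, T i -> Prop)
  (Q : forall i, T i -> T i.+1 -> Prop) (x0 : T 0%N) : P 0%N x0 ->
  (forall i x, P i x -> exists y, P i.+1 y /\ Q i x y) ->
  exists f : forall i, T i, f 0%N = x0 /\ forall i, P i (f i) /\ Q i (f i) (f i.+1).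
move=> P0 hs; pose U i := {x : T i | P i x}.
pose nx i (u : U i) : U i.+1 :=
  let h := cid (hs i (projT1 u) (projT2 u)) in exist _ (projT1 h) (projT2 h).1.
pose g := fix g i : U i := if i is j.+1 then nx j (g j) else exist _ x0 P0.
exists (fun i => projT1 (g i)); split=> // i; split; first exact: (projT2 (g i)).
by rewrite /= /nx; case: (cid _) => y [].
Qed.

Lemma surj_factor R (F K L : lmod R) (p : {linear F -> K})
  (q : {linear F -> L}) : surj p ->
  (forall v, p v = 0 -> q v = 0) -> exists g : {linear K -> L}, forall v, g (p v) = q v.
move=> /choice[s hs] h.
have e v : q (s (p v)) = q v.
  by apply/eqP; rewrite -subr_eq0 -linearB; apply/eqP/h; rewrite linearB hs subrr.
have gl : linear (q \o s).
  move=> a x y /=; rewrite -{1}(hs x) -{1}(hs y) -linearP e linearP.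
  by rewrite -{1}(hs x) -{1}(hs y) !e.
by exists (mklin gl).
Qed.

(** * Free resolutions by matrices *)

Section Resolutions.
Variable R : ring.
Implicit Types K M : lmod R.

Definition pres (I J : finT) (A : J -> I -> R) K : Prop :=
  exists2 p : {linear {ffun I -> R^o} -> K}, surj p &
  forall v, p v = 0 <-> exists u, v = mact A u.

Definition syz (L J I : finT) (B : L -> J -> R) (A : J -> I -> R) : Prop :=
  mcpx B A R^o /\ mex B A R^o.

Lemma sum_rows (L J : finT) (x : L -> {ffun J -> R^o}) (c : L -> R) :
  \sum_l c l *: x l = mact (fun l j => x l j : R) (finfun c : {ffun L -> R^o}).
apply/ffunP => j; rewrite sum_ffunE !ffunE; apply: eq_bigr => l _.
by rewrite !ffunE /GRing.scale /= mulrC.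
Qed.

Lemma sum_unit_row (J : finT) (v : {ffun J -> R^o}) :
  v = \sum_j (v j : R) *: unitv j (1 : R^o).
rewrite {1}(sum_unitv v); apply: eq_bigr => j _; apply/ffunP => k; rewrite !ffunE.
by case: eqP => _; rewrite ?scaler0 // /GRing.scale /= mulr1.
Qed.

Lemma mcpx_ring (I J L : finT) (P : I -> J -> R) (Q : J -> L -> R) M :
  mcpx P Q R^o -> mcpx P Q M.
move=> h; apply: mcpx_mulm => i l.
apply: (mact_ext_ring (Q := fun _ _ => 0)) => v; rewrite -mact_mulm h.
by apply/ffunP => k; rewrite !ffunE big1 // => j _; rewrite scale0r.
Qed.

Lemma lift_matrix (I J L : finT) (D : J -> L -> R)
  (F : {linear {ffun I -> R^o} -> {ffun L -> R^o}}) :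
  (forall v, exists u, F v = mact D u) ->
  exists s : I -> J -> R, forall v : {ffun I -> R^o}, mact D (mact s v) = F v.
move=> hF.
have /choice[u hu] : forall i, exists u, F (unitv i (1 : R^o)) = mact D u by move=> i; exact: hF.
exists (fun i j => u i j) => v.
rewrite {2}(sum_unit_row v) linear_sum.
rewrite (_ : v = finfun (v : I -> R) :> {ffun I -> R^o}); last by apply/ffunP => i; rewrite ffunE.
rewrite -sum_rows linear_sum; apply: eq_bigr => i _.
by rewrite [LHS]mactZ linearZ -hu /= ffunE.
Qed.

Section Step.
Variable nx : nat -> forall I J : finT, (J -> I -> R) -> {L : finT & L -> J -> R}.

Definition matseq (I J : finT) (A : J -> I -> R) :=
  fix st i : {I : finT & {J : finT & J -> I -> R}} :=
  if i is j.+1 then existT _ (projT1 (projT2 (st j))) (nx j (projT2 (projT2 (st j))))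
  else existT _ I (existT _ J A).

Definition matcplx (I J : finT) (A : J -> I -> R) : cplx R :=
  Cplx (fun i => projT2 (projT2 (matseq A i)) : projT1 (matseq A i.+1) -> projT1 (matseq A i) -> R).
End Step.

(** [Pr] is an invariant of the successive matrices; its choice controls the length of the
    resolution or where its entries lie. *)
Lemma resolution_with (Pr : nat -> forall I J : finT, (J -> I -> R) -> Prop)
  (I J : finT) (A : J -> I -> R) K :
  (forall i (I J : finT) (A : J -> I -> R), Pr i I J A ->
  exists (L : finT) (B : L -> J -> R), syz B A /\ Pr i.+1 J L B) ->
  pres A K -> Pr 0%N I J A ->
  exists C : cplx R, [/\ pres (dx C 0) K, forall i, syz (dx C i.+1) (dx C i) &
  forall i, Pr i (C i) (C i.+1) (dx C i)].
move=> hs pA P0.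
have hs' i (I' J' : finT) (A' : J' -> I' -> R) : exists LB : {L : finT & L -> J' -> R},
  Pr i _ _ A' -> syz (projT2 LB) A' /\ Pr i.+1 _ _ (projT2 LB).
  (* Matrices outside [Pr] receive a dummy syzygy, which makes the choice function total. *)
  have [h|h] := pselect (Pr i I' J' A'); last by exists (existT (fun L : finT => L -> J' -> R) void (fun _ _ => 0)).
  by have [L [B hB]] := hs _ _ _ _ h; exists (existT _ L B).
pose nx i I' J' A' := projT1 (cid (hs' i I' J' A')).
have nxP i I' J' A' : Pr i I' J' A' -> syz (projT2 (nx i I' J' A')) A' /\
  Pr i.+1 _ _ (projT2 (nx i I' J' A')) by rewrite /nx; case: (cid _).
pose C := matcplx nx A.
have PC i : Pr i (C i) (C i.+1) (dx C i).
  by elim: i => [//|i IH]; exact: (nxP _ _ _ _ IH).2.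
by exists C; split=> // i; exact: (nxP _ _ _ _ (PC i)).1.
Qed.

Lemma syz_exists (I J : finT) (A : J -> I -> R) : noetherian R ->
  exists (L : finT) (B : L -> J -> R), syz B A.
move=> /noetherianP nR.
have nV : noethM {ffun J -> R^o} by exact: noethM_vec.
pose S : set {ffun J -> R^o} := [set v | mact A v = 0].
have hS : submod S.
  split=> [|u v|a u]; rewrite /S /= ?mact0 ?mactD ?mactZ //; last by move->; rewrite scaler0.
  by move=> -> ->; rewrite addr0.
have [L [x Sx]] := nV S hS; exists L, (fun l j => x l j); split=> v.
  have : S (mact (fun l j => x l j : R) v).
  rewrite Sx; exists v; rewrite sum_rows; congr (mact _ _).
  by apply/ffunP => l; rewrite ffunE.
  by [].
move=> hv; have : S v by []. rewrite Sx => -[c ->]; exists (finfun c).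
exact: sum_rows.
Qed.

Lemma pres_exists K : noetherian R -> fg K ->
  exists (I J : finT) (A : J -> I -> R), pres A K.
move=> /noetherianP nR [I [x hx]].
have nV : noethM {ffun I -> R^o} by exact: noethM_vec.
pose S : set {ffun I -> R^o} := [set v | comb x v = 0].
have hS : submod S.
  split=> [|u v|a u]; rewrite /S /= ?linear0 ?linearD ?linearZ //=.
  by move=> -> ->; rewrite addr0.
  by move->; rewrite scaler0.
have [J [a Sa]] := nV S hS; exists I, J, (fun j i => a j i), (comb x : {linear _ -> _}).
  by move=> k; have /fspanP := hx k.
move=> v; have -> : (comb x v = 0) = S v by []. rewrite Sa; split=> [[c ->]|[u ->]].
  by exists (finfun c); exact: sum_rows.
by exists u; rewrite sum_rows; congr (mact _ _); apply/ffunP => l; rewrite ffunE.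
Qed.

Lemma resolution_exists K : noetherian R -> fg K ->
  exists C : cplx R, pres (dx C 0) K /\ forall i, syz (dx C i.+1) (dx C i).
move=> nR fK; have [I [J [A pA]]] := pres_exists nR fK.
have [|//|C [h1 h2 _]] := @resolution_with (fun _ _ _ _ => True) I J A K _ pA _; last by exists C.
by move=> _ I' J' A' _; have [L [B hB]] := syz_exists A' nR; exists L, B.
Qed.

(* the last matrix is injective and has a row with entries in [n] *)
Fixpoint frm (n : set R) k (I J : finT) (A : J -> I -> R) : Prop :=
  if k is l.+1 then exists (L : finT) (B : L -> J -> R), syz B A /\ frm n l B
  else (exists x, forall y, n (A x y)) /\ forall u : {ffun J -> R^o}, mact A u = 0 -> u = 0.

Lemma empty_syz (I J : finT) (A : J -> I -> R) :
  (forall u : {ffun J -> R^o}, mact A u = 0 -> u = 0) ->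
  syz (fun (_ : void) (_ : J) => 0) A.
have e v : mact (fun (_ : void) (_ : J) => 0 : R) v = 0 :> {ffun J -> R^o}.
  by apply/ffunP => j; rewrite !ffunE big1 // => -[].
by move=> h; split=> [v|v /h ->]; [rewrite e mact0|exists 0; rewrite mact0].
Qed.

Lemma finite_resolution n s (I J : finT) (A : J -> I -> R) K :
  pres A K -> frm n s A ->
  exists C : cplx R, [/\ pres (dx C 0) K, forall i, syz (dx C i.+1) (dx C i),
  exists x : C s.+1, forall y, n (dx C s x y) & C s.+2 -> False].
move=> pA fA; pose Pr i (I' J' : finT) (A' : J' -> I' -> R) : Prop :=
  if (i <= s)%N then frm n (s - i) A' else J' -> False.
have [||C [h1 h2 h3]] := @resolution_with Pr I J A K _ pA _.
- move=> i I' J' A'; rewrite /Pr; case: (ltngtP i s) => [is_|si|->].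
  + rewrite -(subnSK is_) => -[L [B [hB fB]]]; exists L, B; split=> //.
  + move=> h; exists void, (fun _ _ => 0); split; last by case.
  by apply: empty_syz => u _; apply/ffunP => j; case: (h j).
  + rewrite subnn => -[_ h]; exists void, (fun _ _ => 0); split; last by case.
  exact: empty_syz.
- by rewrite /Pr /= subn0.
exists C; split=> //.
  by have := h3 s; rewrite /Pr leqnn subnn => -[].
by have := h3 s.+1; rewrite /Pr ltnn.
Qed.
End Resolutions.

(** The homotopy is built degree by degree: [y v - s (d v)] is a cycle, hence a boundary by
    exactness. The hypothesis [kG] starts the construction at [G 2], where homology is allowed. *)
Lemma acyclic_chtpy R (G : cplx R) y :
  (forall i (M : lmod R), mcpx (dx G i.+1) (dx G i) M) -> (G 1%N -> False) ->
  (forall i, mex (dx G i.+3) (dx G i.+2) R^o) ->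
  (forall v : {ffun G 2%N -> R^o}, exists u, y *: v = mact (dx G 2) u) ->
  exists s, @chtpy R G y s.
move=> cG G1 eG kG; have G0 (v : {ffun G 1%N -> R^o}) : v = 0 by apply/ffunP => x; case: (G1 x).
pose T i := G i.+1 -> G i.+2 -> R.
pose P i (s : T i) := forall w : {ffun G i.+1 -> R^o}, mact (dx G i) w = 0 ->
  mact (dx G i.+1) (mact s w) = y *: w.
pose Q i (s : T i) (s' : T i.+1) := forall v : {ffun G i.+2 -> R^o},
  mact (dx G i.+2) (mact s' v) + mact s (mact (dx G i.+1) v) = y *: v.
have [||f [_ hf]] := @dependent_choice T P Q (fun _ _ => 0).
- by move=> w _; rewrite [w]G0 !mact0 scaler0.
- move=> i s hs.
  have Fl : linear (fun v : {ffun G i.+2 -> R^o} => y *: v - mact s (mact (dx G i.+1) v)).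
  move=> a u v; rewrite !mactD !mactZ scalerDr scalerBr opprD addrACA.
  by rewrite !scalerA mulrC.
  have [|s' hs'] := @lift_matrix R _ _ _ (dx G i.+2) (mklin Fl).
  move=> v; case: i s hs Fl v => [|i] s hs Fl v /=.
  by rewrite [mact (dx G 1) v]G0 mact0 subr0; exact: kG.
  have [|u hu] := eG i (y *: v - mact s (mact (dx G i.+2) v)); last by exists u.
  rewrite mactB mactZ hs ?subrr //; exact: cG.
  exists s'; split=> [w hw|v]; last by rewrite hs' /= subrK.
  by rewrite hs' /= hw mact0 subr0.
by exists f => i v; exact: (hf i).2.
Qed.

Section Shift.
Variables (R : ring) (C : cplx R).

(** Two empty terms come in front, so that [C 0] sits in place 2 and [hmod 1] is the resolved
    module; the zero module [hmod 0] is what the splitting over [K / y K] refers to in its lowest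
    degree. *)
Definition shift2_rk i : finT := if i is i.+2 then C i else void.

Definition shift2_dm i : shift2_rk i.+1 -> shift2_rk i -> R :=
  match i return shift2_rk i.+1 -> shift2_rk i -> R with
  | 0 | 1 => fun _ _ => 0 | i.+2 => dx C i end.

Definition shift2 : cplx R := Cplx shift2_dm.

Hypothesis hC : forall i, syz (dx C i.+1) (dx C i).

Lemma shift2_cpx i (M : lmod R) : mcpx (dx shift2 i.+1) (dx shift2 i) M.
case: i => [|[|i]]; last by apply: mcpx_ring; exact: (hC i).1.
  by move=> v; apply/ffunP => -[].
by move=> v; apply/ffunP => -[].
Qed.

Lemma shift2_hmod0 i : i <> 1%N -> forall z : hmod shift2 i R^o, z = 0.
move=> i1 z; have [v [hv ->]] := hmodW z; apply/zcls0.
case: i v hv i1 {z} => [|[//|i]] v hv _.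
  by exists 0; apply/ffunP => -[].
have [_ /(_ v hv)[u ->]] := hC i; exists u => //.
Qed.

Variable K : lmod R.
Hypothesis pC : pres (dx C 0) K.

Lemma shift2_hmod1 : exists (f : {linear hmod shift2 1 R^o -> K})
  (g : {linear K -> hmod shift2 1 R^o}), cancel f g.
have [p ps pk] := pC.
pose zin : {linear zmod shift2 1 R^o -> {ffun C 0 -> R^o}} := smod_val _.
have z0 (v : {ffun C 0%N -> R^o}) : mact (dx shift2 1) v = 0 by apply/ffunP => -[].
have [w e|f hf] := @surj_factor R _ _ _ (qmod_pi (@bset_submod R shift2 1 R^o))
  (mklin (linearP (p \o zin))) (@qmodS _ _ _ _).
  have [v [hv ew]] := hmodW (qmod_pi (@bset_submod R shift2 1 R^o) w).
  move: e => /qmod_pi0 hw; rewrite /= .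
  by apply/pk; have [u _ hu] := hw; exists u; exact: (esym hu).
have zl : linear (fun v => smod_of (@zset_submod R shift2 1 R^o) (z0 v)).
  by move=> a u v; apply: val_inj.
have [v /pk[u hu]|g hg] := @surj_factor R _ _ _ p
  (mklin (linearP (qmod_pi (@bset_submod R shift2 1 R^o) \o mklin zl))) ps.
  by apply/qmod_pi0; exists u; rewrite // hu.
exists f, g => z; have [w <-] := qmodS z; rewrite hf /= hg /=.
by congr (qmod_pi _ _); apply: val_inj.
Qed.

Lemma shift2_chtpy y : (forall k : K, y *: k = 0) -> exists s, @chtpy R shift2 y s.
move=> yK; have [p ps pk] := pC.
apply: acyclic_chtpy => [i M|[]|i|v]; [exact: shift2_cpx|exact: (hC i).2|].
by have [|u hu] := (pk (y *: v)).1; [rewrite linearZ /= yK|exists u].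
Qed.
End Shift.

Lemma cyclic_pres R (J : set R) (hJ : @submod R R^o J) : noetherian R ->
  exists (I : finT) (A : I -> unit -> R), pres A (qmod hJ) /\
  forall a, J a <-> exists c : {ffun I -> R^o}, mact A c tt = a.
move=> nR; have [I [x ex]] := (noetherianP R).1 nR _ hJ.
pose A (i : I) (_ : unit) : R := x i.
have AE (c : {ffun I -> R^o}) : mact A c tt = \sum_i (c i : R) * x i.
  by rewrite mactE; apply: eq_bigr => i _; exact: mulrC.
have pE a : J a <-> exists c : {ffun I -> R^o}, mact A c tt = a.
  rewrite ex; split=> [[c ->]|[c <-]]; last by rewrite AE; exists c.
  by exists (finfun c : {ffun I -> R^o}); rewrite AE; apply: eq_bigr => i _; rewrite ffunE.
exists I, A; split=> //; exists (qmod_pi hJ \o @coord R R^o unit tt) => [k|v] /=.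
  by have [a <-] := qmodS k; exists [ffun=> a]; rewrite /coord /= ffunE.
rewrite -[_ = 0]/(qmod_pi hJ (v tt) = 0) qmod_pi0 pE; split=> -[c e]; exists c; last by rewrite e.
by apply/ffunP => -[]; rewrite e.
Qed.

(* The dual of a free resolution of [R / J], on which [J] acts by zero up to
   homotopy. *)
Lemma testerP R (J : set R) : noetherian R -> is_ideal J ->
  exists E : coch R, tester E J.
move=> nR iJ; have hJ := (idealS J).1 iJ; have [I [A [pA pE]]] := cyclic_pres hJ nR.
have [||C [pC sC hC]] := @resolution_with R (fun i I _ A => i = 0%N -> (exists x : I, True) /\
  forall x y, J (A x y)) _ _ A (qmod hJ) _ pA.
- by move=> i I' L B _; have [L' [B' hB]] := syz_exists B nR; exists L', B'.
- move=> _; split=> [|x []]; first by exists tt.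
  apply/pE; exists (unitv x (1 : R^o)); rewrite mactE (bigD1 x) //= ffunE eqxx big1 => [|y /negPf yx].
  by rewrite addr0; exact: mulr1.
  by rewrite ffunE yx scaler0.
have [C0 hC0] := hC 0%N erefl.
(* The dual complex: matrices are transposed, and one of the two leading empty terms becomes
   [E 0]. *)
pose S := shift2 C; pose E := Coch (fun i (x : S i.+1) (y : S i.+2) => dx S i.+1 y x).
have zero i x z : mulm (dx S i.+1) (dx S i) x z = 0.
  apply: (mact_ext_ring (Q := fun _ _ => 0)) => v; rewrite -mact_mulm (shift2_cpx sC).
  by apply/ffunP => j; rewrite !ffunE big1 // => k _; rewrite scale0r.
exists E; split=> [i x z|[]||x y|a Ja] //.
- by rewrite -[RHS](zero i.+1 z x); apply: eq_bigr => y _; rewrite mulrC.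
- exact: hC0.
have [k|s hs] := shift2_chtpy sC pC (y := a).
  by have [v <-] := qmodS k; rewrite -linearZ; apply/qmod_pi0; exact: (idealM v iJ).
exists (fun i x y => s i y x) => i x y; rewrite [x == y]eq_sym -(chtpy_mulm (i := i) hs).
by congr (_ + _); apply: eq_bigr => z _; exact: mulrC.
Qed.

(** * Finite free resolutions and global dimension *)

Section GlobalDimension.
Variable R : ring.
Implicit Types K M : lmod R.

(** [D] counts the syzygies taken before an injective matrix is reached. *)
Fixpoint fr D (I J : finT) (A : J -> I -> R) : Prop :=
  if D is k.+1 then exists (L : finT) (B : L -> J -> R), syz B A /\ fr k B
  else forall u : {ffun J -> R^o}, mact A u = 0 -> u = 0.

(** Finite global dimension stated on matrices: every kernel has a finite free resolution of bounded
    length. *)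
Definition gl D : Prop := forall (I J : finT) (A : J -> I -> R), fr D A.

Lemma sum_sig (V : nmodType) (I : finT) (i0 : I) (F : I -> V) :
  \sum_i F i = F i0 + \sum_(i : {i : I | i != i0}) F (val i).
by rewrite (bigD1 i0) //= (big_sub (fun i => i != i0)). Qed.

Definition res_vec M (I : finT) (i0 : I) (v : {ffun I -> M}) :
  {ffun {i : I | i != i0} -> M} := [ffun i => v (val i)].

Definition ext_vec M (I : finT) (i0 : I) (v : {ffun {i : I | i != i0} -> M}) :
  {ffun I -> M} := [ffun i => oapp v 0 (insub i)].

Lemma ext_vec0 M (I : finT) (i0 : I) (v : {ffun {i : I | i != i0} -> M}) :
  ext_vec v i0 = 0.
by rewrite ffunE insubF // eqxx. Qed.

Lemma ext_vecE M (I : finT) (i0 : I) (v : {ffun {i : I | i != i0} -> M}) i :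
  ext_vec v (val i) = v i.
by rewrite ffunE valK. Qed.

Lemma ext_vec_ext M (I : finT) (i0 : I) (v : {ffun {i : I | i != i0} -> M}) (w : {ffun I -> M}) :
  w i0 = 0 -> (forall i : {i | i != i0}, w (val i) = v i) -> w = ext_vec v.
move=> h0 h; apply/ffunP => i; have [->|hi] := eqVneq i i0; first by rewrite ext_vec0.
by rewrite -[i]/(val (exist (fun i => i != i0) i hi)) ext_vecE h.
Qed.

Fact ext_vec_linear M (I : finT) (i0 : I) : linear (@ext_vec M I i0).
move=> a u v; symmetry; apply: ext_vec_ext => [|i].
  by rewrite ffunE ffunE !ext_vec0 scaler0 addr0.
by rewrite [LHS]ffunE [X in X + _]ffunE !ext_vecE !ffunE.
Qed.

Section FieldCase.
Hypotheses (fR : forall x : R, x <> 0 -> exists y, y * x = 1)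
  (nR : noetherian R).

(** A linear relation among the rows of [B] with a nonzero coefficient, over a field, lets that row
    be dropped without changing the image. *)
Lemma field_independent (I J : finT) (A : J -> I -> R) m (L : finT) (B : L -> J -> R) :
  (#|L| <= m)%N -> syz B A -> exists (L' : finT) (B' : L' -> J -> R), syz B' A /\
  forall u : {ffun L' -> R^o}, mact B' u = 0 -> u = 0.
elim: m L B => [|m IH] L B Lm [h1 h2].
  exists L, B; split=> // u _; apply/ffunP => l.
  by have /card0_eq/(_ l) : #|L| = 0%N by apply/eqP; rewrite -leqn0.
have [h|/existsNP[u]] := pselect (forall u : {ffun L -> R^o}, mact B u = 0 -> u = 0).
  by exists L, B.
move=> /not_implyP[u0 un0].
have [l0 hl0] : exists l, u l <> 0.
  apply: contrapT => h; apply: un0; apply/ffunP => l; rewrite [RHS]ffunE.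
  by apply: contrapT => hl; apply: h; exists l.
have [b hb] := fR hl0.
apply: (IH {l : L | l != l0} (fun l => B (val l))).
  by rewrite card_sig -ltnS (leq_trans _ Lm) // (cardD1 l0 L) /= ltnS; apply/subset_leq_card/fintype.subsetP => l; rewrite !inE andbT.
have hm (w : {ffun L -> R^o}) : w l0 = 0 -> mact B w = mact (fun l : {l | l != l0} => B (val l)) (res_vec l0 w).
  move=> w0; apply/ffunP => j; rewrite !ffunE (sum_sig l0) w0 scaler0 add0r.
  by apply: eq_bigr => l _; rewrite ffunE.
split=> [v|v /h2[w ->]].
  have <- : res_vec l0 (ext_vec v) = v by apply/ffunP => l; rewrite ffunE ext_vecE.
  by rewrite -hm ?ext_vec0 // h1.
exists (res_vec l0 (w - (w l0 : R) *: (b *: u))); rewrite -hm.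
  by rewrite mactB !mactZ u0 !scaler0 subr0.
by rewrite !ffunE /GRing.scale /= mulrA -mulrA hb mulr1 subrr.
Qed.

Lemma gl_field : gl 1.
move=> I J A; have [L [B hB]] := syz_exists A nR.
exact: (@field_independent I J A #|L| L B (leqnn _) hB).
Qed.
End FieldCase.

(** Gaussian elimination: a generator and a relation cancel at the unit entry [A j0 i0], and [A'] is
    its Schur complement. *)
Lemma elim_unit (I J : finT) (A : J -> I -> R) K i0 j0 b : pres A K ->
  (forall u : {ffun J -> R^o}, mact A u = 0 -> u = 0) -> b * A j0 i0 = 1 ->
  exists A' : {j : J | j != j0} -> {i : I | i != i0} -> R, pres A' K /\
  (forall u : {ffun {j : J | j != j0} -> R^o}, mact A' u = 0 -> u = 0).
move=> [p ps pk] Ai hb.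
pose A' (j : {j : J | j != j0}) (i : {i : I | i != i0}) :=
  A (val j) (val i) - A (val j) i0 * b * A j0 (val i).
have scaleE (x : R) (y : R^o) : x *: y = x * y by [].
have up (u : {ffun {j : J | j != j0} -> R^o}) : exists w : {ffun J -> R^o},
  (forall j : {j | j != j0}, w (val j) = u j) /\ ext_vec (mact A' u) = mact A w.
  pose c : R := - (b * \sum_(j : {j : J | j != j0}) A (val j) i0 * u j).
  exists (ext_vec u + unitv j0 (c : R^o)); split=> [j|].
  by rewrite ffunE ext_vecE ffunE (negbTE (valP j)) addr0.
  symmetry; apply: ext_vec_ext => [|i].
  rewrite mactE (sum_sig j0) !ffunE eqxx insubF ?eqxx //= add0r !scaleE /c.
  rewrite mulrN mulrA [A _ _ * b]mulrC hb mul1r addrC; apply/eqP; rewrite subr_eq0.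
  apply/eqP/eq_bigr => j _; rewrite !scaleE ffunE ext_vecE ffunE (negbTE (valP j)).
  by rewrite addr0.
  rewrite !mactE (sum_sig j0) !ffunE eqxx insubF ?eqxx //= add0r !scaleE /c.
  rewrite mulrN mulr_sumr mulr_sumr -sumrN -big_split; apply: eq_bigr => j _ /=.
  by rewrite !scaleE ffunE ext_vecE ffunE (negbTE (valP j)) addr0 /A'; ring.
have down (w : {ffun J -> R^o}) : mact A w i0 = 0 ->
  mact A w = ext_vec (mact A' (res_vec j0 w)).
  move=> w0; apply: ext_vec_ext => // i; move: w0.
  rewrite !mactE !(sum_sig j0) !scaleE => /eqP; rewrite addr_eq0 => /eqP e.
  have ew : (w j0 : R) = - (b * \sum_(j : {j : J | j != j0}) A (val j) i0 * w (val j)).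
  transitivity (b * A j0 i0 * w j0); first by rewrite hb mul1r.
  by rewrite -mulrA e mulrN; congr (- (_ * _)); apply: eq_bigr => j _.
  rewrite ew mulrN !mulr_sumr -sumrN -big_split; apply: eq_bigr => j _ /=.
  by rewrite !scaleE !ffunE /A'; ring.
exists A'; split; last first.
  move=> u hu; have [w [hw e]] := up u; apply/ffunP => j; rewrite -hw.
  rewrite (Ai w) ?ffunE // -e hu; symmetry; apply: ext_vec_ext => [|i]; by rewrite !ffunE.
exists (mklin (linearP (p \o mklin (@ext_vec_linear R^o I i0)))) => [k|v].
  have [v <-] := ps k.
  pose w : {ffun I -> R^o} := v - mact A (unitv j0 (v i0 * b : R^o)).
  have w0 : w i0 = 0.
  rewrite !ffunE (bigD1 j0) //= big1 ?addr0; last first.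
  by move=> j /negbTE jn; rewrite ffunE jn scaler0.
  by rewrite ffunE eqxx scaleE [A _ _ * _]mulrC -mulrA hb mulr1 subrr.
  exists (res_vec i0 w) => /=.
  have <- : w = ext_vec (res_vec i0 w) by apply: ext_vec_ext => // i; rewrite [RHS]ffunE.
  by rewrite /w linearB (_ : p (mact _ _) = 0) ?subr0 //; apply/pk; eexists.
split=> [/pk[w e]|[u ->]] /=; last by apply/pk; have [w [_ ->]] := up u; exists w.
exists (res_vec j0 w); have e' : ext_vec v = ext_vec (mact A' (res_vec j0 w)).
  by rewrite -down // -e ext_vec0.
by apply/ffunP => i; have /ffunP/(_ (val i)) := e'; rewrite !ext_vecE.
Qed.

Section Local.
Variable n : set R.
Hypothesis un : forall x, ~ n x -> exists y, y * x = 1.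

(** Unit entries are cancelled one at a time until some row has all its entries in [n] or no row is
    left. *)
Lemma minimal_injective m (I J : finT) (A : J -> I -> R) K : (#|J| <= m)%N ->
  pres A K -> (forall u : {ffun J -> R^o}, mact A u = 0 -> u = 0) ->
  exists (I' J' : finT) (A' : J' -> I' -> R), pres A' K /\
  ((J' -> False) \/ frm n 0 A').
elim: m I J A => [|m IH] I J A Jm pA Ai.
  exists I, J, A; split=> //; left=> j.
  by have /card0_eq/(_ j) : #|J| = 0%N by apply/eqP; rewrite -leqn0.
have [[j0 _]|h0] := pselect (exists j : J, True); last first.
  by exists I, J, A; split=> //; left=> j; apply: h0; exists j.
have [h|/forallNP h] := pselect (exists x, forall y, n (A x y)).
  by exists I, J, A; split=> //; right.
have /existsNP[i0 /un[b hb]] := h j0.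
have [A' [pA' Ai']] := elim_unit pA Ai hb.
apply: (IH _ _ A' _ pA' Ai').
by rewrite card_sig -ltnS (leq_trans _ Jm) // (cardD1 j0 J) /= ltnS; apply/subset_leq_card/fintype.subsetP => l; rewrite !inE andbT.
Qed.
End Local.

Definition imA (I J : finT) (A : J -> I -> R) : lmod R :=
  smod (@rng_sub R _ _ A R^o).

Lemma pres_syz (L I J : finT) (B : L -> J -> R) (A : J -> I -> R) :
  syz B A -> pres B (imA A).
move=> [h1 h2].
have fl : linear (fun v : {ffun J -> R^o} =>
  smod_of (@rng_sub R _ _ A R^o) (ex_intro2 _ _ v Logic.I erefl)).
  by move=> a u v; apply: val_inj; rewrite /= mactD mactZ.
exists (mklin fl) => [k|v].
  by have [v _ e] := smodP k; exists v; apply: val_inj.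
split=> [/(congr1 val)/h2 //|[u ->]]; by apply: val_inj; rewrite /= h1.
Qed.

Lemma pres_ses (I J : finT) (A : J -> I -> R) K : pres A K ->
  exists (f : {linear imA A -> {ffun I -> R^o}}) (g : {linear {ffun I -> R^o} -> K}), ses f g.
move=> [p ps pk]; exists (smod_val _), p; split=> // v.
split=> [/pk[u e]|[a <-]].
  by apply: smod_valP; exists u.
by apply/pk; have [w _ e] := smodP a; exists w.
Qed.

Lemma rows_linear (I J : finT) (f : {linear {ffun J -> R^o} -> {ffun I -> R^o}})
  (u : {ffun J -> R^o}) : mact (fun j i => f (unitv j (1 : R^o)) i : R) u = f u.
rewrite {2}(sum_unit_row u) linear_sum.
have -> : u = finfun (u : J -> R) :> {ffun J -> R^o} by apply/ffunP => j; rewrite ffunE.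
by rewrite -sum_rows; apply: eq_bigr => j _; rewrite linearZ ffunE.
Qed.

(** Minimization starts at the far end: the syzygy module is presented again with a minimal tail,
    and its new generators become the rows of [A']. If the tail has become empty, [A'] is injective
    and is minimized in turn. *)
Lemma fr_minimal n D (I J : finT) (A : J -> I -> R) K :
  (forall x, ~ n x -> exists y, y * x = 1) -> pres A K -> fr D A ->
  exists (I' J' : finT) (A' : J' -> I' -> R), pres A' K /\
  ((J' -> False) \/ exists s, frm n s A').
move=> un; elim: D I J A K => [|D IH] I J A K pA fA.
  have [I' [J' [A' [pA' h]]]] := minimal_injective un (leqnn _) pA fA.
  by exists I', J', A'; split=> //; case: h => [|h]; [left|right; exists 0%N].
have [L [B [hB fB]]] := fA.
have [J' [L' [B' [[p ps pk] h]]]] := IH _ _ B _ (pres_syz hB) fB.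
have [q qs qk] := pA.
pose f : {linear {ffun J' -> R^o} -> {ffun I -> R^o}} := mklin (linearP (smod_val _ \o p)).
pose A' j i : R := f (unitv j (1 : R^o)) i.
have eA' u : mact A' u = f u by exact: rows_linear.
have pA' : pres A' K.
  exists q => // v; rewrite qk; split=> [[u e]|[u ->]]; last first.
  by rewrite eA' /=; have [w _ e] := smodP (p u); exists w.
  have [|k hk] := @smod_valP _ _ _ (@rng_sub R _ _ A R^o) v; first by exists u.
  by have [u' hu'] := ps k; exists u'; rewrite eA' /= hu'.
have f0 u : f u = 0 <-> p u = 0.
  split=> [e|e]; last by rewrite /f /= e; exact: (linear0 (smod_val (@rng_sub R _ _ A R^o))).
  by apply: (@smod_val_inj _ _ _ (@rng_sub R _ _ A R^o)); rewrite linear0.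
case: h => [L0|[s hs]].
  have [|I'' [J'' [A'' [pA'' h]]]] := minimal_injective un (leqnn _) pA'.
  move=> u; rewrite eA' => /f0/pk[w ->]; rewrite (_ : w = 0) ?mact0 //.
  by apply/ffunP => l; case: (L0 l).
  by exists I'', J'', A''; split=> //; case: h => [|h]; [left|right; exists 0%N].
exists I, J', A'; split=> //; right; exists s.+1, L', B'; split=> //.
split=> [u|u]; rewrite eA'; first by apply/f0/pk; exists u.
by move=> /f0/pk.
Qed.

Lemma van_vec E n M (L : finT) t : tester E n -> van E M t -> van E {ffun L -> M} t.
by move=> tE h i it; apply: mex_vec; exact: h. Qed.

Lemma van_quo E n (A B C : lmod R) (f : {linear A -> B}) (g : {linear B -> C}) t :
  tester E n -> ses f g -> van E A t.+1 -> van E B t -> van E C t.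
move=> tE hfg hA hB i it.
apply: (les_quo hfg (Q := @cd R E i.+2)); first exact: tester_cpx tE.
  exact: hB.
exact: hA.
Qed.

Lemma van_free E n (I J : finT) (A : J -> I -> R) K t : tester E n ->
  (J -> False) -> pres A K -> van E R^o t -> van E K t.
move=> tE J0 [p ps pk] h i it.
have [|g hg] := @surj_factor R _ _ _ p idfun ps.
  by move=> v /pk[u ->]; rewrite (_ : u = 0) /= ?mact0 //; apply/ffunP => j; case: (J0 j).
apply: (mex_iso (f := g) (g := p)); last by apply: mex_vec; exact: h.
by move=> k; have [v <-] := ps k; rewrite hg.
Qed.

(** Half of the Auslander-Buchsbaum formula: each step of the resolution costs at most one in
    depth. *)
Lemma van_frm E n m s (I J : finT) (A : J -> I -> R) K t : tester E n ->
  pres A K -> frm m s A -> van E R^o (t + s.+1)%N -> van E K t.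
move=> tE; elim: s I J A K t => [|s IH] I J A K t pA fA h.
  have [f [g hfg]] := pres_ses pA; apply: (van_quo tE hfg).
  apply: (van_free tE _ (pres_syz (empty_syz fA.2))) => //.
  by rewrite -addn1.
  by move=> i it; apply: mex_vec; apply: h; rewrite ltn_addr.
have [L [B [hB fB]]] := fA.
have [f [g hfg]] := pres_ses pA; apply: (van_quo tE hfg).
  by apply: (IH _ _ _ _ _ (pres_syz hB) fB); rewrite addSnnS.
by move=> i it; apply: mex_vec; apply: h; rewrite ltn_addr.
Qed.
End GlobalDimension.

(** * Lifting global dimension from the quotient by a nonzerodivisor *)

Section GlobalDimensionLift.
Variables (R S : ring) (g : R ~~> S) (y : R).
Hypotheses (gs : surj g)
  (gk : forall r, g r = 0 <-> exists a, r = y * a)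
  (yR : nzd y R^o)
  (yrad : forall b, exists c, c * (1 - b * y) = 1)
  (nR : noetherian R).

Definition rmapM (I J : finT) (A : J -> I -> R) : J -> I -> S := fun j i => g (A j i).
Definition rvec (I : finT) (v : {ffun I -> R^o}) : {ffun I -> S^o} := [ffun i => g (v i)].

Lemma rvec_mact (I J : finT) (A : J -> I -> R) (u : {ffun J -> R^o}) :
  mact (rmapM A) (rvec u) = rvec (mact A u).
apply/ffunP => i; rewrite !ffunE rmorph_sum; apply: eq_bigr => j _.
by rewrite !ffunE [RHS]rmorphM.
Qed.

Lemma rvec_surj (I : finT) (v : {ffun I -> S^o}) : exists u, rvec u = v.
have /choice[u hu] : forall i, exists r, g r = v i by move=> i; exact: gs.
by exists (finfun u); apply/ffunP => i; rewrite !ffunE.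
Qed.

Lemma rvec0 (I : finT) (v : {ffun I -> R^o}) : rvec v = 0 -> exists u, v = y *: u.
move=> /ffunP h; have /choice[u hu] : forall i, exists a, v i = y * a.
  by move=> i; apply/gk; have := h i; rewrite !ffunE.
by exists (finfun u); apply/ffunP => i; rewrite !ffunE.
Qed.

Lemma rvecB (I : finT) (u v : {ffun I -> R^o}) : rvec (u - v) = rvec u - rvec v.
by apply/ffunP => i; rewrite !ffunE rmorphB. Qed.

Lemma scale_vec_inj (I : finT) (v : {ffun I -> R^o}) : y *: v = 0 -> v = 0.
by move=> /ffunP h; apply/ffunP => i; have := h i; rewrite !ffunE => /yR. Qed.

Lemma ker_submod (I J : finT) (A : J -> I -> R) :
  submod [set u : {ffun J -> R^o} | mact A u = 0].
split=> [|u v|a u] /=; rewrite ?mact0 ?mactD ?mactZ //.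
  by move=> -> ->; rewrite addr0.
by move->; rewrite scaler0.
Qed.

Lemma nakayama_ker (I J : finT) (A : J -> I -> R) (T : set {ffun J -> R^o}) :
  submod T ->
  (forall u, mact A u = 0 -> exists t w, [/\ T t, mact A w = 0 & u = t + y *: w]) ->
  forall u, mact A u = 0 -> T u.
move=> hT h; apply: (nakayama (J := [set y]) (S := T) (U := [set u | mact A u = 0]) _ hT).
- by apply: noethM_vec; apply/noetherianP.
- exact: ker_submod.
- by move=> _ -> b; have [c hc] := yrad b; exists c.
move=> N [N0 ND NZ] TN hN u /h[t [w [Tt w0 ->]]].
by apply: ND; [exact: TN|exact: hN].
Qed.

(** Syzygies modulo [y] lift to syzygies because the image of [A] is saturated with respect to [y],
    and the lifts generate by Nakayama's lemma. *)
Lemma fr_lift D (I J : finT) (A : J -> I -> R) :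
  (forall v : {ffun I -> R^o}, (exists u, y *: v = mact A u) -> exists u, v = mact A u) ->
  fr D (rmapM A) -> fr D A.
elim: D I J A => [|D IH] I J A hA /=.
  move=> h u hu; apply: (nakayama_ker (A := A) (submod0 _)) => // {u hu} u hu.
  have [w e] : exists w, u = y *: w.
  by apply: rvec0; apply: h; rewrite rvec_mact hu; apply/ffunP => i; rewrite !ffunE rmorph0.
  exists 0, w; split=> //; last by rewrite add0r.
  by apply: scale_vec_inj; rewrite -mactZ -e.
move=> [L [C [[hc1 hc2] fC]]].
have /choice[c hc] : forall l, exists c : {ffun J -> R^o}, rvec c = [ffun j => C l j] /\ mact A c = 0.
  move=> l; have [c0 ec0] := rvec_surj [ffun j => C l j : S^o].
  have [v ev] : exists v, mact A c0 = y *: v.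
  apply: rvec0; rewrite -rvec_mact ec0 -(hc1 (unitv l (1 : S^o))); congr (mact _ _).
  apply/ffunP => j; rewrite !ffunE (bigD1 l) //= big1 ?addr0 => [|k /negbTE kl].
  by rewrite ffunE eqxx /GRing.scale /= mulr1.
  by rewrite ffunE kl scaler0.
  have [|w ew] := hA v; first by exists c0; rewrite ev.
  exists (c0 - y *: w); split; last by rewrite mactB mactZ -ew ev subrr.
  rewrite rvecB ec0 (_ : rvec _ = 0) ?subr0 //; apply/ffunP => j; rewrite !ffunE.
  by apply/gk; exists (w j).
pose B l j : R := c l j.
have eB : rmapM B = C.
  apply: funext => l; apply: funext => j; have /ffunP/(_ j) := (hc l).1.
  by rewrite !ffunE.
have sB : syz B A.
  split=> [v|u hu].
  have -> : v = finfun (v : L -> R) :> {ffun L -> R^o} by apply/ffunP => l; rewrite ffunE.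
  rewrite -sum_rows linear_sum big1 // => l _.
  by rewrite [LHS]mactZ (hc l).2 scaler0.
  have [T1 T2 T3] : submod [set mact B v | v in @setT {ffun L -> R^o}] by exact: rng_sub.
  have [||w _ <-] := @nakayama_ker _ _ A [set mact B v | v in @setT {ffun L -> R^o}] _ _ u hu; last by exists w.
  - by [].
  - move=> {u hu} u hu; have [|w ew] := hc2 (rvec u).
  by rewrite rvec_mact hu; apply/ffunP => i; rewrite !ffunE rmorph0.
  have [w' ew'] := rvec_surj w.
  have [v ev] : exists v, u - mact B w' = y *: v.
  by apply: rvec0; rewrite rvecB -rvec_mact eB ew' ew subrr.
  exists (mact B w'), v; split; [by exists w'| |by rewrite -ev addrC subrK].
  apply: scale_vec_inj; rewrite -mactZ -ev mactB hu.
  have -> : w' = finfun (w' : L -> R) :> {ffun L -> R^o} by apply/ffunP => l; rewrite ffunE.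
  rewrite -sum_rows linear_sum big1 ?subr0 // => l _.
  by rewrite [LHS]mactZ (hc l).2 scaler0.
exists L, B; split=> //; apply: IH; last by rewrite eB.
move=> v [u e]; apply: sB.2; apply: scale_vec_inj; rewrite -mactZ e; exact: sB.1.
Qed.

(** The image of a syzygy matrix is a kernel, hence saturated with respect to the nonzerodivisor
    [y]; taking one syzygy before [fr_lift] raises the bound by one. *)
Lemma gl_lift D : gl S D -> gl R D.+1.
move=> hS I J A; have [L [B hB]] := syz_exists A nR; exists L, B; split=> //.
apply: fr_lift => // v [u e]; apply: hB.2; apply: scale_vec_inj; rewrite -mactZ e.
exact: hB.1.
Qed.
End GlobalDimensionLift.

Section SetSpan.
Variables (R : ring) (V : lmod R).
Implicit Type X S : set V.

Definition sspan X : set V := [set v | exists s : seq (R * V),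
  (forall x, x \in s -> X x.2) /\ v = \sum_(x <- s) x.1 *: x.2].

Lemma sspanS X : submod (sspan X).
split=> [|_ _ [s [hs ->]] [s' [hs' ->]]|a _ [s [hs ->]]].
- by exists [::]; rewrite big_nil.
- exists (s ++ s'); rewrite big_cat; split=> // x.
  by rewrite mem_cat => /orP[/hs|/hs'].
exists [seq (a * x.1, x.2) | x <- s]; split=> [_ /mapP[x /hs hx ->] //|].
by rewrite big_map scaler_sumr; apply: eq_bigr => x _; rewrite scalerA.
Qed.

Lemma sspan_mem X : X `<=` sspan X.
move=> x Xx; exists [:: (1, x)]; rewrite big_seq1 scale1r; split=> // y.
by rewrite inE => /eqP ->.
Qed.

Lemma sspan_min X S : submod S -> X `<=` S -> sspan X `<=` S.
move=> hS XS _ [s [hs ->]]; rewrite big_seq; apply: (submod_sum hS) => x xs.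
by have [_ _ hZ] := hS; apply/hZ/XS/hs.
Qed.

Lemma sspanP X v : sspan X v -> exists (n : nat) (a : 'I_n -> R) (x : 'I_n -> V),
  (forall k, X (x k)) /\ v = \sum_k a k *: x k.
move=> [s [hs ->]].
exists (size s), (fun k => (tnth (in_tuple s) k).1), (fun k => (tnth (in_tuple s) k).2).
by split=> [k|]; [apply: hs; exact: mem_tnth|rewrite big_tnth].
Qed.
End SetSpan.

Lemma linear_preim R (U V : lmod R) (h : U -> V) (S : set V) :
  linear h -> submod S -> submod (h @^-1` S).
by move=> hl hS; exact: (submod_preim (mklin hl) hS). Qed.

Section Relations.
Variables (R : ring) (M : lmod R).

Definition rels (J : finT) (m : J -> M) : set {ffun J -> R^o} :=
  [set r | \sum_j (r j : R) *: m j = 0].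
End Relations.

(** * Base change and flatness by equations *)

Section BaseChange.
Variables (R T : ring) (f : R ~~> T).

Definition fvec (J : finT) (r : {ffun J -> R^o}) : {ffun J -> T^o} := [ffun j => f (r j)].

(* [M'] is the base change of [M] along [f], and all [T]-linear relations
   between images of elements of [M] come from [R]-linear ones. *)
Definition fbc (M : lmod R) (M' : lmod T) (i : M -> M') : Prop :=
  [/\ forall x y, i (x + y) = i x + i y, forall a x, i (a *: x) = f a *: i x,
  forall m', sspan (range i) m' &
  forall (J : finT) (m : J -> M) (t : {ffun J -> T^o}),
  \sum_j (t j : T) *: i (m j) = 0 -> sspan [set fvec r | r in rels m] t].

(** The equational criterion for flatness. *)
Definition flat : Prop := @fbc R^o T^o (fun x => f x).

Fact comb_linear_vec (M' : lmod T) (J : finT) (m : J -> M') :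
  linear (fun t : {ffun J -> T^o} => \sum_j (t j : T) *: m j).
move=> a u v; rewrite scaler_sumr -big_split; apply: eq_bigr => j _ /=.
by rewrite !ffunE scalerDl scalerA.
Qed.

Section Fixed.
Variables (M : lmod R) (M' : lmod T) (i : M -> M').
Hypothesis hi : fbc i.

Lemma fbc0 : i 0 = 0.
by have [_ hZ _ _] := hi; rewrite -(scale0r 0) hZ rmorph0 scale0r. Qed.

Lemma fbcB x y : i (x - y) = i x - i y.
by have [hD hZ _ _] := hi; rewrite -scaleN1r hD hZ rmorphN1 scaleN1r. Qed.

Lemma fbc_sum (J : Type) (s : seq J) (P : pred J) (F : J -> M) :
  i (\sum_(j <- s | P j) F j) = \sum_(j <- s | P j) i (F j).
by apply: (big_morph i); [case: hi|exact: fbc0].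
Qed.

Lemma fbc_comb (J : finT) (m : J -> M) (r : {ffun J -> R^o}) :
  i (\sum_j (r j : R) *: m j) = \sum_j (fvec r j : T) *: i (m j).
have [_ hZ _ _] := hi; rewrite fbc_sum; apply: eq_bigr => j _.
by rewrite hZ ffunE.
Qed.

Definition ivec (L : finT) (v : {ffun L -> M}) : {ffun L -> M'} := [ffun l => i (v l)].

Lemma ivec_mact (I J : finT) (P : I -> J -> R) v :
  ivec (mact P v) = mact (rmapM f P) (ivec v).
have [_ hZ _ _] := hi; apply/ffunP => j; rewrite !ffunE fbc_sum.
by apply: eq_bigr => k _; rewrite hZ ffunE.
Qed.

Lemma ivec0 (L : finT) : ivec (0 : {ffun L -> M}) = 0.
by apply/ffunP => l; rewrite !ffunE fbc0. Qed.

Lemma fbc_gen_vec (L : finT) (v : {ffun L -> M'}) : sspan (range (@ivec L)) v.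
rewrite (sum_unitv v); apply: (submod_sum (sspanS _)) => l _.
have hl := @unitv_linear T M' L l.
have [_ hZ hg _] := hi.
apply: (sspan_min (linear_preim hl (sspanS _)) _ (hg (v l))).
move=> _ [m _ <-]; apply: sspan_mem; exists (unitv l m) => //.
by apply/ffunP => k; rewrite !ffunE; case: eqP; rewrite ?fbc0.
Qed.

(** Coordinates are treated one at a time: [t] is a combination of finitely many relations valid for
    the earlier coordinates, and the criterion, applied to their values at the next one, refines the
    combination. *)
Lemma fbc_rel_vec (L J : finT) (m : J -> {ffun L -> M}) (t : {ffun J -> T^o}) :
  \sum_j (t j : T) *: ivec (m j) = 0 -> sspan [set fvec r | r in rels m] t.
move=> ht.
suff h (ls : seq L) : sspan [set fvec r | r in
  [set r : {ffun J -> R^o} | forall l, l \in ls -> \sum_j (r j : R) *: m j l = 0]] t.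
  apply: sspan_min (h (enum L)); first exact: sspanS.
  move=> _ [r hr <-]; apply: sspan_mem; exists r => //; apply/ffunP => l.
  rewrite sum_ffunE ffunE -[RHS](hr l) ?mem_enum //.
  by apply: eq_bigr => j _; rewrite ffunE.
elim: ls => [|l ls IH].
  rewrite (sum_unit_row t); apply: (submod_sum (sspanS _)) => j _.
  have [_ _ hZ] := sspanS [set fvec r | r in
  [set r : {ffun J -> R^o} | forall l, l \in [::] -> \sum_j (r j : R) *: m j l = 0]].
  apply: hZ; apply: sspan_mem; exists (unitv j (1 : R^o)) => //.
  by apply/ffunP => k; rewrite !ffunE; case: eqP; rewrite ?rmorph1 ?rmorph0.
have [k [s [x [hx et]]]] := sspanP IH.
have /choice[r hr] : forall c, exists r : {ffun J -> R^o},
  (forall l, l \in ls -> \sum_j (r j : R) *: m j l = 0) /\ fvec r = x c.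
  by move=> c; have [r h1 h2] := hx c; exists r.
have [_ _ _ hrel] := hi.
have e : \sum_c (finfun s c : T) *: i (\sum_j (r c j : R) *: m j l) = 0.
  have /ffunP/(_ l) := ht; rewrite sum_ffunE [RHS]ffunE => ht'; rewrite -[RHS]ht'.
  rewrite (eq_bigr (fun c => \sum_j (s c * f (r c j)) *: i (m j l))); last first.
  move=> c _; rewrite ffunE fbc_comb scaler_sumr; apply: eq_bigr => j _.
  by rewrite scalerA ffunE.
  rewrite exchange_big; apply: eq_bigr => j _ /=; rewrite -scaler_suml !ffunE.
  congr (_ *: _); rewrite et sum_ffunE; apply: eq_bigr => c _.
  by rewrite -(hr c).2 !ffunE.
have {}e := hrel _ _ (finfun s : {ffun 'I_k -> T^o}) e.
have hl := @comb_linear_vec {ffun J -> T^o} _ x.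
have -> : t = \sum_c (finfun s c : T) *: x c.
  by rewrite et; apply: eq_bigr => c _; rewrite ffunE.
apply: (sspan_min (linear_preim hl (sspanS _)) _ e).
move=> _ [rho hrho <-]; apply: sspan_mem; exists (\sum_c (rho c : R) *: r c); last first.
  apply/ffunP => j; rewrite ffunE !sum_ffunE rmorph_sum; apply: eq_bigr => c _.
  by rewrite -(hr c).2 !ffunE [LHS]rmorphM.
move=> l'; rewrite inE => hl'.
have sE : \sum_j ((\sum_c (rho c : R) *: r c) j : R) *: m j l' =
  \sum_c (rho c : R) *: \sum_j (r c j : R) *: m j l'.
  transitivity (\sum_j \sum_c ((rho c : R) * r c j) *: m j l').
  apply: eq_bigr => j _; rewrite sum_ffunE -scaler_suml; congr (_ *: _).
  by apply: eq_bigr => c _; rewrite ffunE.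
  rewrite exchange_big; apply: eq_bigr => c _ /=; rewrite scaler_sumr.
  by apply: eq_bigr => j _; rewrite scalerA.
rewrite sE; case/orP: hl' => [/eqP ->|hl']; first exact: hrho.
by rewrite big1 // => c _; rewrite (hr c).1 ?scaler0.
Qed.
End Fixed.
End BaseChange.

(** Exactness at [p] expressed without localizing, by multipliers outside [p]. *)
Definition lex R (p : set R) (I J K : finT) (P : I -> J -> R)
  (Q : J -> K -> R) (M : lmod R) : Prop :=
  forall v : {ffun J -> M}, mact Q v = 0 ->
  exists a, ~ p a /\ exists u, a *: v = mact P u.

Section LocalExactness.
Variables (R T : ring) (f : R ~~> T).
Variables (M : lmod R) (M' : lmod T) (i : M -> M').
Hypothesis hi : fbc f i.
Variables (p : set R) (p' : set T).
Hypotheses (pr' : is_prime p') (pp : forall a, p a <-> p' (f a)).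
Variables (I J K : finT) (P : I -> J -> R) (Q : J -> K -> R).

(** From [R] to [T], the coefficients of a cycle are combinations of relations over [R]. From [T] to
    [R], that [b v] is a boundary is a relation in which [v] has coefficient [b]; if all multipliers
    over [R] were in [p], the criterion would put [b] in [p']. *)
Lemma lex_bc : lex p P Q M <-> lex p' (rmapM f P) (rmapM f Q) M'.
have [id' n1 pM'] := pr'; have [_ hZ _ _] := hi; split=> h v hv.
  have [k [t [x [hx ev]]]] := sspanP (fbc_gen_vec hi v).
  have /choice[m hm] : forall c, exists m, ivec i m = x c.
  by move=> c; have [m _ <-] := hx c; exists m.
  have ev' (t' : 'I_k -> T) : \sum_c t' c *: x c =
  \sum_c ((finfun t' : {ffun 'I_k -> T^o}) c : T) *: ivec i (m c).
  by apply: eq_bigr => c _; rewrite ffunE hm.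
  have : sspan [set fvec f r | r in rels (fun c => mact Q (m c))] (finfun t).
  apply: (fbc_rel_vec hi); rewrite -[RHS]hv ev linear_sum; apply: eq_bigr => c _.
  by rewrite ffunE (ivec_mact hi) -hm linearZ.
  pose S : set {ffun 'I_k -> T^o} := [set t | exists a, ~ p' a /\
  exists u, a *: (\sum_c (t c : T) *: x c) = mact (rmapM f P) u].
  have hS : submod S.
  split=> [|t1 t2 [a [na [u hu]]] [b [nb [w hw]]]|b t1 [a [na [u hu]]]].
  - exists 1; split=> //; exists 0; rewrite mact0 big1 ?scaler0 // => c _.
  by rewrite ffunE scale0r.
  - exists (a * b); split; first by move=> /pM'[].
  exists (b *: u + a *: w); rewrite mactD !mactZ -hu -hw !scalerA.
  rewrite [b * a]mulrC -scalerDr -big_split; congr (_ *: _); apply: eq_bigr => c _.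
  by rewrite ffunE scalerDl.
  exists a; split=> //; exists (b *: u); rewrite mactZ -hu !scalerA [b * a]mulrC -scalerA.
  by congr (_ *: _); rewrite scaler_sumr; apply: eq_bigr => c _; rewrite ffunE scalerA.
  suff SS : sspan [set fvec f r | r in rels (fun c => mact Q (m c))] `<=` S.
  move=> /SS[a [na [u hu]]]; exists a; split=> //; exists u; rewrite -hu ev.
  by congr (_ *: _); apply: eq_bigr => c _; rewrite ffunE.
  apply: sspan_min => // _ [r hr <-].
  have [|a [na [u hu]]] := h (\sum_c (r c : R) *: m c).
  by rewrite linear_sum -[RHS]hr; apply: eq_bigr => c _; rewrite linearZ.
  exists (f a); split; first by move=> /pp.
  exists (ivec i u); rewrite -(ivec_mact hi) -hu.
  apply/ffunP => j; rewrite !ffunE hZ; congr (_ *: _); rewrite !sum_ffunE (fbc_sum hi).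
  by apply: eq_bigr => c _; rewrite -hm !ffunE hZ.
have [|b [nb [w hw]]] := h (ivec i v).
  by rewrite -(ivec_mact hi) hv (ivec0 hi).
have [k [t [x [hx ew]]]] := sspanP (fbc_gen_vec hi w).
have /choice[m hm] : forall c, exists m, ivec i m = x c.
  by move=> c; have [m _ <-] := hx c; exists m.
pose y (o : option 'I_k) := if o is Some c then mact P (m c) else v.
pose s : {ffun option 'I_k -> T^o} := [ffun o => if o is Some c then - t c else b].
have sumO (V : nmodType) (F : option 'I_k -> V) : \sum_o F o = F None + \sum_c F (Some c).
  rewrite (bigD1 None) //=; congr (_ + _).
  rewrite (reindex_omap Some id); first by apply: eq_bigl => c; rewrite eqxx.
  by case.
have : sspan [set fvec f r | r in rels y] s.
  apply: (fbc_rel_vec hi); rewrite sumO ffunE /= hw ew linear_sum -big_split big1 // => c _.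
  by rewrite /= ffunE scaleNr linearZ -hm (ivec_mact hi) subrr.
apply: contraPP => no; have no' a u : a *: v = mact P u -> p' (f a).
  by move=> e; apply/pp; apply: contrapT => na; apply: no; exists a; split=> //; exists u.
move=> hs; apply: nb; have -> : b = s None by rewrite ffunE.
have hc : linear (fun u : {ffun option 'I_k -> T^o} => u None : T^o).
  by move=> a u u'; rewrite !ffunE.
have hS : @submod T {ffun option 'I_k -> T^o} [set u | p' (u None)].
  exact: (@linear_preim T _ T^o _ p' hc id').
apply: (sspan_min hS _ hs).
move=> _ [r hr <-]; rewrite /= ffunE; apply: (no' _ (\sum_c (- (r (Some c) : R)) *: m c)).
move: hr; rewrite /rels /= sumO /= => hr.
apply: (addIr (\sum_c (r (Some c) : R) *: mact P (m c))); rewrite hr linear_sum.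
rewrite -big_split big1 // => c _ /=.
by rewrite [X in X + _]mactZ -scalerDl addNr scale0r.
Qed.
End LocalExactness.

Lemma semilinear_preim (R T : ring) (f : R ~~> T) (V : lmod R)
  (W : lmod T) (h : V -> W) (S : set W) : (forall x y, h (x + y) = h x + h y) ->
  (forall a x, h (a *: x) = f a *: h x) -> submod S -> submod (h @^-1` S).
move=> hD hZ [S0 SD SZ]; split=> [|u v hu hv|a u hu]; rewrite /preimage /=.
- by rewrite -(scale0r 0) hZ rmorph0 scale0r.
- by rewrite hD; exact: SD.
- by rewrite hZ; exact: SZ.
Qed.

Lemma sum_option (V : nmodType) (K : finT) (F : option K -> V) :
  \sum_o F o = F None + \sum_c F (Some c).
rewrite (bigD1 None) //=; congr (_ + _).
rewrite (reindex_omap Some id); first by apply: eq_bigl => c; rewrite eqxx.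
by case.
Qed.

Section BaseChange2.
Variables (R T : ring) (f : R ~~> T).

Lemma fbc_id (M : lmod R) : @fbc R R idfun M M id.
split=> // [m|J m t ht]; first by apply: sspan_mem; exists m.
by apply: sspan_mem; exists t => //; apply/ffunP => j; rewrite ffunE.
Qed.

Lemma fvecD (J : finT) (u v : {ffun J -> R^o}) : fvec f (u + v) = fvec f u + fvec f v.
by apply/ffunP => j; rewrite !ffunE rmorphD. Qed.

Lemma fbc_comp (U : ring) (g : T ~~> U) (M : lmod R)
  (M' : lmod T) (M'' : lmod U) (i : M -> M') (j : M' -> M'') :
  fbc f i -> fbc g j -> fbc (g \o f) (j \o i).
move=> [iD iZ iG iR] [jD jZ jG jR]; split=> [x y|a x|m|J m t].
- by rewrite /= iD jD.
- by rewrite /= iZ jZ.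
- apply: sspan_min (jG m); first exact: sspanS.
  move=> _ [m' _ <-].
  apply: (sspan_min (semilinear_preim jD jZ (sspanS _)) _ (iG m')).
  by move=> _ [x _ <-]; apply: sspan_mem; exists x.
move=> /jR; apply: sspan_min; first exact: sspanS.
move=> _ [r /iR hr <-].
have gD (u v : {ffun J -> T^o}) : fvec g (u + v) = fvec g u + fvec g v.
  by apply/ffunP => k; rewrite !ffunE rmorphD.
have gZ a (v : {ffun J -> T^o}) : fvec g (a *: v) = g a *: fvec g v.
  by apply/ffunP => k; rewrite !ffunE [LHS]rmorphM.
apply: (sspan_min (semilinear_preim gD gZ (sspanS _)) _ hr).
move=> _ [rho hrho <-]; apply: sspan_mem; exists rho => //.
by apply/ffunP => k; rewrite !ffunE.
Qed.

Lemma fbc_vec (M : lmod R) (M' : lmod T) (i : M -> M') (L : finT) :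
  fbc f i -> fbc f (@ivec R T M M' i L).
move=> hi; have [iD iZ _ _] := hi; split=> [x y|a x|m|J m t].
- by apply/ffunP => l; rewrite !ffunE iD.
- by apply/ffunP => l; rewrite !ffunE iZ.
- exact: (fbc_gen_vec hi).
- exact: (fbc_rel_vec hi).
Qed.

Lemma fbc_iso (M N : lmod R) (M' : lmod T) (i : M -> M') (e : {linear N -> M}) 
  (e' : {linear M -> N}) : cancel e e' -> cancel e' e -> fbc f i -> fbc f (i \o e).
move=> k1 k2 [iD iZ iG iR]; split=> [x y|a x|m|J m t].
- by rewrite /= linearD iD.
- by rewrite /= linearZ iZ.
- apply: sspan_min (iG m); first exact: sspanS.
  by move=> _ [x _ <-]; apply: sspan_mem; exists (e' x); rewrite //= k2.
move=> /iR; apply: sspan_min; first exact: sspanS.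
move=> _ [r hr <-]; apply: sspan_mem; exists r => //; apply: (can_inj k1).
rewrite linear0 linear_sum -[RHS]hr; apply: eq_bigr => j _; by rewrite linearZ.
Qed.

Section Quotient.
Variables (M : lmod R) (M' : lmod T) (i : M -> M').
Variables (S : set M) (S' : set M') (hS : submod S) (hS' : submod S').
Hypotheses (hi : fbc f i)
  (e : S' = sspan (i @` S)).

Definition qbc (x : qmod hS) : qmod hS' := qmod_pi hS' (i (repr x)).

Lemma qbcE m : qbc (qmod_pi hS m) = qmod_pi hS' (i m).
apply/eqP; rewrite -subr_eq0 -linearB; apply/eqP/qmod_pi0; rewrite -(fbcB hi) e.
by apply: sspan_mem; eexists; first exact: qcls_repr.
Qed.

Lemma fbc_qmod : fbc f qbc.
have [iD iZ iG iR] := hi; split.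
- move=> x y; have [m <-] := qmodS x; have [m' <-] := qmodS y.
  by rewrite -linearD !qbcE -linearD iD.
- move=> a x; have [m <-] := qmodS x.
  by rewrite -linearZ !qbcE /= -linearZ iZ.
- move=> x; have [m <-] := qmodS x.
  have hp : linear (fun m => qmod_pi hS' m) by exact: linearP.
  apply: (sspan_min (linear_preim hp (sspanS _)) _ (iG m)).
  move=> _ [m0 _ <-]; apply: sspan_mem; exists (qmod_pi hS m0) => //; exact: qbcE.
move=> J x t ht.
have /choice[m hm] : forall j, exists m, qmod_pi hS m = x j by move=> j; exact: qmodS.
have : S' (\sum_j (t j : T) *: i (m j)).
  apply/(qmod_pi0 hS'); rewrite linear_sum -[RHS]ht; apply: eq_bigr => j _.
  by rewrite linearZ -hm qbcE.
rewrite e => /sspanP[k [s [y [hy ey]]]].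
have /choice[z hz] : forall c, exists z, S z /\ i z = y c.
  by move=> c; have [z h1 h2] := hy c; exists z.
(* A relation in the quotient becomes a relation in the module once the elements [z c] of [S] are
   adjoined to the family. *)
pose w (o : J + 'I_k) := match o with inl j => m j | inr c => z c end.
pose u : {ffun (J + 'I_k) -> T^o} := [ffun o => match o with inl j => t j | inr c => - s c end].
have : sspan [set fvec f r | r in rels w] u.
  apply: iR; rewrite big_sumType /= (eq_bigr (fun j => (t j : T) *: i (m j))).
  rewrite ey -big_split big1 // => c _.
  by rewrite /= ffunE (hz c).2 scaleNr subrr.
  by move=> j _; rewrite ffunE.
have hp : linear (fun u : {ffun (J + 'I_k) -> T^o} => [ffun j => u (inl j)] : {ffun J -> T^o}).
  by move=> a v v'; apply/ffunP => j; rewrite !ffunE.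
move=> hu; have -> : t = [ffun j => u (inl j)] by apply/ffunP => j; rewrite !ffunE.
apply: (sspan_min (linear_preim hp (sspanS _)) _ hu).
move=> _ [r hr <-]; apply: sspan_mem; exists [ffun j => r (inl j)]; last first.
  by apply/ffunP => j; rewrite !ffunE.
rewrite /rels /= (eq_bigr (fun j => qmod_pi hS ((r (inl j) : R) *: m j))); last first.
  by move=> j _; rewrite ffunE linearZ hm.
rewrite -linear_sum; apply/qmod_pi0.
move: hr; rewrite /rels /= big_sumType /= => /eqP; rewrite addr_eq0 => /eqP ->.
apply: submodN => //; apply: (submod_sum hS) => c _; have [_ _ hSZ] := hS.
exact/hSZ/(hz c).1.
Qed.
End Quotient.

Section Cokernels.
Variables (M : lmod R) (M' : lmod T) (i : M -> M').
Hypothesis hi : fbc f i.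

Lemma rng_bc (I J : finT) (P : I -> J -> R) :
  [set mact (rmapM f P) v | v in @setT {ffun I -> M'}] =
  sspan (@ivec R T M M' i J @` [set mact P v | v in @setT {ffun I -> M}]).
have hr := @rng_sub T _ _ (rmapM f P) M'.
apply/seteqP; split=> [_ [v _ <-]|]; last first.
  apply: sspan_min => // _ [_ [v _ <-] <-]; rewrite (ivec_mact hi).
  by exists (ivec i v).
have hl : linear (fun v : {ffun I -> M'} => mact (rmapM f P) v) by exact: linearP.
apply: (sspan_min (linear_preim hl (sspanS _)) _ (fbc_gen_vec hi v)).
move=> _ [u _ <-]; apply: sspan_mem; exists (mact P u); first by exists u.
exact: ivec_mact.
Qed.

Definition bcx (H : cplx R) : cplx T := Cplx (fun i => rmapM f (dx H i)).

Lemma fbc_phi (H : cplx R) : exists j : phi H M -> phi (bcx H) M', fbc f j.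
exists (@qbc _ _ (@ivec R T M M' i (H 0%N)) _ _ (@rng_sub R _ _ (dx H 0) M)
  (@rng_sub T _ _ (rmapM f (dx H 0)) M')).
by apply: fbc_qmod; [exact: fbc_vec|exact: rng_bc].
Qed.

Lemma fbc_ymod y : exists j : ymod y M -> ymod (f y) M', fbc f j.
exists (@qbc _ _ i _ _ (@yset_submod R y M) (@yset_submod T (f y) M')).
have [iD iZ iG iR] := hi; apply: fbc_qmod => //; apply/seteqP; split=> [_ [v _ <-]|]; last first.
  apply: sspan_min; first exact: yset_submod.
  by move=> _ [_ [v _ <-] <-]; exists (i v); rewrite ?iZ.
have hl : linear (fun v : M' => f y *: v) by exact: scale_linear.
apply: (sspan_min (linear_preim hl (sspanS _)) _ (iG v)).
by move=> _ [u _ <-]; apply: sspan_mem; exists (y *: u); [exists u|rewrite iZ].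
Qed.

Lemma fbc_fg : fg M -> fg M'.
move=> [I [x hx]]; exists I, (i \o x) => m'; have [iD iZ iG iR] := hi.
apply: sspan_min (iG m'); first exact: fspanS.
move=> _ [m _ <-]; have [c ->] := hx m; exists (f \o c).
by rewrite (fbc_sum hi); apply: eq_bigr => k _; rewrite iZ.
Qed.
End Cokernels.

Lemma pres_iso (I J : finT) (A : J -> I -> R) (M : lmod R) : pres A M ->
  exists (e : {linear M -> qmod (@rng_sub R _ _ A R^o)})
   (e' : {linear qmod (@rng_sub R _ _ A R^o) -> M}), cancel e e' /\ cancel e' e.
move=> [p ps pk].
have [v /pk[u ->]|e he] := @surj_factor R _ _ _ p (qmod_pi (@rng_sub R _ _ A R^o)) ps.
  by apply/qmod_pi0; exists u.
have [v /qmod_pi0[u _ <-]|e' he'] := @surj_factor R _ _ _ (qmod_pi (@rng_sub R _ _ A R^o)) p (@qmodS _ _ _ _).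
  by apply/pk; exists u.
exists e, e'; split=> x; first by have [v <-] := ps x; rewrite he he'.
by have [v <-] := qmodS x; rewrite he' he.
Qed.

Lemma fbc_exists (M : lmod R) : flat f -> noetherian R -> fg M ->
  exists (M' : lmod T) (i : M -> M'), fbc f i /\ fg M'.
move=> hf nR fM; have [I [J [A pA]]] := pres_exists nR fM.
have [e [e' [k1 k2]]] := pres_iso pA.
pose j := @qbc _ _ (@ivec R T R^o T^o (fun x => f x) I) _ _ (@rng_sub R _ _ A R^o)
  (@rng_sub T _ _ (rmapM f A) T^o).
have hj : fbc f j by apply: fbc_qmod; [exact: fbc_vec|exact: (rng_bc hf)].
have hi := fbc_iso k1 k2 hj.
by exists (qmod (@rng_sub T _ _ (rmapM f A) T^o)), (j \o e); split=> //; exact: fbc_fg hi fM.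
Qed.

Definition bcE (E : coch R) : coch T := Coch (fun i => rmapM f (@cd R E i)).

Lemma bcE_tester E J : tester E J -> tester (bcE E) (ideal_gen (f @` J)).
have fm (I K L : finT) (A : I -> K -> R) (B : K -> L -> R) x z :
  mulm (rmapM f A) (rmapM f B) x z = f (mulm A B x z).
  by rewrite /mulm rmorph_sum; apply: eq_bigr => k _; rewrite rmorphM.
move=> [dd E0 E1 Ed Eh]; split=> //.
- by move=> i x z; rewrite fm dd rmorph0.
- by move=> x y; apply: sub_ideal_gen; exists (@cd R E 1 x y).
move=> a; apply: (ideal_gen_sub (htpy_ideal (bcE E))) => _ [b Jb <-].
have [s hs] := Eh b Jb; exists (fun i => rmapM f (s i)) => i x y.
rewrite !fm -rmorphD hs rmorphM; congr (_ * _); by case: (x == y); rewrite ?rmorph1 ?rmorph0.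
Qed.
End BaseChange2.

(** The depth of [M_p] is at least [t]. The tester lives over [R] and exactness is local at [p], so
    statements can move between rings; over a Noetherian ring and for finitely generated [M], any
    tester for [p] gives the same answer. *)
Definition dep R (p : set R) (M : lmod R) t : Prop :=
  exists E : coch R, tester E p /\
  forall i, (i < t)%N -> lex p (@cd R E i) (@cd R E i.+1) M.

Lemma dep_le R (p : set R) (M : lmod R) s t : (s <= t)%N ->
  dep p M t -> dep p M s.
by move=> st [E [tE h]]; exists E; split=> // i is_; apply: h; exact: leq_trans st. Qed.

Definition locz R (p : set R) (M : lmod R) : Prop :=
  forall m : M, exists a, ~ p a /\ a *: m = 0.

(** * Depth at a prime and base change *)

Section Depth.
Variables (R T : ring) (f : R ~~> T) (M : lmod R) (M' : lmod T).
Variables (i : M -> M') (p : set R) (n : set T).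
Hypotheses (hi : fbc f i)
  (pn : is_prime n)
  (un : forall x, ~ n x -> exists y, y * x = 1)
  (pp : forall a, p a <-> n (f a)).

Lemma lex_mex (I J K : finT) (P : I -> J -> T) (Q : J -> K -> T) (L : lmod T) :
  lex n P Q L <-> mex P Q L.
have [_ n1 _] := pn; split=> h v hv; last first.
  by have [u hu] := h v hv; exists 1; split=> //; exists u; rewrite scale1r.
have [a [na [u hu]]] := h v hv; have [b hb] := un na.
by exists (b *: u); rewrite mactZ -hu scalerA hb scale1r.
Qed.

Lemma fbc_mex (I J K : finT) (P : I -> J -> R) (Q : J -> K -> R) :
  lex p P Q M <-> mex (rmapM f P) (rmapM f Q) M'.
by rewrite -lex_mex; exact: (lex_bc hi pn pp). Qed.

Lemma fbc_locz : locz p M <-> forall m : M', m = 0.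
(* Vanishing of a module is exactness of [0 -> M -> 0]. *)
pose P (_ : void) (_ : unit) : R := 0; pose Q (_ : unit) (_ : void) : R := 0.
transitivity (lex p P Q M).
  split=> h; last first.
  move=> m; have [|a [na [u /ffunP/(_ tt)]]] := h [ffun=> m].
  by apply/ffunP => -[].
  rewrite !ffunE big1 => [e|[]]; by exists a.
  move=> v _; have [a [na e]] := h (v tt); exists a; split=> //; exists 0.
  by rewrite mact0; apply/ffunP => -[]; rewrite !ffunE.
rewrite fbc_mex; split=> h => [m|]; last exact: mex_triv.
have [|u /ffunP/(_ tt)] := h [ffun=> m]; first by apply/ffunP => -[].
by rewrite !ffunE big1 => [|[]].
Qed.

Hypotheses (nR : noetherian R) (nT : noetherian T) (fM : fg M).
Hypothesis rad : forall b, n b -> exists k, ideal_gen (f @` p) (b ^+ k).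

(** A tester for [p] becomes over [T] a tester for the extension of [p], whose radical is [n];
    [van_indep] then admits every tester for [n]. *)
Lemma dep_van E t : tester E n -> dep p M t <-> van E M' t.
move=> tE; have fM' := fbc_fg hi fM; have idn := primeI pn.
have idp : is_ideal p.
  have [n0 nD nM] := idn; split=> [|x y|a x]; rewrite !pp; first by rewrite rmorph0.
  by rewrite rmorphD; exact: nD.
  by rewrite rmorphM; exact: nM.
have key E0 : tester E0 p ->
  (forall j, (j < t)%N -> lex p (@cd R E0 j) (@cd R E0 j.+1) M) <-> van E M' t.
  move=> tE0; have tB := bcE_tester f tE0.
  rewrite -(van_indep t nT fM' (ideal_genP _) idn tB tE) //.
  by split=> h j jt; apply/fbc_mex; exact: h.
  by apply: ideal_gen_sub => // _ [a pa <-]; apply/pp.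
split=> [[E0 [tE0 h]]|h]; first exact/(key E0).
by have [E0 tE0] := testerP nR idp; exists E0; split=> //; apply/(key E0).
Qed.
End Depth.

(** * Localization at a prime *)

Section LocalizationRing.
Variables (R : ring) (p : prime_ideal R).
Local Notation T := (loc_ring p).
Local Notation den := (@den R p).

Lemma rfracE (a b : R) (s t : denom p) : rfrac a s = rfrac b t <->
  exists u : denom p, den u * (den t * a) = den u * (den s * b).
exact: (@loc_fracP R p R^o). Qed.

Lemma rfrac_mul (a b : R) (s t : denom p) :
  (rfrac a s * rfrac b t : T) = rfrac (a * b) (denomM s t).
exact: (@loc_scaleE R p R^o). Qed.

Lemma rfrac_add (a b : R) (s t : denom p) :
  (rfrac a s + rfrac b t : T) = rfrac (den t * a + den s * b) (denomM s t).
exact: (@loc_addE R p R^o). Qed.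

Lemma rfracW (P : T -> Prop) : (forall a s, P (rfrac a s)) -> forall x, P x.
exact: (@loc_fracW R p R^o). Qed.

Definition locr (a : R) : T := rfrac a (denom1 p).

Fact locr_is_zmod_morphism : zmod_morphism locr.
move=> a b; apply/eqP; rewrite eq_sym subr_eq eq_sym; apply/eqP; rewrite /locr rfrac_add.
symmetry; by apply/rfracE; exists (denom1 p); rewrite !den1 !denM !den1; ring.
Qed.

Fact locr_is_monoid_morphism : monoid_morphism locr.
split=> // a b; rewrite /locr rfrac_mul; apply/rfracE; exists (denom1 p).
by rewrite !den1 !denM !den1; ring.
Qed.

HB.instance Definition _ := GRing.isZmodMorphism.Build R T locr locr_is_zmod_morphism.
HB.instance Definition _ := GRing.isMonoidMorphism.Build R T locr locr_is_monoid_morphism.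

Local Ltac rfrac_ring :=
  rewrite /locr rfrac_mul; apply/rfracE; exists (denom1 p); rewrite !denM !den1; ring.

Definition locm (M : lmod R) (m : M) : loc p M := loc_frac m (denom1 p).

Lemma common_denom (J : finT) (t : J -> T) :
  exists (s : denom p) (a : J -> R), forall j, t j = rfrac (a j) s.
suff h (js : seq J) : exists s, forall j, j \in js -> exists a, t j = rfrac a s.
  have [s hs] := h (enum J).
  have /choice[a ha] : forall j, exists a, t j = rfrac a s by move=> j; apply: hs; rewrite mem_enum.
  by exists s, a.
elim: js => [|j js [s IH]]; first by exists (denom1 p).
have [a [w e]] : exists a w, t j = rfrac a w.
  by elim/rfracW: (t j) => a w; exists a, w.
exists (denomM s w) => k; rewrite inE => /orP[/eqP ->|/IH[b ->]].
  by exists (den s * a); rewrite e; apply/rfracE; exists (denom1 p); rewrite denM; ring.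
by exists (den w * b); apply/rfracE; exists (denom1 p); rewrite denM; ring.
Qed.

Lemma fbc_loc (M : lmod R) : fbc locr (@locm M).
have e1 (M' : lmod R) (m n : M') (s t : denom p) :
  den t *: m = den s *: n -> loc_frac m s = loc_frac n t :> loc p M'.
  by move=> e; apply/loc_fracP; exists (denom1 p); rewrite e.
have hD (x y : M) : locm (x + y) = locm x + locm y.
  by rewrite /locm [RHS]loc_addE; apply: e1; rewrite denM !den1 mulr1 !scale1r.
have hZ a (x : M) : locm (a *: x) = locr a *: locm x.
  by rewrite /locm [RHS]loc_scaleE; apply: e1; rewrite denM !den1 mulr1 !scale1r.
have h0 : locm 0 = 0 :> loc p M by rewrite /locm.
split=> // [m|J m t].
  elim/loc_fracW: m => m s.
  have -> : loc_frac m s = (rfrac 1 s : T) *: locm m.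
  by rewrite [RHS]loc_scaleE; apply: e1; rewrite denM !den1 mulr1 scale1r.
  have [_ _ Z] := sspanS (range (@locm M)); apply: Z.
  by apply: sspan_mem; exists m.
have [s [a ha]] := common_denom t.
have ts j : t j = (rfrac 1 s : T) * locr (a j).
  by rewrite ha /locr rfrac_mul; apply/rfracE; exists (denom1 p); rewrite !denM !den1; ring.
move=> h.
have {}h : locm (\sum_j a j *: m j) = 0.
  have e : (locr (den s) * rfrac 1 s : T) = 1.
  by rfrac_ring.
  rewrite (big_morph _ hD h0) -[LHS]scale1r -e -scalerA.
  rewrite [X in _ *: X](_ : _ = 0) ?scaler0 //; rewrite scaler_sumr -[RHS]h.
  by apply: eq_bigr => j _; rewrite hZ ts scalerA.
move: h => /loc_fracP[u]; rewrite !den1 !scale1r !scaler0 => hu.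
pose r : {ffun J -> R^o} := [ffun j => den u * a j].
have er : rels m r.
  rewrite /rels /= -[RHS]hu scaler_sumr; apply: eq_bigr => j _.
  by rewrite ffunE scalerA.
have -> : t = (rfrac 1 (denomM u s) : T) *: fvec locr r.
  apply/ffunP => j; rewrite !ffunE [RHS]rfrac_mul ha; apply/rfracE; exists (denom1 p).
  by rewrite !denM !den1; ring.
by have [_ _ Z] := sspanS [set fvec locr r | r in rels m]; apply: Z; apply: sspan_mem; exists r.
Qed.

Lemma flat_loc : flat locr.
exact: (@fbc_loc R^o). Qed.

Definition locI (q : set R) : set T := [set x | exists a s, q a /\ x = rfrac a s].

Lemma locI_ideal q : is_ideal q -> is_ideal (locI q).
move=> [q0 qD qM]; split.
- by exists 0, (denom1 p).
- move=> _ _ [a [s [qa ->]]] [b [t [qb ->]]]; exists (den t * a + den s * b), (denomM s t).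
  by rewrite rfrac_add; split=> //; apply: qD; apply: qM.
move=> x _ [a [s [qa ->]]]; elim/rfracW: x => b t; exists (b * a), (denomM t s).
by rewrite rfrac_mul; split=> //; exact: qM.
Qed.

Lemma locI_frac q a s : is_prime q -> q `<=` prime_set p ->
  locI q (rfrac a s) <-> q a.
move=> [[_ _ qM] _ qP] qp; split=> [[b [t [qb /rfracE[u e]]]]|qa]; last by exists a, s.
have h (w : denom p) x : q (den w * x) -> q x.
  by move=> /qP[/qp/denomP//|].
by apply: (h t); apply: (h u); rewrite e; exact: (qM _ _ (qM _ _ qb)).
Qed.

Lemma locI_prime q : is_prime q -> q `<=` prime_set p -> is_prime (locI q).
move=> hq qp; have [iq q1 qP] := hq; split; first exact: locI_ideal.
  by rewrite -[1]/(rfrac 1 (denom1 p) : T) locI_frac.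
move=> x y; elim/rfracW: x => a s; elim/rfracW: y => b t.
by rewrite rfrac_mul !locI_frac //; exact: qP.
Qed.

Lemma locI_locr q a : is_prime q -> q `<=` prime_set p -> locI q (locr a) <-> q a.
by move=> hq qp; exact: locI_frac. Qed.

Lemma loc_idealE : loc_ideal p = locI p. by []. Qed.

Lemma loc_prime : is_prime (loc_ideal p).
by apply: locI_prime => //; exact: prime_setP. Qed.

Lemma loc_locr a : prime_set p a <-> loc_ideal p (locr a).
by rewrite [X in _ <-> X]locI_locr //; exact: prime_setP. Qed.

Lemma loc_unit (x : T) : ~ loc_ideal p x -> exists y, y * x = 1.
elim/rfracW: x => a s; rewrite [loc_ideal p _]locI_frac //; last exact: prime_setP.
move=> na; have oa : outside p a by apply/asboolPn.
exists (rfrac (den s) (exist _ a oa)); rewrite rfrac_mul; apply/rfracE; exists (denom1 p).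
by rewrite !denM !den1 /Defs.den /=; ring.
Qed.

Lemma locI_gen q x : locI q x -> ideal_gen (locr @` q) x.
move=> [a [s [qa ->]]]; have -> : rfrac a s = rfrac 1 s * locr a :> T.
  by rfrac_ring.
have [_ _ iM] := ideal_genP (locr @` q); apply: iM.
by apply: sub_ideal_gen; exists a.
Qed.

Lemma prime_locI (P : set T) : is_prime P ->
  [/\ is_prime (locr @^-1` P), (locr @^-1` P) `<=` prime_set p & locI (locr @^-1` P) = P].
move=> [[P0 PD PM] P1 PP].
have unitP (s : denom p) : ~ P (locr (den s)).
  move=> h; apply: P1.
  have -> : 1 = rfrac 1 s * locr (den s) :> T.
  by rfrac_ring.
  exact: PM.
split.
- split; rewrite /preimage /= ?rmorph1 //; first split=> [|x y|a x] /=.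
  + by rewrite rmorph0.
  + by rewrite rmorphD; exact: PD.
  + by rewrite rmorphM; exact: PM.
  + by move=> x y; rewrite rmorphM; exact: PP.
- move=> a Pa; apply: contrapT => na; have oa : outside p a by apply/asboolPn.
  exact: (unitP (exist _ a oa)).
apply/seteqP; split=> [_ [a [s [Pa ->]]]|x].
  have -> : rfrac a s = rfrac 1 s * locr a :> T.
  by rfrac_ring.
  exact: PM.
elim/rfracW: x => a s Px; exists a, s; split=> //; rewrite /preimage /=.
have -> : locr a = locr (den s) * rfrac a s :> T.
  by rfrac_ring.
exact: PM.
Qed.

Lemma loc_noetherian : noetherian R -> noetherian T.
move=> nR; apply/noetherianP => S hS.
have hJ : is_ideal (locr @^-1` S).
  have [S0 SD SZ] := hS; split=> [|x y hx hy|a x hx]; rewrite /preimage /=.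
  - by rewrite rmorph0.
  - by rewrite rmorphD; exact: SD.
  - by rewrite rmorphM; exact: SZ.
have [I [x Sx]] := (noetherianP R).1 nR _ hJ.
exists I, (fun i => locr (x i)); apply/seteqP; split; last first.
  apply: fspan_sub => // i; have : fspan (M := R^o) x (x i) by exact: span_mem.
  by rewrite -Sx.
move=> y; elim/rfracW: y => a s Sy.
have : (locr @^-1` S) a.
  rewrite /preimage /=; have -> : locr a = locr (den s) * rfrac a s :> T.
  by rfrac_ring.
  by have [_ _ SZ] := hS; exact: SZ.
rewrite Sx => -[c ec]; exists (fun i => rfrac 1 s * locr (c i)).
have -> : rfrac a s = rfrac 1 s * locr a :> T.
  by rfrac_ring.
rewrite ec rmorph_sum mulr_sumr; apply: eq_bigr => i _.
by rewrite [in LHS]/GRing.scale /= rmorphM mulrA.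
Qed.
End LocalizationRing.

(** Working form of a Noetherian local ring: locality is invertibility outside [n]. *)
Definition lring R (n : set R) : Prop :=
  [/\ noetherian R, is_prime n & forall x, ~ n x -> exists y, y * x = 1].

Lemma lring_loc R (p : prime_ideal R) : noetherian R ->
  lring (loc_ideal p).
by move=> nR; split; [exact: loc_noetherian|exact: loc_prime|exact: loc_unit]. Qed.

Lemma prime_of_maximal R (m : set R) : is_maximal m -> is_prime m.
move=> [im m1 max]; split=> // a b mab.
have [ma|na] := pselect (m a); [by left|right].
have hA := addI_ideal a im.
have : addI m a 1.
  apply: contrapT => h1; have e := max _ hA h1 (@addI_sub _ m a).
  by apply: na; rewrite -e; exact: addI_mem.
move=> /addIP[y [c [my e]]]; have -> : b = b * y + c * (a * b).
  by rewrite -[LHS]mulr1 e; ring.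
by have [_ mD mM] := im; apply: mD; exact: mM.
Qed.

Lemma lring_local R (m : set R) : local_ring m -> lring m.
move=> [nR mm uniq]; have pm := prime_of_maximal mm; split=> // x nx.
pose I := ideal_gen [set x]; have iI : is_ideal I by exact: ideal_genP.
have [I1|I1] := pselect (I 1).
  have : addI [set 0] x 1.
  have h0 : is_ideal [set 0 : R] by exact: (@submod0 R R^o).
  apply: (ideal_gen_sub (addI_ideal x h0) _ I1) => _ ->; exact: addI_mem.
  by move=> /addIP[y [b [-> e]]]; exists b; rewrite e add0r.
have nM := (noetherianP R).1 nR.
have [K [[iK K1] IK Kmax]] := @noeth_max R R^o nM [set J | is_ideal J /\ ~ J 1] I (fun S h => h.1) (conj iI I1).
have mK : is_maximal K.
  split=> // J iJ J1 KJ; apply/seteqP; split=> //; exact: Kmax.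
by case: nx; rewrite -(uniq K mK); apply: IK; apply: sub_ideal_gen.
Qed.

Lemma ideal_expSr R (J : set R) k a b :
  ideal_exp J k a -> J b -> ideal_exp J k.+1 (a * b).
move=> ha Jb; apply: (ideal_gen_prod (ideal_genP _) _ ha (sub_ideal_gen Jb)) => _ c [s [ss sJ ->]] Jc.
apply: sub_ideal_gen; exists (rcons s c); split; rewrite ?size_rcons ?ss // -?cats1 ?big_cat ?big_seq1 //.
by move=> d; rewrite mem_cat inE => /orP[/sJ|/eqP ->].
Qed.

(** * Modules of finite length *)

Section Length.
Variable R : ring.
Implicit Types A B C M : lmod R.

Definition lenge M l : Prop := exists S : nat -> set M,
  (forall i, submod (S i)) /\ forall i, (i < l)%N -> S i `<=` S i.+1 /\ ~ S i.+1 `<=` S i.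

Definition flen M : Prop := exists l, forall k, lenge M k -> (k <= l)%N.

Definition lenle M l : Prop := forall k, lenge M k -> (k <= l)%N.

Lemma lenge0 M : lenge M 0.
by exists (fun _ => setT); split=> // i; exact: submodT. Qed.

(** A weakly increasing chain is compressed to a strict one; the sum counts its strict steps. *)
Lemma weak_chain M (S : nat -> set M) k : (forall i, submod (S i)) ->
  (forall i, S i `<=` S i.+1) ->
  exists S' : nat -> set M, [/\ forall i, submod (S' i),
  forall i, (i < \sum_(j < k) `[< ~ S j.+1 `<=` S j >])%N ->
  S' i `<=` S' i.+1 /\ ~ S' i.+1 `<=` S' i &
  S' (\sum_(j < k) `[< ~ S j.+1 `<=` S j >])%N = S k].
move=> hS hi; elim: k => [|k [S' [h1 h2 h3]]].
  by exists (fun=> S 0%N); split=> // i; rewrite big_ord0.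
rewrite big_ord_recr /=; set c := (\sum_(j < k) _)%N in h2 h3 *.
case: asboolP => hk; last first.
  exists S'; rewrite addn0; split=> //; rewrite h3; apply/seteqP; split; first exact: hi.
  by apply: contrapT.
exists (fun i => if (i <= c)%N then S' i else S k.+1); rewrite addn1 ltnn; split=> // [i|i].
  by case: ifP.
move=> hic; have /orP[/eqP ->|ic] : (i == c) || (i < c)%N by rewrite -leq_eqVlt -ltnS.
  2: by rewrite (ltnW ic) ic; exact: h2.
by rewrite leqnn ltnn h3; split=> //; exact: hi.
Qed.

(** At each step of a strict chain in [B], its trace on [A] or its image in [C] grows. *)
Lemma lenle_ses A B C (f : {linear A -> B}) (g : {linear B -> C}) a c :
  ses f g -> lenle A a -> lenle C c -> lenle B (a + c).
move=> [fi gs ex] hA hC k [S0 [hS0 hs0]].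
pose S i := if (i <= k)%N then S0 i else S0 k.
have hS i : submod (S i) by rewrite /S; case: ifP.
have hs i : S i `<=` S i.+1.
  rewrite /S; case: (leqP i.+1 k) => [ik|ki]; first by rewrite ltnW //; case: (hs0 i ik).
  have [ik|ik] := leqP i k; last by [].
  by have -> : i = k by lia.
have [SA [h1 h2 _]] := weak_chain k (fun i => submod_preim f (hS i))
  (fun i x => hs i (f x)).
have [SC [h1' h2' _]] := weak_chain k (fun i => submod_im g (hS i))
  (fun i => image_subset (hs i)).
have kA : (\sum_(j < k) `[< ~ f @^-1` S j.+1 `<=` f @^-1` S j >] <= a)%N by apply: hA; exists SA.
have kC : (\sum_(j < k) `[< ~ g @` S j.+1 `<=` g @` S j >] <= c)%N by apply: hC; exists SC.
apply: leq_trans (leq_add kA kC); rewrite -big_split /=.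
rewrite -[X in (X <= _)%N]card_ord -sum1_card; apply: leq_sum => j _.
have [|nA] := asboolP (~ f @^-1` S j.+1 `<=` f @^-1` S j) => //.
have [|nC] := asboolP (~ g @` S j.+1 `<=` g @` S j) => //.
exfalso; have [_ []] := hs0 j (ltn_ord j).
have -> : S0 j.+1 = S j.+1 by rewrite /S ltn_ord.
have -> : S0 j = S j by rewrite /S (ltnW (ltn_ord j)).
move=> x Sx; have [|y Sy e] := (contrapT nC) (g x); first by exists x.
have [|z hz] := (ex (x - y)).1; first by rewrite linearB e subrr.
have Sz : S j (f z).
  apply: (contrapT nA); rewrite /preimage /= hz.
  by apply: submodB => //; exact: (hs j).
rewrite -(subrK y x) -hz; have [_ hD _] := hS j; exact: hD.
Qed.

Lemma lenge_ses A B C (f : {linear A -> B}) (g : {linear B -> C}) a c :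
  ses f g -> lenge A a -> lenge C c -> lenge B (a + c).
move=> [fi gs ex] [SA [hA sA]] [SC [hC sC]].
exists (fun i => if (i < a)%N then f @` SA i else g @^-1` SC (i - a)%N); split.
  by move=> i; case: ifP => _; [exact: submod_im|exact: submod_preim].
have fg x : g (f x) = 0 by apply/ex; exists x.
move=> i; case: (ltnP i.+1 a) => [ia _|]; last rewrite leq_eqVlt => /orP[/eqP ea _|ai il].
- rewrite (ltnW ia); have [s1 s2] := sA i (ltnW ia); split; first exact: image_subset.
  by move=> h; apply: s2 => x Sx; have [|y Sy /fi <-] := h (f x); first by exists x.
- have ia : (i < a)%N by rewrite ea.
  have [s1 s2] := sA i ia; rewrite ia -ea subnn; split.
  by move=> _ [x _ <-]; rewrite /preimage /= fg; case: (hC 0%N).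
  move=> h; apply: s2 => x Sx; have [|y Sy /fi <-] := h (f x); last by [].
  by rewrite /preimage /= fg; case: (hC 0%N).
have -> : (i < a)%N = false by lia.
rewrite subSn //.
have ic : (i - a < c)%N by lia.
have [s1 s2] := sC (i - a)%N ic.
split; first by move=> x; exact: s1.
by move=> h; apply: s2 => x Sx; have [b e] := gs x; rewrite -e; apply: h; rewrite /preimage /= e.
Qed.

(** A total function with default 0; it is the length under [flen]. *)
Definition len M : nat :=
  if pselect (exists l, lenge M l /\ lenle M l) is left h then projT1 (cid h) else 0.

Lemma lenP M : flen M -> lenge M (len M) /\ lenle M (len M).
move=> [b hb]; rewrite /len; case: pselect => [h|]; first by case: (cid h).
case; have ex : exists n, `[< lenge M n >] by exists 0%N; apply/asboolP/lenge0.
have bd n : `[< lenge M n >] -> (n <= b)%N by move=> /asboolP/hb.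
case: (ex_maxnP ex bd) => l /asboolP h1 h2; exists l; split=> // k hk.
by apply: h2; apply/asboolP.
Qed.

Lemma len_eq M l : lenge M l -> lenle M l -> flen M /\ len M = l.
move=> h1 h2; have fM : flen M by exists l.
have [h3 h4] := lenP fM; split=> //; apply/eqP; rewrite eqn_leq.
by apply/andP; split; [exact: h2|exact: h4].
Qed.

Lemma len_ses A B C (f : {linear A -> B}) (g : {linear B -> C}) : ses f g ->
  flen A -> flen C -> flen B /\ len B = (len A + len C)%N.
move=> h /lenP[a1 a2] /lenP[c1 c2].
by apply: len_eq; [exact: (lenge_ses h)|exact: (lenle_ses h)].
Qed.

Lemma flen_ses A B C (f : {linear A -> B}) (g : {linear B -> C}) : ses f g ->
  flen B -> flen A /\ flen C.
move=> h [b hb]; split; exists b => k hk; apply: hb.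
  by rewrite -(addn0 k); apply: (lenge_ses h) => //; exact: lenge0.
by rewrite -(add0n k); apply: (lenge_ses h) => //; exact: lenge0.
Qed.

Lemma len_triv M : (forall m : M, m = 0) -> flen M /\ len M = 0%N.
move=> h; apply: len_eq; first exact: lenge0.
move=> [//|k] [S [hS hs]]; have [_ []] := hs 0%N isT.
by move=> x _; rewrite (h x); case: (hS 0%N).
Qed.

Section FiniteLength.
Variable n : set R.
Hypotheses (idn : is_ideal n)
  (un : forall x, ~ n x -> exists y, y * x = 1).

Lemma lenle_cyclic M (x : M) : (forall m : M, exists a, m = a *: x) ->
  (forall a, n a -> a *: x = 0) -> lenle M 1.
move=> hx hn [|[|k]] // [S [hS hs]]; exfalso.
have all (T : set M) m : submod T -> m <> 0 -> T m -> T x.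
  move=> [T0 TD TZ] m0 Tm; have [a ea] := hx m.
  have [na|na] := pselect (n a); first by case: m0; rewrite ea hn.
  have [b hb] := un na; have -> : x = b *: m by rewrite ea scalerA hb scale1r.
  exact: TZ.
have [s0 s1] := hs 0%N isT; have [t0 []] := hs 1%N isT.
have [m [Sm m0]] : exists m, S 1%N m /\ m <> 0.
  apply: contrapT => h; apply: s1 => m Sm; have -> : m = 0.
  by apply: contrapT => m0; apply: h; exists m.
  by case: (hS 0%N).
move=> y _; have [a ->] := hx y; have [_ _ hZ] := hS 1%N; apply: hZ.
exact: (all _ m).
Qed.

Lemma flen_killed k M : noetherian R -> (exists (x : 'I_k -> M), forall m, fspan x m) ->
  (forall a (m : M), n a -> a *: m = 0) -> flen M.
move=> nR; elim: k M => [|k IH] M [x hx] hn.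
  apply: (proj1 (len_triv _)) => m; have [c ->] := hx m; by rewrite big_ord0.
pose S := fspan (fun i : 'I_k => x (lift ord0 i)).
have hS : submod S by exact: fspanS.
have h := smod_ses hS; suff : flen (smod hS) /\ flen (qmod hS).
  by move=> [f1 f2]; case: (len_ses h f1 f2).
split.
  apply: IH => [|a m na]; last by apply: smod_val_inj; rewrite linearZ linear0; exact: hn.
  exists (fun i => smod_of hS (span_mem (fun i : 'I_k => x (lift ord0 i)) i)) => m.
  have [c e] := smodP m; exists c; apply: (@smod_val_inj _ _ _ hS).
  by rewrite linear_sum [LHS]e; apply: eq_bigr => i _; rewrite linearZ.
exists 1%N; apply: (@lenle_cyclic _ (qmod_pi hS (x ord0))) => [m|a na]; last first.
  by rewrite -linearZ hn ?linear0.
have [v <-] := qmodS m; have [c ->] := hx v; exists (c ord0).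
rewrite -linearZ big_ord_recl linearD -[RHS]addr0; congr (_ + _).
by apply/qmod_pi0; exists (fun i => c (lift ord0 i)).
Qed.

(** Induction on [k]: the quotient by [n M] is killed by [n], and [n M] by one power less. *)
Lemma flen_fg k M : noetherian R -> fg M ->
  (forall a (m : M), ideal_exp n k a -> a *: m = 0) -> flen M.
move=> nR; elim: k M => [|k IH] M fM hk.
  apply: (proj1 (len_triv _)) => m; rewrite -(scale1r m); apply: hk.
  by rewrite ideal_exp0.
pose S := smulS n [set: M]; have hS : submod S by exact: smulS_submod.
have h := smod_ses hS; suff : flen (smod hS) /\ flen (qmod hS).
  by move=> [f1 f2]; case: (len_ses h f1 f2).
have nM := fg_noeth ((noetherianP R).1 nR) fM; split.
  apply: IH; first exact: (noethM_fg (noethM_inj (@smod_val_inj _ _ _ hS) nM)).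
  move=> a m ka; apply: smod_val_inj; rewrite linearZ linear0 /=.
  pose N : set M := [set m | a *: m = 0].
  have hN : submod N.
  split=> [|u v|b u]; rewrite /N /= ?scaler0 ?scalerDr //.
  by move=> -> ->; rewrite addr0.
  by rewrite scalerA mulrC -scalerA => ->; rewrite scaler0.
  have hm : forall N, submod N ->
  (forall a u, n a -> [set: M] u -> N (a *: u)) -> N (val m) := smodP m.
  apply: (hm N hN) => b u nb _; rewrite /N /= scalerA; apply: hk; exact: ideal_expSr.
have [I [x hx]] := fM.
apply: (@flen_killed #|I|) => //.
  exists (fun i => qmod_pi hS (x (enum_val i))) => m.
  have [v <-] := qmodS m; have [c ->] := hx v.
  exists (fun i => c (enum_val i)); rewrite linear_sum.
  rewrite (reindex (fun i : 'I_#|I| => enum_val i)) /=; last first.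
  by apply: onW_bij; exact: enum_val_bij.
  by apply: eq_bigr => i _; rewrite linearZ.
move=> a m na; have [v <-] := qmodS m; rewrite -linearZ; apply/qmod_pi0.
by move=> N hN hN'; exact: hN'.
Qed.
End FiniteLength.
End Length.

(** * Chains of primes and Krull's principal ideal theorem *)

Section PrimeChains.
Variable R : ring.
Implicit Types (p q P Q I : set R).

Inductive pchain p : set R -> nat -> Prop :=
| pchain0 : is_prime p -> pchain p p 0
| pchainS q q' l : pchain p q l -> is_prime q' -> q `<=` q' -> ~ q' `<=` q ->
  pchain p q' l.+1.

Lemma pchainP p q l : pchain p q l -> [/\ is_prime p, is_prime q & p `<=` q].
by elim=> [//|{}q q' {}l _ [h1 h2 h3] h4 h5 _]; split=> // x /h3/h5. Qed.

Lemma pchain_cat p q r k l : pchain p q k -> pchain q r l -> pchain p r (k + l).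
move=> h; elim=> [_|s s' {}l _ IH h1 h2 h3]; first by rewrite addn0.
by rewrite addnS; exact: (pchainS IH).
Qed.

Lemma pchain1 p q : is_prime p -> is_prime q -> p `<=` q -> ~ q `<=` p -> pchain p q 1.
by move=> h1 h2 h3 h4; apply: (pchainS (q := p)) => //; exact: pchain0. Qed.

Lemma pchain_cons p q r l : is_prime p -> p `<=` q -> ~ q `<=` p -> pchain q r l ->
  pchain p r l.+1.
move=> h1 h2 h3 h; have [h4 _ _] := pchainP h.
by rewrite -add1n; apply: (pchain_cat _ h); exact: pchain1.
Qed.

Lemma pchain_inv p q l : pchain p q l.+1 ->
  exists q', [/\ pchain p q' l, is_prime q, q' `<=` q & ~ q `<=` q'].
by move=> h; inversion h; subst; exists q0. Qed.

Lemma pchain_uncons p r l : pchain p r l.+1 ->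
  exists q, [/\ is_prime p, p `<=` q, ~ q `<=` p & pchain q r l].
elim: l r => [|l IH] r /pchain_inv[q [h1 h2 h3 h4]].
  by inversion h1; subst; exists r; split=> //; exact: pchain0.
have [s [k1 k2 k3 k4]] := IH _ h1; exists s; split=> //; exact: (pchainS k4).
Qed.

(** The [Ik] are the symbolic powers of [q] modulo [q0]. They become stationary modulo [J] because
    [R / J] has finite length, and by Nakayama's lemma they are stationary. A second use of
    Nakayama, in the localization at [q], puts a power of [q] inside [q0]. *)
Lemma krull_pit_local n q0 q y : lring n -> is_prime q0 -> is_prime q ->
  q0 `<=` q -> q `<=` n -> ~ n `<=` q -> n y ->
  (forall P, is_prime P -> q0 `<=` P -> P y -> P = n) -> q `<=` q0.
move=> [nR pn un] pq0 pq q0q qn nq ny hmin.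
have iq0 := primeI pq0; have [iq _ qP] := pq; have idn := primeI pn.
have nqy : ~ q y by move=> qy; apply: nq; rewrite -(hmin q pq q0q qy).
pose qk k := ideal_exp q k.
have iqk k : is_ideal (qk k) by exact: ideal_exp_ideal.
pose S k : set R := @addS R R^o q0 (qk k).
have iS k : is_ideal (S k) by exact: (@addSS R R^o q0 (qk k) iq0 (iqk k)).
pose Ik k : set R := [set a | exists s, ~ q s /\ S k (s * a)].
have iI k : is_ideal (Ik k).
  have [S0 SD SM] := iS k; split.
  - by exists 1; split; [case: pq|rewrite mulr0].
  - move=> a b [s [ns hs]] [t [nt ht]]; exists (s * t); split; first by move=> /qP[].
  rewrite (_ : s * t * (a + b) = t * (s * a) + s * (t * b)); last by ring.
  by apply: SD; apply: SM.
  move=> a b [s [ns hs]]; exists s; split=> //; rewrite mulrCA; exact: SM.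
have SS k : S k.+1 `<=` S k.
  move=> _ [a [b [qa qb ->]]]; exists a, b; split=> //.
  by apply: (ideal_exp_le iq) qb.
have II k : Ik k.+1 `<=` Ik k by move=> a [s [ns /SS hs]]; exists s.
have q0I k : q0 `<=` Ik k.
  move=> a qa; exists 1; split; first by case: pq.
  rewrite mul1r; exists a, 0; split=> //; [by case: (iqk k)|by rewrite addr0].
pose J := addI q0 y; have iJ : is_ideal J by exact: addI_ideal.
have [N hN] : exists N, ideal_exp n N `<=` J.
  apply: ideal_exp_primes => // P pP JP.
  rewrite (hmin P pP) //; first by move=> x q0x; apply: JP; exact: addI_sub.
  by apply: JP; exact: addI_mem.
pose M : lmod R := @qmod R R^o J iJ; pose pi : {linear R^o -> M} := @qmod_pi R R^o J iJ.
have [B hB] : flen M.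
  apply: (@flen_fg R n un N M nR).
  by apply: (fg_surj (g := pi)); [exact: qmodS|exact: fg_ring].
  move=> a m /hN Ja; have [b <-] := qmodS m; rewrite -linearZ; apply/qmod_pi0.
  by rewrite /GRing.scale /= mulrC; have [_ _ h] := iJ; exact: h.
(* Otherwise the images of the [Ik], taken in reverse order, form a strict chain longer than the
   bound [B] on the length of [M]. *)
have [k hk] : exists k, Ik k `<=` @addS R R^o (Ik k.+1) J.
  apply: contrapT => /forallNP h.
  have : lenge M B.+1; last by move=> /hB; rewrite ltnn.
  exists (fun i => pi @` Ik (B.+1 - i)%N); split=> [i|i iB]; first exact: (@submod_im R R^o M pi _ (iI _)).
  rewrite -(subnSK iB); split; first exact/image_subset/II.
  move=> hi; apply: (h (B.+1 - i.+1)%N) => a ha.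
  have [|b hb e] := hi (pi a); first by exists a.
  exists b, (a - b); split=> //; last by rewrite addrC subrK.
  by apply/(@qmod_pi0 R R^o J iJ); rewrite -/pi linearB e subrr.
have step1 : Ik k `<=` Ik k.+1.
  apply: (@nakayama R R^o _ [set y] (Ik k.+1) (Ik k) (iI _) (iI _)).
  - exact/noetherianP.
  - move=> a -> b; apply: un => h; have [_ n1 _] := pn; apply: n1.
  rewrite -(subrK (b * y) 1); have [_ nD nM] := idn; apply: nD => //; exact: nM.
  move=> T [T0 TD TM] IT hT a Ia.
  have [b [c [Ib Jc ea]]] := hk a Ia; move: Jc => /addIP[d [r [qd ec]]].
  (* [y] is outside [q], so it can be absorbed in the multiplier: [r * y] in [Ik k] forces [r] in
     [Ik k]. *)
  have Ir : Ik k r.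
  have [s [ns hs]] : Ik k (r * y).
  have -> : r * y = a - b - d by rewrite ea ec; ring.
  apply: (idealB (iI k)); [apply: (idealB (iI k)) => //; exact: II|exact: q0I].
  exists (s * y); split; first by move=> /qP[].
  by rewrite -mulrA [y * r]mulrC.
  have -> : a = (b + d) + y * r by rewrite ea ec; ring.
  exact: TD _ _ (TD _ _ (IT _ Ib) (IT _ (q0I _ _ qd))) (hT _ _ erefl Ir).
pose Q := PrimeIdeal pq.
have hq0 : q0 `<=` prime_set Q by [].
have step2 : @locI R Q (qk k) `<=` @locI R Q q0.
  apply: (@nakayama _ (loc_ring Q)^o _ (loc_ideal Q) (@locI R Q q0) (@locI R Q (qk k))).
  - by apply/noetherianP; exact: loc_noetherian.
  - exact: locI_ideal.
  - exact: locI_ideal.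
  - move=> a qa b; apply: loc_unit => h; have [_ n1 _] := loc_prime Q; apply: n1.
  rewrite -(subrK (b * a) 1); have [_ nD nM] := primeI (loc_prime Q).
  by apply: nD => //; exact: nM.
  move=> T [T0 TD TM] IT hT _ [g [s [qg ->]]].
  have [s' [ns' hs']] : Ik k.+1 g.
  apply: step1; exists 1; split; first by have [_ q1 _] := pq.
  by rewrite mul1r; exists 0, g; split=> //; [case: iq0|rewrite add0r].
  have [c [d [q0c qd e]]] : exists c d : R, [/\ q0 c, qk k.+1 d & s' * g = c + d] := hs'.
  have os' : outside Q s' by apply/asboolPn.
  pose w : denom Q := exist _ s' os'.
  have -> : rfrac g s = rfrac c (denomM w s) + rfrac d (denomM w s) :> loc_ring Q.
  rewrite rfrac_add; apply/rfracE; exists (denom1 Q).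
  rewrite !denM !den1; have -> : den w = s' by [].
  have -> : den s * (s' * den s * c + s' * den s * d) = den s * s' * den s * (c + d) by ring.
  by rewrite -e; ring.
  apply: (TD) => //; first by apply: IT; exists c, (denomM w s).
  pose I := [set x : R | T (rfrac x (denomM w s) : loc_ring Q)].
  have iI' : is_ideal I.
  split; rewrite /I /=.
  - rewrite (_ : rfrac 0 _ = 0 :> loc_ring Q) //; apply/rfracE; exists (denom1 Q); ring.
  - move=> x z hx hz; have := TD _ _ hx hz; rewrite rfrac_add.
  rewrite (_ : rfrac _ (denomM (denomM w s) _) = rfrac (x + z) (denomM w s)) //.
  by apply/rfracE; exists (denom1 Q); rewrite !denM; ring.
  move=> a x hx; have := TM (@locr R Q a) _ hx; rewrite [_ *: _]rfrac_mul.
  rewrite (_ : rfrac _ (denomM (denom1 Q) _) = rfrac (a * x) (denomM w s)) //.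
  by apply/rfracE; exists (denom1 Q); rewrite !denM !den1; ring.
  apply: (@ideal_expD R q 1 k I iI') qd => a b; rewrite (ideal_exp1 iq) => qa qb.
  have := hT (@locr R Q a) (rfrac b (denomM w s)).
  rewrite [_ *: _]rfrac_mul /I /= (_ : rfrac _ (denomM (denom1 Q) _) = rfrac (a * b) (denomM w s)); last first.
  by apply/rfracE; exists (denom1 Q); rewrite !denM !den1; ring.
  by apply; [exists a, (denom1 Q)|exists b, (denomM w s)].
move=> x qx; apply: (primeX pq0 (k := k)); apply/(locI_frac (p := Q) _ (denom1 Q) pq0 hq0).
by apply: step2; exists (x ^+ k), (denom1 Q); split=> //; exact: ideal_expS.
Qed.
End PrimeChains.

(** * Krull's height theorem and systems of parameters *)

Section KrullHeight.
Variable R : ring.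
Implicit Types (p q P Q I : set R).

(** Contrapositive of the local form: if no prime over [q0] and [y] lies strictly inside [P], then
    [P] is minimal over them and no prime fits strictly between [q0] and [P]. *)
Lemma krull_pit q0 q P y : noetherian R -> is_prime q0 -> is_prime q -> is_prime P ->
  q0 `<=` q -> ~ q `<=` q0 -> q `<=` P -> ~ P `<=` q -> P y ->
  exists q', [/\ is_prime q', q0 `<=` q', q' y, q' `<=` P & ~ P `<=` q'].
move=> nR pq0 pq pP q0q nq qP nP Py; apply: contrapT => no; apply: nq.
pose Pi := PrimeIdeal pP.
have q0P : q0 `<=` prime_set Pi by move=> x /q0q/qP.
have hl := lring_loc Pi nR.
have h : @locI R Pi q `<=` @locI R Pi q0.
  apply: (krull_pit_local hl (y := @locr R Pi y)).
  - exact: locI_prime.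
  - exact: locI_prime.
  - by move=> _ [a [s [qa ->]]]; exists a, s; split=> //; exact: q0q.
  - by move=> _ [a [s [qa ->]]]; exists a, s; split=> //; exact: qP.
  - move=> h; apply: nP => x Px; apply/(@locI_locr R Pi q x pq qP); apply: h.
  exact/loc_locr.
  - exact/loc_locr.
  move=> Q pQ q0Q Qy; have [h1 h2 h3] := prime_locI pQ.
  rewrite -h3 loc_idealE; congr (@locI R Pi _); apply/seteqP; split=> //.
  apply: contrapT => h4; apply: no; exists ((@locr R Pi) @^-1` Q); split=> //.
  by move=> x q0x; apply: q0Q; apply/locI_locr.
by move=> x qx; apply/(@locI_locr R Pi q0 x pq0 q0P); apply: h; apply/locI_locr.
Qed.

(** Working down from the top, a step [qb < qa < q] with [y] outside [qa] is replaced by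
    [qb < q' < q] with [y] in [q']. *)
Lemma pchain_adjust p q l y : noetherian R -> pchain p q l.+1 -> q y ->
  exists p1, [/\ is_prime p1, p `<=` p1, p1 y & pchain p1 q l].
move=> nR; elim: l q => [|l IH] q /pchain_inv[qa [h1 h2 h3 h4]] qy.
  by have [_ _ h] := pchainP h1; exists q; split=> //; [move=> x /h/h3|exact: pchain0].
have [ya|nya] := pselect (qa y).
  by have [p1 [k1 k2 k3 k4]] := IH _ h1 ya; exists p1; split=> //; exact: (pchainS k4).
have [qb [k1 k2 k3 k4]] := pchain_inv h1; have [_ pb _] := pchainP k1.
have [q' [j1 j2 j3 j4 j5]] := krull_pit nR pb k2 h2 k3 k4 h3 h4 qy.
have [|p1 [i1 i2 i3 i4]] := IH q' _ j3.
  by apply: (pchainS k1) => // h; apply: nya; apply: k3; exact: h.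
by exists p1; split=> //; exact: (pchainS i4).
Qed.

(** Each element of [ys] shortens the chain by one through [pchain_adjust]. *)
Lemma krull_height (ys : seq R) p q l : noetherian R -> pchain p q l ->
  (forall y, y \in ys -> q y) ->
  (forall P, is_prime P -> p `<=` P -> (forall y, y \in ys -> P y) -> P `<=` q -> P = q) ->
  (l <= size ys)%N.
move=> nR; elim: ys p l => [|y ys IH] p l hl hq hmin.
  have [h1 h2 h3] := pchainP hl; case: l hl => // l hl.
  have e : p = q by apply: hmin.
  by have [s [_ k1 k2 k3]] := pchain_uncons hl; have [_ _ h] := pchainP k3; case: k2; rewrite e.
case: l hl => // l hl; rewrite ltnS.
have [p1 [h1 h2 h3 h4]] := pchain_adjust nR hl (hq y (mem_head _ _)).
apply: (IH p1) => // [z hz|P hP p1P hz Pq].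
  by apply: hq; rewrite inE hz orbT.
apply: hmin => // [x /h2/p1P //|z]; rewrite inE => /orP[/eqP ->|]; [exact: p1P|exact: hz].
Qed.

Definition sop (n : set R) I (ys : seq R) : Prop :=
  (forall y, y \in ys -> n y) /\
  forall P, is_prime P -> I `<=` P -> (forall y, y \in ys -> P y) -> P = n.

Definition dimle I r : Prop := forall p q l, I `<=` p -> pchain p q l -> (l <= r)%N.

Lemma lring_sub (n : set R) P : lring n -> is_prime P -> P `<=` n.
move=> [_ _ un] [[_ _ PM] P1 _] x Px; apply: contrapT => /un[y e].
by apply: P1; rewrite -e; exact: PM.
Qed.

(** Prime avoidance gives an element of [n] outside those of the finitely many primes controlling
    [I] that do not contain [n]; adjoining it lowers the dimension of [R / I]. *)
Lemma dimle_sop (n : set R) I r : lring n -> is_ideal I -> dimle I r ->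
  exists2 ys, size ys = r & sop n I ys.
move=> ln; have [nR pn un] := ln; elim: r I => [|r IH] I iI hd.
  exists [::] => //; split=> // P pP IP _; apply/seteqP.
  split; first exact: lring_sub ln _.
  apply: contrapT => h; have := hd P n 1%N IP; rewrite ltnn => k; suff : false by [].
  by apply: k; apply: pchain1 => //; exact: lring_sub ln _.
have [K [P [hP hmin]]] := finite_primes nR iI.
have [x nx hx] : exists2 x, n x & forall k, ~ n `<=` P k -> ~ P k x.
  apply: contrapT => no.
  have [|x nx|k] := @addI_prod_avoid R n {k : K | `[< ~ n `<=` P k >]} (fun k => P (val k)) (primeI pn).
  - by move=> k; exact: (hP _).1.
  - apply: contrapT => /forallNP h; apply: no; exists x => // j nj pj.
  apply: (h (exist _ j (asboolT nj))) => //.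
  by move=> h; have /asboolP := valP k.
have iA := addI_ideal x iI.
have [|ys sys [h1 h2]] := IH _ iA.
  move=> p q l Ap hl; have [pp pq pl] := pchainP hl.
  have [k hk] := hmin p pp (fun z Iz => Ap z (@addI_sub _ I x z Iz)).
  have [nk|nk] := pselect (n `<=` P k).
  suff -> : l = 0%N by [].
  case: l hl => // l /pchain_uncons[s [_ j1 j2 j3]]; case: j2.
  have [ps _ _] := pchainP j3.
  by move=> z /(lring_sub ln ps)/nk/hk.
  rewrite -ltnS; apply: (hd (P k) q) => //; first by case: (hP k).
  apply: (pchain_cons _ hk) hl; first by case: (hP k).
  by move=> h; apply: (hx k nk); apply: h; apply: Ap; exact: addI_mem.
exists (x :: ys); first by rewrite /= sys.
split=> [y|p pp Ip hy]; first by rewrite inE => /orP[/eqP ->|/h1].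
apply: h2 => // [|y hys]; last by apply: hy; rewrite inE hys orbT.
by apply: addI_min => //; [exact: primeI|apply: hy; exact: mem_head].
Qed.

Lemma sop_dimle (n : set R) I ys : lring n -> sop n I ys -> dimle I (size ys).
move=> ln [h1 h2] p q l Ip hl; have [nR pn _] := ln; have [pp pq _] := pchainP hl.
have main k : pchain p n k -> (k <= size ys)%N.
  move=> hk; apply: (krull_height nR hk) => // P pP pP' hy _.
  by apply: h2 => // x /Ip/pP'.
have [nq|nq] := pselect (n `<=` q).
  apply: main; rewrite (_ : n = q) //; apply/seteqP; split=> //.
  exact: lring_sub ln _.
apply: leq_trans (main l.+1 _) => //; apply: (pchainS hl) => //.
exact: lring_sub ln _.
Qed.

Lemma lring_dimle (n : set R) I : lring n -> exists r, dimle I r.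
move=> ln; have [nR pn _] := ln; have [x ex] := nR n (primeI pn).
exists (size x); apply: (sop_dimle ln); split=> [y hy|P pP _ hy].
  by rewrite ex; exact: sub_ideal_gen.
apply/seteqP; split; first exact: lring_sub ln _.
by rewrite ex; apply: ideal_gen_sub => //; exact: primeI.
Qed.
End KrullHeight.

(** The prime sought contains the extension of [p] and avoids every product of an image of an
    element outside [p] with an element outside [P]. *)
Lemma going_down (R T : ring) (f : R ~~> T) (P : set T) (p : set R) :
  flat f -> noetherian T -> is_prime P -> is_prime p -> p `<=` f @^-1` P ->
  exists P', [/\ is_prime P', P' `<=` P & f @^-1` P' = p].
move=> [_ _ _ hf] nT pP pp pP'; have [iP P1 PP] := pP; have [ip p1 ppP] := pp.
pose W : set T := [set x | exists a b, [/\ ~ p a, ~ P b & x = f a * b]].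
pose I := ideal_gen (f @` p).
have [||b|P' [h1 h2 h3]] := @prime_avoiding _ I W nT (ideal_genP _).
- by exists 1, 1; split=> //; rewrite rmorph1 mulr1.
- move=> _ _ [a [b [na nb ->]]] [a' [b' [na' nb' ->]]]; exists (a * a'), (b * b').
  by split; [move=> /ppP[]|move=> /PP[]|rewrite rmorphM mulrACA].
- move=> Ib [a [b' [na nb' e]]]; apply: nb'.
  have [s hs es] := Ib.
  have /choice[c hc] : forall k : 'I_(size s), exists c, p c /\ f c = (tnth (in_tuple s) k).1.
  by move=> k; have [c h1 h2] := hs _ (mem_tnth k (in_tuple s)); exists c.
  (* Such a product in the extension is a relation between [a] and elements of [p]. By flatness [b']
     is a combination of images of coefficients [r None] with [r None * a] in [p], so it would lie
     in [P]. *)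
  pose m (o : option 'I_(size s)) : R^o := if o is Some k then c k else a.
  pose t : {ffun option 'I_(size s) -> T^o} :=
  [ffun o => if o is Some k then - (tnth (in_tuple s) k).2 : T else b'].
  have : sspan [set fvec f r | r in rels m] t.
  apply: hf; rewrite sum_option ffunE [X in X + _]mulrC -e es big_tnth -big_split big1 // => k _.
  by rewrite /= ffunE (hc k).2 [X in _ + X]mulNr mulrC; exact: subrr.
  pose S : set {ffun option 'I_(size s) -> T^o} := [set t | P (t None)].
  have hS : submod S.
  have [P0 PD PM] := iP.
  by split=> [|u v|d u]; rewrite /S /= ffunE; [exact: P0|exact: PD|exact: PM].
  have -> : b' = t None by rewrite ffunE.
  apply: (sspan_min hS) => _ [r hr <-]; rewrite /S /= ffunE; apply: pP'.
  move: hr; rewrite /rels /= sum_option /= => /eqP; rewrite addr_eq0 => /eqP er.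
  have /ppP[//|//] : p (r None * a).
  rewrite [_ * _]er; apply: (@submodN R R^o p ip); apply: (@submod_sum R R^o p ip) => k _.
  exact: (idealMl _ ip (hc k).1).
exists P'; split=> // [x Px|].
  apply: contrapT => nx; apply: (h3 x Px); exists 1, x; split=> //.
  by rewrite rmorph1 mul1r.
apply/seteqP; split=> a; last by move=> pa; apply: h2; apply: sub_ideal_gen; exists a.
move=> Pa; apply: contrapT => na; apply: (h3 _ Pa); exists a, 1; split=> //.
by rewrite mulr1.
Qed.

Lemma prime_preim (R T : ring) (f : R ~~> T) (P : set T) :
  is_prime P -> is_prime (f @^-1` P).
move=> [[P0 PD PM] P1 PP]; split; rewrite /preimage /= ?rmorph1 //.
  split=> [|x y|a x] /=; rewrite ?rmorph0 ?rmorphD ?rmorphM //; [exact: PD|exact: PM].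
by move=> x y; rewrite rmorphM; exact: PP.
Qed.

Lemma going_down_chain (R T : ring) (f : R ~~> T) (P : set T)
  (p q : set R) l : flat f -> noetherian T -> is_prime P -> f @^-1` P = q ->
  pchain p q l -> exists P', f @^-1` P' = p /\ pchain P' P l.
move=> hf nT pP e hl; elim: l p hl => [|l IH] p hl.
  by inversion hl; subst; exists P; split=> //; exact: pchain0.
have [s [pp ps nsp /IH[P1 [e1 h1]]]] := pchain_uncons hl.
have [pP1 _ _] := pchainP h1.
have [|P' [k1 k2 k3]] := going_down hf nT pP1 pp; first by rewrite e1.
exists P'; split=> //; apply: (pchain_cons k1 k2) h1 => h; apply: nsp.
by rewrite -k3 -e1 => x; exact: h.
Qed.

Lemma dep_local R (n : set R) (M : lmod R) t E : lring n -> fg M -> tester E n -> dep n M t <-> van E M t.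
move=> [nR pn un] fM; apply: (dep_van (fbc_id M) pn un) => // b nb.
by exists 1%N; rewrite expr1; apply: sub_ideal_gen; exists b.
Qed.

Lemma fbc_nzd (R T : ring) (f : R ~~> T) (M : lmod R) (M' : lmod T)
  (i : M -> M') (n' : set T) p y : fbc f i -> is_prime n' ->
  (forall x, ~ n' x -> exists y, y * x = 1) -> (forall a, p a <-> n' (f a)) ->
  nzd y M -> nzd (f y) M'.
move=> hi pn un pp hy.
(* Injectivity of multiplication by [y] is exactness of [0 -> M -> M]. *)
pose P (_ : void) (_ : unit) : R := 0; pose Q (_ : unit) (_ : unit) : R := y.
have : mex (rmapM f P) (rmapM f Q) M'.
  apply/(fbc_mex hi pn un pp) => v hv; exists 1; split.
  by rewrite pp rmorph1; case: pn.
  exists 0; rewrite mact0 scale1r; apply/ffunP => -[]; rewrite ffunE; apply: hy.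
  by have /ffunP/(_ tt) := hv; rewrite !ffunE sum_unit.
move=> h m hm; have [|u /ffunP/(_ tt)] := h [ffun=> m].
  by apply/ffunP => -[]; rewrite !ffunE sum_unit ffunE.
by rewrite !ffunE big1 // => -[].
Qed.

Lemma mulr_unit1 R (n : set R) x b : lring n -> n x -> exists c, c * (1 - b * x) = 1.
move=> [nR pn un] nx; apply: un => h; have [[_ nD nM] n1 _] := pn; apply: n1.
by rewrite -(subrK (b * x) 1); apply: nD => //; exact: nM.
Qed.

Lemma pchain0_eq R (p q : set R) : pchain p q 0 -> p = q.
by move=> h; inversion h. Qed.

(** * Depth at neighbouring primes *)

Section DepthPrimes.
Variable R : ring.
Implicit Types (p q P n : set R) (M N : lmod R).

Lemma dep_loc (p : prime_ideal R) M t E : noetherian R -> fg M ->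
  tester E (loc_ideal p) -> dep p M t <-> van E (loc p M) t.
move=> nR fM; have [nT pT uT] := lring_loc p nR.
apply: (dep_van (fbc_loc p M) pT uT) => // [a|b hb]; first exact: loc_locr.
by exists 1%N; rewrite expr1; exact: locI_gen.
Qed.

Lemma dep_loc_ideal (p : prime_ideal R) M t : noetherian R -> fg M ->
  dep p M t <-> dep (loc_ideal p) (loc p M) t.
move=> nR fM; have lT := lring_loc p nR; have [nT pT uT] := lT.
have [E tE] := testerP nT (primeI pT).
rewrite (dep_loc t nR fM tE) (dep_local t lT _ tE) //.
exact: fbc_fg (fbc_loc p M) fM.
Qed.

Lemma dep_ymod (p : prime_ideal R) M y t : noetherian R -> fg M -> prime_set p y ->
  nzd y M -> dep p M t.+1 <-> dep p (ymod y M) t.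
move=> nR fM py hy; have [nT pT uT] := lring_loc p nR.
have [E tE] := testerP nT (primeI pT).
have hi := fbc_loc p M; have [j hj] := fbc_ymod hi y.
have fy := fg_ymod y fM.
have hrad b : loc_ideal p b -> exists k, ideal_gen (@locr R p @` prime_set p) (b ^+ k).
  by move=> hb; exists 1%N; rewrite expr1; exact: locI_gen.
rewrite (dep_van hi pT uT (@loc_locr R p) nR nT fM hrad _ tE).
rewrite (dep_van hj pT uT (@loc_locr R p) nR nT fy hrad _ tE).
apply: (van_ymod _ tE); first exact/loc_locr.
exact: (fbc_nzd hi pT uT (@loc_locr R p)).
Qed.

Lemma dep1_nzd n M : lring n -> fg M -> dep n M 1 -> exists y, n y /\ nzd y M.
move=> ln fM; have [nR pn un] := ln.
have [E tE] := testerP nR (primeI pn).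
rewrite (dep_local _ ln fM tE) => h.
by apply: (exists_nzd nR fM (primeI pn) tE); exact: h.
Qed.

Lemma dep1_killed (p : prime_ideal R) M (m : M) : noetherian R -> fg M ->
  dep p M 1 -> (forall a, prime_set p a -> a *: m = 0) ->
  exists a, ~ prime_set p a /\ a *: m = 0.
move=> nR fM; have [nT pT uT] := lring_loc p nR.
have [E tE] := testerP nT (primeI pT).
rewrite (dep_loc _ nR fM tE) => h hm.
have /(cex0P _ tE) h0 := h 0%N isT.
have /loc_fracP[u] : locm p m = 0.
  apply: h0 => _ [a [s [pa ->]]]; rewrite [_ *: _]loc_scaleE hm //.
  by apply/loc_fracP; exists (denom1 p); rewrite !scaler0.
rewrite !den1 !scale1r scaler0 => hu; exists (den u); split=> //; exact: denomP.
Qed.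

Lemma locz_dep (p : prime_ideal R) M t : noetherian R -> locz p M ->
  dep p M t.
move=> nR h; have pp := prime_setP p.
have [E tE] := testerP nR (primeI pp).
exists E; split=> // i _ v _.
have /choice[a ha] : forall x, exists a, ~ prime_set p a /\ a *: v x = 0 by move=> x.
exists (\prod_x a x); split; first by move=> /(prime_prod pp)[x [_]]; case: (ha x).
exists 0; rewrite mact0; apply/ffunP => x; rewrite !ffunE (bigD1 x) //= mulrC -scalerA.
by rewrite (ha x).2 scaler0.
Qed.

(** A nonzerodivisor in [p] lowers both depths. Without one, some element killed by [p] survives
    modulo a nonzerodivisor [y] of [n]; the associated prime above its annihilator contains [p] and
    [y], hence is [n], which contradicts depth at least 2 at [n]. *)
Lemma dep_adjacent_local n (p : prime_ideal R) M t : lring n -> fg M ->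
  prime_set p `<=` n -> ~ n `<=` prime_set p ->
  (forall q, is_prime q -> prime_set p `<=` q -> ~ q `<=` prime_set p -> q = n) ->
  dep n M t.+1 -> dep p M t.
move=> ln fM pn np adj; have [nR prn un] := ln; have pp := prime_setP p.
have [E tE] := testerP nR (primeI prn).
elim: t M fM => [|t IH] M fM hd.
  by have [E' tE'] := testerP nR (primeI pp); exists E'.
have [[y [py hy]]|no] := pselect (exists y, prime_set p y /\ nzd y M).
  apply/(dep_ymod _ nR fM py hy); apply: IH; first exact: fg_ymod.
  apply/(dep_local _ ln (fg_ymod y fM) tE)/(van_ymod _ tE (pn _ py) hy).
  exact/(dep_local _ ln fM tE).
exfalso; have [|y [ny hy]] := @dep1_nzd n M ln fM; first exact: dep_le hd.
have [|u [u0 _ hu]] := zero_divisors_ass nR fM (primeI pp).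
  move=> a pa; apply: contrapT => h; apply: no; exists a; split=> // m am.
  by apply: contrapT => m0; apply: h; exists m.
pose U : set M := [set u | forall a, prime_set p a -> a *: u = 0].
have hU : submod U.
  split=> [a _|x z hx hz a pa|b x hx a pa]; first by rewrite scaler0.
  by rewrite scalerDr hx ?hz ?addr0.
  by rewrite scalerA mulrC -scalerA hx ?scaler0.
have nM := fg_noeth ((noetherianP R).1 nR) fM.
(* If [U] were contained in [y M], then [U = y U], because [y] is a nonzerodivisor, and Nakayama's
   lemma would make [U] zero. *)
have [w [Uw nw]] : exists w, U w /\ ~ @yset R y M w.
  apply: contrapT => h; apply: u0.
  have U0 : U `<=` [set 0 : M].
  apply: (nakayama (J := [set y]) nM (submod0 M) hU) => [_ -> b|N hN _ hN' x Ux].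
  exact: (mulr_unit1 b ln ny).
  have [z _ ez] : @yset R y M x by apply: contrapT => h'; apply: h; exists x.
  rewrite -ez; apply: hN' => // a pa; apply: hy.
  by rewrite scalerA mulrC -scalerA ez Ux.
  exact/U0.
have w0 : ymod_pi y M w <> 0 by move=> /qmod_pi0.
have [m' [m'0 am' pm']] := ass_above nR w0.
have em : ann m' = n.
  apply: adj => // [a pa|h].
  by apply: am'; rewrite /ann /= -linearZ Uw ?linear0.
  have py : prime_set p y by apply: h; apply: am'; exact: ymod_kills.
  by apply: u0; apply: hy; exact: hu.
have : van E (ymod y M) 1.
  apply/(van_ymod _ tE ny hy); apply/(dep_local _ ln fM tE); exact: dep_le hd.
move=> /(_ 0%N isT)/(cex0P _ tE)/(_ m') h; apply: m'0; apply: h => a.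
by rewrite -em.
Qed.
End DepthPrimes.

(** * Depth along chains of primes *)

Section DepthChains.
Variable R : ring.
Implicit Types (p q P : prime_ideal R) (M N : lmod R).

(** Localization at [q] makes it maximal; localizing a second time at [p] is again a base change
    from [R], so the depth at [p] is unaffected. *)
Lemma dep_adjacent p q M t : noetherian R -> fg M ->
  prime_set p `<=` prime_set q -> ~ prime_set q `<=` prime_set p ->
  (forall r, is_prime r -> prime_set p `<=` r -> ~ r `<=` prime_set p ->
  r `<=` prime_set q -> prime_set q `<=` r) ->
  dep q M t.+1 -> dep p M t.
move=> nR fM pq nqp adj.
have lT := lring_loc q nR; have [nT pT uT] := lT.
have hi := fbc_loc q M; have fM' := fbc_fg hi fM.
have pp := prime_setP p; have pp' := locI_prime pp pq.
pose p' := PrimeIdeal pp'.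
rewrite (dep_loc_ideal _ _ nR fM) => hd.
have : dep p' (loc q M) t.
  apply: (dep_adjacent_local lT fM') hd => //.
  - by move=> _ [a [s [pa ->]]]; exists a, s; split=> //; exact: pq.
  - move=> h; apply: nqp => x qx; apply/(locI_locr x pp pq); apply: h.
  exact/loc_locr.
  move=> P pP p'P nP; have [h1 h2 h3] := prime_locI pP.
  rewrite -h3 loc_idealE; congr (locI _); apply/seteqP; split=> //.
  apply: adj => // [x px|h]; first by apply: p'P; apply/locI_locr.
  by apply: nP; rewrite -h3 => _ [a [s [/h pa ->]]]; exists a, s.
have lT' := lring_loc p' nT; have [nT' pT' uT'] := lT'.
have [E tE] := testerP nT' (primeI pT').
rewrite (dep_loc _ nT fM' tE) => hv.
have hj := fbc_comp hi (fbc_loc p' (loc q M)).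
apply/(dep_van hj pT' uT' _ nR nT' fM _ _ tE) => //.
  move=> a; rewrite /= -loc_locr; split=> [pa|]; first exact/(locI_locr a pp pq).
  by move=> /(locI_locr a pp pq).
move=> b hb; exists 1%N; rewrite expr1.
have := locI_gen hb; apply: ideal_gen_sub; first exact: ideal_genP.
move=> _ [x px <-].
have := locI_gen px; pose I := [set z | ideal_gen ((@locr _ p' \o @locr _ q) @` prime_set p) (locr p' z)].
have iI : is_ideal I.
  have [i0 iD iM] := ideal_genP ((@locr _ p' \o @locr _ q) @` prime_set p).
  by split=> [|u v hu hv'|u v hu]; rewrite /I /= ?rmorph0 ?rmorphD ?rmorphM; [exact: i0|exact: iD|exact: iM].
apply: (ideal_gen_sub iI) => _ [a pa <-]; apply: sub_ideal_gen; by exists a.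
Qed.

Lemma pchain_bounded q : noetherian R -> exists b, forall (p : set R) l, pchain p q l -> (l <= b)%N.
move=> nR; have pq := prime_setP q; have [x ex] := nR _ (primeI pq).
exists (size x) => p l hl; apply: (krull_height nR hl) => [y hy|P pP _ hy Pq].
  by rewrite ex; exact: sub_ideal_gen.
apply/seteqP; split=> //; rewrite {1}ex; apply: ideal_gen_sub => //; exact: primeI.
Qed.

(** [h] is the greatest length of a chain from [p] to [q], so that all steps of such a chain join
    adjacent primes. *)
Lemma dep_chain p q : noetherian R -> prime_set p `<=` prime_set q ->
  exists h, pchain p q h /\
  forall M t, fg M -> dep q M (t + h) -> dep p M t.
move=> nR pq; have pp := prime_setP p; have pq' := prime_setP q.
have [b hb] := pchain_bounded q nR.
have [c0 hc0] : exists c, pchain p q c.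
  have [h|h] := pselect (prime_set q `<=` prime_set p); last by exists 1%N; exact: pchain1.
  by exists 0%N; rewrite (_ : prime_set q = prime_set p); [exact: pchain0|apply/seteqP].
have ex : exists c, `[< pchain p q c >] by exists c0; apply/asboolP.
have bd c : `[< pchain p q c >] -> (c <= b)%N by move=> /asboolP/hb.
case: (ex_maxnP ex bd) => h /asboolP hh hm; exists h; split=> // M t fM.
have {}hm c : pchain p q c -> (c <= h)%N by move=> hc; apply: hm; apply/asboolP.
elim: h p t pp pq hh hm {c0 hc0 ex bd} => [|h IH] p t pp pq hh hm.
  by rewrite (pchain0_eq hh) addn0.
have [s [_ ps nsp hs]] := pchain_uncons hh; have [prs _ sq] := pchainP hs.
rewrite -addSnnS => hd.
apply: (@dep_adjacent p (PrimeIdeal prs) M t nR fM ps nsp).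
  move=> r pr pr' nr rs; apply: contrapT => nsr.
  have := hm h.+2; rewrite ltnn => k; suff : false by []; apply: k.
  by apply: (pchain_cons pp pr' nr); exact: (pchain_cons pr rs nsr).
apply: (IH (PrimeIdeal prs)) => // c hc.
by rewrite -ltnS; apply: hm; exact: (pchain_cons pp ps nsp hc).
Qed.
End DepthChains.

Definition htge R (q : set R) l : Prop := exists p, pchain p q l.

Lemma htge_le R (q : set R) k l : (k <= l)%N -> htge q l -> htge q k.
move=> kl [p h]; elim: l k p h kl => [|l IH] k p h.
  by rewrite leqn0 => /eqP ->; exists p.
rewrite leq_eqVlt => /orP[/eqP ->|]; first by exists p.
by rewrite ltnS => kl; have [s [_ _ _ hs]] := pchain_uncons h; exact: (IH _ s).
Qed.

Lemma htge_cat R (p q : set R) k l : htge p k -> pchain p q l ->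
  htge q (k + l).
by move=> [s hs] h; exists s; exact: pchain_cat h. Qed.

(** If the depth exceeded the length of a longest chain from an associated prime [P] to [n], a
    positive depth would be left at [P], where an element has annihilator exactly [P]. *)
Lemma dep_height_local R (n : set R) (M : lmod R) t : lring n -> fg M -> (exists m : M, m <> 0) ->
  dep n M t -> htge n t.
move=> ln fM [m m0] hd; have [nR pn un] := ln.
have [m' [m'0 am pm]] := ass_above nR m0.
pose P := PrimeIdeal pm; pose n' := PrimeIdeal pn.
have [|h [hc hh]] := @dep_chain R P n' nR; first exact: (lring_sub ln).
have [th|ht] := leqP t h; first by apply: (htge_le th); exists P.
have [|a [na am']] := @dep1_killed R P M m' nR fM _ (fun a (h : prime_set P a) => h); last by case: na.
by apply: hh => //; exact: dep_le hd.
Qed.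

(** * Depth, height and the Cohen-Macaulay property *)

Section DepthHeight.
Variable R : ring.
Implicit Types (p q : prime_ideal R) (M N : lmod R).

Lemma pchain_contract q (P P' : set (loc_ring q)) l : pchain P P' l ->
  pchain (@locr R q @^-1` P) (@locr R q @^-1` P') l.
elim=> [hP|Q Q' {}l hl IH pQ QQ' nQ]; first by apply: pchain0; exact: prime_preim.
have [_ pQ0 _] := pchainP hl.
apply: (pchainS IH); [exact: prime_preim|by move=> x; exact: QQ'|].
have [h1 h2 h3] := prime_locI pQ; have [k1 k2 k3] := prime_locI pQ0.
by move=> h; apply: nQ; rewrite -h3 -k3 => _ [a [s [/h pa ->]]]; exists a, s.
Qed.

Lemma dep_height q M t : noetherian R -> fg M -> ~ locz q M ->
  dep q M t -> htge q t.
move=> nR fM nz; rewrite (dep_loc_ideal _ _ nR fM) => hd.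
have [|P hP] := dep_height_local (lring_loc q nR) (fbc_fg (fbc_loc q M) fM) _ hd.
  apply: contrapT => h; apply: nz.
  apply/(fbc_locz (fbc_loc q M) (loc_prime q) (@loc_unit R q) (@loc_locr R q)) => m.
  by apply: contrapT => m0; apply: h; exists m.
exists (@locr R q @^-1` P); have -> : prime_set q = @locr R q @^-1` loc_ideal q.
  by apply/seteqP; split=> x /loc_locr.
exact: pchain_contract.
Qed.

(** Cohen-Macaulay at [n]: the depth reaches the height. *)
Definition cm (n : set R) : Prop := forall l, htge n l -> dep n R^o l.

Lemma cm_loc p q : noetherian R -> cm q -> prime_set p `<=` prime_set q ->
  cm p.
move=> nR hq pq l hl; have [h [hc hh]] := dep_chain nR pq.
by apply: hh; [exact: fg_ring|apply: hq; exact: htge_cat hl hc].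
Qed.

(** Depth [d] at [q] leaves depth [d - h] at [p], and depth is at most height. *)
Lemma cm_dim p q d : noetherian R -> cm q -> prime_set p `<=` prime_set q ->
  htge q d ->
  exists h, pchain p q h /\ htge p (d - h).
move=> nR hq pq hd; have [h [hc hh]] := dep_chain nR pq; exists h; split=> //.
have [dh|hd'] := leqP d h.
  rewrite (_ : (d - h)%N = 0%N); last by apply/eqP.
  by exists p; apply: pchain0; exact: prime_setP.
apply: (@dep_height _ R^o) => //; first exact: fg_ring.
  move=> /(_ 1)[a [na]]; rewrite /GRing.scale /= mulr1 => a0; apply: na; rewrite a0.
  by case: (prime_setP p) => -[].
by apply: hh; [exact: fg_ring|rewrite subnK ?(ltnW hd') //; exact: hq].
Qed.
End DepthHeight.

Lemma ele_nsup (P : set nat) k : P 0%N -> (forall a b, (a <= b)%N -> P b -> P a) ->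
  ele (Some k) (nsup P) <-> P k.
move=> P0 Pd; rewrite /nsup; case: pselect => [h|h].
  case: (cid h) => b [hb1 hb2] /=; split=> [kb|/hb1 //].
  apply: (Pd _ b) => //; apply: contrapT => nb.
  case: b hb1 hb2 kb nb => [//|b] hb1 hb2 kb nb.
  have : (b.+1 <= b)%N; last by rewrite ltnn.
  apply: hb2 => a Pa; rewrite leqNgt; apply/negP => ba; apply: nb; exact: Pd Pa.
split=> // _; apply: contrapT => nk; apply: h.
have bd a : P a -> (a <= k)%N.
  by move=> Pa; rewrite leqNgt; apply/negP => ka; apply: nk; apply: Pd Pa; exact: ltnW.
have ex : exists a, `[< P a >] by exists 0%N; apply/asboolP.
have bd' a : `[< P a >] -> (a <= k)%N by move=> /asboolP/bd.
case: (ex_maxnP ex bd') => b /asboolP Pb hb; exists b; split=> [a Pa|b' hb'].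
  by apply: hb; apply/asboolP.
exact: hb'.
Qed.

Lemma ele_emin n H D : ele (emin (Some n) H) D <->
  forall k, (k <= n)%N -> ele (Some k) H -> ele (Some k) D.
case: H => [h|]; case: D => [d|]; rewrite /emin /=.
- case: ifP => [nh|/negbT]; first by split=> [nd k kn _|]; [exact: leq_trans nd|apply].
  by rewrite -ltnNge => hn; split=> [hd k _ kh|h']; [exact: leq_trans hd|apply: h' => //; exact: ltnW].
- by case: ifP.
- by split=> [nd k kn _|h']; [exact: leq_trans nd|exact: h'].
- by [].
Qed.

(** * Regular sequences, Krull dimension and Serre's condition *)

Section RegularSequences.
Variable R : ring.
Implicit Types M L : lmod R.

Lemma smul_submod (I : set R) M : submod (smul I M).
by split; [exact: smul0|move=> x y; exact: smulD|move=> a x; exact: smulZ]. Qed.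

Lemma smul_mem (I : set R) M a (m : M) : I a -> smul I M (a *: m).
move=> Ia; exists [:: (a, m)]; last by rewrite big_seq1.
by move=> t; rewrite inE => /eqP ->.
Qed.

Lemma smul_min (I : set R) M (S : set M) : submod S ->
  (forall a m, I a -> S (a *: m)) -> smul I M `<=` S.
move=> hS h _ [s hs ->]; rewrite big_seq; apply: (submod_sum hS) => t ts.
exact/h/hs.
Qed.

Lemma smul_cons y s M (z : M) : smul (seq_set (y :: s)) M z <->
  smul (seq_set s) (ymod y M) (ymod_pi y M z).
split=> [|h].
  have hS := submod_preim (ymod_pi y M) (smul_submod (seq_set s) (ymod y M)).
  apply: (smul_min hS) => a m; rewrite /seq_set /= inE => /orP[/eqP ->|sa].
  suff : smul (seq_set s) (ymod y M) (y *: ymod_pi y M m) by rewrite -linearZ.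
  by rewrite ymod_kills; exact: smul0.
  suff : smul (seq_set s) (ymod y M) (a *: ymod_pi y M m) by rewrite -linearZ.
  exact: smul_mem.
pose S : set (ymod y M) := (ymod_pi y M) @` smul (seq_set (y :: s)) M.
have hS : submod S by apply: submod_im; exact: smul_submod.
have [|z' hz' e] := smul_min hS _ h.
  move=> a m sa; have [m0 <-] := qmodS m; exists (a *: m0); last by rewrite linearZ.
  by apply: smul_mem; rewrite /seq_set /= inE sa orbT.
have /(qmod_pi0 (@yset_submod R y M))[w _ ew] : ymod_pi y M (z - z') = 0 by rewrite linearB e subrr.
rewrite -(subrK z' z) -ew; apply: smulD => //; apply: smul_mem; exact: mem_head.
Qed.

Lemma smul_nil M (z : M) : smul (seq_set [::]) M z <-> z = 0.
split=> [|->]; last exact: smul0.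
by apply: (smul_min (submod0 M)) => a m.
Qed.

Lemma regular_seq_cons y s M : regular_seq M (y :: s) <->
  nzd y M /\ regular_seq (ymod y M) s.
split=> [[h [z nz]]|[hy [h [z nz]]]].
  split=> [m ym|]; first by apply/smul_nil; apply: (h 0%N) => //; rewrite /= ym; exact: smul0.
  split=> [i si w|]; last by exists (ymod_pi y M z) => /smul_cons.
  have [m <-] := qmodS w; rewrite -linearZ => /smul_cons hw; apply/smul_cons.
  exact: (h i.+1).
split=> [[|i] si m|]; last first.
- by have [w ew] := qmodS z; exists w => /smul_cons; rewrite ew.
- move=> /smul_cons hm; apply/smul_cons; apply: (h i) => //.
  by move: hm; rewrite linearZ.
by move=> /smul_nil/hy ->; exact: smul0.
Qed.

Lemma regular_seq_regs s M : regular_seq M s -> regs s M.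
by elim: s M => [//|y s IH] M /regular_seq_cons[h1 /IH h2]. Qed.

Lemma ymod_neq0 n M y : lring n -> fg M -> n y -> (exists m : M, m <> 0) ->
  exists m : ymod y M, m <> 0.
move=> ln fM ny [m m0]; have [nR _ _] := ln; apply: contrapT => h; apply: m0.
have nM := fg_noeth ((noetherianP R).1 nR) fM.
suff : setT `<=` [set 0 : M] by apply.
apply: (nakayama (J := [set y]) nM (submod0 M) (submodT M)) => [_ -> b|N hN _ hN' x _].
  exact: (mulr_unit1 b ln ny).
have /(qmod_pi0 (@yset_submod R y M))[w _ <-] : ymod_pi y M x = 0.
  by apply: contrapT => hx; apply: h; exists (ymod_pi y M x).
exact: hN'.
Qed.

Lemma dep_ymod_local n M y t : lring n -> fg M -> n y -> nzd y M ->
  dep n M t.+1 <-> dep n (ymod y M) t.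
move=> ln fM ny hy; have [nR pn _] := ln.
exact: (@dep_ymod R (PrimeIdeal pn) M y t nR fM ny hy).
Qed.

Lemma dep_regular n M k : lring n -> fg M -> (exists m : M, m <> 0) ->
  (exists x : seq R, [/\ size x = k, forall a, a \in x -> n a & regular_seq M x]) <->
  dep n M k.
move=> ln; have [nR pn _] := ln; elim: k M => [|k IH] M fM nz.
  split=> _; first by have [E tE] := testerP nR (primeI pn); exists E.
  exists [::]; split=> //; split=> //; have [m m0] := nz.
  by exists m => /smul_nil.
split=> [[x [sx hx rx]]|hd].
  case: x sx hx rx => // y x [sx] hx /regular_seq_cons[hy rx].
  have ny : n y by apply: hx; exact: mem_head.
  apply/(dep_ymod_local _ ln fM ny hy)/(IH _ (fg_ymod y fM) (ymod_neq0 ln fM ny nz)).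
  by exists x; split=> // a ax; apply: hx; rewrite inE ax orbT.
have [|y [ny hy]] := dep1_nzd ln fM; first exact: dep_le hd.
move: hd => /(dep_ymod_local _ ln fM ny hy)/(IH _ (fg_ymod y fM) (ymod_neq0 ln fM ny nz)).
move=> [x [sx hx rx]]; exists (y :: x); split; [by rewrite /= sx| |exact/regular_seq_cons].
by move=> a; rewrite inE => /orP[/eqP ->|/hx].
Qed.

Lemma ele_depth n M k : lring n -> fg M -> ele (Some k) (depth M n) <-> dep n M k.
move=> ln fM; have [nR pn _] := ln; rewrite /depth; case: asboolP => [h|h].
  split=> // _; apply: (@locz_dep R (PrimeIdeal pn)) => // m.
  by have [_ n1 _] := pn; exists 1; split; [|exact: h].
have nz : exists m : M, m <> 0 by apply: contrapT => h'; apply: h => y; apply: contrapT => y0; apply: h'; exists y.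
rewrite ele_nsup.
- exact: dep_regular.
- by apply/(dep_regular _ ln fM nz); have [E tE] := testerP nR (primeI pn); exists E.
by move=> a b ab /(dep_regular _ ln fM nz) h'; apply/(dep_regular _ ln fM nz); exact: dep_le h'.
Qed.

Lemma prime_chain_pchain (c : nat -> prime_ideal R) l : prime_chain c l ->
  pchain (prime_set (c 0%N)) (prime_set (c l)) l.
elim: l => [|l IH] h; first by apply: pchain0; exact: prime_setP.
have [h1 h2] := h l (ltnSn l).
apply: (pchainS (IH _)) => //; first by move=> i il; apply: h; exact: ltnW.
exact: prime_setP.
Qed.

Lemma pchain_prime_chain (p q : set R) l : pchain p q l ->
  exists c : nat -> prime_ideal R, [/\ prime_chain c l, prime_set (c 0%N) = p & prime_set (c l) = q].
elim=> [hp|{}q q' {}l hl [c [h1 h2 h3]] pq' qq' nq]; first by exists (fun=> PrimeIdeal hp).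
exists (fun i => if (i <= l)%N then c i else PrimeIdeal pq'); rewrite ltnn; split=> // i.
move=> hil; have /orP[/eqP ->|il] : (i == l) || (i < l)%N by rewrite -leq_eqVlt -ltnS.
  2: by rewrite (ltnW il) il; exact: h1.
by rewrite leqnn ltnn; split; rewrite h3.
Qed.

Lemma ele_height (p : prime_ideal R) k : ele (Some k) (height p) <-> htge p k.
have e : [set l | exists2 c, prime_chain c l & prime_set (c l) = prime_set p] = htge p.
  apply/seteqP; split=> [l [c h e]|l [q /pchain_prime_chain[c [h1 _ h2]]]]; last by exists c.
  by exists (prime_set (c 0%N)); rewrite -e; exact: prime_chain_pchain.
rewrite /height e ele_nsup //; last exact: htge_le.
by exists p; apply: pchain0; exact: prime_setP.
Qed.

Lemma ele_krull_dim (n : set R) k : lring n -> ele (Some k) (krull_dim R) <-> htge n k.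
move=> ln; have [nR pn _] := ln.
have e : [set l | exists c : nat -> prime_ideal R, prime_chain c l] = htge n.
  apply/seteqP; split=> [l [c h]|l [q /pchain_prime_chain[c [h1 _ h2]]]]; last by exists c.
  have hc := prime_chain_pchain h; have [_ pc _] := pchainP hc.
  have [ns|ns] := pselect (n `<=` prime_set (c l)).
  exists (prime_set (c 0%N)); rewrite (_ : n = prime_set (c l)) //.
  by apply/seteqP; split=> //; exact: lring_sub ln _.
  apply: (@htge_le _ _ _ l.+1) => //; exists (prime_set (c 0%N)).
  by apply: (pchainS hc) => //; exact: lring_sub ln _.
rewrite /krull_dim e ele_nsup //; last exact: htge_le.
by exists n; exact: pchain0.
Qed.
End RegularSequences.

Lemma serreP R (M : lmod R) n : noetherian R -> fg M ->
  serre M n <-> forall (p : prime_ideal R) k, (k <= n)%N -> htge p k ->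
  dep p M k.
move=> nR fM.
have key (p : prime_ideal R) : ele (emin (Some n) (height p)) (depth (loc p M) (loc_ideal p)) <->
  forall k, (k <= n)%N -> htge p k -> dep p M k.
  rewrite ele_emin; split=> h k kn hk.
  rewrite (dep_loc_ideal _ _ nR fM); apply/(ele_depth _ (lring_loc p nR)).
  exact: fbc_fg (fbc_loc p M) fM.
  by apply: h => //; apply/ele_height.
  apply/(ele_depth _ (lring_loc p nR)); first exact: fbc_fg (fbc_loc p M) fM.
  by rewrite -(dep_loc_ideal _ _ nR fM); apply: h => //; apply/ele_height.
split=> [h p|h p _]; last by apply/key => k; exact: h.
have [ps|ps] := pselect (Defs.support M p); first by apply/key/h.
(* Outside the support the localization is zero and has every depth. *)
move=> k _ _; apply: locz_dep => //.
apply/(fbc_locz (fbc_loc p M) (loc_prime p) (@loc_unit R p) (@loc_locr R p)) => m.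
by apply/eqP; apply: contrapT => /negP m0; apply: ps; exists m.
Qed.

Lemma fgP R (M : lmod R) : finitely_generated M -> fg M.
move=> [x hx]; exists 'I_(size x), (fun i : 'I_(size x) => x`_i) => m.
by have [a ->] := hx m; exists (fun i : 'I_(size x) => a i).
Qed.

Lemma noetherian_image (R T : ring) (g : R ~~> T) :
  surj g -> noetherian R -> noetherian T.
move=> gs nR; apply/noetherianP => S hS.
have hJ : @submod R R^o (g @^-1` S).
  have [S0 SD SZ] := hS; split=> [|x y|a x]; rewrite /preimage /= ?rmorph0 ?rmorphD //.
  exact: SD.
  by rewrite -[a *: x]/(a * x) rmorphM; exact: SZ.
have [I [x Sx]] := (noetherianP R).1 nR _ hJ.
exists I, (fun i => g (x i)); apply/seteqP; split; last first.
  apply: fspan_sub => // i; have : fspan (M := R^o) x (x i) by exact: span_mem.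
  by rewrite -Sx.
move=> y Sy; have [l el] := gs y; have : (g @^-1` S) l by rewrite /preimage /= el.
rewrite Sx -el => -[c ->]; exists (fun i => g (c i)).
by rewrite rmorph_sum; apply: eq_bigr => i _; rewrite -[_ *: _]/(c i * x i) rmorphM.
Qed.

(** * Restriction of scalars *)

Section RestrictionOfScalars.
Variables (L T : ring) (g : L ~~> T).

(** The morphism is an argument of the type so that the module structure over [L] can be inferred
    from it. *)
Definition resc & L ~~> T := fun M : lmod T => (M : Type).

Section Fixed.
Variable M : lmod T.

HB.instance Definition _ := GRing.Zmodule.on (resc g M).

Definition resc_scale (a : L) (m : resc g M) : resc g M := (g a *: (m : M)).

Fact resc_scaleA a b m : resc_scale a (resc_scale b m) = resc_scale (a * b) m.
by rewrite /resc_scale scalerA rmorphM. Qed.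
Fact resc_scale1 : left_id 1 resc_scale.
by move=> m; rewrite /resc_scale rmorph1 scale1r. Qed.
Fact resc_scaleDr : right_distributive resc_scale +%R.
by move=> a x y; rewrite /resc_scale scalerDr. Qed.
Fact resc_scaleDl m : {morph resc_scale^~ m : a b / a + b}.
by move=> a b; rewrite /resc_scale rmorphD scalerDl. Qed.

HB.instance Definition _ := GRing.Zmodule_isLmodule.Build L (resc g M)
  resc_scaleA resc_scale1 resc_scaleDr resc_scaleDl.
End Fixed.

Lemma resc_mact (M : lmod T) (I J : finT) (P : I -> J -> L)
  (v : {ffun I -> resc g M}) : mact P v = mact (rmapM g P) (v : {ffun I -> M}).
by []. Qed.

Lemma resc_mex (M : lmod T) (I J K : finT) (P : I -> J -> L) (Q : J -> K -> L) :
  mex P Q (resc g M) <-> mex (rmapM g P) (rmapM g Q) M.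
by []. Qed.

Definition mod_iso R (A B : lmod R) : Prop :=
  exists (e : {linear A -> B}) (e' : {linear B -> A}), cancel e e' /\ cancel e' e.

Lemma same_kernel_iso R (F A B : lmod R) (p : {linear F -> A})
  (q : {linear F -> B}) : surj p -> surj q ->
  (forall v, p v = 0 <-> q v = 0) -> mod_iso A B.
move=> ps qs h.
have [v /h //|e he] := @surj_factor R _ _ _ p q ps.
have [v /h //|e' he'] := @surj_factor R _ _ _ q p qs.
exists e, e'; split=> x; first by have [v <-] := ps x; rewrite he he'.
by have [v <-] := qs x; rewrite he' he.
Qed.

Lemma mod_iso_mex R (A B : lmod R) (I J K : finT)
  (P : I -> J -> R) (Q : J -> K -> R) : mod_iso A B -> mex P Q A <-> mex P Q B.
by move=> [e [e' [k1 k2]]]; split; [exact: (mex_iso k2)|exact: (mex_iso k1)].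
Qed.

Lemma mod_iso_phi R (H : cplx R) (A B : lmod R) :
  mod_iso A B -> mod_iso (phi H A) (phi H B).
move=> [e [e' [k1 k2]]]; exists (phi_map H e), (phi_map H e').
have idE (C : lmod R) (z : phi H C) : phi_map H (idfun : {linear C -> C}) z = z.
  have [v <-] := qmodS z; rewrite phi_mapE; congr (qmod_pi _ _).
  by apply/ffunP => i; rewrite ffunE.
by split=> z; rewrite (phi_map_comp (h := idfun)) ?idE //.
Qed.

Lemma resc_phi (M : lmod T) (H : cplx L) :
  mod_iso (phi H (resc g M)) (resc g (phi (bcx g H) M)).
pose q (v : {ffun H 0%N -> resc g M}) : resc g (phi (bcx g H) M) :=
  qmod_pi (@rng_sub T _ _ (rmapM g (dx H 0)) M) (v : {ffun H 0%N -> M}).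
have ql : linear q.
  by move=> a u v; rewrite /q; exact: (linearP (qmod_pi (@rng_sub T _ _ (rmapM g (dx H 0)) M)) (g a)).
apply: (@same_kernel_iso L _ _ _ (qmod_pi (@rng_sub L _ _ (dx H 0) (resc g M))) (mklin ql)).
- exact: qmodS.
- exact: (@qmodS _ _ _ (@rng_sub T _ _ (rmapM g (dx H 0)) M)).
move=> v; rewrite qmod_pi0.
exact: iff_sym (@qmod_pi0 _ _ _ (@rng_sub T _ _ (rmapM g (dx H 0)) M) v).
Qed.
End RestrictionOfScalars.

Lemma ymods_pi R (xs : seq R) (M : lmod R) :
  exists p : {linear M -> ymods xs M}, surj p /\
  forall z, p z = 0 <-> smul (seq_set xs) M z.
elim: xs M => [|x xs IH] M; first by exists idfun; split=> [y|z]; [exists y|rewrite smul_nil].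
have [p [ps pk]] := IH (ymod x M).
exists (mklin (linearP (p \o ymod_pi x M))); split=> [y|z]; last by rewrite smul_cons -pk.
by have [w <-] := ps y; have [z <-] := qmodS w; exists z.
Qed.

Lemma van_ymods R (E : coch R) n (xs : seq R) (M : lmod R) t :
  tester E n -> (forall x, x \in xs -> n x) -> regs xs M ->
  van E (ymods xs M) t -> van E M (t + size xs).
move=> tE; elim: xs M => [|x xs IH] M hx /=; first by rewrite addn0.
move=> [hy hr] h; rewrite addnS; apply/(van_ymod _ tE (hx x (mem_head _ _)) hy).
by apply: IH => // y hy'; apply: hx; rewrite inE hy' orbT.
Qed.

Lemma rmapM_mcpx (R T : ring) (f : R ~~> T) (I J K : finT)
  (P : I -> J -> R) (Q : J -> K -> R) (M : lmod T) : mcpx P Q R^o ->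
  mcpx (rmapM f P) (rmapM f Q) M.
move=> h; apply: mcpx_mulm => i k.
have -> : mulm (rmapM f P) (rmapM f Q) i k = f (mulm P Q i k).
  by rewrite /mulm rmorph_sum; apply: eq_bigr => j _; rewrite rmorphM.
rewrite (mact_ext_ring (Q := fun _ _ => 0)) ?rmorph0 // => v; rewrite -mact_mulm h.
by apply/ffunP => l; rewrite !ffunE big1 // => j _; rewrite scale0r.
Qed.

(** * Depth of a Tor-independent tensor product *)

Section DepthOfTensor.
Variables (R T L : ring) (f : R ~~> T) (g : L ~~> T).
Variables (p : prime_ideal R) (nT : set T) (xs : seq L) (D : nat).
Hypotheses (nR : noetherian R) (flatf : flat f).
Hypotheses (lL : lring (g @^-1` nT))
  (glL : gl L D)
  (gs : surj g)
  (gk : forall l, g l = 0 <-> ideal_gen (seq_set xs) l)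
  (xn : forall x, x \in xs -> nT (g x))
  (xreg : regs xs L^o)
  (pnT : is_prime nT)
  (pp : forall a, prime_set p a <-> nT (f a))
  (rad : forall b, nT b -> exists k, ideal_gen (f @` prime_set p) (b ^+ k)).

Let n := g @^-1` nT.

Let uT x : ~ nT x -> exists y, y * x = 1.
have [l <-] := gs x; have [_ _ un] := lL => /un[y e].
by exists (g y); rewrite -rmorphM e rmorph1.
Qed.

Let noT : noetherian T.
by have [nL _ _] := lL; exact: noetherian_image gs nL. Qed.

Let xk x : x \in xs -> g x = 0.
by move=> hx; apply/gk; exact: sub_ideal_gen. Qed.

Section Testers.
Variables (E : coch L) (tE : tester E n).

Let tgE : tester (bcE g E) nT.
rewrite (_ : nT = ideal_gen (g @` n)); first exact: bcE_tester.
apply/seteqP; split=> [y hy|]; last first.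
  by apply: ideal_gen_sub; [exact: primeI|move=> _ [x hx <-]].
by have [l el] := gs y; apply: sub_ideal_gen; exists l; rewrite // /n /preimage /= el.
Qed.

(** Depth over [R] at [p] is read off over [L], since the image in [T] of a tester of [L] is a
    tester again. *)
Lemma resc_van (M : lmod R) (M' : lmod T) (i : M -> M') t : fg M -> fbc f i ->
  van E (resc g M') t <-> dep p M t.
move=> fM hi; rewrite (dep_van hi pnT uT pp nR noT fM rad t tgE).
by split=> h j jt; apply/resc_mex; exact: h.
Qed.

Let TL := ymods xs L^o.

Let isoT : mod_iso TL (resc g T^o).
have [q [qs qk]] := ymods_pi xs L^o.
have gl' : linear (fun l : L^o => (g l : T^o) : resc g T^o).
  by move=> a u v; rewrite [LHS]rmorphD; congr (_ + _); exact: rmorphM.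
apply: (@same_kernel_iso L _ _ _ q (mklin gl')) => [//|b|v]; first by have [l <-] := gs b; exists l.
by rewrite qk; exact: iff_sym (gk v).
Qed.

Lemma dep_of_ymods t : van E TL t -> dep p R^o t.
move=> h; apply/(resc_van t (fg_ring R) flatf) => j jt; apply/(mod_iso_mex _ _ isoT); exact: h.
Qed.

(** [T] is [L] modulo the regular sequence [xs], so the depth over [L] exceeds that over [T] by
    [size xs]. *)
Lemma van_base t : cm p -> htge p t -> van E L^o (t + size xs).
move=> hc ht; apply: (van_ymods tE xn xreg) => j jt.
apply/(mod_iso_mex _ _ isoT); apply: (resc_van t (fg_ring R) flatf).2 => //.
exact: hc.
Qed.

Section Chart.
Variables (H : cplx R) (M N : lmod R) (xi : nat).
Hypotheses (fM : fg M) (fN : fg N).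
Hypotheses (pN : pres (dx H 0) N)
  (sH : forall i, syz (dx H i.+1) (dx H i))
  (hM : hac H M)
  (hp : cm p)
  (Nz : ~ locz p N)
  (xih : htge p xi)
  (hX : dep p (phi H M) xi).

Lemma mex_bc (A : lmod R) (A' : lmod T) (i : A -> A') (I J K : finT)
  (P : I -> J -> R) (Q : J -> K -> R) : fbc f i -> mex P Q A ->
  mex (rmapM f P) (rmapM f Q) A'.
move=> hi h; apply/(fbc_mex hi pnT uT pp) => v /h[u ->].
have [_ p1 _] := prime_setP p.
by exists 1; split=> //; exists u; rewrite scale1r.
Qed.

(** Let [nu] be the exact depth of [N] at [p], and [s + 1] the projective dimension over [L] of the
    base change of [M]. The inequality [xi + s + 1 <= nu + size xs] is what the depth formula
    predicts. With [nu] at most the height of [p] it gives the claim through [van_frm]; if it fails,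
    [chase] raises the depth of [N] above [nu]. *)
Lemma dep_tensor : dep p M xi.
have [nL pL unL] := lL.
have [M' [i [hi fM']]] := fbc_exists flatf nR fM.
apply/(resc_van xi fM hi).
pose K := resc g M'.
have fK : fg K.
  have [I [x hx]] := fM'; exists I, x => m; have [c ->] := hx m.
  have /choice[l hl] : forall k, exists l, g l = c k by move=> k; exact: gs.
  by exists l; apply: eq_bigr => k _; rewrite -hl.
have [I [J [A pA]]] := pres_exists nL fK.
have [I' [J' [A' [pA' hfr]]]] := fr_minimal unL pA (glL A).
have [J0|[s fs]] : (J' -> False) \/ exists s, frm n s A' by [].
  apply: (van_free tE J0 pA'); apply: (van_le _ (van_base hp xih)).
  by rewrite leq_addr.
apply: (van_frm tE pA' fs).
(* When [s + 1] is at most [size xs], the depth of [L] alone is enough. *)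
have [sx|xs_s] := leqP (size xs) s; last first.
  by apply: (van_le _ (van_base hp xih)); rewrite leq_add2l.
(* The depth of [N] is bounded by the height of [p], as [N] does not vanish there. *)
have [nu [hnu mnu]] : exists nu, dep p N nu /\ ~ dep p N nu.+1.
  apply: contrapT => h; have [b hb] := pchain_bounded p nR.
  have all k : dep p N k.
  elim: k => [|k IH]; last by apply: contrapT => nk; apply: h; exists k.
  by have [E0 tE0] := testerP nR (primeI (prime_setP p)); exists E0.
  have [q hq] := dep_height nR fN Nz (all b.+1).
  by have := hb _ _ hq; rewrite ltnn.
suff ineq : (xi + s.+1 <= nu + size xs)%N.
  by apply: van_le ineq _; apply: (van_base hp); exact: (dep_height nR fN Nz hnu).
rewrite leqNgt; apply/negP => lt; apply: mnu.
have [C [pC sC [x0 hx0] C0]] := finite_resolution pA' fs.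
have /choice[lf hlf] : forall t : T, exists l, g l = t by exact: gs.
(* Entries are lifted arbitrarily, so [LH] is known to be a complex only on modules that come from
   [T]. *)
pose LH : cplx L := Cplx (fun i => fun x y => lf (f (dx H i x y))).
have eLH j : rmapM g (dx LH j) = rmapM f (dx H j).
  by apply: funext => x; apply: funext => y; rewrite /rmapM /= hlf.
have ebc : bcx g LH = bcx f H.
  by rewrite /bcx; congr Cplx; apply: functional_extensionality_dep => j; exact: eLH.
have phiB (B : lmod R) (B' : lmod T) (j : B -> B') t : fg B -> fbc f j ->
  van E (phi LH (resc g B')) t <-> dep p (phi H B) t.
  move=> fB hj; have [k hk] := fbc_phi hj H.
  have fP : fg (phi H B) by apply: fg_surj (fg_vec _ fB); exact: qmodS.
  rewrite -(resc_van t fP hk).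
  have iso : mod_iso (phi LH (resc g B')) (resc g (phi (bcx f H) B')) by rewrite -ebc; exact: resc_phi.
  by split=> h u ut; apply/(mod_iso_mex _ _ iso); exact: h.
have hacB (B : lmod R) (B' : lmod T) (j : B -> B') : fbc f j ->
  (forall k, mex (dx H k.+1) (dx H k) B) -> hac LH (resc g B').
  by move=> hj hB k; apply/resc_mex; rewrite !eLH; exact: (mex_bc hj (hB k)).
have isoP := mod_iso_phi LH isoT.
have phiT t : van E (phi LH TL) t <-> dep p N t.
  have [e [e' [k1 k2]]] := pres_iso pN.
  have -> : van E (phi LH TL) t <-> van E (phi LH (resc g T^o)) t.
  by split=> h u ut; apply/(mod_iso_mex _ _ isoP); exact: h.
  rewrite (phiB R^o T^o _ t (fg_ring R) flatf).
  split=> -[E0 [tE0 h]]; exists E0; split=> // u ut v hv.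
  have [|a [na [w hw]]] := h u ut (vmap e v); first by rewrite -vmap_mact hv vmap0.
  exists a; split=> //; exists (vmap e' w); rewrite -vmap_mact -hw vmapZ.
  by congr (_ *: _); apply/ffunP => x; rewrite !ffunE k1.
  have [|a [na [w hw]]] := h u ut (vmap e' v); first by rewrite -vmap_mact hv vmap0.
  exists a; split=> //; exists (vmap e w); rewrite -vmap_mact -hw vmapZ.
  by congr (_ *: _); apply/ffunP => x; rewrite !ffunE k2.
pose G := shift2 C.
pose Pn (B : lmod L) := hac LH B /\ van E (phi LH B) xi.
have Ptriv (B : lmod L) : (forall z : B, z = 0) -> Pn B.
  move=> hB; split; first exact: hac_triv.
  by move=> u _; apply: mex_triv; exact: phi_triv.
have PK : Pn K by split; [exact: hacB hi hM|exact/(phiB M M' i)].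
(* Since [xs] kills [K], the homology over [L / xs] is made of direct sums of copies of [K], and it
   vanishes above index [1 + size xs]. *)
have [||||||||h1 h2] := @hmod_ymods L G Pn xs L^o 1.
- move=> B1 B2 B3 u v hd [a1 a2] [b1 b2]; split=> [k|k kx].
  exact: (mex_dsum hd (a1 k) (b1 k)).
  exact: (mex_dsum (phi_dsum LH hd) (a2 k kx) (b2 k kx)).
- by [].
- by move=> k B; exact: shift2_cpx.
- move=> x hx; apply: (shift2_chtpy sC pC) => k.
  by rewrite -[LHS]/(g x *: (k : M')) (xk hx) scale0r.
- exact: Ptriv.
- exact: xreg.
- case=> [|[|k]].
  + by apply: Ptriv; exact: shift2_hmod0.
  + have [u [v k1]] := shift2_hmod1 pC; have [a1 a2] := PK.
  have kp : cancel (phi_map LH u) (phi_map LH v).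
  move=> z; rewrite (phi_map_comp (h := idfun)) //.
  have [w <-] := qmodS z; rewrite phi_mapE; congr (qmod_pi _ _).
  by apply/ffunP => x; rewrite ffunE.
  split=> [k|k kx]; first exact: (mex_iso k1).
  by apply: (mex_iso kp); exact: a2.
  + by apply: Ptriv; exact: shift2_hmod0.
- by case=> [//|[//|k]] _; exact: shift2_hmod0.
have dLH k : mcpx (dx LH k.+1) (dx LH k) TL.
  have [e [e' [k1 k2]]] := isoT.
  apply: (mcpx_inj (f := e)); first exact: (can_inj k1).
  have h := @rmapM_mcpx _ _ f _ _ _ _ _ T^o (sH k).1.
  by move=> v; have := h (v : {ffun _ -> T^o}); rewrite -!eLH.
have hacT : hac LH TL.
  move=> k; apply/(mod_iso_mex _ _ isoT); apply: (hacB R^o T^o (fun x => f x) flatf) => j.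
  exact: (sH j).2.
apply/phiT => u; rewrite ltnS leq_eqVlt => /orP[/eqP ->|uu]; last exact: (phiT nu).2.
(* Because of the shift by two, the last matrix [dx C s] is [dx G s.+2], which makes the parameter
   [t] of the chase equal to [s.+1]. *)
apply: (@chase L LH G E n TL (1 + size xs) s.+1 xi nu tE dLH _ _ hacT h1 h2 C0 x0) => //.
- by move=> k B; exact: shift2_cpx.
- exact/phiT.
- by move: lt; lia.
Qed.
End Chart.
End Testers.
End DepthOfTensor.

(** * Passage to localized charts *)

Section LocalizedGlobalDimension.
Variables (R : ring) (p : prime_ideal R).
Local Notation T := (loc_ring p).

Lemma fr_ker (S : ring) D (I I' J : finT) (A : J -> I -> S) (A' : J -> I' -> S) :
  (forall v : {ffun J -> S^o}, mact A v = 0 <-> mact A' v = 0) -> fr D A -> fr D A'.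
move=> h; case: D => [|D] /=; first by move=> hA u /h/hA.
move=> [L [B [[h1 h2] fB]]]; exists L, B; split=> //.
by split=> [v|v /h/h2//]; apply/h/h1.
Qed.

Lemma syz_loc (L J I : finT) (B : L -> J -> R) (A : J -> I -> R) :
  syz B A -> syz (rmapM (@locr R p) B) (rmapM (@locr R p) A).
move=> [h1 h2]; split; first exact: rmapM_mcpx.
apply/(fbc_mex (flat_loc p) (loc_prime p) (@loc_unit R p) (@loc_locr R p)) => v /h2[u ->].
have [_ p1 _] := prime_setP p.
by exists 1; split=> //; exists u; rewrite scale1r.
Qed.

Lemma fr_loc D (I J : finT) (A : J -> I -> R) : fr D A -> fr D (rmapM (@locr R p) A).
elim: D I J A => [|D IH] I J A /=; last first.
  move=> [L [B [hB fB]]]; exists L, (rmapM (@locr R p) B).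
  by split; [exact: syz_loc|exact: IH].
move=> /empty_syz/syz_loc[_ h] u /h[w ->].
by apply/ffunP => j; rewrite !ffunE big1 // => -[].
Qed.

(** Clearing a common denominator does not change the kernel of a matrix. *)
Lemma gl_loc D : gl R D -> gl T D.
move=> hR I J A.
have [s [a ha]] := @common_denom R p (J * I)%type (fun x => A x.1 x.2).
pose A0 j i := a (j, i).
apply: (fr_ker _ (fr_loc (hR _ _ A0))) => v.
have e : mact A v = (rfrac 1 s : T) *: mact (rmapM (@locr R p) A0) v.
  apply/ffunP => i; rewrite !ffunE scaler_sumr; apply: eq_bigr => j _.
  rewrite scalerA (ha (j, i)); congr (_ *: _).
  rewrite /rmapM /locr rfrac_mul; apply/rfracE; exists (denom1 p).
  by rewrite !denM !den1 /A0; ring.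
rewrite e; split=> [->|h]; first by rewrite scaler0.
have es : (locr p (den s) * rfrac 1 s : T) = 1.
  by rewrite /locr rfrac_mul; apply/rfracE; exists (denom1 p); rewrite !denM !den1; ring.
by rewrite -[LHS]scale1r -es -scalerA h scaler0.
Qed.
End LocalizedGlobalDimension.

Section LocalizedMap.
Variables (R S : ring) (h : R ~~> S) (P : prime_ideal S) (p : prime_ideal R).
Hypothesis hp : forall a, prime_set p a <-> prime_set P (h a).

Fact locden_subproof (s : denom p) : outside P (h (den s)).
by apply/asboolPn => /hp; exact: denomP. Qed.

Definition locden (s : denom p) : denom P := exist (outside P) _ (locden_subproof s).

Definition locmap (x : loc_ring p) : loc_ring P :=
  rfrac (h (repr (x : loc p R^o)).1) (locden (repr (x : loc p R^o)).2).

Lemma locmapE a s : locmap (rfrac a s) = rfrac (h a) (locden s).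
rewrite /locmap; have := @loc_frac_repr R p R^o (rfrac a s).
case: (repr _) => b t /= /rfracE[u e]; apply/rfracE; exists (locden u).
by rewrite /den /= -!rmorphM /=; congr (h _).
Qed.

Fact locmap_zmod : zmod_morphism locmap.
move=> x y; apply/eqP; rewrite eq_sym subr_eq eq_sym; apply/eqP.
rewrite -[in RHS](subrK y x); move: (x - y) => z.
elim/rfracW: z => a s; elim/rfracW: y => b t.
have e1 : rfrac a s + rfrac b t = rfrac (den t * a + den s * b) (denomM s t) :> loc_ring p.
  exact: rfrac_add.
rewrite [X in _ = locmap X]e1 !locmapE.
have e2 := rfrac_add (h a) (h b) (locden s) (locden t).
transitivity (rfrac (h a) (locden s) + rfrac (h b) (locden t) : loc_ring P) => //.
rewrite e2; apply/rfracE; exists (denom1 P).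
by rewrite /den /= rmorphD !rmorphM.
Qed.

Fact locmap_monoid : monoid_morphism locmap.
split=> [|x y].
  rewrite [1](_ : _ = rfrac 1 (denom1 p)) // locmapE; apply/rfracE; exists (denom1 P).
  by rewrite /den /= !rmorph1.
elim/rfracW: x => a s; elim/rfracW: y => b t.
rewrite rfrac_mul !locmapE rfrac_mul; apply/rfracE; exists (denom1 P).
by rewrite /den /= !rmorphM.
Qed.

HB.instance Definition _ := GRing.isZmodMorphism.Build _ _ locmap locmap_zmod.
HB.instance Definition _ := GRing.isMonoidMorphism.Build _ _ locmap locmap_monoid.

Hypothesis hs : surj h.

Lemma locmap_surj y : exists x, locmap x = y.
elim/rfracW: y => b t; have [a ea] := hs b; have [s es] := hs (den t).
have os : outside p s by apply/asboolPn => /hp; rewrite es; exact: denomP.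
exists (rfrac a (exist _ s os)); rewrite locmapE ea; apply/rfracE; exists (denom1 P).
by rewrite /den /= es.
Qed.

Lemma locmap_ker (xs : seq R) : (forall a, h a = 0 <-> ideal_gen (seq_set xs) a) ->
  forall x, locmap x = 0 <-> ideal_gen (seq_set (map (@locr R p) xs)) x.
move=> hk x; split; last first.
  apply: (@ideal_gen_sub _ _ [set x | locmap x = 0]).
  split=> [|u v|a u] /=; rewrite ?rmorph0 ?rmorphD ?rmorphM //.
  by move=> e1 e2; transitivity (locmap u + locmap v); rewrite // e1 e2 addr0.
  by move=> e1; transitivity (locmap a * locmap u); rewrite // e1 mulr0.
  move=> _ /mapP[y hy ->] /=; rewrite locmapE (_ : h y = 0); last first.
  by apply/hk; exact: sub_ideal_gen.
  by apply/rfracE; exists (denom1 P); rewrite !mulr0.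
elim/rfracW: x => a s; rewrite locmapE => e.
have {e} : rfrac (h a) (locden s) = rfrac 0 (denom1 P) by rewrite e.
move=> /rfracE[u]; rewrite !mulr0 den1 mul1r => hu.
have [w ew] := hs (den u).
have ow : outside p w by apply/asboolPn => /hp; rewrite ew; exact: denomP.
have /hk hI : h (w * a) = 0 by rewrite rmorphM ew.
pose d : denom p := exist _ w ow.
have -> : rfrac a s = rfrac 1 (denomM d s) * locr p (w * a) :> loc_ring p.
  rewrite /locr rfrac_mul; apply/rfracE; exists (denom1 p).
  by rewrite !denM !den1 /den /=; ring.
have [_ _ iM] := ideal_genP (seq_set (map (@locr R p) xs)); apply: (iM _ _).
have iI : is_ideal [set z | ideal_gen (seq_set (map (@locr R p) xs)) (locr p z)].
  have [i0 iD _] := ideal_genP (seq_set (map (@locr R p) xs)).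
  split=> [|u' v' hu' hv'|u' v' hu'] /=; rewrite ?rmorph0 ?rmorphD ?rmorphM; [exact: i0|exact: iD|exact: iM].
apply: (ideal_gen_sub iI _ hI) => y hy /=; apply: sub_ideal_gen.
exact: map_f.
Qed.

Lemma locmap_ideal x : loc_ideal p x <-> loc_ideal P (locmap x).
elim/rfracW: x => a s; rewrite locmapE.
apply: (iff_trans (locI_frac a s (prime_setP p) (@subset_refl _ _))).
by apply: (iff_trans (hp a)); apply: iff_sym; apply: locI_frac => //; exact: prime_setP.
Qed.
End LocalizedMap.

Lemma regs_bc (R T : ring) (f : R ~~> T) (n : set T) p (xs : seq R)
  (M : lmod R) (M' : lmod T) (i : M -> M') : is_prime n ->
  (forall x, ~ n x -> exists y, y * x = 1) -> (forall a, p a <-> n (f a)) ->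
  fbc f i -> regs xs M -> regs (map f xs) M'.
move=> pn un pp; elim: xs M M' i => [//|x xs IH] M M' i hi /= [hx hr].
split; first exact: (fbc_nzd hi pn un pp hx).
by have [j hj] := fbc_ymod hi x; exact: (IH _ _ j hj hr).
Qed.

(** The localization is taken at a prime minimal over the extension of [q] and lying over [q]; there
    the extension is primary to the maximal ideal, as [dep_tensor] requires. *)
Lemma dep_tensor_chart (R C Q : ring) (f : R ~~> C)
  (g : Q ~~> C) (xs : seq Q) D (H : cplx R) (M N : lmod R) (q : prime_ideal R) xi :
  noetherian R -> noetherian C -> noetherian Q -> flat f -> gl Q D ->
  surj g -> (forall l, g l = 0 <-> ideal_gen (seq_set xs) l) ->
  regs xs Q^o -> (exists P, is_prime P /\ forall a, prime_set q a <-> P (f a)) ->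
  fg M -> fg N -> pres (dx H 0) N -> (forall i, syz (dx H i.+1) (dx H i)) ->
  hac H M -> cm q -> ~ locz q N -> htge q xi ->
  dep q (phi H M) xi -> dep q M xi.
move=> nR nC nQ flf glQ gs gk xr [P0 [pP0 hP0]] fM fN pN sH hM hc Nz hx hX.
have [|P1 [pP1 qP1 P10 minP]] := @minimal_prime C (ideal_gen (f @` prime_set q)) P0 nC (ideal_genP _) pP0.
  by apply: ideal_gen_sub; [exact: primeI|move=> _ [a qa <-]; apply/hP0].
have hP1 a : prime_set q a <-> P1 (f a).
  split=> [qa|/P10/hP0//]; by apply: qP1; apply: sub_ideal_gen; exists a.
pose P := PrimeIdeal pP1; pose p := PrimeIdeal (prime_preim g pP1).
have hp a : prime_set p a <-> prime_set P (g a) by [].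
have lL : lring (locmap hp @^-1` loc_ideal P).
  rewrite (_ : _ @^-1` _ = loc_ideal p); first exact: lring_loc.
  by apply/seteqP; split=> x h; exact/(locmap_ideal hp).
have fl : flat (@locr C P \o f) by exact: (fbc_comp flf (flat_loc P)).
have [nL pL _] := lL.
have [E tE] := testerP nL (primeI pL).
refine (@dep_tensor R (loc_ring P) (loc_ring p) (@locr C P \o f) (locmap hp) q
  (loc_ideal P) (map (@locr Q p) xs) D nR fl lL (@gl_loc Q p D glQ) (locmap_surj hp gs)
  (locmap_ker hp gs gk) _ _ (loc_prime P) _ _ E tE H M N xi fM fN pN sH hM hc Nz hx hX).
- by move=> x /mapP[y hy ->]; apply: (locmap_ideal hp _).1; apply: (loc_locr p y).1; apply/hp;
  rewrite (gk y).2; [have [[]] := pP1|exact: sub_ideal_gen].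
- exact: (regs_bc (loc_prime p) (@loc_unit Q p) (@loc_locr Q p) (flat_loc p) xr).
- by move=> a; rewrite /= -loc_locr.
- move=> b nb; have [nT _ _] := lring_loc P nC.
  have [|N' hN'] := @ideal_exp_primes _ (loc_ideal P)
  (ideal_gen ((@locr C P \o f) @` prime_set q)) nT (ideal_genP _); last first.
  by exists N'; apply: hN'; exact: ideal_expS.
  move=> S pS qS; have [k1 k2 k3] := prime_locI pS.
  rewrite -k3 loc_idealE (_ : prime_set P = @locr C P @^-1` S) //.
  symmetry; apply: minP => //; apply: ideal_gen_sub; first exact: primeI.
  by move=> _ [a qa <-]; apply: qS; apply: sub_ideal_gen; exists a.
Qed.

Lemma strong_recursion (A : Type) (a0 : A) (Phi : nat -> (nat -> A) -> A) :
  (forall k h h', (forall j, (j < k)%N -> h j = h' j) -> Phi k h = Phi k h') ->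
  exists h, forall k, h k = Phi k h.
move=> hP; pose H n := iter n (fun h k => Phi k h) (fun=> a0).
have st n k : (k < n)%N -> H n k = H k.+1 k.
  elim/ltn_ind: k n => k IH [//|n]; rewrite ltnS => kn /=.
  by apply: hP => j jk; rewrite -/(H n) -/(H k) !IH // (leq_trans jk).
exists (fun k => H k.+1 k) => k /=; apply: hP => j jk.
by rewrite -/(H k) st.
Qed.

(** * Power series rings *)

Section PowerSeriesBasics.
Variable A : ring.
Local Notation PS := (powser A).
Implicit Types (F G : PS) (a : A).

Definition pconst a : PS := fun k => if k is 0 then a else 0.
Definition pX : PS := fun k => (k == 1)%:R.
Definition pshift F : PS := fun k => F k.+1.
Definition pcoef0 F : A := F 0%N.

Lemma psM F G k : (F * G) k = \sum_(i < k.+1) F i * G (k - i)%N. by []. Qed.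
Lemma psD F G k : (F + G) k = F k + G k. by []. Qed.

Lemma psum (J : Type) (s : seq J) (P : pred J) (F : J -> PS) k :
  (\sum_(j <- s | P j) F j) k = \sum_(j <- s | P j) F j k.
by elim/big_rec2: _ => // j x y _ <-. Qed.

Lemma pconstM a F k : (pconst a * F) k = a * F k.
by rewrite psM big_ord_recl subn0 big1 ?addr0 // => i _; rewrite mul0r. Qed.

Lemma pXM0 F : (pX * F) 0%N = 0.
by rewrite psM big_ord_recl big_ord0 mul0r addr0. Qed.

Lemma pXMS F k : (pX * F) k.+1 = F k.
rewrite psM big_ord_recl mul0r add0r big_ord_recl mul1r subSS subn0 big1 ?addr0 //.
by move=> i _; rewrite mul0r.
Qed.

Fact pconst_zmod : zmod_morphism pconst.
by move=> a b; apply: funext => -[|k] //; rewrite -[RHS]/(0 - 0) subr0. Qed.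

Fact pconst_monoid : monoid_morphism pconst.
split; first by apply: funext => -[].
by move=> a b; apply: funext => k; rewrite pconstM; case: k => //= k; rewrite mulr0.
Qed.

HB.instance Definition _ := GRing.isZmodMorphism.Build A PS pconst pconst_zmod.
HB.instance Definition _ := GRing.isMonoidMorphism.Build A PS pconst pconst_monoid.

Fact pcoef0_zmod : zmod_morphism pcoef0. by []. Qed.

Fact pcoef0_monoid : monoid_morphism pcoef0.
by split=> // F G; rewrite /pcoef0 psM big_ord_recl big_ord0 addr0. Qed.

HB.instance Definition _ := GRing.isZmodMorphism.Build PS A pcoef0 pcoef0_zmod.
HB.instance Definition _ := GRing.isMonoidMorphism.Build PS A pcoef0 pcoef0_monoid.

Lemma ps_decomp F : F = pconst (pcoef0 F) + pX * pshift F.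
apply: funext => -[|k]; first by rewrite psD pXM0 addr0.
by rewrite psD pXMS add0r.
Qed.

Lemma pcoef0_ker F : pcoef0 F = 0 <-> exists G, F = pX * G.
split=> [h|[G ->]]; last exact: pXM0.
by exists (pshift F); rewrite {1}(ps_decomp F) h rmorph0 add0r.
Qed.

Lemma pX_nzd : nzd pX (PS^o).
move=> F h; apply: funext => k; have : (pX * F) k.+1 = 0 by rewrite [pX * F]h.
by rewrite pXMS.
Qed.

Lemma ps_geometric G : exists H, H * (1 - G * pX) = 1.
(* Recursion for the coefficients of the inverse, read off [H = 1 + X G H]. *)
pose Phi k (h : nat -> A) : A := (k == 0)%:R +
  (if k is j.+1 then \sum_(i < k) G i * h (j - i)%N else 0).
have [|H hH] := @strong_recursion A 0 Phi.
  move=> [|k] h h' e //; rewrite /Phi; congr (_ + _); apply: eq_bigr => i _.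
  by congr (_ * _); apply: e; rewrite ltnS leq_subr.
exists (H : PS); have e : (H : PS) = 1 + pX * (G * (H : PS)).
  apply: funext => -[|k]; rewrite hH psD; first by rewrite pXM0 /Phi.
  by rewrite pXMS.
by rewrite mulrBr mulr1 {1}e; ring.
Qed.

Lemma ps_unit F : (exists b, b * pcoef0 F = 1) -> exists G, G * F = 1.
move=> [b hb]; have [H hH] := ps_geometric (- (pconst b * pshift F)).
exists (H * pconst b); rewrite -hH -mulrA; congr (_ * _).
rewrite {1}(ps_decomp F) mulrDr -rmorphM hb rmorph1; ring.
Qed.

Lemma ps_lring n : lring n -> noetherian PS -> lring (pcoef0 @^-1` n).
move=> [_ pn un] nP; split=> // [|F nF]; first exact: prime_preim.
by apply: ps_unit; exact: un.
Qed.

Fixpoint psmulX i F : PS := if i is j.+1 then pX * psmulX j F else F.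

Lemma psmulXE i F : psmulX i F = pX ^+ i * F.
by elim: i => [|i IH] /=; rewrite ?expr0 ?mul1r // IH exprS mulrA. Qed.

Lemma psXn i F k : (pX ^+ i * F) k = if (i <= k)%N then F (k - i)%N else 0.
rewrite -psmulXE; elim: i k => [|i IH] k /=; first by rewrite subn0.
by case: k => [|k]; [rewrite pXM0|rewrite pXMS IH ltnS subSS].
Qed.

Lemma ps_divX i F : (forall k, (k < i)%N -> F k = 0) -> exists G, F = pX ^+ i * G.
move=> h; exists (fun k => F (k + i)%N); apply: funext => k; rewrite psXn.
by case: leqP => ik; [rewrite subnK|exact: h].
Qed.

Section Noetherian.
Hypothesis nA : noetherian A.

(** Initial coefficients at order [k]; they replace the leading coefficients of Hilbert's basis
    theorem. *)
Definition lead (I : set PS) k : set A :=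
  [set a | exists F, [/\ I F, forall j, (j < k)%N -> F j = 0 & F k = a]].

Lemma ps_noetherian : noetherian PS.
apply/noetherianP => I hI; have iI : is_ideal I := hI.
have [I0 ID IM] := iI.
have nA' := (noetherianP A).1 nA.
have hL k : @submod A A^o (lead I k).
  split.
  - by exists 0; split.
  - move=> a b [F [IF F0 Fk]] [G [IG G0 Gk]]; exists (F + G); split; first exact: ID.
  by move=> j jk; rewrite psD F0 // G0 // addr0.
  by rewrite psD Fk Gk.
  move=> a b [F [IF F0 Fk]]; exists (pconst a * F); split; first exact: IM.
  by move=> j jk; rewrite pconstM F0 // mulr0.
  by rewrite pconstM Fk.
have hLS k : lead I k `<=` lead I k.+1.
  move=> a [F [IF F0 Fk]]; exists (pX * F); split; [exact: IM| |by rewrite pXMS].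
  by case=> [|j] jk; [rewrite pXM0|rewrite pXMS F0].
have [K hK] := noeth_acc nA' hL hLS.
have /choice[X hX] : forall k, exists X : {J : finT & J -> A}, lead I k = @fspan A A^o _ (projT2 X).
  by move=> k; have [J [x hx]] := nA' _ (hL k); exists (existT _ J x).
have hG k j : exists F, [/\ I F, forall l, (l < k)%N -> F l = 0 & F k = projT2 (X k) j].
  have : lead I k (projT2 (X k) j) by rewrite hX; exact: (@span_mem A A^o).
  by [].
pose g k j : PS := projT1 (cid (hG k j)).
have gP k j : [/\ I (g k j), forall l, (l < k)%N -> g k j l = 0 & g k j k = projT2 (X k) j].
  by rewrite /g; case: (cid _).
pose U : finT := {k : 'I_K.+1 & projT1 (X k)}.
pose u (x : U) : PS := g (tag x) (tagged x).
exists U, u; apply/seteqP; split; last first.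
  by apply: fspan_sub => // x; have [h _ _] := gP (tag x) (tagged x).
pose S : set PS := @fspan PS PS^o U u.
have hS : @submod PS PS^o S by exact: fspanS.
have [S0 SD SM] := hS.
have gS (k : 'I_K.+1) j : S (g k j).
  by have : S (u (existT _ k j)) by exact: (@span_mem PS PS^o).
(* From order [K] on, the ideals of initial coefficients are constant, so multiples by powers of [X]
   of the generators of order [K] correct every coefficient in turn; the coefficients used are
   collected into the series [C j]. *)
have top F : I F -> (forall j, (j < K)%N -> F j = 0) -> S F.
  move=> IF F0.
  pose P n (G : PS) := I G /\ forall j, (j < K + n)%N -> G j = 0.
  pose Qr n (G G' : PS) := exists c : projT1 (X K) -> A,
  G = G' + pX ^+ n * \sum_j pconst (c j) * g K j.
  have [||G [G00 hGs]] := @dependent_choice (fun _ => PS) P Qr F.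
  - by split=> //; rewrite addn0.
  - move=> n G [IG G0].
  have : lead I K (G (K + n)%N).
  by apply: (hK (K + n)%N); exists G.
  rewrite hX => -[c ec].
  exists (G - pX ^+ n * \sum_j pconst (c j) * g K j); split; last by exists c; rewrite subrK.
  have Is : I (pX ^+ n * \sum_j pconst (c j) * g K j).
  apply: (IM _ _); apply: (@submod_sum PS PS^o I hI) => j _; apply: (IM _ _).
  by have [] := gP K j.
  split; first exact: (idealB iI).
  move=> j; rewrite addnS ltnS leq_eqVlt => jK.
  rewrite -[(G - _) j]/(G j - (pX ^+ n * \sum_j pconst (c j) * g K j) j) psXn.
  case/orP: jK => [/eqP ->|jK].
  rewrite leq_addl addnK psum ec; apply/eqP; rewrite subr_eq0; apply/eqP/eq_bigr => i _.
  by rewrite pconstM; have [_ _ ->] := gP K i.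
  rewrite (G0 j jK); case: leqP => nj; last by rewrite subr0.
  rewrite psum big1 ?subr0 // => i _; rewrite pconstM; have [_ h0 _] := gP K i; rewrite h0 ?mulr0 //.
  by rewrite ltn_subLR // addnC.
  have /choice[c hc] : forall n, exists c : projT1 (X K) -> A,
  G n = G n.+1 + pX ^+ n * \sum_j pconst (c j) * g K j by move=> n; exact: (hGs n).2.
  pose C j : PS := fun n => c n j.
  have main N : F = G N + \sum_j (\sum_(n < N) pconst (c n j) * pX ^+ n) * g K j.
  elim: N => [|N IH].
  by rewrite G00 big1 ?addr0 // => j _; rewrite big_ord0 mul0r.
  rewrite {1}IH (hc N) -addrA mulr_sumr -big_split; congr (_ + _); apply: eq_bigr => j _ /=.
  by rewrite big_ord_recr /=; ring.
  have -> : F = \sum_j C j * g K j.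
  apply: funext => k; rewrite {1}(main k.+1) psD (hGs k.+1).1.2; last by rewrite addnS ltnS leq_addl.
  rewrite add0r !psum; apply: eq_bigr => j _; rewrite !psM; apply: eq_bigr => i _.
  congr (_ * _); rewrite psum (bigD1 i) //= pconstM -[pX ^+ i]mulr1 psXn leqnn subnn mulr1.
  rewrite big1 ?addr0 // => l li; rewrite pconstM -[pX ^+ l]mulr1 psXn.
  case: leqP => // il; last by rewrite mulr0.
  rewrite (_ : (1 : PS) (i - l)%N = 0) ?mulr0 //.
  have : (l < i)%N by rewrite ltn_neqAle il andbT.
  by rewrite -subn_gt0; case: (i - l)%N.
  apply: (@submod_sum PS PS^o S hS) => j _; apply: (SM _ _).
  exact: (gS ord_max j).
(* The order is lowered from [K] to [K - d] by induction on [d]. *)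
have all d F : (d <= K)%N -> I F -> (forall j, (j < K - d)%N -> F j = 0) -> S F.
  elim: d F => [|d IH] F dK IF F0; first by apply: top => //; rewrite -(subn0 K).
  have : lead I (K - d.+1)%N (F (K - d.+1)%N) by exists F.
  rewrite hX => -[c ec].
  have hk : (K - d.+1 < K.+1)%N by rewrite ltnS leq_subr.
  pose k : 'I_K.+1 := Ordinal hk.
  pose E := \sum_j pconst (c j) * g (K - d.+1)%N j.
  have SE : S E by apply: (@submod_sum PS PS^o S hS) => j _; apply: (SM _ _); exact: (gS k j).
  have IE : I E.
  apply: (@submod_sum PS PS^o I hI) => j _; apply: (IM _ _); by have [] := gP (K - d.+1)%N j.
  rewrite -(subrK E F); apply: SD => //; apply: IH; [exact: ltnW|exact: (idealB iI)|].
  move=> j; rewrite -[(F - E) j]/(F j - E j) /E psum -(subnSK dK) ltnS leq_eqVlt => /orP[/eqP ->|jk].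
  rewrite ec; apply/eqP; rewrite subr_eq0; apply/eqP/eq_bigr => i _.
  by rewrite pconstM; have [_ _ ->] := gP (K - d.+1)%N i.
  rewrite F0 // big1 ?subr0 // => i _; rewrite pconstM.
  by have [_ h0 _] := gP (K - d.+1)%N i; rewrite h0 ?mulr0.
by move=> F IF; apply: (all K) => // j; rewrite subnn.
Qed.
End Noetherian.

Lemma ps_gl D : noetherian PS -> gl A D -> gl PS D.+1.
move=> nP; apply: (@gl_lift PS A pcoef0 pX) => //.
- by move=> a; exists (pconst a).
- exact: pcoef0_ker.
- exact: pX_nzd.
- move=> G; exact: ps_geometric.
Qed.
End PowerSeriesBasics.

Lemma mps_noetherian A d : noetherian A -> noetherian (power_series A d).
by move=> nA; elim: d => [//|d IH]; exact: ps_noetherian. Qed.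

Lemma mps_gl A d D : noetherian A -> gl A D -> gl (power_series A d) (d + D).
move=> nA h; elim: d => [//|d IH]; rewrite addSn; apply: ps_gl => //.
exact/ps_noetherian/mps_noetherian.
Qed.


(* A relation over [L] comes modulo [I^b] from relations modulo [I^b]; by
   Artin-Rees and Krull's intersection theorem it comes from relations. *)
Lemma flat_filtered (B L : ring) (f : B ~~> L) (I : set B) :
  noetherian B -> noetherian L -> is_ideal I ->
  (forall a, ideal_gen (f @` I) a -> forall b, exists c, c * (1 - b * a) = 1) ->
  (forall b (J : finT) (m : J -> B^o) (t : {ffun J -> L^o}),
  \sum_j (t j : L) * f (m j) = 0 -> exists u w, [/\ t = u + w,
  sspan [set fvec f r | r in [set r : {ffun J -> B^o} |
  ideal_exp I b (\sum_j (r j : B) * m j)]] u &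
  forall j, ideal_gen (f @` ideal_exp I b) (w j)]) ->
  flat f.
move=> nB nL iI hrad H; split=> [x y|a x|y|J m t ht].
- exact: rmorphD.
- exact: rmorphM.
- have [_ _ Z] := @sspanS L L^o (range (fun x : B^o => f x : L^o)).
  by rewrite -[y]mulr1; apply: Z; apply: sspan_mem; exists 1; rewrite ?rmorph1.
have nBM := (noetherianP B).1 nB.
pose J' := ideal_gen (f @` I); have iJ' : is_ideal J' by exact: ideal_genP.
have hK := @sspanS L {ffun J -> L^o} [set fvec f r | r in rels m].
apply: (@krull_intersection L {ffun J -> L^o} J' _ nL (fg_vec _ (fg_ring L)) iJ' hrad hK) => k.
pose U : set B^o := fspan m; have hU : submod U by exact: fspanS.
have [b' hb'] := weak_artin_rees nB (fg_ring B) k iI hU.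
have [u [w [-> hu hw]]] := H (b' + k)%N J m t ht.
have hS := @smulS_submod L {ffun J -> L^o} (ideal_exp J' k) setT.
have hKS := addSS hK hS.
have fexp a : ideal_exp I k a -> ideal_exp J' k (f a).
  apply: (@ideal_gen_sub _ _ [set a | ideal_exp J' k (f a)]) => [|_ [s [ss sI ->]] /=].
  have [i0 iD iM] := ideal_exp_ideal J' k.
  by split=> [|x y|c x] /=; rewrite ?rmorph0 ?rmorphD ?rmorphM; [exact: i0|exact: iD|exact: iM].
  apply: sub_ideal_gen; exists (map f s); split; first by rewrite size_map.
  by move=> _ /mapP[c cs ->]; apply: sub_ideal_gen; exists c => //; exact: sI.
  by rewrite rmorph_prod big_map.
have vecS (v : {ffun J -> L^o}) : (forall j, ideal_exp J' k (v j)) ->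
  smulS (ideal_exp J' k) [set: {ffun J -> L^o}] v.
  move=> hv; rewrite (sum_unit_row v); apply: (submod_sum hS) => j _ N hN hN'.
  exact: hN'.
have [_ KD _] := hKS; apply: KD; last first.
  apply: (addSr hK); apply: vecS => j; move: (hw j).
  apply: ideal_gen_sub; first exact: ideal_exp_ideal.
  move=> _ [a ha <-]; apply: fexp; apply: ideal_exp_le ha => //; exact: leq_addl.
apply: (sspan_min hKS _ hu) => _ [r hr <-].
have [r' [hr' er']] : exists r' : {ffun J -> B^o}, (forall j, ideal_exp I k (r' j)) /\
  \sum_j (r j : B) * m j = \sum_j (r' j : B) * m j.
  pose N : set B^o := [set x | exists r' : {ffun J -> B^o}, (forall j, ideal_exp I k (r' j)) /\
  x = \sum_j (r' j : B) * m j].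
  have [i0 iD iM] := ideal_exp_ideal I k.
  have hN : submod N.
  split.
  - by exists 0; split=> [j|]; rewrite ?ffunE ?big1 // => j _; rewrite ffunE mul0r.
  - move=> x y [c [hc ->]] [d [hd ->]]; exists (c + d); split=> [j|].
  by rewrite ffunE; exact: iD.
  by rewrite -big_split; apply: eq_bigr => j _; rewrite ffunE mulrDl.
  move=> a x [c [hc ->]]; exists (a *: c); split=> [j|].
  by rewrite ffunE; exact: iM.
  by rewrite scaler_sumr; apply: eq_bigr => j _; rewrite ffunE /GRing.scale /= mulrA.
  have hUm : U (\sum_j (r j : B) * m j) by exists r.
  have : smulS (ideal_exp I b') setT (\sum_j (r j : B) * m j : B^o).
  move=> S hS' hS''; rewrite -[X in S X]mulr1; apply: hS'' => //.
  by apply: ideal_exp_le hr => //; exact: leq_addr.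
  move=> h; have /(_ N hN) := hb' _ (conj h hUm); apply=> a x ha [c ->].
  exists [ffun j => a * c j]; split=> [j|].
  by rewrite ffunE mulrC; exact: iM.
  by rewrite scaler_sumr; apply: eq_bigr => j _; rewrite ffunE /GRing.scale /= mulrA.
exists (fvec f (r - r')), (fvec f r'); split.
- apply: sspan_mem; exists (r - r') => //; rewrite /rels /=.
  have e : \sum_j (r j : B) * m j - \sum_j (r' j : B) * m j = 0 by rewrite er' subrr.
  rewrite -[RHS]e -sumrB; apply: eq_bigr => j _.
  by rewrite !ffunE /GRing.scale /= mulrBl.
- by apply: vecS => j; rewrite ffunE; apply: fexp.
by rewrite -fvecD subrK.
Qed.

(** * The completion of a local ring *)

Section CompletionTheory.
Variables (R : ring) (m : set R).
Hypothesis lm : lring m.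
Local Notation C := (completion m).
Local Notation cl := (quot_class (@null_seq R m)).

Let nR : noetherian R. by case: lm. Qed.
Let pm : is_prime m. by case: lm. Qed.
Let im : is_ideal m. by case: pm. Qed.
Let iexp k : is_ideal (ideal_exp m k). exact: ideal_exp_ideal. Qed.

Fact to_completion_zmod : zmod_morphism (@to_completion R m).
move=> a b; rewrite /to_completion -rmorphB; congr (quot_class _ _).
by apply: val_inj; apply: funext.
Qed.

Fact to_completion_monoid : monoid_morphism (@to_completion R m).
split; first by rewrite /to_completion -(rmorph1 cl); congr (quot_class _ _); apply: val_inj.
move=> a b; rewrite /to_completion -rmorphM; congr (quot_class _ _).
by apply: val_inj; apply: funext.
Qed.

HB.instance Definition _ := GRing.isZmodMorphism.Build R C (@to_completion R m) to_completion_zmod.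
HB.instance Definition _ := GRing.isMonoidMorphism.Build R C (@to_completion R m) to_completion_monoid.

Lemma cauchyP (x : cauchy_seq m) k l : (k <= l)%N -> ideal_exp m k (val x l - val x k).
elim: l => [|l IH] kl.
  by move: kl; rewrite leqn0 => /eqP ->; rewrite subrr; case: (iexp 0%N).
move: kl; rewrite leq_eqVlt => /orP[/eqP ->|kl]; first by rewrite subrr; case: (iexp l.+1).
have -> : val x l.+1 - val x k = (val x l.+1 - val x l) + (val x l - val x k) by ring.
have [_ iD _] := iexp k; apply: iD; last exact: IH.
by apply: (ideal_exp_le im (_ : (k <= l)%N)) => //; exact: (asboolP _ (valP x)).
Qed.

Lemma null_ideal : is_ideal (@null_seq R m).
split=> [n|x y hx hy n|a x hx n]; have [i0 iD iM] := iexp n.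
- exact: i0.
- by apply: iD; [exact: hx|exact: hy].
- exact: iM.
Qed.

Lemma cl0 x : cl x = 0 <-> forall n, ideal_exp m n (val x n).
rewrite -(rmorph0 cl); split=> [/quot_classP|h].
  by rewrite subr0 (ideal_gen_id null_ideal).
by apply/quot_classP; rewrite subr0; exact: sub_ideal_gen.
Qed.

(** The kernel of the projection to [R / m^b]. *)
Definition cfil b : set C := [set c | exists x, c = cl x /\ ideal_exp m b (val x b)].

Lemma cfil_cl b x : cfil b (cl x) <-> ideal_exp m b (val x b).
split=> [[y [/quot_classP e hy]]|h]; last by exists x.
move: e; rewrite (ideal_gen_id null_ideal) => e.
rewrite -(subrK (val y b) (val x b)); have [_ iD _] := iexp b; by apply: iD => //; exact: e.
Qed.

Lemma cl_surj (c : C) : exists x, cl x = c.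
by elim/quot_classW: c => x; exists x. Qed.

Lemma cfil_ideal b : is_ideal (cfil b).
have [i0 iD iM] := iexp b; split.
- by rewrite -(rmorph0 cl); apply/cfil_cl.
- move=> c d; have [x <-] := cl_surj c; have [y <-] := cl_surj d.
  by rewrite -rmorphD !cfil_cl; exact: iD.
move=> c d; have [x <-] := cl_surj c; have [y <-] := cl_surj d.
by rewrite -rmorphM !cfil_cl; exact: iM.
Qed.

Lemma cfil_to b r : cfil b (to_completion m r) <-> ideal_exp m b r.
exact: cfil_cl. Qed.

Lemma cfil_dense b c : exists r, cfil b (c - to_completion m r).
have [x <-] := cl_surj c; exists (val x b); rewrite -rmorphB; apply/cfil_cl.
rewrite (_ : val _ b = 0); first by case: (iexp b).
exact: subrr.
Qed.

Definition mkcauchy (x : nat -> R) (h : forall n, ideal_exp m n (x n.+1 - x n)) :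
  cauchy_seq m := exist _ x (asboolT h).

(** The differences of a representative lie in [m^(n+b)], hence are combinations of finitely many
    generators of [m^b] with coefficients in [m^n]; the sums of these coefficients are Cauchy. *)
Lemma cfil_gen b c : cfil b c -> ideal_gen (@to_completion R m @` ideal_exp m b) c.
have [x <-] := cl_surj c; rewrite cfil_cl => hx.
have [g eg] := nR (iexp b).
have gen k r : ideal_exp m (k + b) r -> exists a : 'I_(size g) -> R,
  (forall i, ideal_exp m k (a i)) /\ r = \sum_i a i * g`_i.
  pose N := [set r | exists a : 'I_(size g) -> R,
  (forall i, ideal_exp m k (a i)) /\ r = \sum_i a i * g`_i].
  have [i0 iD iM] := iexp k.
  have hN : is_ideal N.
  split.
  - by exists (fun=> 0); split=> //; rewrite big1 // => i _; rewrite mul0r.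
  - move=> u v [a [ha ->]] [a' [ha' ->]]; exists (fun i => a i + a' i).
  by split=> [i|]; [exact: iD|rewrite -big_split; apply: eq_bigr => i _; rewrite mulrDl].
  move=> u v [a [ha ->]]; exists (fun i => u * a i); split=> [i|]; first exact: iM.
  by rewrite mulr_sumr; apply: eq_bigr => i _; rewrite mulrA.
  apply: (ideal_expD hN) => u v hu; rewrite eg ideal_genE => -[c' ->].
  exists (fun i => u * c' i); split=> [i|]; first by rewrite mulrC; exact: iM.
  by rewrite mulr_sumr; apply: eq_bigr => i _; rewrite /GRing.scale /= mulrA.
have /choice[a ha] : forall n, exists a : 'I_(size g) -> R, (forall i, ideal_exp m n (a i)) /\
  val x (n.+1 + b)%N - val x (n + b)%N = \sum_i a i * g`_i.
  by move=> n; apply: gen; apply: cauchyP; rewrite leq_add2r.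
have [a0 [_ ea0]] := gen 0%N (val x b) hx.
pose s i n := a0 i + \sum_(k < n) a k i.
have hs i n : ideal_exp m n (s i n.+1 - s i n).
  rewrite (_ : s i n.+1 - s i n = a n i); first exact: (ha n).1.
  by rewrite /s big_ord_recr /=; ring.
pose y i : cauchy_seq m := mkcauchy (hs i).
have -> : cl x = \sum_i cl (y i) * to_completion m g`_i.
  apply/eqP; rewrite -subr_eq0; apply/eqP.
  rewrite (eq_bigr (fun i => cl (y i * exist _ (fun=> g`_i) (cauchy_cst m g`_i)))); last first.
  by move=> i _; rewrite [RHS]rmorphM.
  rewrite -rmorph_sum -rmorphB; apply/cl0 => n.
  have vsum (J : finT) (F : J -> cauchy_seq m) : val (\sum_j F j) n = \sum_j val (F j) n.
  by elim/big_rec2: _ => [//|j u v _ <-].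
  rewrite -[val (_ - _) n]/(val x n - val (\sum_(i < size g) _) n) vsum.
  have -> : \sum_(j < size g) val (y j * exist _ (fun=> g`_j) (cauchy_cst m g`_j)) n = val x (n + b)%N.
  elim: n {vsum} => [|n IH].
  by rewrite add0n ea0; apply: eq_bigr => i _; rewrite -[LHS]/(s i 0%N * g`_i) /s big_ord0 addr0.
  rewrite -(subrK (val x (n + b)%N) (val x (n.+1 + b)%N)) (ha n).2 -IH -big_split.
  apply: eq_bigr => i _.
  rewrite -[LHS]/(s i n.+1 * g`_i) -[X in _ = X]/(a n i * g`_i + s i n * g`_i) /s big_ord_recr /=; ring.
  by rewrite -opprB; apply: (idealN (iexp n)); apply: cauchyP; exact: leq_addr.
apply: (@ideal_sum _ _ _ _ _ _ (ideal_genP _)) => i _; apply: (idealMl _ (ideal_genP _)).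
apply: sub_ideal_gen; exists g`_i => //; rewrite eg; apply: sub_ideal_gen.
exact: mem_nth.
Qed.

Lemma completion_ideal : cfil 1 = ideal_gen (@to_completion R m @` m).
apply/seteqP; split=> [c /cfil_gen|]; first by rewrite (ideal_exp1 im).
apply: ideal_gen_sub; first exact: cfil_ideal.
by move=> _ [a ma <-]; apply/cfil_to; rewrite (ideal_exp1 im).
Qed.

Lemma completion_prime : is_prime (cfil 1).
have [_ m1 mP] := pm; split; first exact: cfil_ideal.
  by rewrite -(rmorph1 (@to_completion R m)) cfil_to (ideal_exp1 im).
move=> c d; have [x <-] := cl_surj c; have [y <-] := cl_surj d.
by rewrite -rmorphM !cfil_cl (ideal_exp1 im); exact: mP.
Qed.

Lemma completion_unit (c : C) : ~ cfil 1 c -> exists d, d * c = 1.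
have [x <-] := cl_surj c; rewrite cfil_cl (ideal_exp1 im) => nx.
have [_ _ un] := lm.
have /choice[y hy] : forall n, exists y, y * val x n.+1 = 1.
  move=> n; apply: un => h; apply: nx.
  have := cauchyP x (_ : (1 <= n.+1)%N); rewrite (ideal_exp1 im) => /(_ isT) h'.
  have -> : val x 1%N = val x n.+1 - (val x n.+1 - val x 1%N) by ring.
  exact: idealB.
(* As [m^0] is the whole ring, the term of index 0 is unconstrained; the inverses start at index
   1. *)
pose z n := if n is k.+1 then y k else 0.
have hz n : ideal_exp m n (z n.+1 - z n).
  case: n => [|n]; first by rewrite ideal_exp0.
  have -> : z n.+2 - z n.+1 = - (y n.+1 * y n) * (val x n.+2 - val x n.+1).
  by rewrite mulrBr !mulNr -mulrA [y n * _]mulrC mulrA hy mul1r -mulrA hy mulr1 /=; ring.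
  by apply: (idealMl _ (iexp n.+1)); exact: cauchyP.
exists (cl (mkcauchy hz)); rewrite -rmorphM -(rmorph1 cl); apply/eqP; rewrite -subr_eq0 -rmorphB.
apply/eqP/cl0 => -[|n]; first by rewrite ideal_exp0.
rewrite (_ : val _ n.+1 = 0); first by case: (iexp n.+1).
by rewrite -[LHS]/(y n * val x n.+1 - 1) hy subrr.
Qed.

Lemma lring_completion : noetherian C -> lring (cfil 1).
by move=> nC; split; [|exact: completion_prime|exact: completion_unit]. Qed.

(** The coefficients of a relation are approximated modulo [cfil b] by elements of [R], which
    satisfy the relation modulo [m^b]. *)
Lemma flat_completion : noetherian C -> flat (@to_completion R m).
move=> nC; apply: (flat_filtered (I := m)) => // [a|b J mm t ht].
  by rewrite -completion_ideal => ha b; exact: (mulr_unit1 b (lring_completion nC) ha).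
have /choice[r hr] : forall j, exists r, cfil b (t j - to_completion m r).
  by move=> j; exact: cfil_dense.
exists (fvec (@to_completion R m) (finfun r : {ffun J -> R^o})).
exists (t - fvec (@to_completion R m) (finfun r : {ffun J -> R^o})); split.
- by rewrite addrC subrK.
- apply: sspan_mem; exists (finfun r) => //=; apply/cfil_to; rewrite rmorph_sum.
  have e : \sum_j to_completion m ((finfun r : {ffun J -> R^o}) j * mm j) =
  - \sum_j (t j - to_completion m (r j)) * to_completion m (mm j).
  rewrite -[RHS]add0r -[X in X - _]ht -sumrB; apply: eq_bigr => j _.
  by rewrite ffunE rmorphM; ring.
  rewrite e; apply: (idealN (cfil_ideal b)); apply: (@submod_sum C C^o _ (cfil_ideal b)) => j _.
  exact: (idealM _ (cfil_ideal b)).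
by move=> j; rewrite !ffunE; exact: cfil_gen.
Qed.

(* [C] is complete for the powers of [y]: every series in [y] has a sum *)
Lemma completion_complete (y : C) (a : nat -> C) : cfil 1 y ->
  exists s : nat -> C, forall j, s j = a j + y * s j.+1.
move=> hy; have /choice[x hx] : forall j, exists x, cl x = a j by move=> j; exact: cl_surj.
have [z ez] := cl_surj y.
have mz n : (0 < n)%N -> m (val z n).
  move=> n0; have z1 : m (val z 1%N) by move: hy; rewrite -ez cfil_cl (ideal_exp1 im).
  have h : ideal_exp m 1 (val z n - val z 1%N) by exact: cauchyP.
  rewrite -(subrK (val z 1%N) (val z n)); move: h; rewrite (ideal_exp1 im) => h.
  by have [_ iD _] := im; exact: iD.
have zk n k : (0 < n)%N -> ideal_exp m k (val z n ^+ k) by move=> n0; apply/ideal_expS/mz.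
(* The [n]-th approximation of the tail starting at [a j] keeps [n] of its terms. *)
pose s j n := \sum_(k < n) val (x (j + k)%N) n * val z n ^+ k.
have hs j n : ideal_exp m n (s j n.+1 - s j n).
  case: n => [|n]; first by rewrite ideal_exp0.
  have -> : s j n.+2 - s j n.+1 = val (x (j + n.+1)%N) n.+2 * val z n.+2 ^+ n.+1 +
  \sum_(k < n.+1) (val (x (j + k)%N) n.+2 * val z n.+2 ^+ k -
  val (x (j + k)%N) n.+1 * val z n.+1 ^+ k).
  by rewrite /s big_ord_recr /= sumrB; ring.
  have [_ iD iM] := iexp n.+1; apply: (iD).
  by apply: iM; exact: zk.
  apply: (@submod_sum R R^o _ (iexp n.+1)) => k _.
  have xk : ideal_exp m n.+1 (val (x (j + k)%N) n.+2 - val (x (j + k)%N) n.+1) by exact: cauchyP.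
  have zz : ideal_exp m n.+1 (val z n.+2 ^+ k - val z n.+1 ^+ k).
  rewrite subrXX; apply: (idealM _ (iexp n.+1)); exact: cauchyP.
  have -> : val (x (j + k)%N) n.+2 * val z n.+2 ^+ k - val (x (j + k)%N) n.+1 * val z n.+1 ^+ k =
  val (x (j + k)%N) n.+2 * (val z n.+2 ^+ k - val z n.+1 ^+ k) +
  val z n.+1 ^+ k * (val (x (j + k)%N) n.+2 - val (x (j + k)%N) n.+1) by ring.
  by apply: iD; apply: (iM _ _).
exists (fun j => cl (mkcauchy (hs j))) => j; rewrite -hx -ez -rmorphM -rmorphD.
apply/eqP; rewrite -subr_eq0 -rmorphB; apply/eqP/cl0 => n.
rewrite -[val _ n]/(s j n - (val (x j) n + val z n * s j.+1 n)).
case: n => [|n]; first by rewrite ideal_exp0.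
have -> : s j n.+1 - (val (x j) n.+1 + val z n.+1 * s j.+1 n.+1) =
  - (val (x (j.+1 + n)%N) n.+1 * val z n.+1 ^+ n.+1).
  rewrite /s big_ord_recl addn0 expr0 mulr1 mulr_sumr big_ord_recr /=.
  rewrite (eq_bigr (fun k : 'I_n => val z n.+1 * (val (x (j.+1 + k)%N) n.+1 * val z n.+1 ^+ k))); last first.
  move=> k _; have -> : (j + bump 0 k = j.+1 + k)%N by rewrite /bump; lia.
  rewrite [bump 0 k]add1n exprS; set A := sval _ _; set Z := sval z _.
  by rewrite -[val z _]/Z -[val (x _) _]/A; ring.
  rewrite exprS; set A := sval (x j) _; set B := \sum_(i < n) _.
  rewrite -[X in _ + (X + _)]/B.
  by set D := sval (x (j.+1 + n)%N) _; set Z := sval z _; ring.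
by apply: (idealN (iexp n.+1)); apply: (idealMl _ (iexp n.+1)); exact: zk.
Qed.
End CompletionTheory.

Lemma ker_ideal (R T : ring) (g : R ~~> T) :
  is_ideal [set a | g a = 0].
split=> [|x y /= e1 e2|a x /= e]; first exact: rmorph0.
  by rewrite rmorphD e1 e2 addr0.
by rewrite rmorphM e mulr0.
Qed.

(** * Flatness of maps on coefficients *)

Section CoefficientMap.
Variables (A D : ring) (h : A ~~> D).

Definition pmap (F : powser A) : powser D := fun k => h (F k).

Fact pmap_zmod : zmod_morphism pmap.
by move=> F G; apply: funext => k; exact: rmorphB. Qed.

Fact pmap_monoid : monoid_morphism pmap.
split; first by apply: funext => k; exact: rmorph_nat.
move=> F G; apply: funext => k; rewrite psM /pmap psM rmorph_sum.
by apply: eq_bigr => i _; rewrite rmorphM.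
Qed.

HB.instance Definition _ := GRing.isZmodMorphism.Build _ _ pmap pmap_zmod.
HB.instance Definition _ := GRing.isMonoidMorphism.Build _ _ pmap pmap_monoid.

Lemma ideal_exp_pX b (F : powser A) : (forall k, (k < b)%N -> F k = 0) ->
  ideal_exp (ideal_gen [set @pX A]) b F.
move=> /ps_divX[G ->]; apply: (idealM _ (ideal_exp_ideal _ b)); apply: ideal_expS.
exact: sub_ideal_gen.
Qed.

(** Modulo [X^b], a relation between series is a finite system of linear equations between
    coefficients, to which flatness of [h] applies. *)
Lemma flat_pmap : flat h -> noetherian (powser A) -> noetherian (powser D) -> flat pmap.
move=> fh nA nD; apply: (flat_filtered (I := ideal_gen [set @pX A]) nA nD).
- exact: ideal_genP.
- move=> a ha b.
  have [G ->] : exists G, a = pX D * G.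
  apply/pcoef0_ker; apply: (ideal_gen_sub (ker_ideal (@pcoef0 D)) _ ha) => _ [F hF <-].
  suff : pcoef0 F = 0 by rewrite /pcoef0 => e; rewrite /= /pcoef0 /= /pmap e rmorph0.
  by apply: (ideal_gen_sub (ker_ideal (@pcoef0 A)) _ hF) => _ ->.
  have [c hc] := ps_geometric (b * G); exists c.
  by rewrite -[RHS]hc -mulrA [G * _]mulrC.
move=> b J m t ht.
have pairE (V : nmodType) (F : J * 'I_b -> V) : \sum_x F x = \sum_j \sum_i F (j, i).
  by rewrite pair_bigA; apply: eq_bigr => -[].
(* The vector of index [(j, i)] holds the first [b] coefficients of [X^i] times [m j]. *)
pose m' (x : J * 'I_b) : {ffun 'I_b -> A^o} :=
  [ffun k : 'I_b => if (x.2 <= k)%N then m x.1 (k - x.2)%N else 0].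
pose t' : {ffun J * 'I_b -> D^o} :=
  [ffun x : J * 'I_b => (t x.1 : powser D) x.2].
have /(fbc_rel_vec fh) : \sum_(x : J * 'I_b) (t' x : D) *: ivec (fun x : A^o => h x : D^o) (m' x) = 0.
  apply/ffunP => k; rewrite sum_ffunE !ffunE.
  have := congr1 (fun F : powser D => F k) ht; rewrite psum -[RHS]/(0 : D) => ht'; rewrite -[RHS]ht'.
  rewrite pairE.
  apply: eq_bigr => j _; rewrite psM.
  rewrite [RHS](big_ord_widen_cond b predT (fun i => t j i * pmap (m j) (k - i)%N)); last exact: ltn_ord.
  rewrite [RHS]big_mkcond; apply: eq_bigr => i _; rewrite !ffunE /= ltnS /GRing.scale /=.
  by case: ifP => // _; rewrite rmorph0 mulr0.
move=> /sspanP[N [c [x [hx ex]]]].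
pose lft (r : {ffun J * 'I_b -> A^o}) : {ffun J -> (powser A)^o} :=
  [ffun j => fun k => if insub k is Some i then r (j, i) else 0].
have /choice[r hr] : forall s, exists r, rels m' r /\ fvec h r = x s.
  by move=> s; have [r h1 h2] := hx s; exists r.
pose u : {ffun J -> (powser D)^o} := \sum_s pconst (c s) *: fvec pmap (lft (r s)).
have uEs s j k : (pconst (c s) *: fvec pmap (lft (r s))) j k = c s * h (lft (r s) j k).
  have -> : (pconst (c s) *: fvec pmap (lft (r s))) j = pconst (c s) * pmap (lft (r s) j).
  by rewrite !ffunE.
  by rewrite pconstM.
have uE j k : u j k = if insub k is Some i then t j (i : 'I_b) else 0.
  rewrite /u sum_ffunE psum; case: insubP => [i _ ei|hk].
  have := ffapp (j, i) ex.
  rewrite sum_ffunE !ffunE /= => ->; apply: eq_bigr => s _.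
  rewrite uEs -(hr s).2 !ffunE; congr (_ * h _); case: insubP => [i' _ ei'|]; last by rewrite -ei ltn_ord.
  by congr (r s (j, _)); apply: val_inj; rewrite /= ei'.
  rewrite big1 // => s _; rewrite uEs ffunE.
  by case: insubP => [i|]; [rewrite (negbTE hk)|rewrite rmorph0 mulr0].
exists u, (t - u); split.
- by rewrite addrC subrK.
- apply: (submod_sum (sspanS _)) => s _; set X := (X in sspan X).
  have [_ _ SZ] := sspanS X; apply: SZ.
  apply: sspan_mem; exists (lft (r s)) => //=; apply: ideal_exp_pX => k kb.
  have := ffapp (Ordinal kb) (hr s).1.
  rewrite sum_ffunE !ffunE psum => e; rewrite -[RHS]e.
  rewrite pairE.
  apply: eq_bigr => j _; rewrite psM.
  rewrite [LHS](big_ord_widen_cond b predT (fun i => lft (r s) j i * m j (k - i)%N)); last exact: kb.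
  rewrite [LHS]big_mkcond; apply: eq_bigr => i _; rewrite !ffunE /= ltnS /GRing.scale /=.
  case: ifP => _; last by rewrite mulr0.
  congr (_ * _); case: insubP => [i' _ ei'|]; last by rewrite ltn_ord.
  by congr (r s (j, _)); apply: val_inj; rewrite /= ei'.
move=> j; have [G ->] : exists G, (t - u) j = pX D ^+ b * G.
  apply: ps_divX => k kb; rewrite !ffunE -[LHS]/(t j k - u j k) uE.
  by rewrite (insubT (fun k => (k < b)%N) kb) /= subrr.
apply: (idealM _ (ideal_genP _)); apply: sub_ideal_gen; exists (pX A ^+ b).
  by apply: ideal_expS; apply: sub_ideal_gen.
rewrite rmorphXn; congr (_ ^+ b); apply: funext => k; exact: rmorph_nat.
Qed.
End CoefficientMap.

Fixpoint psmap (A D : ring) (h : A ~~> D) l :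
  power_series A l ~~> power_series D l :=
  if l is l'.+1 then pmap (psmap h l') else h.

Lemma flat_psmap (A D : ring) (h : A ~~> D) l :
  flat h -> noetherian A -> noetherian D -> flat (psmap h l).
move=> fh nA nD; elim: l => //= l IH.
by apply: flat_pmap => //; apply: (@mps_noetherian _ l.+1).
Qed.

(** Torsion-free algebras over a valuation ring are flat: when all [m j] are multiples of [m j0],
    the relations expressing them through [m j0] generate the others. *)
Lemma flat_valuation (A D : ring) (h : A ~~> D) :
  (forall (J : finT) (m : J -> A), J -> exists j0, forall j, exists c, m j = c * m j0) ->
  (domain D) ->
  (forall a, h a = 0 -> a = 0) -> flat h.
move=> val dom inj; split=> [x y|a x|y|J m t ht].
- exact: rmorphD.
- exact: rmorphM.
- have [_ _ Z] := @sspanS D D^o (range (fun x : A^o => h x : D^o)).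
  by rewrite -[y]mulr1; apply: Z; apply: sspan_mem; exists 1; rewrite ?rmorph1.
case: (pickP (fun _ : J => true)) => [j1 _|noJ]; last first.
  rewrite (_ : t = 0); last by apply/ffunP => j; move: (noJ j).
  by case: (sspanS [set fvec h r | r in rels m]).
have [j0 /choice[c hc]] := val J m j1.
have [hz|nz] := pselect (m j0 = 0).
  rewrite (sum_unitv t); apply: (submod_sum (sspanS _)) => j _.
  have [_ _ Z] := sspanS [set fvec h r | r in rels m].
  rewrite (_ : unitv j (t j) = (t j : D) *: fvec h (unitv j (1 : A^o))); last first.
  apply/ffunP => i; rewrite !ffunE; case: eqP => _; rewrite /GRing.scale /= ?rmorph1 ?mulr1 //.
  by rewrite rmorph0 mulr0.
  apply: Z; apply: sspan_mem; exists (unitv j (1 : A^o)) => //.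
  by rewrite /rels /= big1 // => i _; rewrite hc hz mulr0 scaler0.
have e0 : \sum_j (t j : D) * h (c j) = 0.
  have hz : \sum_j (t j : D) * h (c j) * h (m j0) = 0.
  rewrite -[RHS]ht; apply: eq_bigr => j _.
  by rewrite -[_ *: _]/(t j * h (m j)) [in RHS]hc rmorphM mulrA.
  by move: hz; rewrite -mulr_suml => /dom[|/inj].
pose r j : {ffun J -> A^o} := unitv j (1 : A^o) - unitv j0 (c j : A^o).
have hr j : rels m (r j).
  rewrite /rels /= (eq_bigr (fun i => (unitv j (1 : A^o) i : A) * m i - (unitv j0 (c j : A^o) i : A) * m i)); last first.
  by move=> i _; rewrite /r !ffunE /GRing.scale /= mulrBl.
  rewrite sumrB (bigD1 j) //= [X in _ + X - _]big1 ?addr0; last first.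
  by move=> i /negPf ij; rewrite ffunE ij mul0r.
  rewrite [X in _ - X](bigD1 j0) //= [X in _ - (_ + X)]big1 ?addr0; last first.
  by move=> i /negPf ij; rewrite ffunE ij mul0r.
  by rewrite !ffunE !eqxx mul1r -hc subrr.
rewrite (_ : t = \sum_j (t j : D) *: fvec h (r j)); last first.
  apply/ffunP => i; rewrite sum_ffunE.
  rewrite (eq_bigr (fun j => t j * (i == j)%:R - (i == j0)%:R * (t j * h (c j)))); last first.
  move=> j _; rewrite !ffunE -[_ *: _]/(t j * h _) rmorphB.
  by do 2 case: eqP => _; rewrite ?rmorph1 ?rmorph0 /=; ring.
  rewrite sumrB -mulr_sumr e0 mulr0 subr0 (bigD1 i) //= eqxx mulr1 big1 ?addr0 //.
  by move=> j /negPf ji; rewrite eq_sym ji mulr0.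
have [_ _ Z] := sspanS [set fvec h r | r in rels m].
by apply: (submod_sum (sspanS _)) => j _; apply: Z; apply: sspan_mem; exists (r j).
Qed.

(** [s j] stands for the tail [a j + y a_(j+1) + y^2 a_(j+2) + ...]; convergence is expressed
    without a topology. *)
Definition summable (C : ring) (y : C) : Prop :=
  forall a : nat -> C, exists s : nat -> C, forall j, s j = a j + y * s j.+1.

Lemma summable_quot (C D : ring) (h : C ~~> D) y :
  surj h -> summable y -> summable (h y).
move=> hs sy a; have /choice[a' ha] : forall j, exists c, h c = a j by move=> j; exact: hs.
have [s es] := sy a'; exists (fun j => h (s j)) => j.
by rewrite [in LHS]es rmorphD rmorphM ha.
Qed.

Lemma summable_pconst (C : ring) (y : C) : summable y -> summable (pconst y).
move=> sy a; have /choice[s hs] : forall k, exists s : nat -> C, forall j, s j = a j k + y * s j.+1.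
  by move=> k; exact: sy.
exists (fun j => (fun k => s k j) : powser C) => j; apply: funext => k.
by rewrite psD pconstM; exact: hs.
Qed.

Lemma krull_power (C : ring) (I : set C) (y : C) c : noetherian C -> is_ideal I ->
  (forall b, exists d, d * (1 - b * y) = 1) ->
  (forall k, exists i d, I i /\ c = i + y ^+ k * d) -> I c.
move=> nC iI hy hc; pose J := ideal_gen [set y].
have iJ : is_ideal J by exact: ideal_genP.
have Jy : J y by exact: sub_ideal_gen.
apply: (@krull_intersection C C^o J I nC (fg_ring C) iJ _ iI) => [a Ja b|k].
  have [d ->] : exists d, a = d * y.
  apply: (@ideal_gen_sub _ [set y] [set a | exists d, a = d * y] _ _ _ Ja) => [|_ ->]; last by exists 1; rewrite mul1r.
  split=> [|_ _ [u ->] [v ->]|u _ [v ->]]; first by exists 0; rewrite mul0r.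
  by exists (u + v); rewrite mulrDl.
  by exists (u * v); rewrite mulrA.
  by rewrite mulrA; exact: hy.
have [i [d [Ii ->]]] := hc k; exists i, (y ^+ k * d); split=> // S hS h.
by rewrite -[_ * d]/(y ^+ k *: (d : C^o)); apply: h => //; exact: ideal_expS.
Qed.

(** * Evaluation of power series by division by [X - y] *)

Section Evaluation.
Variables (C : ring) (y : C).
Hypotheses (nC : noetherian C)
  (hy : forall b, exists d, d * (1 - b * y) = 1)
  (sy : summable y).

Let Xy : powser C := @pX C - pconst y.

Let XyE (S : powser C) k : (Xy * S) k = (if k is j.+1 then S j else 0) - y * S k.
rewrite mulrDl mulNr -[LHS]/((pX C * S) k - (pconst y * S) k) pconstM.
by case: k => [|k]; rewrite ?pXM0 ?pXMS.
Qed.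

Let chain0 (S : nat -> C) : (forall k, S k = y * S k.+1) -> forall k, S k = 0.
move=> hS k; have i0 : is_ideal [set 0 : C].
  by split=> [|a b -> ->|a b ->] //=; rewrite ?addr0 ?mulr0.
apply: (krull_power (I := [set 0]) nC i0 hy) => n; exists 0, (S (k + n)%N); split=> //.
rewrite add0r; elim: n => [|n IH]; first by rewrite mul1r addn0.
by rewrite IH hS exprSr mulrA addnS.
Qed.

Lemma eval_nzd : nzd (@pX C - pconst y) (powser C)^o.
move=> F e; apply: funext => k; apply: chain0 => {}k.
have := congr1 (fun G : powser C => G k.+1) e; rewrite -[_ *: _]/(Xy * F) XyE.
by move=> /eqP; rewrite subr_eq0 => /eqP.
Qed.

(** The quotient on division by [X - y] has the tails of the series [F(y)] as its coefficients. *)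
Lemma eval_exists (F : powser C) : exists c S, F = pconst c + Xy * S.
have [s hs] := sy F; exists (s 0%N), (fun k => s k.+1); apply: funext => k.
rewrite psD XyE; case: k => [|k]; rewrite /pconst hs; ring.
Qed.

(** If [X - y] divides a constant, the coefficients of the quotient satisfy [S k = y * S k.+1] and
    vanish by Krull's intersection theorem. *)
Lemma eval_uniq c d (S T : powser C) : pconst c + Xy * S = pconst d + Xy * T -> c = d.
move=> e; have {e} e k : (pconst (c - d)) k = (Xy * (T - S)) k.
  rewrite rmorphB mulrBr -[LHS]/(pconst c k - pconst d k) -[RHS]/((Xy * T) k - (Xy * S) k).
  have := congr1 (fun G : powser C => G k) e; rewrite !psD => {}e.
  by rewrite -[pconst c k](addrK ((Xy * S) k)) e; ring.
have z k : (T - S) k = 0.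
  by apply: chain0 => j; have := e j.+1; rewrite XyE /= => /esym/eqP; rewrite subr_eq0 => /eqP.
by have := e 0%N; rewrite XyE z mulr0 subr0 /= => /eqP; rewrite subr_eq0 => /eqP.
Qed.

(** The remainder on division by [X - y]; its multiplicativity follows from the uniqueness of
    remainders. *)
Definition eval & summable y : powser C -> C := fun F => xget 0 [set c | exists S, F = pconst c + Xy * S].

Let evalP F : exists S, F = pconst (eval sy F) + Xy * S.
by have [c [S e]] := eval_exists F; apply: (xgetPex 0 (P := [set c | exists S, F = pconst c + Xy * S])); exists c, S. Qed.

Lemma evalE F c S : F = pconst c + Xy * S -> eval sy F = c.
by move=> e; have [T eT] := evalP F; apply: (@eval_uniq _ _ T S); rewrite -eT. Qed.

Fact eval_zmod : zmod_morphism (eval sy).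
move=> F G; have [S eF] := evalP F; have [T eG] := evalP G.
by apply: (evalE (S := S - T)); rewrite [in LHS]eF [in LHS]eG rmorphB; ring.
Qed.

Fact eval_monoid : monoid_morphism (eval sy).
split; first by apply: (evalE (S := 0)); rewrite rmorph1 mulr0 addr0.
move=> F G; have [S eF] := evalP F; have [T eG] := evalP G.
apply: (evalE (S := pconst (eval sy F) * T + S * G)).
by rewrite [in LHS]eF mulrDl [in X in X + _]eG rmorphM; ring.
Qed.

Definition evalm : powser C ~~> C :=
  HB.pack (eval sy) (GRing.isZmodMorphism.Build _ _ (eval sy) eval_zmod)
  (GRing.isMonoidMorphism.Build _ _ (eval sy) eval_monoid).

Lemma evalmP F : exists S, F = pconst (evalm F) + (@pX C - pconst y) * S.
exact: evalP. Qed.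

Lemma evalm_ker F : evalm F = 0 <-> exists S, F = (@pX C - pconst y) * S.
split=> [e|[S ->]]; last by apply: (evalE (S := S)); rewrite rmorph0 add0r.
by have [S eS] := evalP F; exists S; rewrite eS -[eval sy F]/(evalm F) e rmorph0 add0r.
Qed.

Lemma evalm_sum F (s : nat -> C) : (forall j, s j = F j + y * s j.+1) -> evalm F = s 0%N.
move=> hs; apply: (evalE (S := fun k => s k.+1)); apply: funext => k.
rewrite psD XyE; case: k => [|k]; rewrite /pconst hs; ring.
Qed.
End Evaluation.

(** * Lengths of subquotients, given by pairs of submodules *)

Section PairLength.
Variables (R : ring) (W : lmod R).
Implicit Types X Y Z S : set W.

Definition pge X Y l : Prop := exists S : nat -> set W,
  [/\ forall i, submod (S i), forall i, Y `<=` S i, forall i, S i `<=` X &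
  forall i, (i < l)%N -> S i `<=` S i.+1 /\ ~ S i.+1 `<=` S i].

Section SubquotientModule.
Variables (X Y : set W) (hX : submod X) (hY : submod Y).

Lemma sq_submod : submod (@smod_val _ _ _ hX @^-1` Y).
exact: submod_preim. Qed.

Definition sq : lmod R := qmod sq_submod.

Lemma sqW (z : sq) : exists x (hx : X x), z = qmod_pi sq_submod (smod_of hX hx).
have [x <-] := qmodS z; exists (val x), (smodP x); congr (qmod_pi _ _).
exact: val_inj.
Qed.

Lemma lenge_sq l : Y `<=` X -> lenge sq l <-> pge X Y l.
move=> YX; have [X0 XD XZ] := hX; split=> [[S [hS Sl]]|[S [hS YS SX Sl]]].
  pose S' i := [set w | exists hw : X w, S i (qmod_pi sq_submod (smod_of hX hw))].
  have S'P i w (hw : X w) : S' i w <-> S i (qmod_pi sq_submod (smod_of hX hw)).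
  split=> [[h]|]; last by exists hw.
  by rewrite (_ : smod_of hX h = smod_of hX hw) //; exact: val_inj.
  exists S'; split=> [i|i w Yw|i w [] //|i il].
  - have [S0 SD SZ] := hS i; split=> [|x y [hx Sx] [hy Sy]|a x [hx Sx]].
  + by exists X0; rewrite (_ : smod_of hX X0 = 0) ?linear0 //; exact: val_inj.
  + exists (XD _ _ hx hy); rewrite (_ : smod_of hX _ = smod_of hX hx + smod_of hX hy); last exact: val_inj.
  by rewrite linearD; exact: SD.
  + exists (XZ a _ hx); rewrite (_ : smod_of hX _ = a *: smod_of hX hx); last exact: val_inj.
  by rewrite linearZ; exact: SZ.
  - exists (YX _ Yw); have [S0 _ _] := hS i.
  rewrite (_ : qmod_pi _ _ = 0) //; exact/qmod_pi0.
  have [h1 h2] := Sl i il; split=> [w [hw] Sw|h3]; first by exists hw; exact: h1.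
  apply: h2 => z; have [x [hx ->]] := sqW z => Sz.
  by apply/S'P/h3; exists hx.
exists (fun i => [set z | exists w (hw : X w), S i w /\ z = qmod_pi sq_submod (smod_of hX hw)]); split=> i.
  have [S0 SD SZ] := hS i; split=> [|_ _ [x [hx [Sx ->]]] [y [hy [Sy ->]]]|a _ [x [hx [Sx ->]]]].
  - by exists 0, X0; split=> //; rewrite (_ : smod_of hX X0 = 0) ?linear0 //; exact: val_inj.
  - exists (x + y), (XD _ _ hx hy); split; first exact: SD.
  by rewrite -linearD; congr (qmod_pi _ _); exact: val_inj.
  - exists (a *: x), (XZ a _ hx); split; first exact: SZ.
  by rewrite -linearZ; congr (qmod_pi _ _); exact: val_inj.
move=> il; have [h1 h2] := Sl i il; split=> [_ [x [hx [Sx ->]]]|h3].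
  by exists x, hx; split=> //; exact: h1.
apply: h2 => w Sw; have [x [hx [Sx e]]] := h3 _ (ex_intro _ w (ex_intro _ (SX i.+1 _ Sw) (conj Sw erefl))).
have {e} : Y (w - x).
  have : qmod_pi sq_submod (smod_of hX (SX i.+1 _ Sw) - smod_of hX hx) = 0.
  by rewrite linearB /= e subrr.
  by move/qmod_pi0.
move=> Yd; rewrite -(subrK x w); have [_ SD _] := hS i; apply: SD => //; exact: YS Yd.
Qed.
End SubquotientModule.

(** Total on sets, with value 0 unless both are submodules, so that [mult] can recurse without
    carrying proofs. *)
Definition plen X Y : nat :=
  if pselect (submod X /\ submod Y) is left h then len (sq h.1 h.2) else 0%N.

Lemma plenE X Y (hX : submod X) (hY : submod Y) : plen X Y = len (sq hX hY).
rewrite /plen; case: pselect => [h|[]] //; rewrite (Prop_irrelevance h.1 hX).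
by rewrite (Prop_irrelevance h.2 hY).
Qed.

Lemma plen_add X Y Z : submod X -> submod Y -> submod Z -> Z `<=` Y -> Y `<=` X ->
  (forall hX hZ, flen (@sq X Z hX hZ)) -> plen X Z = (plen X Y + plen Y Z)%N.
move=> hX hY hZ ZY YX fl; rewrite !plenE addnC.
have fS (u : smod hY) : (@smod_val _ _ _ hY @^-1` Z) u ->
  (@smod_val _ _ _ hX @^-1` Z) (smod_of hX (YX _ (smodP u))) by [].
have inc_lin : linear (fun u : smod hY => smod_of hX (YX _ (smodP u))).
  by move=> a u v; exact: val_inj.
pose f := qmap (sq_submod hY hZ) (sq_submod hX hZ) (f := mklin inc_lin) fS.
have gS (u : smod hX) : (@smod_val _ _ _ hX @^-1` Z) u -> (@smod_val _ _ _ hX @^-1` Y) (@idfun (smod hX) u).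
  exact: ZY.
have id_lin : linear (@idfun (smod hX)) by [].
pose g := qmap (sq_submod hX hZ) (sq_submod hX hY) (f := mklin id_lin) gS.
have s : ses f g.
  split.
  - apply: inj0 => z; have [x [hx ->]] := sqW z; rewrite qmapE => /qmod_pi0 h.
  exact/qmod_pi0.
  - move=> z; have [x [hx ->]] := sqW z; exists (qmod_pi _ (smod_of hX hx)); exact: qmapE.
  move=> z; have [x [hx ->]] := sqW z; rewrite qmapE; split=> [/qmod_pi0 Yx|[a]].
  exists (qmod_pi _ (smod_of hY Yx)); rewrite qmapE; congr (qmod_pi _ _); exact: val_inj.
  have [y [hy ->]] := sqW a; rewrite qmapE => e; apply/qmod_pi0.
  have h : Z (x - y) := (qclsP _ _ _).1 (esym e).
  rewrite /preimage /= -(subrK y x); have [_ YD _] := hY; apply: YD => //; exact: ZY.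
have [f1 f2] := flen_ses s (fl hX hZ).
by have [_ ->] := len_ses s f1 f2.
Qed.

Lemma plen_eq X Y (hX : submod X) (hY : submod Y) l : Y `<=` X ->
  pge X Y l -> (forall k, pge X Y k -> (k <= l)%N) -> flen (sq hX hY) /\ plen X Y = l.
move=> YX h1 h2; rewrite (plenE hX hY); apply: len_eq; first exact/lenge_sq.
by move=> k /(lenge_sq hX hY k YX).1; exact: h2.
Qed.

Lemma plen_pge X Y (hX : submod X) (hY : submod Y) : Y `<=` X ->
  flen (sq hX hY) -> pge X Y (plen X Y) /\ forall k, pge X Y k -> (k <= plen X Y)%N.
move=> YX fl; have [h1 h2] := lenP fl; rewrite (plenE hX hY); split; first exact/lenge_sq/h1.
by move=> k h; apply: h2; exact/(lenge_sq hX hY k YX).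
Qed.
End PairLength.

Section PairIso.
Variables (R R' : ring) (g : R ~~> R') (W : lmod R) (W' : lmod R').
Variable phi : W -> W'.
Hypotheses (gs : surj g)
  (phiD : forall x y, phi (x + y) = phi x + phi y)
  (phiZ : forall a x, phi (a *: x) = g a *: phi x).

(** [phi] induces a bijection from [X / Y] to [X' / Y'], without leaving the ambient modules. *)
Definition pair_iso (X Y : set W) (X' Y' : set W') : Prop :=
  [/\ forall x, X x -> X' (phi x), forall x', X' x' -> exists x y', [/\ X x, Y' y' & x' = phi x + y'] &
  forall x, X x -> (Y' (phi x) <-> Y x)].

Let phi0 : phi 0 = 0.
by apply: (@addIr _ (phi 0)); rewrite -phiD !add0r. Qed.

Let phiB x y : phi (x - y) = phi x - phi y.
by apply: (@addIr _ (phi y)); rewrite -phiD !subrK. Qed.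

Lemma pair_iso_pge X Y X' Y' l : submod X -> submod Y -> submod X' -> submod Y' ->
  Y `<=` X -> Y' `<=` X' -> pair_iso X Y X' Y' -> pge X Y l <-> pge X' Y' l.
move=> hX hY hX' hY' YX YX' [iX sX eY]; split=> -[S [hS YS SX Sl]].
  exists (fun i => [set w | exists x y', [/\ S i x, Y' y' & w = phi x + y']]); split=> i.
  - have [S0 SD SZ] := hS i; have [Y0 YD YZ] := hY'; split.
  + by exists 0, 0; rewrite phi0 addr0.
  + move=> _ _ [x [y [Sx Yy ->]]] [x1 [y1 [Sx1 Yy1 ->]]]; exists (x + x1), (y + y1).
  by split; [exact: SD|exact: YD|rewrite phiD addrACA].
  + move=> b _ [x [y [Sx Yy ->]]]; have [a <-] := gs b; exists (a *: x), (g a *: y).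
  by split; [exact: SZ|exact: YZ|rewrite phiZ scalerDr].
  - by move=> y Yy; exists 0, y; rewrite phi0 add0r; split=> //; case: (hS i).
  - move=> _ [x [y [Sx Yy ->]]]; have [_ XD _] := hX'.
  by apply: XD; [exact: iX (SX i _ Sx)|exact: YX'].
  move=> il; have [h1 h2] := Sl i il; split.
  by move=> _ [x [y [Sx Yy ->]]]; exists x, y; split=> //; exact: h1.
  move=> h3; apply: h2 => x Sx.
  have [|s [y [Ss Yy e]]] := h3 (phi x); first by exists x, 0; rewrite addr0; split=> //; case: hY'.
  have Yd : Y (x - s).
  apply/eY; first by apply: (submodB hX); [exact: SX Sx|exact: SX Ss].
  by rewrite phiB e (addrC (phi s)) addrK.
  rewrite -(subrK s x); have [_ SD _] := hS i; apply: SD => //; exact: YS.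
exists (fun i => X `&` phi @^-1` (S i)); split=> i.
- have [S0 SD SZ] := hS i; have [X0 XD XZ] := hX; split.
  + by split=> //; rewrite /preimage /= phi0.
  + by move=> x y [Xx Sx] [Xy Sy]; split; [exact: XD|rewrite /preimage /= phiD; exact: SD].
  + by move=> a x [Xx Sx]; split; [exact: XZ|rewrite /preimage /= phiZ; exact: SZ].
- by move=> y Yy; split; [exact: YX|apply: YS; apply/eY => //; exact: YX].
- by move=> x [].
move=> il; have [h1 h2] := Sl i il; split=> [x [Xx Sx]|h3]; first by split=> //; exact: h1.
apply: h2 => x' Sx'; have [x [y' [Xx Yy e]]] := sX _ (SX _ _ Sx').
have [] : (X `&` phi @^-1` S i) x.
  apply: h3; split=> //; rewrite /preimage /= -[phi x](addrK y') -e.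
  by apply: (submodB (hS _)) => //; exact: YS.
move=> _ Sx; rewrite e; have [_ SD _] := hS i; apply: SD => //; exact: YS.
Qed.

Lemma pair_iso_plen X Y X' Y' : submod X -> submod Y -> submod X' -> submod Y' ->
  Y `<=` X -> Y' `<=` X' -> pair_iso X Y X' Y' ->
  (forall hX hY, flen (@sq _ _ X Y hX hY)) -> plen X Y = plen X' Y'.
move=> hX hY hX' hY' YX YX' iso fl.
have [h1 h2] := plen_pge YX (fl hX hY).
have hl l : pge X' Y' l <-> pge X Y l.
  by split=> /(pair_iso_pge l hX hY hX' hY' YX YX' iso).
have [|k /hl|_ ->] // := @plen_eq _ _ X' Y' hX' hY' (plen X Y) YX'; first exact/hl.
exact: h2.
Qed.
End PairIso.

(** * Multiplicities *)

Section MultiplicityDefinition.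
Variables (R : ring) (W : lmod R).
Implicit Types X Y : set W.

Definition tset (t : R) X : set W := [set t *: x | x in X].
Definition tcol (t : R) X Y : set W := [set x | X x /\ Y (t *: x)].

(** The Euler characteristic of the Koszul homology of [X / Y], in Northcott's recursive form: the
    value on the cokernel of [t] minus the value on its kernel. *)
Fixpoint mult (ts : seq R) X Y : int :=
  if ts is t :: ts' then
  mult ts' X (addS Y (tset t X)) - mult ts' (tcol t X Y) Y
  else (plen X Y)%:Z.

Lemma tset_submod t X : submod X -> submod (tset t X).
move=> [X0 XD XZ]; split=> [|_ _ [x Xx <-] [y Xy <-]|a _ [x Xx <-]].
- by exists 0; rewrite ?scaler0.
- by exists (x + y); rewrite ?scalerDr //; exact: XD.
- by exists (a *: x); [exact: XZ|rewrite !scalerA mulrC].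
Qed.

Lemma tcol_submod t X Y : submod X -> submod Y -> submod (tcol t X Y).
move=> [X0 XD XZ] [Y0 YD YZ]; split=> [|x y [Xx Yx] [Xy Yy]|a x [Xx Yx]].
- by split; rewrite ?scaler0.
- by split; [exact: XD|rewrite scalerDr; exact: YD].
- by split; [exact: XZ|rewrite scalerA mulrC -scalerA; exact: YZ].
Qed.
End MultiplicityDefinition.

Lemma foldl_addI_min R (ts : seq R) (J I : set R) : is_ideal I ->
  J `<=` I -> (forall t, t \in ts -> I t) -> foldl (@addI R) J ts `<=` I.
move=> iI; elim: ts J => //= t ts IH J JI tI; apply: IH => [|u us]; last by apply: tI; rewrite inE us orbT.
by apply: addI_min => //; apply: tI; exact: mem_head.
Qed.

Lemma foldl_addI_sub R (ts : seq R) (J : set R) : J `<=` foldl (@addI R) J ts.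
by elim: ts J => [J|t ts IH J] //=; apply: subset_trans (IH _); exact: addI_sub.
Qed.

(* [ts] generates a primary ideal modulo [J] *)
Definition pars R (n J : set R) (ts : seq R) : Prop :=
  exists k, ideal_exp n k `<=` foldl (@addI R) J ts.

Section Multiplicity.
Variables (R : ring) (n : set R).
Hypothesis ln : lring n.
Variable W : lmod R.
Hypothesis fW : fg W.
Implicit Types (X Y Z : set W) (J : set R).

Let nR : noetherian R. by case: ln. Qed.
Let nW : noethM W. by apply: fg_noeth => //; exact/noetherianP. Qed.

Lemma flen_sq J X Y (hX : submod X) (hY : submod Y) : pars n J [::] ->
  (forall a x, J a -> X x -> Y (a *: x)) -> flen (sq hX hY).
move=> [k hk] kill; have [_ pn un] := ln.
apply: (@flen_fg R n un k) => //.
  apply: (fg_surj (@qmodS _ _ _ _)); apply: noethM_fg.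
  exact: (noethM_inj (@smod_val_inj _ _ _ hX)).
move=> a z /hk Ja; have [x [hx ->]] := sqW z; rewrite -linearZ; apply/qmod_pi0; exact: kill.
Qed.

Lemma tkill J t X Y : submod X -> submod Y -> is_ideal J ->
  (forall a x, J a -> X x -> Y (a *: x)) ->
  (forall a x, addI J t a -> X x -> addS Y (tset t X) (a *: x)) /\
  (forall a x, addI J t a -> tcol t X Y x -> Y (a *: x)).
move=> [X0 XD XZ] [Y0 YD YZ] iJ kill.
split=> [a x /addIP[y [b [Jy ->]]] Xx|a x /addIP[y [b [Jy ->]]] [Xx Ytx]].
  rewrite scalerDl; exists (y *: x), ((b * t) *: x); split=> //; first exact: kill.
  by exists (b *: x); [exact: XZ|rewrite scalerA mulrC].
by rewrite scalerDl -scalerA; apply: YD; [exact: kill|exact: YZ].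
Qed.

Lemma mult_iso (R' : ring) (g : R ~~> R') (W' : lmod R') (phi : W -> W')
  ts J X Y (X' Y' : set W') : surj g ->
  (forall x y, phi (x + y) = phi x + phi y) -> (forall a x, phi (a *: x) = g a *: phi x) ->
  is_ideal J -> pars n J ts -> submod X -> submod Y -> submod X' -> submod Y' ->
  Y `<=` X -> Y' `<=` X' -> (forall a x, J a -> X x -> Y (a *: x)) ->
  pair_iso phi X Y X' Y' -> mult ts X Y = mult (map g ts) X' Y'.
move=> gs phiD phiZ.
have phiB x y : phi (x - y) = phi x - phi y.
  by apply: (@addIr _ (phi y)); rewrite -phiD !subrK.
elim: ts J X Y X' Y' => [|t ts IH] J X Y X' Y' iJ fin hX hY hX' hY' YX YX' kill iso /=.
  congr (_%:Z); apply: (pair_iso_plen gs phiD phiZ) => // *; exact: (flen_sq _ _ fin).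
have [iX sX eY] := iso; have [k1 k2] := tkill t hX hY iJ kill.
have iJ' : is_ideal (addI J t) by exact: addI_ideal.
have [_ XD XZ] := hX; have [_ YD YZ] := hY; have [_ X'D X'Z] := hX'; have [Y'0 Y'D Y'Z] := hY'.
have tX : tset t X `<=` X by move=> _ [x Xx <-]; exact: XZ.
have tX' : tset (g t) X' `<=` X' by move=> _ [x Xx <-]; exact: X'Z.
congr (_ - _); apply: (IH (addI J t)) => //.
- by apply: addSS => //; exact: tset_submod.
- by apply: addSS => //; exact: tset_submod.
- exact: addS_min.
- exact: addS_min.
- split=> // [x' /sX[x [y' [Xx Yy ->]]]|x Xx].
  by exists x, y'; split=> //; apply: addSl => //; exact: tset_submod.
  split=> [[y' [_ [Yy [x1' Xx1 <-] e]]]|[y [_ [Yy [x1 Xx1 <-] ->]]]].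
  have [x1 [y1 [Xx1' Yy1 e1]]] := sX _ Xx1.
  exists (x - t *: x1), (t *: x1); split; [|by exists x1|by rewrite subrK].
  apply/eY; first by apply: (submodB hX) => //; exact: XZ.
  rewrite phiB phiZ e e1 [g t *: (_ + _)]scalerDr; set u := g t *: phi x1.
  rewrite (_ : _ - _ = y' + g t *: y1); first by apply: Y'D => //; exact: Y'Z.
  by rewrite addrCA addrAC subrr add0r.
  rewrite phiD phiZ; exists (phi y), (g t *: phi x1); split=> //; last by exists (phi x1) => //; exact: iX.
  by apply/eY => //; exact: YX.
- exact: tcol_submod.
- exact: tcol_submod.
- by move=> y Yy; split; [exact: YX|exact: YZ].
- by move=> y Yy; split; [exact: YX'|exact: Y'Z].
split=> [x [Xx Yx]|x' [Xx' Yx']|x [Xx _]]; last exact: eY.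
  by split; [exact: iX|rewrite -phiZ; apply/eY => //; exact: XZ].
have [x [y' [Xx Yy e]]] := sX _ Xx'; exists x, y'; split=> //; split=> //.
apply/eY; first exact: XZ.
rewrite phiZ -[phi x](addrK y') -e scalerBr; apply: (submodB hY') => //; exact: Y'Z.
Qed.

Lemma mult_iso_lin (W' : lmod R) (phi : W -> W') ts J X Y (X' Y' : set W') :
  (forall x y, phi (x + y) = phi x + phi y) -> (forall a x, phi (a *: x) = a *: phi x) ->
  is_ideal J -> pars n J ts -> submod X -> submod Y -> submod X' -> submod Y' ->
  Y `<=` X -> Y' `<=` X' -> (forall a x, J a -> X x -> Y (a *: x)) ->
  pair_iso phi X Y X' Y' -> mult ts X Y = mult ts X' Y'.
move=> hD hZ iJ fin hX hY hX' hY' YX YX' kill iso; rewrite -[in RHS](map_id ts).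
by apply: (@mult_iso R idfun W' phi ts J X Y X' Y') => // b; exists b.
Qed.

Lemma mult_iso_id ts J X Y X' Y' : is_ideal J -> pars n J ts ->
  submod X -> submod Y -> submod X' -> submod Y' -> Y `<=` X -> Y' `<=` X' ->
  (forall a x, J a -> X x -> Y (a *: x)) -> X `<=` X' -> X' `<=` addS X Y' ->
  (forall x, X x -> (Y' x <-> Y x)) -> mult ts X Y = mult ts X' Y'.
move=> iJ fin hX hY hX' hY' YX YX' kill XX' hs he.
rewrite (@mult_iso R idfun W id ts J X Y X' Y') ?map_id //; by move=> b; exists b.
Qed.

(** The snake lemma for multiplication by [t], spelled out on submodules: [e1] and [e2] filter
    cokernels, [e3], [e5] and [e6] treat kernels, and [e4] identifies the two sides of the
    connecting map. *)
Lemma mult_add ts J X Y Z : is_ideal J -> pars n J ts ->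
  submod X -> submod Y -> submod Z -> Z `<=` Y -> Y `<=` X ->
  (forall a x, J a -> X x -> Z (a *: x)) -> mult ts X Z = mult ts X Y + mult ts Y Z.
elim: ts J X Y Z => [|t ts IH] J X Y Z iJ fin hX hY hZ ZY YX kill /=.
  rewrite (plen_add hX hY hZ) ?PoszD // => *; exact: (flen_sq _ _ fin).
have iJ' : is_ideal (addI J t) by exact: addI_ideal.
have killY a y : J a -> Y y -> Z (a *: y) by move=> Ja /YX; exact: kill.
have [k1 k2] := tkill t hX hZ iJ kill; have [k3 k4] := tkill t hY hZ iJ killY.
have htX := tset_submod t hX; have htY := tset_submod t hY.
have hZX := addSS hZ htX; have hZY := addSS hZ htY; have hYX := addSS hY htX.
have hcX := tcol_submod t hX hZ; have hcY := tcol_submod t hY hZ; have hU := tcol_submod t hX hY.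
have hI := submodI hY hZX; have hV := addSS hY hcX.
have [_ XD XZ] := hX; have [_ YD YZ] := hY; have [_ ZD ZZ] := hZ.
have tXX : tset t X `<=` X by move=> _ [x Xx <-]; exact: XZ.
have tYY : tset t Y `<=` Y by move=> _ [x Xx <-]; exact: YZ.
have ZX : Z `<=` X by exact: subset_trans YX.
have IH' := IH _ _ _ _ iJ' fin.
have sZX : Z `<=` addS Z (tset t X) by exact: addSl.
have e1 : mult ts X (addS Z (tset t X)) =
  mult ts X (addS Y (tset t X)) + mult ts Y (Y `&` addS Z (tset t X)).
  rewrite (IH' X (addS Y (tset t X)) _ hX hYX hZX) //.
  - congr (_ + _); symmetry.
  apply: (mult_iso_id iJ' fin hY hI hYX hZX) => //.
  + by apply: addS_min => //; [exact: subset_trans (addSl _)|exact: addSr].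
  + by move=> a y Ja Yy; split; [exact: YZ|apply: k1 => //; exact: YX].
  + exact: addSl.
  + move=> _ [y [_ [Yy [x Xx <-] ->]]]; exists y, (t *: x); split=> //.
  by apply: addSr => //; exists x.
  + by move=> y Yy; split=> [h|[]].
  - by apply: addS_min => //; [exact: subset_trans (addSl _)|exact: addSr].
  - exact: addS_min.
have e2 : mult ts Y (addS Z (tset t Y)) =
  mult ts Y (Y `&` addS Z (tset t X)) + mult ts (Y `&` addS Z (tset t X)) (addS Z (tset t Y)).
  apply: (IH' _ _ _ hY hI hZY) => //.
  move=> _ [z [_ [Zz [y Yy <-] ->]]]; split; first by apply: YD; [exact: ZY|exact: YZ].
  by exists z, (t *: y); split=> //; exists y => //; exact: YX.
have YU : Y `<=` tcol t X Y by move=> y Yy; split; [exact: YX|exact: YZ].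
have cU : tcol t X Z `<=` tcol t X Y by move=> x [Xx /ZY].
have kU a x : addI J t a -> tcol t X Y x -> Y (a *: x).
  apply: (tkill t hX hY iJ _).2 => b y Jb Xy; apply: ZY; exact: kill.
have VU : addS Y (tcol t X Z) `<=` tcol t X Y by exact: addS_min.
have e3 : mult ts (tcol t X Y) Y = mult ts (tcol t X Y) (addS Y (tcol t X Z)) +
  mult ts (addS Y (tcol t X Z)) Y.
  by apply: (IH' _ _ _ hU hV hY) => //; exact: addSl.
have e4 : mult ts (tcol t X Y) (addS Y (tcol t X Z)) =
  mult ts (Y `&` addS Z (tset t X)) (addS Z (tset t Y)).
  rewrite (@mult_iso R idfun W (fun x => t *: x) ts (addI J t) _ _ (Y `&` addS Z (tset t X))
  (addS Z (tset t Y))) ?map_id //.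
  - by move=> b; exists b.
  - by move=> x y; rewrite scalerDr.
  - by move=> a x; rewrite !scalerA mulrC.
  - move=> _ [z [_ [Zz [y Yy <-] ->]]]; split; first by apply: YD; [exact: ZY|exact: YZ].
  by exists z, (t *: y); split=> //; exists y => //; exact: YX.
  - by move=> a x Ja Ux; apply: addSl => //; exact: kU.
  split=> [x [Xx Yx]|w [Yw [z [_ [Zz [x Xx <-] e]]]]|x [Xx Yx]].
  - by split=> //; apply: addSr => //; exists x.
  - exists x, z; split; [split=> //|exact: addSl|by rewrite addrC].
  by rewrite -[t *: x](addKr z) -e addrC; apply: (submodB hY) => //; exact: ZY.
  split=> [[z [_ [Zz [y Yy <-] e]]]|[y [w [Yy [Xw Zw] ->]]]].
  exists y, (x - y); split=> //; last by rewrite addrC subrK.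
  by split; [apply: (submodB hX) => //; exact: YX|rewrite scalerBr e addrK].
  by rewrite scalerDr addrC; exists (t *: w), (t *: y); split=> //; exists y.
have e5 : mult ts (addS Y (tcol t X Z)) Y = mult ts (tcol t X Z) (tcol t Y Z).
  symmetry; apply: (mult_iso_id iJ' fin hcX hcY hV hY) => //.
  - by move=> y [Yy Zy]; split=> //; exact: YX.
  - exact: addSl.
  - move=> a x Ja cx; have Zx := k2 _ _ Ja cx; split; first exact: ZY.
  by apply: ZZ.
  - exact: addSr.
  - by move=> _ [y [w [Yy cw ->]]]; exists w, y; rewrite addrC.
  - by move=> x [Xx Zx]; split=> [Yx|[]].
have e6 : mult ts (tcol t X Z) Z = mult ts (tcol t X Z) (tcol t Y Z) + mult ts (tcol t Y Z) Z.
  apply: (IH' _ _ _ hcX hcY hZ) => // [z Zz|y [Yy Zy]]; first by split; [exact: ZY|exact: ZZ].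
  by split=> //; exact: YX.
rewrite e1 e2 e6 e3 e4 e5; ring.
Qed.

Lemma mult_xx ts X : submod X -> mult ts X X = 0.
move=> hX; have iT : is_ideal [set: R] by [].
have fin : pars n setT ts by exists 0%N => x _; exact: foldl_addI_sub.
have := mult_add iT fin hX hX hX (fun x Xx => Xx) (fun x Xx => Xx) (fun a x _ => let: And3 _ _ XZ := hX in XZ a x).
by move=> /eqP; rewrite -subr_eq0 opprD addrA subrr sub0r oppr_eq0 => /eqP.
Qed.

(** The dimension is at most the number of parameters, by Krull's height theorem. *)
Lemma pars_chain J P ts l : pars n J ts -> J `<=` P -> pchain P n l -> (forall t, t \in ts -> n t) ->
  (l <= size ts)%N.
move=> [k hk] JP hP nts; apply: (krull_height nR hP nts) => P' pP' PP' tP' P'n.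
apply/seteqP; split=> // x nx; apply: (primeX pP' (k := k)).
apply: (foldl_addI_min (primeI pP') _ tP' (hk _ (ideal_expS _ nx))).
exact: subset_trans PP'.
Qed.

(** Induction on the parameters and, inside it, on [Y] from above. [Y1] adds to [Y] one element [x]
    whose annihilator [P0] modulo [Y] is prime. If [t] is in [P0], this layer contributes 0 and its
    dimension is too small for a chain of full length; otherwise [t] is injective on the layer, and
    the outer induction applies to its cokernel. *)
Lemma mult_pos ts J X Y : is_ideal J -> pars n J ts -> (forall t, t \in ts -> n t) ->
  submod X -> submod Y -> Y `<=` X -> (forall a x, J a -> X x -> Y (a *: x)) ->
  0 <= mult ts X Y /\ forall P, pchain P n (size ts) ->
  (forall a, (forall x, X x -> Y (a *: x)) -> P a) -> 0 < mult ts X Y.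
have nM := nW; have [_ pn _] := ln.
elim: ts J X Y => [|t ts IH] J X Y iJ fin nts hX hY YX kill.
  split=> // P hP annP; rewrite /= ltz_nat lt0n; apply/eqP => z.
  have [h1 h2] := plen_pge YX (flen_sq hX hY fin kill).
  have [] := pchainP hP => -[_ P1 _] _ _; apply: P1; apply: annP => x Xx.
  rewrite scale1r; apply: contrapT => nY; suff : pge X Y 1 by move=> /h2; rewrite z.
  exists (fun i => if i is 0%N then Y else X).
  by split=> [[|i]|[|i]|[|i]|[|i] //] // _; split=> // /(_ _ Xx).
have nt : n t by apply: nts; exact: mem_head.
have nts' u : u \in ts -> n u by move=> us; apply: nts; rewrite inE us orbT.
have iJ' : is_ideal (addI J t) by exact: addI_ideal.
move: YX kill; elim/(noeth_ind nM): Y / hY => Y hY IHY YX kill.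
have [XY|/existsNP[x0 /not_implyP[Xx0 nYx0]]] := pselect (X `<=` Y).
  have -> : X = Y by apply/seteqP.
  rewrite mult_xx //; split=> // P hP annP; have [] := pchainP hP => -[_ P1 _] _ _.
  by case: P1; apply: annP => x; rewrite scale1r.
have [z [z0 _ pz]] : exists z : sq hX hY, [/\ z <> 0, ann (qmod_pi (sq_submod hX hY) (smod_of hX Xx0)) `<=` ann z & is_prime (ann z)].
  by apply: (ass_above nR) => /qmod_pi0.
have [x [Xx ez]] := sqW z.
have annE a : ann z a <-> Y (a *: x).
  rewrite ez /ann /= -linearZ; exact: (qmod_pi0 (sq_submod hX hY)).
have nYx : ~ Y x by move=> Yx; apply: z0; rewrite ez; apply/qmod_pi0.
set P0 := ann z in pz annE; have [[P00 P0D P0M] P01 P0P] := pz.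
pose L := fspan (fun _ : unit => x); have hL : submod L by exact: fspanS.
pose Y1 := addS Y L; have hY1 : submod Y1 by exact: addSS.
have Y1E w : Y1 w <-> exists y a, Y y /\ w = y + a *: x.
  split=> [[y [_ [Yy [c ->] ->]]]|[y [a [Yy ->]]]]; first by exists y, (c tt); rewrite sum_unit.
  by exists y, (a *: x); split=> //; exists (fun=> a); rewrite sum_unit.
have YY1 : Y `<=` Y1 by exact: addSl.
have Y1X : Y1 `<=` X by apply: addS_min => // ; apply: fspan_sub.
have Y1x : Y1 x by apply/Y1E; exists 0, 1; rewrite scale1r add0r; split=> //; exact: (let: And3 h _ _ := hY in h).
have [_ XD XZ] := hX; have [Y0 YD YZ] := hY.
have kill1 a w : J a -> Y1 w -> Y (a *: w) by move=> Ja /Y1X; exact: kill.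
have JP0 : J `<=` P0 by move=> a Ja; apply/annE; exact: kill.
have [p1 p2] : 0 <= mult (t :: ts) X Y1 /\ forall P, pchain P n (size (t :: ts)) ->
  (forall a, (forall x, X x -> Y1 (a *: x)) -> P a) -> 0 < mult (t :: ts) X Y1.
  apply: IHY => //; first by move=> h; apply: nYx; exact: h.
  by move=> a w Ja Xw; apply: YY1; exact: kill.
have tY : tset t Y1 `<=` addS Y (tset t Y1) by apply: addSr.
have [c1 c2] : 0 <= mult (t :: ts) Y1 Y /\
  forall P, pchain P n (size (t :: ts)) -> P0 `<=` P -> 0 < mult (t :: ts) Y1 Y.
  have [P0t|nP0t] := pselect (P0 t).
  have e1 : addS Y (tset t Y1) = Y.
  apply/seteqP; split; last by apply: addSl; exact: tset_submod.
  apply: addS_min => // _ [_ /Y1E[y [a [Yy ->]]] <-]; rewrite scalerDr.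
  by apply: YD; [exact: YZ|rewrite scalerA mulrC -scalerA; apply: YZ; apply/annE].
  have e2 : tcol t Y1 Y = Y1.
  apply/seteqP; split=> [w []//|w Y1w]; split=> //; rewrite -e1.
  by apply: tY; exists w.
  rewrite /= e1 e2 subrr; split=> // P hP P0P'.
  have : pars n (addI J t) ts by [].
  move/pars_chain => /(_ P (size (t :: ts)) _ hP nts'); rewrite /= ltnn => h.
  suff : false by []; apply: h; apply: addI_min => //; [|exact: subset_trans P0P'|exact: P0P'].
  by have [] := pchainP hP => /primeI.
  have e2 : tcol t Y1 Y = Y.
  apply/seteqP; split=> [w [/Y1E[y [a [Yy ->]]]]|y Yy]; last by split; [exact: YY1|exact: YZ].
  rewrite scalerDr => Yt; apply: YD => //; apply/annE.
  have /annE/P0P[//|//] : Y ((t * a) *: x).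
  rewrite -scalerA -[_ *: _](addKr (t *: y)) addrC; apply: (submodB hY) => //; exact: YZ.
  have [k1 k2] := tkill t hY1 hY iJ kill1.
  have hYt : submod (addS Y (tset t Y1)) by apply: addSS => //; exact: tset_submod.
  rewrite /= e2 mult_xx // subr0.
  have [m1 m2] := IH (addI J t) Y1 (addS Y (tset t Y1)) iJ' fin nts' hY1 hYt
  (addS_min hY1 YY1 (fun _ '(ex_intro2 w Yw e) => let: And3 _ _ Z := hY1 in eq_ind _ Y1 (Z t w Yw) _ e)) k1.
  split=> // P hP P0P'.
  have [_ _ Pn] := pchainP hP.
  have [P1 [pP1 PP1 P1t hP1]] := pchain_adjust nR hP nt.
  apply: (m2 P1 hP1) => a /(_ x Y1x)[y [_ [Yy [_ /Y1E[y' [b [Yy' ->]]] <-] e]]].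
  have : P0 (a - t * b).
  apply/annE; rewrite scalerBl e scalerDr scalerA addrA addrK.
  by apply: YD => //; exact: YZ.
  move=> /P0P'/PP1 h; rewrite -(subrK (t * b) a); have [iP1 _ _] := pP1.
  have [_ D _] := iP1; by apply: D => //; exact: idealM.
have -> : mult (t :: ts) X Y = mult (t :: ts) X Y1 + mult (t :: ts) Y1 Y.
  exact: (mult_add iJ fin hX hY1 hY YY1 Y1X kill).
split=> [|P hP annP]; first exact: Num.Theory.addr_ge0.
have [[iP P1 PP] _ _] := pchainP hP.
(* Annihilators of [X / Y1] and of the layer multiply into that of [X / Y], so one of the two lies
   in the prime [P]. *)
have [h|/existsNP[b /not_implyP[hb nPb]]] := pselect (forall a, (forall x, X x -> Y1 (a *: x)) -> P a).
  by apply: Num.Theory.ltr_wpDr => //; exact: (p2 P).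
apply: Num.Theory.ltr_wpDl => //; apply: (c2 P) => // a Pa.
have /PP[] // : P (b * a).
apply: annP => w Xw; rewrite mulrC -scalerA.
have /Y1E[y [c [Yy ->]]] := hb w Xw; rewrite scalerDr; apply: YD; first exact: YZ.
by rewrite scalerA mulrC -scalerA; apply: YZ; apply/annE.
Qed.
End Multiplicity.

Definition cyc R (G : cplx R) i : set {ffun G i.+1 -> R^o} :=
  [set v | mact (dx G i) v = 0].
Definition bnd R (G : cplx R) i : set {ffun G i.+1 -> R^o} :=
  [set mact (dx G i.+1) v | v in setT].
Arguments cyc {R} G i _.
Arguments bnd {R} G i _.

Lemma cyc_submod R (G : cplx R) i : submod (cyc G i).
exact: ker_submod. Qed.

Lemma bnd_submod R (G : cplx R) i : submod (bnd G i).
exact: rng_sub. Qed.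

Definition euler R (G : cplx R) (ts : seq R) N : int :=
  \sum_(i < N) (-1) ^+ i * mult ts (cyc G i) (bnd G i).

Lemma telescope0 (b : nat -> int) N : b N = 0 -> b 0%N = 0 ->
  \sum_(i < N) (-1) ^+ i * (b i + b i.+1) = 0.
move=> bN b0; suff -> : \sum_(i < N) (-1) ^+ i * (b i + b i.+1) = b 0%N - (-1) ^+ N * b N.
  by rewrite bN b0 mulr0 subrr.
elim: N {bN} => [|N IH]; first by rewrite big_ord0 mul1r subrr.
by rewrite big_ord_recr /= IH exprS; ring.
Qed.

Lemma ideal_annP R (W : lmod R) (X Y : set W) : submod X -> submod Y ->
  is_ideal [set a | forall x, X x -> Y (a *: x)].
move=> [X0 XD XZ] [Y0 YD YZ]; split=> [x _|a b ha hb x Xx|a b hb x Xx].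
- by rewrite scale0r.
- by rewrite scalerDl; apply: YD; [exact: ha|exact: hb].
- by rewrite -scalerA; apply: YZ; exact: hb.
Qed.

(** * Euler characteristics modulo a parameter *)

Section EulerStep.
Variables (R R' : ring) (g : R ~~> R') (t : R) (n : set R).
Hypotheses (ln : lring n)
  (gs : surj g)
  (gk : forall r, g r = 0 <-> exists a, r = t * a)
  (tR : nzd t R^o).
Variables (G : cplx R) (J0 : set R) (ts : seq R).
Hypotheses (G1 : G 1%N -> False)
  (cG : forall i (M : lmod R), mcpx (dx G i.+1) (dx G i) M)
  (hJ0 : forall a, J0 a -> exists s, @chtpy R G a s)
  (fin : pars n (ideal_gen J0) (t :: ts)).

Let J := ideal_gen J0.
Let iJ : is_ideal J. exact: ideal_genP. Qed.
Let iJ' : is_ideal (addI J t). exact: addI_ideal. Qed.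
Let W i : lmod R := {ffun G i.+1 -> R^o}.
Let fW i : fg (W i). exact: fg_vec (fg_ring R). Qed.
Let tW i : set (W i) := tset t setT.
Let htW i : submod (@tW i). exact: tset_submod (submodT _). Qed.
Let hc := @cyc_submod R G.
Let hb := @bnd_submod R G.

Let bc i : bnd G i `<=` cyc G i.
by move=> _ [v _ <-]; exact: cG. Qed.

Let tfree (I : finT) (u : {ffun I -> R^o}) : t *: u = 0 -> u = 0.
move=> e; apply/ffunP => x; have := ffapp x e.
by rewrite !ffunE; exact: tR.
Qed.

(** Pulled back to [G], the homology of [G / t G] is [X / Y]; the part [V / Y] is the homology of
    [G] modulo [t], and [X / V] is the [t]-torsion of the homology one index lower. *)
Let X0 i : set (W i) := [set v | exists u, mact (dx G i) v = t *: u].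
Local Notation X := (@X0).
Let Y0 i : set (W i) := addS (bnd G i) (@tW i).
Local Notation Y := (@Y0).
Let V0 i : set (W i) := addS (cyc G i) (@tW i).
Local Notation V := (@V0).

Let hX i : submod (X i).
split=> [|x y [u eu] [v ev]|a x [u eu]].
- by exists 0; rewrite mact0 scaler0.
- by exists (u + v); rewrite mactD eu ev scalerDr.
- by exists (a *: u); rewrite mactZ eu !scalerA mulrC.
Qed.
Let hY i : submod (Y i). exact: (addSS (hb i) (@htW i)). Qed.
Let hV i : submod (V i). exact: (addSS (hc i) (@htW i)). Qed.
Let VX i : V i `<=` X i.
apply: addS_min => [|v cv|_ [w _ <-]]; first exact: hX.
  by exists 0; rewrite scaler0.
by exists (mact (dx G i) w); rewrite mactZ.
Qed.

Let YV i : Y i `<=` V i.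
apply: addS_min; first exact: hV.
  by apply: subset_trans (addSl (@htW i)); exact: bc.
exact: (addSr (hc i)).
Qed.

Let killJ0 a i v u : J0 a -> mact (dx G i) v = t *: u -> Y i (a *: v).
move=> /hJ0[s hs]; case: i v u => [|i] v u e.
  rewrite (_ : v = 0) ?scaler0; first by case: (hY 0%N).
  by apply/ffunP => x; case: (G1 x).
rewrite -(hs i v) e mactZ; exists (mact (dx G i.+2) (mact (s i.+1) v)), (t *: mact (s i) u).
by split=> //; [exists (mact (s i.+1) v)|exists (mact (s i) u)].
Qed.

Let killX i a v : addI J t a -> X i v -> Y i (a *: v).
have iA := ideal_annP (hX i) (hY i); move=> Ja Xv; apply: (addI_min iA _ _ Ja) => //.
  by apply: ideal_gen_sub => // b J0b w [u e]; exact: killJ0 e.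
by move=> w _; apply: addSr => //; exists w.
Qed.

Let killc i a v : J a -> cyc G i v -> bnd G i (a *: v).
have iA := ideal_annP (hc i) (hb i); move=> Ja; apply: (ideal_gen_sub iA _ Ja) => b /hJ0[s hs] w.
case: i {v} w {iA} => [|i] w cw.
  rewrite (_ : w = 0) ?scaler0; first by case: (hb 0%N).
  by apply/ffunP => x; case: (G1 x).
by rewrite -(hs i w) cw mact0 addr0; exists (mact (s i.+1) w).
Qed.

Let rvecD i (x y : W i) : rvec g (x + y) = rvec g x + rvec g y.
by apply/ffunP => k; rewrite !ffunE rmorphD. Qed.

Let rvecZ i a (x : W i) : rvec g (a *: x) = g a *: rvec g x.
by apply/ffunP => k; rewrite !ffunE rmorphM. Qed.

Let e1 i : mult (map g ts) (cyc (bcx g G) i) (bnd (bcx g G) i) = mult ts (X i) (Y i).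
symmetry; apply: (mult_iso ln (@fW i) gs (@rvecD i) (@rvecZ i) iJ' fin (hX i) (hY i)) => //.
- exact: cyc_submod.
- exact: bnd_submod.
- exact: subset_trans (@YV i) (@VX i).
- move=> _ [v _ <-]; have [u <-] := rvec_surj gs v.
  rewrite /cyc /bcx /= !rvec_mact cG; apply/ffunP => k; rewrite !ffunE; exact: rmorph0.
- by move=> a x; exact: killX.
split=> [v [u e]|v' cv|v [u e]].
- rewrite /cyc /bcx /= rvec_mact e; apply/ffunP => k; rewrite !ffunE rmorphM.
  by rewrite (_ : g t = 0) ?mul0r //; apply/gk; exists 1; rewrite mulr1.
- have [v ev] := rvec_surj gs v'; exists v, 0; rewrite addr0; split=> //; last by case: (bnd_submod (bcx g G) i).
  apply: (rvec0 gk); rewrite -rvec_mact ev; exact: cv.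
split=> [[w' _ e']|[_ [_ [[w _ <-] [w' _ <-] ->]]]].
  have [w ew] := rvec_surj gs w'.
  have [|z ez] := rvec0 gk (v := v - mact (dx G i.+1) w).
  by rewrite rvecB -e' -ew -rvec_mact subrr.
  exists (mact (dx G i.+1) w), (t *: z); split; [by exists w|by exists z|by rewrite -ez addrC subrK].
exists (rvec g w) => //; rewrite [LHS]rvec_mact rvecD rvecZ (_ : g t = 0) ?scale0r ?addr0 //.
by apply/gk; exists 1; rewrite mulr1.
Qed.

Let e2 i : mult ts (X i) (Y i) = mult ts (X i) (V i) + mult ts (V i) (Y i).
exact: (mult_add ln (@fW i) iJ' fin (hX i) (hV i) (hY i) (@YV i) (@VX i) (@killX i)). Qed.

Let e3 i : mult ts (V i) (Y i) = mult ts (cyc G i) (addS (bnd G i) (tset t (cyc G i))).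
have h := tset_submod t (hc i); symmetry.
apply: (mult_iso_id ln (@fW i) iJ' fin (hc i) (addSS (hb i) h) (hV i) (hY i)) => //.
- by apply: (addS_min (hc i) (@bc i)) => _ [v cv <-]; have [_ _ Z] := hc i; exact: Z.
- by move=> a v Ja cv; apply: (tkill t (hc i) (hb i) iJ (@killc i)).1.
- exact: addSl.
- by move=> _ [v [w [cv tw ->]]]; exists v, w; split=> //; exact: addSr.
move=> v cv; split=> [[x0 [_ [bw [w _ <-] e]]]|[b [_ [bb [w cw <-] ->]]]]; last first.
  by exists b, (t *: w); split=> //; exists w.
rewrite e; exists x0, (t *: w); split=> //; exists w => //.
have : mact (dx G i) (t *: w) = 0.
  by rewrite -[t *: w](addKr x0) -e addrC mactB cv (bc bw) subrr.
by rewrite mactZ; exact: tfree.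
Qed.

Let b i : int := mult ts (tcol t (cyc G i) (bnd G i)) (bnd G i).

Let e4 i : mult ts (X i.+1) (V i.+1) = b i.
have hI := submodI (@htW i) (hb i); have hT := tset_submod t (hb i).
have TI : tset t (bnd G i) `<=` @tW i `&` bnd G i.
  by move=> _ [v bv <-]; split; [exists v|have [_ _ Z] := hb i; exact: Z].
transitivity (mult ts (@tW i `&` bnd G i) (tset t (bnd G i))).
  apply: (@mult_iso_lin R n ln _ (@fW i.+1) (W i) (mact (dx G i.+1)) ts (addI J t)) => //.
  - by move=> x y; rewrite mactD.
  - by move=> a x; rewrite mactZ.
  - by move=> a x Ja Xx; apply: YV; exact: killX.
  split=> [v [u e]|_ [[u _ <-] [w _ e]]|v [u e]].
  - by split; [exists u|exists v].
  - by exists w, 0; rewrite addr0; split=> //; [exists u|case: hT].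
  split=> [[_ [w _ <-] e']|[c [_ [cc [w _ <-] ->]]]].
  exists (v - t *: w), (t *: w); split; [|by exists w|by rewrite subrK].
  by rewrite /cyc /= mactB mactZ e' subrr.
  exists (mact (dx G i.+1) w); first by exists w.
  by rewrite mactD cc add0r mactZ.
symmetry; apply: (@mult_iso_lin R n ln _ (@fW i) (W i) (fun x => t *: x) ts (addI J t)) => //.
- by move=> x y; rewrite scalerDr.
- by move=> a x; rewrite !scalerA mulrC.
- exact: (tcol_submod t (hc i) (hb i)).
- exact: hb.
- by move=> x bx; split; [exact: bc|have [_ _ Z] := hb i; exact: Z].
- exact: (tkill t (hc i) (hb i) iJ (@killc i)).2.
split=> [x [cx bx]|_ [[u _ <-] bu]|x [cx bx]].
- by split=> //; exists x.
- exists u, 0; rewrite addr0; split=> //; [split=> //|by case: hT].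
  by apply: tfree; rewrite -mactZ; exact: bc.
split=> [[w bw e]|bx']; last by exists x.
suff -> : x = w by [].
by apply/eqP; rewrite -subr_eq0; apply/eqP/tfree; rewrite scalerBr e subrr.
Qed.

Let empty_eq i (S S' : set (W i)) : (G i.+1 -> False) -> submod S -> submod S' -> S = S'.
move=> Gi [S0 _ _] [S0' _ _]; have z (v : W i) : v = 0 by apply/ffunP => x; case: (Gi x).
by apply/seteqP; split=> v _; rewrite (z v).
Qed.

(** The torsion term of each index occurs in the homology of [G / t G] one index higher and in the
    recursion for [mult]; the alternating sum of these contributions telescopes. *)
Lemma euler_step N : (G N -> False) ->
  euler G (t :: ts) N = euler (bcx g G) (map g ts) N.
move=> GN; pose c j := if j is i.+1 then b i else 0.
apply/esym/eqP; rewrite -subr_eq0 /euler -sumrB.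
have -> : \sum_(i < N) ((-1) ^+ i * mult (map g ts) (cyc (bcx g G) i) (bnd (bcx g G) i) -
  (-1) ^+ i * mult (t :: ts) (cyc G i) (bnd G i)) = \sum_(i < N) (-1) ^+ i * (c i + c i.+1).
  apply: eq_bigr => -[i iN] _ /=; rewrite -mulrBr; congr (_ * _).
  rewrite e1 e2 e3 -/(b i) opprB addrA addrAC addrK addrC [RHS]addrC; congr (_ + _).
  case: i {iN} => [|i] /=; last exact: e4.
  by rewrite (empty_eq G1 (hX 0%N) (hV 0%N)) (mult_xx ln (@fW 0%N)).
rewrite telescope0 //; case: N GN => // N GN.
rewrite /c /b (empty_eq GN (tcol_submod t (hc N) (hb N)) (hb N)).
by rewrite (mult_xx ln (@fW N)) //; exact: hb.
Qed.
End EulerStep.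

Lemma mactN R (M : lmod R) (I J : finT) (P : I -> J -> R)
  (v : {ffun I -> M}) : mact P (- v) = - mact P v.
by rewrite -[- v]sub0r mactB mact0 sub0r. Qed.

(** * The doubled complex and its Euler characteristic *)

Section DoubledComplex.
Variables (R : ring) (F : cplx R) (x0 : R) (h : forall i, F i.+2 -> F i -> R).

Definition dbl_rk i : finT := if i is j.+1 then (F j.+1 + F j)%type else void.

(* [d (a, b) = (d a + x0 b, - h a - d b)] *)
Definition dbl_dm i : dbl_rk i.+1 -> dbl_rk i -> R :=
  match i return dbl_rk i.+1 -> dbl_rk i -> R with
  | 0 => fun _ _ => 0
  | j.+1 => fun x y => match x, y with
  | inl a, inl c => dx F j.+1 a c
  | inl a, inr c => - @h j a c
  | inr b, inl c => x0 * (b == c)%:R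
  | inr b, inr c => - dx F j b c
  end
  end.

Definition dbl : cplx R := Cplx dbl_dm.

Section Action.
Variables (T : ring) (f : R ~~> T) (M : lmod T).

Definition fstv j (v : {ffun dbl_rk j.+1 -> M}) : {ffun F j.+1 -> M} := [ffun x => v (inl x)].
Definition sndv j (v : {ffun dbl_rk j.+1 -> M}) : {ffun F j -> M} := [ffun x => v (inr x)].
Definition pairv j (a : {ffun F j.+1 -> M}) (b : {ffun F j -> M}) : {ffun dbl_rk j.+1 -> M} :=
  [ffun x => match x with inl y => a y | inr y => b y end].

Lemma pairv_eta j (v : {ffun dbl_rk j.+1 -> M}) : v = pairv (fstv v) (sndv v).
by apply/ffunP => -[x|x]; rewrite !ffunE. Qed.

Lemma pairv_inj j (a a' : {ffun F j.+1 -> M}) (b b' : {ffun F j -> M}) :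
  pairv a b = pairv a' b' -> a = a' /\ b = b'.
move=> e; split; apply/ffunP => x.
  by have := ffapp (inl x) e; rewrite !ffunE.
by have := ffapp (inr x) e; rewrite !ffunE.
Qed.

Lemma fstv_pair j (a : {ffun F j.+1 -> M}) (b : {ffun F j -> M}) : fstv (pairv a b) = a.
by apply/ffunP => x; rewrite !ffunE. Qed.

Lemma sndv_pair j (a : {ffun F j.+1 -> M}) (b : {ffun F j -> M}) : sndv (pairv a b) = b.
by apply/ffunP => x; rewrite !ffunE. Qed.

Lemma dbl_act j (a : {ffun F j.+2 -> M}) (b : {ffun F j.+1 -> M}) :
  mact (rmapM f (dx dbl j.+1)) (pairv a b) =
  pairv (mact (rmapM f (dx F j.+1)) a + f x0 *: b)
  (- mact (rmapM f (@h j)) a - mact (rmapM f (dx F j)) b).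
apply/ffunP => -[x|x]; rewrite !ffunE big_sumType /=; congr (_ + _).
- by apply: eq_bigr => y _; rewrite ffunE.
- rewrite (bigD1 x) //= ffunE /rmapM /= eqxx mulr1 big1 ?addr0 // => y /negPf yx.
  by rewrite /rmapM /= yx mulr0 rmorph0 scale0r.
- by rewrite -sumrN; apply: eq_bigr => y _; rewrite ffunE /rmapM /= rmorphN scaleNr.
- by rewrite -sumrN; apply: eq_bigr => y _; rewrite ffunE /rmapM /= rmorphN scaleNr.
Qed.

Lemma dbl_act0 (v : {ffun dbl_rk 1 -> M}) : mact (rmapM f (dx dbl 0)) v = 0.
by apply/ffunP => -[]. Qed.

Hypotheses (dd : forall j (v : {ffun F j.+2 -> M}),
  mact (rmapM f (dx F j)) (mact (rmapM f (dx F j.+1)) v) = f x0 *: mact (rmapM f (@h j)) v)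
  (hd : forall j (v : {ffun F j.+3 -> M}),
  mact (rmapM f (@h j)) (mact (rmapM f (dx F j.+2)) v) =
  mact (rmapM f (dx F j)) (mact (rmapM f (@h j.+1)) v)).

(** The square vanishes because [d d = x0 h] and [h] commutes with [d]; [h] is the Eisenbud operator
    of a resolution lifted from the hypersurface [x0 = 0]. *)
Lemma dbl_cpx j : mcpx (rmapM f (dx dbl j.+1)) (rmapM f (dx dbl j)) M.
move=> v; case: j v => [|j] v; first exact: dbl_act0.
rewrite [v]pairv_eta !dbl_act !mactB !mactN !mactD !mactZ !dd hd.
set A := mact _ (fstv v); set B := mact _ (sndv v); set A' := mact _ (mact _ _).
set B' := mact (rmapM f (@h j)) _.
have -> : f x0 *: A + f x0 *: B + f x0 *: (- A - B) = 0.
  by rewrite -!scalerDr -opprD subrr scaler0.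
have -> : - (A' + f x0 *: B') - (- A' - f x0 *: B') = 0 by rewrite -(opprD A') subrr.
by apply/ffunP => -[x|x]; rewrite !ffunE.
Qed.
End Action.
End DoubledComplex.

Section DoubledEuler.
Variables (R T : ring) (f : R ~~> T) (F : cplx R) (x0 : R).
Variable h : forall i, F i.+2 -> F i -> R.
Variables (n J : set T) (N : nat).
Hypotheses (ln : lring n)
  (iJ : is_ideal J)
  (fin : pars n J [::])
  (fx0 : f x0 = 0)
  (dd : forall j (v : {ffun F j.+2 -> T^o}),
  mact (rmapM f (dx F j)) (mact (rmapM f (dx F j.+1)) v) = 0)
  (hd : forall j (v : {ffun F j.+3 -> T^o}),
  mact (rmapM f (@h j)) (mact (rmapM f (dx F j.+2)) v) =
  mact (rmapM f (dx F j)) (mact (rmapM f (@h j.+1)) v)).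
Let FF := bcx f F.
Let GG := bcx f (dbl x0 h).
Hypotheses (killF : forall i a v, J a -> cyc FF i v -> bnd FF i (a *: v))
  (killG : forall i a v, J a -> cyc GG i v -> bnd GG i (a *: v)).
Hypotheses (F0 : F 0%N -> False) (F1 : F 1%N -> False) (FN1 : F N.+1 -> False) (FN2 : F N.+2 -> False).

Let m (W : lmod T) (X Y : set W) : int := mult [::] X Y.
Let fv (I : finT) : fg ({ffun I -> T^o} : lmod T). exact: fg_vec (fg_ring T). Qed.
Let d j (v : {ffun F j.+1 -> T^o}) : {ffun F j -> T^o} := mact (rmapM f (dx F j)) v.
Let k j (v : {ffun F j.+2 -> T^o}) : {ffun F j -> T^o} := mact (rmapM f (@h j)) v.
Local Notation A := (cyc FF).
Local Notation B := (bnd FF).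
Let hA := @cyc_submod T FF.
Let hB := @bnd_submod T FF.
Let BA i : B i `<=` A i.
by move=> _ [v _ <-]; exact: dd. Qed.

(** Cycles whose class is killed by the map that [k] induces on homology; [rho] is the length of the
    image of that map. *)
Let U0 j : set {ffun F j.+2 -> T^o} := [set a | A j.+1 a /\ exists b, k a = d b].
Local Notation U := (@U0).
Let hU j : submod (U j).
have [a0 aD aZ] := hA j.+1; split=> [|x y [ax [b eb]] [ay [c ec]]|a x [ax [b eb]]].
- by split=> //; exists 0; rewrite /k /d !mact0.
- by split; [exact: aD|exists (b + c); rewrite /k /d !mactD; congr (_ + _)].
- by split; [exact: aZ|exists (a *: b); rewrite /k /d !mactZ; congr (_ *: _)].
Qed.
Let BU j : B j.+1 `<=` U j.
move=> _ [v _ <-]; split; first by apply: BA; exists v.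
by exists (k v); rewrite /k /d -hd.
Qed.
Let UA j : U j `<=` A j.+1. by move=> x []. Qed.
Let rho i : int := if i is j.+1 then m (A j.+1) (U j) else 0.

Let e1 j : m (A j.+1) (B j.+1) = rho j.+1 + m (U j) (B j.+1).
exact: (mult_add ln (fv _) iJ fin (hA _) (hU j) (hB _) (@BU j) (@UA j) (@killF _)). Qed.

Let Q0 j : set {ffun F j.+1 -> T^o} := addS [set k a | a in A j.+2] (B j).
Local Notation Q := (@Q0).
Let hK j : submod [set k a | a in A j.+2].
have [a0 aD aZ] := hA j.+2; split=> [|_ _ [x ax <-] [y ay <-]|a _ [x ax <-]].
- by exists 0; rewrite /k ?mact0.
- by exists (x + y); [exact: aD|rewrite /k mactD].
- by exists (a *: x); [exact: aZ|rewrite /k mactZ].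
Qed.
Let hQ j : submod (Q j). exact: (addSS (hK j) (hB j)). Qed.
Let QA j : Q j `<=` A j.
apply: (addS_min (hA j) _ (@BA j)) => _ [a aa <-].
by rewrite /cyc /FF /= -hd (_ : mact _ a = 0) ?mact0.
Qed.
Let BQ j : B j `<=` Q j. exact: (addSr (hK j)). Qed.
Let e2 j : m (A j) (B j) = m (A j) (Q j) + rho j.+2.
rewrite /m (mult_add ln (fv _) iJ fin (hA _) (hQ j) (hB _) (@BQ j) (@QA j) (@killF _)); congr (_ + _).
symmetry; apply: (mult_iso_lin (phi := @k j.+1) ln (fv _) _ _ iJ fin (hA j.+2) (hU j.+1) (hQ j) (hB j) (@UA j.+1) (@BQ j)) => //.
- by move=> x y; exact: mactD.
- by move=> a x; exact: mactZ.
- by move=> a x Ja ax; apply: BU; exact: killF.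
split=> [a aa|_ [_ [b [[a aa <-] Bb ->]]]|a aa].
- by apply: (addSl (hB j)); exists a.
- by exists a, b.
by split=> [[b _ e]|[_ [b e]]]; [split=> //; exists b|exists b].
Qed.

Let Z0 j : set {ffun dbl_rk F j.+2 -> T^o} := [set v | cyc GG j.+1 v /\ B j.+1 (fstv v)].
Local Notation Z1 := (@Z0).
Let GE j (v : {ffun dbl_rk F j.+2 -> T^o}) : cyc GG j.+1 v <-> A j.+1 (fstv v) /\ k (fstv v) + d (sndv v) = 0.
rewrite [in X in X <-> _](pairv_eta v) /cyc /GG /= dbl_act fx0 scale0r addr0; split=> [e|[e1' e2']].
  have [-> e'] : mact (rmapM f (dx F j.+1)) (fstv v) = 0 /\ - k (fstv v) - d (sndv v) = 0.
  by apply: pairv_inj; rewrite [LHS]e; apply/ffunP => -[x|x]; rewrite !ffunE.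
  by split=> //; apply: oppr_inj; rewrite oppr0 -e' opprD.
by rewrite e1' -opprD e2'; apply/ffunP => -[x|x]; rewrite !ffunE ?oppr0.
Qed.
Let BE j (v : {ffun dbl_rk F j.+2 -> T^o}) : bnd GG j.+1 v <->
  exists a b, v = pairv (d a) (- k a - d b).
split=> [[w _ <-]|[a [b ->]]].
  exists (fstv w), (sndv w); rewrite [in LHS](pairv_eta w) /GG /= dbl_act.
  by rewrite fx0 scale0r addr0.
by exists (pairv a b) => //; rewrite /GG /= dbl_act fx0 scale0r addr0.
Qed.
Let hG := @cyc_submod T GG.
Let hbG := @bnd_submod T GG.
Let fstvD j (x y : {ffun dbl_rk F j.+1 -> T^o}) : fstv (x + y) = fstv x + fstv y.
by apply/ffunP => z; rewrite !ffunE. Qed.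
Let fstvZ j a (x : {ffun dbl_rk F j.+1 -> T^o}) : fstv (a *: x) = a *: fstv x.
by apply/ffunP => z; rewrite !ffunE. Qed.
Let fst0 j : fstv (0 : {ffun dbl_rk F j.+1 -> T^o}) = 0.
by apply/ffunP => z; rewrite !ffunE. Qed.
Let hZ1 j : submod (Z1 j).
have [c0 cD cZ] := hG j.+1; have [b0 bD bZ] := hB j.+1.
split=> [|x y [cx bx] [cy byy]|a x [cx bx]].
- by split=> //; rewrite fst0.
- by split; [exact: cD|rewrite fstvD; exact: bD].
- by split; [exact: cZ|rewrite fstvZ; exact: bZ].
Qed.
Let BZ j : bnd GG j.+1 `<=` Z1 j.
move=> v /BE[a [b ->]]; split; last by rewrite fstv_pair; exists a.
apply/GE; rewrite fstv_pair sndv_pair /A /=; split; first exact: dd.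
by rewrite /k /d mactB mactN hd dd subr0 subrr.
Qed.
Let ZC j : Z1 j `<=` cyc GG j.+1. by move=> v []. Qed.
Let e3 j : m (cyc GG j.+1) (bnd GG j.+1) = m (U j) (B j.+1) + m (A j) (Q j).
have kill a v : J a -> cyc GG j.+1 v -> Z1 j (a *: v) by move=> Ja cv; apply: BZ; exact: killG.
rewrite /m (mult_add ln (fv _) iJ fin (hG _) (hZ1 j) (hbG _) (@BZ j) (@ZC j) (@killG _)); congr (_ + _).
  apply: (mult_iso_lin (phi := @fstv R F T T^o j.+1) ln (fv _) _ _ iJ fin (hG _) (hZ1 j) (hU j) (hB _) (@ZC j) (@BU j)) => //.
  - exact: fstvD.
  - exact: fstvZ.
  split=> [v /GE[e1' e2']|a [aa [b e]]|v cv].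
  - split=> //; exists (- sndv v); rewrite /d mactN.
  by apply/eqP; rewrite -addr_eq0; apply/eqP.
  - exists (pairv a (- b)), 0; rewrite fstv_pair addr0; split=> //; last by case: (hB j.+1).
  by apply/GE; rewrite fstv_pair sndv_pair; split=> //; rewrite e /d mactN subrr.
  by split=> [|[]].
symmetry; apply: (mult_iso_lin (phi := fun b : {ffun F j.+1 -> T^o} => pairv 0 b : {ffun dbl_rk F j.+2 -> T^o}) ln (fv _) _ _ iJ fin (hA j) (hQ j) (hZ1 j) (hbG _) (@QA j) (@BZ j)) => //.
- by move=> x y; apply/ffunP => -[z|z]; rewrite !ffunE ?addr0.
- by move=> a x; apply/ffunP => -[z|z]; rewrite !ffunE ?scaler0.
- by move=> a x Ja ax; apply: BQ; exact: killF.
split=> [b ab|v [/GE[_ ev] [a _ ea]]|b ab].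
- split; last by rewrite fstv_pair; case: (hB j.+1).
  apply/GE; rewrite fstv_pair sndv_pair; split; first by case: (hA j.+1).
  by rewrite /k mact0 add0r.
- exists (sndv v + k a), (pairv (d a) (- k a - d 0)); split.
  + by rewrite /cyc /FF /= mactD -hd ea addrC; exact: ev.
  + by apply/BE; exists a, 0.
  rewrite [v in LHS]pairv_eta; apply/ffunP => -[z|z]; rewrite !ffunE.
  by have := ffapp z ea; rewrite !ffunE add0r => <-.
  by rewrite [X in _ - X]big1 ?subr0 ?addrK // => i _; rewrite ffunE scaler0.
split=> [/BE[a [b' /pairv_inj[ea ->]]]|[_ [_ [[a aa <-] [b' _ <-] ->]]]].
  exists (k (- a)), (d (- b')); split; [exists (- a) => //|by exists (- b')|by rewrite /k /d !mactN].
  by apply: (submodN (hA j.+2)); exact: (esym ea).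
apply/BE; exists (- a), (- b').
have -> : d (- a) = 0 by exact: (submodN (hA j.+2) aa).
by rewrite /k /d !mactN !opprK.
Qed.

(** Where [x0] vanishes, the doubled complex is an extension of [F] by its own shift, with
    connecting map [k]. Each homology length enters twice with opposite signs, and the lengths [rho]
    telescope. *)
Lemma euler_dbl : euler GG [::] N.+1 = 0.
have empty_eq (I : finT) (S S' : set {ffun I -> T^o}) : (I -> False) -> submod S -> submod S' -> S = S'.
  move=> Gi [S0 _ _] [S0' _ _]; have z (v : {ffun I -> T^o}) : v = 0 by apply/ffunP => x; case: (Gi x).
  by apply/seteqP; split=> v _; rewrite (z v).
have xx (I : finT) (S : set ({ffun I -> T^o} : lmod T)) : submod S -> m S S = 0.
  by move=> hS; exact: (mult_xx ln (fv I)).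
pose H i := m (A i) (B i).
have H0 : H 0%N = 0 by rewrite /H (empty_eq _ _ _ F1 (hA 0%N) (hB 0%N)) (xx _ _ (hB _)).
have HN : H N = 0 by rewrite /H (empty_eq _ _ _ FN1 (hA N) (hB N)) (xx _ _ (hB _)).
have r1 : rho 1 = 0.
  rewrite /rho (_ : U 0%N = A 1%N) ?(xx _ _ (hA _)) //; apply/seteqP; split=> // a aa; split=> //.
  by exists 0; apply/ffunP => x; case: (F0 x).
have rN : rho N.+1 = 0 by rewrite /rho (empty_eq _ _ _ FN2 (hA N.+1) (hU N)) (xx _ _ (hU _)).
rewrite /euler big_ord_recl expr0 mul1r -/(m _ _).
have G1 : GG 1%N -> False by case.
rewrite (empty_eq _ _ _ G1 (hG 0%N) (hbG 0%N)) (xx _ _ (hbG _)) add0r.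
rewrite (eq_bigr (fun i : 'I_N => (-1) ^+ i * (rho i.+1 + rho i.+2) - (-1) ^+ i * (H i + H i.+1))); last first.
  move=> i _; rewrite -[LHS]/((-1) ^+ i.+1 * m (cyc GG i.+1) (bnd GG i.+1)).
  rewrite e3 exprS /H e1 e2; ring.
rewrite sumrB (telescope0 HN H0) (telescope0 (b := fun i => rho i.+1) rN r1) subrr.
by [].
Qed.
End DoubledEuler.

Fixpoint pcst (A : ring) l : A ~~> power_series A l :=
  if l is l'.+1 then @pconst (power_series A l') \o pcst A l' else idfun.

Fixpoint pco (A : ring) l : power_series A l ~~> A :=
  if l is l'.+1 then pco A l' \o @pcoef0 (power_series A l') else idfun.

Lemma pco_cst (A : ring) l (a : A) : pco A l (pcst A l a) = a.
by elim: l => //= l IH. Qed.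

Lemma mps_lring (A : ring) (n : set A) l : lring n -> lring (pco A l @^-1` n).
move=> ln; elim: l => [|l IH]; first exact: ln.
by apply: (ps_lring IH); apply: (@mps_noetherian A l.+1); case: ln.
Qed.

Lemma psmap_cst (A D : ring) (h : A ~~> D) l a :
  psmap h l (pcst A l a) = pcst D l (h a).
elim: l => //= l IH; rewrite -IH; apply: funext => -[|k] //; exact: rmorph0.
Qed.

Lemma pco_psmap (A D : ring) (h : A ~~> D) l F :
  pco D l (psmap h l F) = h (pco A l F).
by elim: l F => //= l IH F; rewrite -IH. Qed.

Lemma psmap_comp (A C D : ring) (f : A ~~> C) (h : C ~~> D) l F :
  psmap (h \o f) l F = psmap h l (psmap f l F).
by elim: l F => //= l IH F; apply: funext => k; exact: IH. Qed.

Lemma summable_pcst (A : ring) l (y : A) : summable y -> summable (pcst A l y).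
by elim: l => //= l IH sy; apply: summable_pconst; exact: IH. Qed.

(** * Evaluation in several variables *)

Section IteratedEvaluation.
Variables (D : ring) (n : set D).
Hypothesis ln : lring n.
Variable y : nat -> D.
Hypotheses (ny : forall i, n (y i))
  (sy : forall i, summable (y i)).

Let nPS l : noetherian (power_series D l).
by apply: mps_noetherian; case: ln. Qed.

Lemma pcst_rad l i b : exists d, d * (1 - b * pcst D l (y i)) = 1.
by apply: (mulr_unit1 b (mps_lring l ln)); rewrite /preimage /= pco_cst.
Qed.

Definition evtop l : powser (power_series D l) ~~> power_series D l :=
  evalm (@nPS l) (@pcst_rad l l) (summable_pcst (l := l) (@sy l)).

(** The outermost variable, of index [l - 1], is evaluated before the others. *)
Fixpoint evl l : power_series D l ~~> D :=
  if l is l'.+1 then evl l' \o evtop l' else idfun.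

Definition ttop l : powser (power_series D l) := @pX _ - pconst (pcst D l (y l)).

Fixpoint tsl l : seq (power_series D l) :=
  if l is l'.+1 then ttop l' :: map (@pconst _) (tsl l') else [::].

Lemma evtopP l F : exists S, F = pconst (evtop l F) + ttop l * S.
exact: evalmP. Qed.

Lemma evtop_eq l F c S : F = pconst c + ttop l * S -> evtop l F = c.
by move=> e; apply: (evalE _ _ _ e); [exact: nPS|exact: pcst_rad].
Qed.

Lemma evtop_sum l (F : powser (power_series D l)) s :
  (forall j, s j = F j + pcst D l (y l) * s j.+1) -> evtop l F = s 0%N.
exact: evalm_sum. Qed.

Lemma evl_cst l a : evl l (pcst D l a) = a.
elim: l => //= l IH; rewrite -[RHS]IH; congr (evl _ _).
by apply: (@evtop_eq l _ _ 0); rewrite mulr0 addr0.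
Qed.

Lemma size_tsl l : size (tsl l) = l.
by elim: l => //= l IH; rewrite size_map IH. Qed.

Lemma tsl_max l t : t \in tsl l -> n (pco D l t).
elim: l t => //= l IH t; rewrite inE => /orP[/eqP ->|/mapP[u us ->]]; last exact: IH.
rewrite /pcoef0 /ttop -[(_ - _) 0%N]/(@pX _ 0%N - pcst D l (y l)) sub0r rmorphN pco_cst.
by apply: idealN => //; apply: primeI; case: ln.
Qed.

(** The kernel is generated by [tsl l]: division by the top variable minus its value leaves a
    remainder with one variable less. *)
Lemma evl_ker l (I : set (power_series D l)) F : is_ideal I ->
  (forall t, t \in tsl l -> I t) -> evl l F = 0 -> I F.
elim: l I F => [|l IH] I F iI tI /=; first by move=> ->; case: iI.
have [S eF] := evtopP F.
move=> e; rewrite eF; have [_ ID _] := iI; apply: ID; last first.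
  by apply: (idealM _ iI); apply: tI; exact: mem_head.
have [I0 I1 I2] := iI.
apply: (IH (@pconst _ @^-1` I)) => //.
  split=> [|a b|a b]; rewrite /preimage /= ?rmorph0 ?rmorphD ?rmorphM //; [exact: I1|exact: I2].
by move=> t tl; apply: tI; rewrite inE map_f ?orbT.
Qed.

Lemma evl_pco l F : n (evl l F - pco D l F).
have ip : is_ideal n by apply: primeI; case: ln.
elim: l F => [|l IH] F /=; first by rewrite subrr; case: ip.
have [S eF] := evtopP F.
have -> : pcoef0 F = evtop l F - pcst D l (y l) * S 0%N.
  rewrite [in LHS]eF /pcoef0 mulrDl mulNr.
  rewrite -[LHS]/(evtop l F + ((@pX _ * S) 0%N - (pconst (pcst D l (y l)) * S) 0%N)).
  by rewrite pXM0 pconstM sub0r.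
rewrite rmorphB rmorphM pco_cst opprB addrC addrAC -addrA; have [_ ID _] := ip; apply: ID.
  exact: idealM.
exact: IH.
Qed.

Lemma evl_max l F : n (evl l F) <-> n (pco D l F).
have ip : is_ideal n by apply: primeI; case: ln.
have h := evl_pco F; have [_ ID _] := ip; split=> hF.
  rewrite (_ : pco D l F = evl l F - (evl l F - pco D l F)); last by rewrite opprB addrC subrK.
  exact: idealB.
by rewrite -(subrK (pco D l F) (evl l F)); exact: ID.
Qed.
End IteratedEvaluation.

Lemma evl_natural (C D : ring) (h : C ~~> D) (nC : set C) (nD : set D)
  (lC : lring nC) (lD : lring nD) (y : nat -> C) (ny : forall i, nC (y i)) (nyD : forall i, nD (h (y i)))
  (sy : forall i, summable (y i)) (syD : forall i, summable (h (y i))) l F :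
  evl lD nyD syD l (psmap h l F) = h (evl lC ny sy l F).
elim: l F => //= l IH F; rewrite -IH; congr (evl _ _ _ _ _).
have [S eF] := evtopP lC ny sy F.
apply: (@evtop_eq D nD lD (fun i => h (y i)) nyD syD l _ _ (pmap (psmap h l) S)).
rewrite [F in LHS]eF rmorphD rmorphM rmorphB; congr (_ + (_ - _) * _).
- by apply: funext => -[|k] //=; rewrite /pmap /= rmorph0.
- by apply: funext => k; exact: rmorph_nat.
by apply: funext => -[|k]; [exact: psmap_cst|exact: rmorph0].
Qed.

(* The coefficient ring of a complete local ring: a field, for [pi = 0], or a
   complete discrete valuation ring with uniformizer [pi]. *)
Definition coef_ring (A : ring) (pi : A) : Prop :=
  [/\ lring [set a | exists b, a = pi * b], summable pi &
  forall (J : finT) (m : J -> A), J -> exists j0, forall j, exists c, m j = c * m j0].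

(* [C] is complete with maximal ideal generated by [alpha pi] and [y i], [i < l],
   and residue field that of [A] *)
Definition coef_map (A C : ring) (pi : A) (alpha : A ~~> C) (n : set C)
  (l : nat) (y : nat -> C) : Prop :=
  [/\ lring n, forall c, n c -> summable c, forall i, n (y i), n (alpha pi) &
  forall c, (exists a, n (c - alpha a)) /\
  (n c -> exists b (e : 'I_l -> C), c = b * alpha pi + \sum_(i < l) e i * y i)].

Lemma lring_image (R S : ring) (g : R ~~> S) (n : set R) :
  lring n -> surj g -> (forall r, g r = 0 -> n r) ->
  lring (g @` n) /\ forall r, (g @` n) (g r) <-> n r.
move=> [nR pn un] gs gk; have ip := primeI pn; have [n0 nD nM] := ip.
have gn r : (g @` n) (g r) <-> n r.
  split=> [[s ns e]|nr]; last by exists r.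
  by rewrite -(subrK s r); apply: nD => //; apply: gk; rewrite rmorphB e subrr.
split=> //; split; first exact: (noetherian_image gs).
  have [_ n1 nP] := pn; split.
  - split=> [|_ _ [x nx <-] [z nz <-]|a _ [x nx <-]].
  + by exists 0; rewrite ?rmorph0.
  + by exists (x + z); [exact: nD|rewrite rmorphD].
  + by have [b <-] := gs a; exists (b * x); [exact: nM|rewrite rmorphM].
  - by rewrite -(rmorph1 g) gn.
  - by move=> a b; have [x <-] := gs a; have [z <-] := gs b; rewrite -rmorphM !gn; exact: nP.
move=> s; have [r <-] := gs s; rewrite gn => /un[b e]; exists (g b).
by rewrite -rmorphM e rmorph1.
Qed.

(** * Presenting a complete local ring by power series *)

Section CoefficientMaps.
Variables (A C : ring) (pi : A) (alpha : A ~~> C) (n : set C).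
Variables (l : nat) (y : nat -> C).
Hypotheses (cA : coef_ring pi)
  (cC : coef_map pi alpha n l y).

Lemma coef_lring : lring n. by case: cC. Qed.
Lemma coef_max i : n (y i). by case: cC. Qed.
Lemma coef_sum i : summable (y i). by case: cC => _ h k _ _; exact: h. Qed.

Let ln := coef_lring.
Let nC : noetherian C. by case: ln. Qed.
Let iN : is_ideal n. by apply: primeI; case: ln. Qed.

Definition ecoef k : power_series A k ~~> C :=
  evl ln coef_max coef_sum k \o psmap alpha k.

(** Iterating the relation puts [u 0] in [I + z^k C] for all [k], and Krull's intersection theorem
    applies modulo [I]. *)
Let closed_diff z (I : set C) (u : nat -> C) : is_ideal I -> n z ->
  (forall j, exists i, I i /\ u j = i + z * u j.+1) -> I (u 0%N).
move=> iI nz hu; have [I0 ID IM] := iI.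
apply: (krull_power (y := z) nC iI) => [b|k]; first exact: (mulr_unit1 b ln).
suff H j : exists i, I i /\ u j = i + z ^+ k * u (j + k)%N by have [i [Ii e]] := H 0%N; exists i, (u k).
elim: k j => [|k IH] j; first by exists 0; rewrite mul1r addn0 add0r.
have [i [Ii ei]] := hu j; have [i' [Ii' ei']] := IH j.+1.
exists (i + z * i'); split; first by apply: ID => //; exact: IM.
by rewrite ei ei' addnS -addSn exprS; ring.
Qed.

(** Modulo all the [y], elements are expanded in powers of [alpha pi]. The generators [y k] are then
    released from the ideal [I] one by one, each providing the expansion in one more variable. *)
Lemma ecoef_surj c : exists F, ecoef l F = c.
have [_ _ _ npi hC] := cC; have [_ spi _] := cA.
suff H k (I : set C) : is_ideal I ->
  (forall c, exists a i b (e : 'I_k -> C), I i /\ c = alpha a + i + b * alpha pi + \sum_(i < k) e i * y i) ->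
  forall c, exists F, I (ecoef k F - c).
  have [||F] := H l [set 0 : C] _ _ c.
  - by split=> [|a b -> ->|a b ->] //=; rewrite ?addr0 ?mulr0.
  - move=> d; have [[a na] _] := hC d; have [_ /(_ na)[b [e he]]] := hC (d - alpha a).
  exists a, 0, b, e; split=> //; rewrite addr0 -addrA -he; ring.
  by move=> /eqP; rewrite subr_eq0 => /eqP; exists F.
elim: k I => [|k IH] I iI hI d.
  have /choice[a /choice[i /choice[b h]]] : forall c, exists a i b, I i /\ c = alpha a + i + b * alpha pi.
  by move=> x; have [a [i [b [e [Ii ->]]]]] := hI x; exists a, i, b; rewrite big_ord0 addr0.
  pose x j := iter j b d; have [s hs] := spi (fun j => a (x j)).
  exists (s 0%N); apply: (closed_diff (z := alpha pi) (u := fun j => alpha (s j) - x j)) => // j.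
  exists (- i (x j)); have [Ii e] := h (x j); split; first exact: idealN.
  rewrite [in X in X = _]e hs rmorphD rmorphM -[x j.+1]/(b (x j)); ring.
have iI' := addI_ideal (y k) iI.
have /choice[F /choice[i /choice[b h]]] : forall c, exists F i b, I i /\ ecoef k F - c = i + b * y k.
  move=> x; have [|F /addIP[i [b [Ii e]]]] := IH (addI I (y k)) iI' _ x; last by exists F, i, b.
  move=> z; have [a [i [b [e [Ii ->]]]]] := hI z.
  exists a, (i + e ord_max * y k), b, (fun j => e (widen_ord (leqnSn k) j)).
  split; first by apply/addIP; exists i, (e ord_max).
  rewrite big_ord_recr /=; ring.
(* The successive remainders in the expansion of [d] by powers of [y k]. *)
pose x j := iter j (fun c => - b c) d.
have [s hs] := summable_pcst (l := k) (coef_sum k) (fun j => psmap alpha k (F (x j))).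
exists ((fun j => F (x j)) : powser (power_series A k)).
have -> : ecoef k.+1 (fun j => F (x j)) = evl ln coef_max coef_sum k (s 0%N).
  by rewrite -(@evtop_sum C n ln y coef_max coef_sum k (fun j => psmap alpha k (F (x j))) s hs).
apply: (closed_diff (z := y k) (u := fun j => evl ln coef_max coef_sum k (s j) - x j)) => //; first exact: coef_max.
move=> j; have [Ii e] := h (x j); exists (i (x j)); split=> //.
rewrite hs rmorphD rmorphM evl_cst -[x j.+1]/(- b (x j)).
rewrite -[evl _ _ _ _ (psmap _ _ _)]/(ecoef k (F (x j))) -[ecoef k _](subrK (x j)) e; ring.
Qed.
End CoefficientMaps.

Lemma prime_image (R T : ring) (g : R ~~> T) (P : set R) :
  surj g -> is_prime P -> (forall r, g r = 0 -> P r) ->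
  (forall r, (g @` P) (g r) <-> P r) /\ is_prime (g @` P).
move=> gs [[P0 PD PM] P1 PP] gk.
have gP r : (g @` P) (g r) <-> P r.
  split=> [[s Ps e]|Pr]; last by exists r.
  by rewrite -(subrK s r); apply: PD => //; apply: gk; rewrite rmorphB e subrr.
split=> //; split.
- split=> [|_ _ [x nx <-] [z nz <-]|a _ [x nx <-]].
  + by exists 0; rewrite ?rmorph0.
  + by exists (x + z); [exact: PD|rewrite rmorphD].
  + by have [b <-] := gs a; exists (b * x); [exact: PM|rewrite rmorphM].
- by rewrite -(rmorph1 g) gP.
- by move=> a b; have [x <-] := gs a; have [z <-] := gs b; rewrite -rmorphM !gP; exact: PP.
Qed.

Lemma pchain_preim (R T : ring) (g : R ~~> T) (P Q : set T) k :
  surj g -> pchain P Q k -> pchain (g @^-1` P) (g @^-1` Q) k.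
move=> gs; elim=> [pP|q q' j _ IH pq' qq' nq]; first by apply: pchain0; exact: prime_preim.
apply: (pchainS IH) => [|r|h]; [exact: prime_preim|exact: qq'|].
by apply: nq => t; have [r <-] := gs t; exact: h.
Qed.

Lemma pchain_image (R T : ring) (g : R ~~> T) (P Q : set R) k :
  surj g -> (forall r, g r = 0 -> P r) -> pchain P Q k ->
  pchain (g @` P) (g @` Q) k.
move=> gs gk; elim=> [pP|q q' j ch IH pq' qq' nq]; first by apply: pchain0; case: (prime_image gs pP gk).
have [_ pq Pq] := pchainP ch; have gq r : g r = 0 -> q r by move/gk/Pq.
have [h1 _] := prime_image gs pq gq.
have [_ h3] := prime_image gs pq' (fun r e => qq' _ (gq r e)).
apply: (pchainS IH h3) => [_ [r qr <-]|h]; first by exists r => //; exact: qq'.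
by apply: nq => r q'r; apply/h1/h; exists r.
Qed.

Lemma quot_factor (R T : ring) (I : set R) (g : R ~~> T) :
  (forall a, I a -> g a = 0) ->
  exists g' : quot_ring I ~~> T, forall x, g' (quot_class I x) = g x.
move=> gI; pose g0 (z : quot_ring I) := g (repr z).
have gE x : g0 (quot_class I x) = g x.
  apply/eqP; rewrite -subr_eq0 -rmorphB; apply/eqP.
  apply: (ideal_gen_sub (ker_ideal g) gI); apply/quot_classP; rewrite /quot_class reprK.
  by [].
have zm : zmod_morphism g0.
  by move=> a b; elim/quot_classW: a => a; elim/quot_classW: b => b; rewrite -rmorphB !gE rmorphB.
have mm : monoid_morphism g0.
  split; first by rewrite -(rmorph1 (quot_class I)) gE rmorph1.
  by move=> a b; elim/quot_classW: a => a; elim/quot_classW: b => b; rewrite -rmorphM !gE rmorphM.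
pose g' : quot_ring I ~~> T :=
  HB.pack g0 (GRing.isZmodMorphism.Build _ _ g0 zm) (GRing.isMonoidMorphism.Build _ _ g0 mm).
by exists g'.
Qed.

Lemma ideal_gen1 R (y a : R) : ideal_gen [set y] a <-> exists b, a = y * b.
split=> [|[b ->]]; last by apply: (idealM _ (ideal_genP _)); exact: sub_ideal_gen.
apply: (@ideal_gen_sub _ _ [set a | exists b, a = y * b]); last by move=> _ ->; exists 1; rewrite mulr1.
split=> [|_ _ [u ->] [v ->]|u _ [v ->]]; first by exists 0; rewrite mulr0.
  by exists (u + v); rewrite mulrDr.
by exists (u * v); rewrite mulrCA.
Qed.

Lemma quot1_ker R (y a : R) :
  quot_class [set y] a = 0 <-> exists b, a = y * b.
rewrite -(rmorph0 (quot_class [set y])); apply: iff_trans (quot_classP _ _ _) _.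
by rewrite subr0; exact: ideal_gen1.
Qed.

Lemma mulmA R (I J K L : finT) (A : I -> J -> R) (B : J -> K -> R)
  (C : K -> L -> R) i l : mulm A (mulm B C) i l = mulm (mulm A B) C i l.
rewrite /mulm (eq_bigr (fun j => \sum_k A i j * B j k * C k l)); last first.
  by move=> j _; rewrite mulr_sumr; apply: eq_bigr => k _; rewrite mulrA.
by rewrite exchange_big; apply: eq_bigr => k _; rewrite mulr_suml.
Qed.

Lemma mulm_rmap (R T : ring) (f : R ~~> T) (I J K : finT)
  (A : I -> J -> R) (B : J -> K -> R) i k :
  mulm (rmapM f A) (rmapM f B) i k = f (mulm A B i k).
by rewrite /mulm rmorph_sum; apply: eq_bigr => j _; rewrite rmorphM. Qed.

Lemma mact_eq R (M : lmod R) (I J : finT) (A B : I -> J -> R)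
  (v : {ffun I -> M}) : (forall i j, A i j = B i j) -> mact A v = mact B v.
by move=> e; apply/ffunP => j; rewrite !mactE; apply: eq_bigr => i _; rewrite e. Qed.

Lemma scale_mact R (M : lmod R) (I J : finT) (A : I -> J -> R) a
  (v : {ffun I -> M}) : a *: mact A v = mact (fun i j => a * A i j) v.
apply/ffunP => j; rewrite !ffunE scaler_sumr.
by apply: eq_bigr => i _; rewrite scalerA.
Qed.

(** * Resolutions over a hypersurface *)

Section Hypersurface.
Variables (B : ring) (x0 : B) (p1 : set B) (D : nat).
Hypotheses (nB : noetherian B)
  (x0B : nzd x0 B^o)
  (ip1 : is_ideal p1)
  (p1x0 : p1 x0).
Let A := quot_ring [set x0].
Let q : B ~~> A := quot_class [set x0].
Hypothesis glA : gl A D.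

Let qs (a : A) : exists b, q b = a.
by elim/quot_classW: a => b; exists b. Qed.

Let pA : set A := q @` p1.
Let pAq b : pA (q b) <-> p1 b.
split=> [[b' pb' e]|pb]; last by exists b.
have /quot1_ker[c ec] : q (b - b') = 0 by rewrite rmorphB e subrr.
by rewrite -(subrK b' b) ec; have [_ pD pM] := ip1; apply: pD => //; exact: idealM.
Qed.

Let hpA : @submod A A^o pA.
have [p0 pD pM] := ip1; split=> [|_ _ [b pb <-] [c pc <-]|a _ [b pb <-]].
- by exists 0; rewrite ?rmorph0.
- by exists (b + c); rewrite ?rmorphD //; exact: pD.
- by have [c <-] := qs a; exists (c * b); rewrite ?rmorphM //; exact: pM.
Qed.

Let cyclic_resolution : exists C : cplx A, [/\ pres (dx C 0) (qmod hpA),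
  forall i, syz (dx C i.+1) (dx C i),
  forall i, (D < i)%N -> C i.+1 -> False &
  exists u : C 0%N, (forall x, x = u) /\
  forall a, pA a <-> exists c : {ffun C 1%N -> A^o}, mact (dx C 0) c u = a].
have nA : noetherian A by exact: (noetherian_image qs).
have [I [A0 [pA0 pAE]]] := cyclic_pres hpA nA.
pose Pr i (I J : finT) (M : J -> I -> A) : Prop :=
  (i = 0%N -> exists u : I, (forall x, x = u) /\
  forall a, pA a <-> exists c : {ffun J -> A^o}, mact M c u = a) /\
  (if (i <= D)%N then fr (D - i) M else J -> False).
have [|||C [pC sC PC]] := @resolution_with A Pr _ _ A0 (qmod hpA).
- move=> i I' J' M [_]; case: leqP => iD; last first.
  move=> J0; exists void, (fun _ _ => 0); split; last first.
  by split=> //; rewrite leqNgt ltnS ltnW.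
  by apply: empty_syz => u _; apply/ffunP => j; case: (J0 j).
  case E : (D - i)%N => [|k] /= h.
  exists void, (fun _ _ => 0); split; first exact: empty_syz.
  by split=> //; rewrite leqNgt ltnS (_ : D = i) ?leqnn //; lia.
  have [L [M' [h1 h2]]] := h; exists L, M'; split=> //; split=> //.
  have -> : (i.+1 <= D)%N by lia.
  by have -> : (D - i.+1 = k)%N by lia.
- exact: pA0.
- by split=> [_|]; [exists tt; split=> [[]|a]|rewrite leq0n subn0; exact: glA].
exists C; split=> //.
  by move=> i Di; have [_] := PC i; rewrite leqNgt Di.
by have [h _] := PC 0%N; exact: h.
Qed.

(** A finite free resolution of [B / p1] over the quotient by [x0] is lifted entrywise to [B];
    doubling the lift gives a resolution of [B / p1] over [B] to which [euler_dbl] applies. *)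
Lemma dbl_resolution : exists (F : cplx B) (h : forall i, F i.+2 -> F i -> B) (N : nat),
  [/\ [/\ F 0%N -> False, F 1%N -> False & forall i, (N < i)%N -> F i -> False],
   (forall j x z, mulm (dx F j.+1) (dx F j) x z = x0 * h j x z) /\
   (forall j x z, mulm (dx F j.+2) (h j) x z = mulm (h j.+1) (dx F j) x z),
   forall i, mex (dx (dbl x0 h) i.+3) (dx (dbl x0 h) i.+2) B^o,
   exists u : F 2%N, (forall x, x = u) /\
  forall a, p1 a <-> exists w : {ffun dbl_rk F 3 -> B^o}, mact (dx (dbl x0 h) 2) w (inl u) = a &
   forall (T : ring) (f : B ~~> T), f x0 = 0 -> forall a i v, p1 a ->
  cyc (bcx f F) i v -> bnd (bcx f F) i (f a *: v)].
have [C [pC sC NC [u [uu uP]]]] := cyclic_resolution.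
pose FA := shift2 C; have cA i (M : lmod A) := @shift2_cpx A C sC i M.
(* The lifted matrices compose to zero modulo [x0] only, and [h] is the composite divided by
   [x0]. *)
pose F : cplx B := @Cplx B (fun i => FA i) (fun i x y => repr (dx FA i x y)).
have qF i x y : q (dx F i x y) = dx FA i x y by rewrite /q /= /quot_class reprK.
pose h j (x : F j.+2) (z : F j) := xget 0 [set c | mulm (dx F j.+1) (dx F j) x z = x0 * c].
have hP j x z : mulm (dx F j.+1) (dx F j) x z = x0 * h j x z.
  apply: (xgetPex 0 (P := [set c | mulm (dx F j.+1) (dx F j) x z = x0 * c])).
  apply/quot1_ker; rewrite -/(q _) -mulm_rmap.
  have := cA j (A^o) (unitv x (1 : A^o)); rewrite mact_mulm => /ffunP/(_ z).
  rewrite mactE ffunE (bigD1 x) //= ffunE eqxx big1 => [|y /negPf yx]; last by rewrite ffunE yx scaler0.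
  rewrite addr0 /GRing.scale /= mulr1 => e; rewrite -[RHS]e.
  by apply: eq_bigr => y _; rewrite /rmapM !qF.
(* Multiplied by [x0], both sides become the triple product of the differentials. *)
have hd j x z : mulm (dx F j.+2) (h j) x z = mulm (h j.+1) (dx F j) x z.
  apply/eqP; rewrite -subr_eq0; apply/eqP/x0B; rewrite -[_ *: _]/(x0 * _) mulrBr /mulm !mulr_sumr.
  apply/eqP; rewrite subr_eq0; apply/eqP.
  transitivity (mulm (dx F j.+2) (mulm (dx F j.+1) (dx F j)) x z).
  by apply: eq_bigr => y _; rewrite hP; ring.
  by rewrite mulmA; apply: eq_bigr => y _; rewrite hP; ring.
have act_dd j (v : {ffun F j.+2 -> B^o}) : mact (rmapM idfun (dx F j)) (mact (rmapM idfun (dx F j.+1)) v) =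
  x0 *: mact (rmapM idfun (h j)) v.
  by rewrite mact_mulm scale_mact; apply: mact_eq => x z; exact: hP.
have act_hd j (v : {ffun F j.+3 -> B^o}) : mact (rmapM idfun (h j)) (mact (rmapM idfun (dx F j.+2)) v) =
  mact (rmapM idfun (dx F j)) (mact (rmapM idfun (h j.+1)) v).
  by rewrite !mact_mulm; apply: mact_eq => x z; exact: hd.
exists F, h, (D.+3); split.
- split; [by case|by case|case=> [|[|i]] //= iN].
  by case: i iN => [|i] iN //; apply: NC; lia.
- by split.
(* The first component of a cycle is a cycle modulo [x0], hence can be removed by a boundary; the
   second component is then killed by the nonzerodivisor [x0]. *)
- move=> i v; have [gq1 gq2] := (qs, @quot1_ker B x0).
  set a := fstv v; set b := sndv v; rewrite (pairv_eta v) => e.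
  have e' := e; rewrite (dbl_act x0 h idfun) in e'.
  have [ea _] : mact (dx F i.+2) a + x0 *: b = 0 /\ - mact (h i.+1) a - mact (dx F i.+1) b = 0.
  by apply: pairv_inj; rewrite [LHS]e'; apply/ffunP => -[x|x]; rewrite !ffunE.
  have [w ew] : exists w, rvec q a = mact (dx FA i.+3) w.
  have [_ ex] := sC i; apply: ex; apply/ffunP => z.
  have := congr1 (fun v : {ffun F i.+2 -> B^o} => q (v z)) ea.
  rewrite !ffunE rmorphD rmorph0 rmorphM (_ : q x0 = 0) ?mul0r ?addr0; last first.
  by apply/quot1_ker; exists 1; rewrite mulr1.
  rewrite rmorph_sum => e1; rewrite -[RHS]e1; apply: eq_bigr => x _.
  by rewrite rmorphM qF ffunE.
  have [w' ew'] := rvec_surj gq1 w.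
  have [|z ez] := rvec0 gq2 (v := a - mact (dx F i.+3) w').
  rewrite rvecB ew -ew'; apply/eqP; rewrite subr_eq0; apply/eqP.
  by rewrite -rvec_mact; apply: mact_eq => x y; rewrite /rmapM qF.
  exists (pairv w' z); pose v' := pairv a b - mact (dx (dbl x0 h) i.+3) (pairv w' z).
  have cv' : mact (dx (dbl x0 h) i.+2) v' = 0.
  by rewrite mactB e (dbl_cpx (f := idfun) act_dd act_hd) subrr.
  have ev' : fstv v' = 0.
  rewrite /v' (dbl_act x0 h idfun); apply/ffunP => y; rewrite !ffunE.
  have := ffapp y ez; rewrite !ffunE => ezy.
  by rewrite opprD addrA ezy subrr.
  suff bz : sndv v' = 0.
  apply/eqP; rewrite -subr_eq0 -/v' (pairv_eta v') ev' bz; apply/eqP/ffunP => -[y|y]; by rewrite !ffunE.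
  move: cv'; rewrite {1}(pairv_eta v') ev' (dbl_act x0 h idfun) mact0 add0r => cv'.
  apply/ffunP => y; rewrite [RHS]ffunE; apply: x0B.
  by have := ffapp (inl y) cv'; rewrite !ffunE.
- exists u; split=> // a; split=> [pa|[w <-]].
  have /uP[c ec] := (pAq a).2 pa.
  have [c' ec'] := rvec_surj qs c.
  have /quot1_ker[b eb] : q (a - mact (dx F 2) c' u) = 0.
  apply/eqP; rewrite rmorphB subr_eq0 -ec -ec'; apply/eqP; rewrite !mactE rmorph_sum.
  by apply: eq_bigr => x _; rewrite rmorphM qF ffunE.
  exists (pairv c' [ffun=> b]); rewrite (dbl_act x0 h idfun) !ffunE -mactE.
  by rewrite -[X in _ + X]/(x0 * b) -eb addrC subrK.
  rewrite (pairv_eta w) (dbl_act x0 h idfun) !ffunE; have [_ pD pM] := ip1; apply: pD; last exact: idealM.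
  apply/pAq/uP; exists (rvec q (fstv w)); rewrite mactE rmorph_sum; apply: eq_bigr => x _.
  by rewrite rmorphM qF !ffunE.
(* As [f] kills [x0], it factors through the quotient, where elements of [p1] are homotopic to zero
   on the resolution. *)
move=> T f fx0 a i v pa.
have [f' f'q] := quot_factor (I := [set x0]) (g := f) (fun b e => eq_ind_r (fun z => f z = 0) fx0 e).
have [s hs] : exists s, @chtpy A FA (q a) s.
  apply: (shift2_chtpy sC pC) => k; have [c <-] := qmodS k.
  by rewrite -linearZ; apply/qmod_pi0; rewrite -[_ *: _]/(q a * c) mulrC; have [_ _ Z] := hpA; apply: Z; apply/pAq.
case: i v => [|i] v cv.
  rewrite (_ : v = 0) ?scaler0; first by case: (bnd_submod (bcx f F) 0).
  by apply/ffunP => -[].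
have eF k (w : {ffun F k.+1 -> T^o}) : mact (rmapM f (dx F k)) w = mact (rmapM f' (dx FA k)) w.
  by apply: mact_eq => x y; rewrite /rmapM -f'q -/(q _) qF.
have cv' : mact (rmapM f (dx F i.+1)) v = 0 := cv.
have e : mact (rmapM f' (dx FA i.+2)) (mact (rmapM f' (s i.+1)) v) = f' (q a) *: v.
  have := @chtpyE A FA (q a) s (resc f' T^o) i v hs.
  rewrite [mact (s i) _]resc_mact [mact (dx FA i.+1) _]resc_mact.
  rewrite -[mact (rmapM f' (dx FA i.+1)) _]eF cv' mact0 addr0 => e; rewrite -[RHS]e.
  by rewrite !resc_mact.
exists (mact (rmapM f' (s i.+1)) v) => //; rewrite -f'q -[RHS]e.
exact: eF.
Qed.
End Hypersurface.

Lemma preim_ideal (R T : ring) (g : R ~~> T) (I : set T) :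
  is_ideal I -> is_ideal (g @^-1` I).
move=> [I0 ID IM]; split=> [|a b|a b]; rewrite /preimage /=.
- by rewrite rmorph0.
- by rewrite rmorphD; exact: ID.
- by rewrite rmorphM; exact: IM.
Qed.

Lemma pars_image (R T : ring) (g : R ~~> T) (n J : set R) (n' J' : set T) t ts :
  (forall x, n' x -> exists2 y, n y & g y = x) -> is_ideal J' ->
  (forall x, J x -> J' (g x)) -> g t = 0 -> pars n J (t :: ts) -> pars n' J' (map g ts).
move=> hn iJ' hJ gt [k hk]; exists k.
have iF (r : seq T) (I : set T) : is_ideal I -> is_ideal (foldl (@addI T) I r).
  by elim: r I => //= u r IH I iI; apply: IH; exact: addI_ideal.
have iF' := iF (map g ts) J' iJ'; have [F0 FD FM] := iF'.
apply: ideal_gen_sub => // _ [s [ss sn ->]].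
have [s' [ss' sn' es']] : exists s', [/\ size s' = size s, forall a, a \in s' -> n a & map g s' = s].
  elim: s sn {ss} => [|x s IH] sn; first by exists [::].
  have [|s' [h1 h2 h3]] := IH; first by move=> a as'; apply: sn; rewrite inE as' orbT.
  have [y ny ey] := hn x (sn _ (mem_head _ _)).
  exists (y :: s'); split; [by rewrite /= h1|move=> a|by rewrite /= h3 ey].
  by rewrite inE => /orP[/eqP ->|/h2].
rewrite -es' big_map -rmorph_prod.
have /hk : ideal_exp n k (\prod_(a <- s') a).
  by apply: sub_ideal_gen; exists s'; split=> //; rewrite ss'.
have mem u : u \in ts -> foldl (@addI T) J' (map g ts) (g u).
  elim: ts J' iJ' {hk hJ iF' F0 FD FM} => //= v r IH I iI; rewrite inE => /orP[/eqP ->|ur].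
  by apply: foldl_addI_sub; exact: addI_mem.
  by apply: IH => //; exact: addI_ideal.
have ipre : is_ideal (g @^-1` foldl (@addI T) J' (map g ts)).
  exact: preim_ideal.
apply: (foldl_addI_min (I := g @^-1` foldl (@addI T) J' (map g ts)) (ts := t :: ts) ipre) => [x /hJ|u].
  exact: foldl_addI_sub.
by rewrite inE => /orP[/eqP ->|/mem //]; rewrite /preimage /= gt.
Qed.

Lemma chtpy_bc (R T : ring) (f : R ~~> T) (G : cplx R) a s :
  chtpy (G := G) a s -> chtpy (G := bcx f G) (f a) (fun i => rmapM f (s i)).
by move=> hs i v; have := @chtpyE R G a s (resc f T^o) i v hs; rewrite !resc_mact. Qed.

Lemma dbl_cpx_mat (R T : ring) (F : cplx R) (x0 : R) (h : forall i, F i.+2 -> F i -> R)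
  (f : R ~~> T) (M : lmod T) j :
  (forall j x z, mulm (dx F j.+1) (dx F j) x z = x0 * h j x z) ->
  (forall j x z, mulm (dx F j.+2) (h j) x z = mulm (h j.+1) (dx F j) x z) ->
  mcpx (rmapM f (dx (dbl x0 h) j.+1)) (rmapM f (dx (dbl x0 h) j)) M.
move=> dd hd; apply: dbl_cpx => k v; rewrite !mact_mulm ?scale_mact; apply: mact_eq => x z.
  by rewrite mulm_rmap dd rmorphM.
by rewrite !mulm_rmap hd.
Qed.

Lemma flat_mex (R T : ring) (f : R ~~> T) (n : set T) (I J K : finT)
  (P : I -> J -> R) (Q : J -> K -> R) : flat f -> lring n ->
  mex P Q R^o -> mex (rmapM f P) (rmapM f Q) T^o.
move=> ff [nT pn un] ex; have [_ n1 _] := pn.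
apply: (fbc_mex ff pn un (p := f @^-1` n) _ P Q).1 => // v /ex[u e].
by exists 1; split; [rewrite /preimage /= rmorph1|exists u; rewrite scale1r].
Qed.

(** * Specializing all variables *)

Section EulerIterated.
Variables (B D : ring) (n : set D) (ln : lring n) (y : nat -> D).
Hypotheses (ny : forall i, n (y i))
  (sy : forall i, summable (y i)).
Variables (G : cplx B) (p1 : set B) (N : nat).
Hypotheses (G1 : G 1%N -> False)
  (GN : G N -> False)
  (cG : forall (T : ring) (f : B ~~> T) i (M : lmod T),
  mcpx (rmapM f (dx G i.+1)) (rmapM f (dx G i)) M)
  (hG : forall a, p1 a -> exists s, chtpy (G := G) a s).

(** The variables are specialized one at a time; each step consumes one parameter [X - y] through
    [euler_step], until none is left. *)
Lemma euler_tsl k (b : B ~~> power_series D k) :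
  pars (pco D k @^-1` n) (ideal_gen (b @` p1)) (tsl y k) ->
  euler (bcx b G) (tsl y k) N = euler (bcx (evl ln ny sy k \o b) G) [::] N /\
  pars n (ideal_gen ((evl ln ny sy k \o b) @` p1)) [::].
elim: k b => [|k IH] b fin; first by split.
have lk := mps_lring k ln; have lk1 := mps_lring k.+1 ln.
have nk : noetherian (power_series D k) by case: lk.
pose g := evtop ln ny sy k.
have gc c : g (pconst c) = c by apply: (@evtop_eq D n ln y ny sy k _ _ 0); rewrite mulr0 addr0.
have gs c : exists a, g a = c by exists (pconst c).
have gk r : g r = 0 <-> exists a, r = ttop y k * a by exact: evalm_ker.
have mg : map g (map (@pconst _) (tsl y k)) = tsl y k.
  by rewrite -map_comp -[RHS]map_id; apply: eq_map => c; exact: gc.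
have fin' : pars (pco D k @^-1` n) (ideal_gen ((g \o b) @` p1)) (tsl y k).
  rewrite -mg; apply: (pars_image _ (ideal_genP _) _ _ fin) => [x nx|x|].
  - by exists (pconst x) => //; exact: gc.
  - apply: (ideal_gen_sub (preim_ideal g (ideal_genP ((g \o b) @` p1)))).
  by move=> _ [z pz <-]; apply: sub_ideal_gen; exists z.
  by apply/gk; exists 1; rewrite mulr1.
have [e1 e2] := IH (g \o b) fin'; split; last exact: e2.
rewrite [RHS](_ : _ = euler (bcx (evl ln ny sy k \o (g \o b)) G) [::] N) // -e1.
rewrite [LHS](euler_step lk1 gs gk _ (G := bcx b G) (J0 := b @` p1)) ?mg //.
- by apply: (eval_nzd nk (y := pcst D k (y k))) => b0; exact: (pcst_rad ln ny).
- by move=> i M; exact: cG.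
by move=> _ [a pa <-]; have [s hs] := hG pa; exists (fun i => rmapM b (s i)); exact: chtpy_bc.
Qed.
End EulerIterated.

(** Modulo all the variables, the quotient is [V] modulo the constant term of [x], a field by the
    last hypothesis; [gl_lift] restores the variables one at a time. *)
Lemma gl_hypersurface (V : ring) l (x : power_series V l) : noetherian V ->
  nzd (pco V l x) V^o -> (forall a, (exists b, a = pco V l x * b) \/ exists b, b * a = 1) ->
  nzd x (power_series V l)^o /\ gl (quot_ring [set x]) l.+1.
move=> nV; elim: l x => [|l IH] x nx hx.
  split=> //; apply: gl_field; last first.
  by apply: (@noetherian_image _ _ (quot_class [set x])) nV => t; elim/quot_classW: t => a; exists a.
  elim/quot_classW=> a; have [[b e]|[b e] _] := hx a.
  by move=> []; apply/quot1_ker; exists b.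
  by exists (quot_class _ b); rewrite -rmorphM e rmorph1.
have [nx' gl'] := IH (pcoef0 x) nx hx.
have nP : noetherian (powser (power_series V l)) by exact: (@mps_noetherian V l.+1).
(* The variable is a nonzerodivisor modulo [x], because the constant term of [x] is a
   nonzerodivisor. *)
have X0 (F G : powser (power_series V l)) : pX (power_series V l) * F = (x : powser (power_series V l)) * G ->
  exists2 G', G = pX (power_series V l) * G' & F = (x : powser (power_series V l)) * G'.
  move=> e; have /pcoef0_ker[G' eG] : pcoef0 G = 0.
  have e0 : 0 = pcoef0 x * pcoef0 G.
  transitivity (pcoef0 (pX (power_series V l) * F)); first by rewrite /pcoef0 pXM0.
  by rewrite e rmorphM.
  by apply: nx'; exact: (esym e0).
  exists G' => //; apply/eqP; rewrite -subr_eq0; apply/eqP/pX_nzd.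
  by rewrite -[_ *: _]/(_ * _) mulrBr e eG; ring.
split.
  move=> F e; apply: funext => k; elim: k F e => [|k IHk] F e.
  by apply: nx'; have := congr1 (@pcoef0 _) e; rewrite -[_ *: F]/(x * F) rmorphM rmorph0.
  have [|G eG _] := X0 0 F; first by rewrite mulr0; exact: (esym e).
  rewrite eG pXMS; apply: IHk; apply: pX_nzd; rewrite -[RHS]e eG.
  exact: (mulrCA (pX _) (x : powser _) G).
have [|g gE] := @quot_factor _ _ [set x] (quot_class [set pcoef0 x] \o @pcoef0 (power_series V l)).
  by move=> _ -> /=; apply/quot1_ker; exists 1; rewrite mulr1.
apply: (@gl_lift _ _ g (quot_class [set x] (@pX _))) gl'.
- by elim/quot_classW=> a; exists (quot_class [set x] (pconst a)); rewrite gE.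
- elim/quot_classW=> F; rewrite gE /=; split=> [/quot1_ker[c ec]|[a]].
  have /pcoef0_ker[G eG] : pcoef0 (F - x * pconst c) = 0.
  have e2 : pcoef0 F - pcoef0 x * c = 0 by rewrite ec subrr.
  by rewrite rmorphB rmorphM; exact: e2.
  exists (quot_class _ G); rewrite -rmorphM -eG rmorphB.
  have z : quot_class [set x] (x * pconst c) = 0 by apply/quot1_ker; exists (pconst c).
  apply: esym; apply: etrans (subr0 _); congr (_ - _); exact: z.
  elim/quot_classW: a => G; rewrite -rmorphM => e.
  have /quot1_ker[H eH] : quot_class [set x] (F - pX _ * G) = 0.
  by apply: etrans (rmorphB _ _ _) _; apply/eqP; rewrite subr_eq0; apply/eqP; exact: e.
  apply/quot1_ker; exists (pcoef0 H).
  transitivity (pcoef0 (F - pX _ * G)); last by rewrite eH; exact: rmorphM.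
  by rewrite /pcoef0 -[RHS]/(F 0%N - (pX (power_series V l) * G) 0%N) pXM0 subr0.
- elim/quot_classW=> F; rewrite -[_ *: _]/(_ * _) -rmorphM => /quot1_ker[G /X0[G' _ ->]].
  by apply/quot1_ker; exists G'.
- elim/quot_classW=> F; have [c e] := ps_geometric F; exists (quot_class _ c).
  apply: etrans (etrans (congr1 (quot_class [set x]) e) (rmorph1 _)); symmetry.
  apply: etrans (rmorphM _ _ _) _; congr (_ * _); apply: etrans (rmorphB _ _ _) _.
  by congr (_ - _); exact: rmorphM.
by apply: (@noetherian_image _ _ (quot_class [set x])) nP => t; elim/quot_classW: t => a; exists a.
Qed.

(** * Reduction to the diagonal *)

Section ChainBound.
Variables (A C D : ring) (pi : A) (alpha : A ~~> C) (n : set C).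
Variables (l : nat) (y : nat -> C) (h : C ~~> D) (P S : set C) (a b : nat).
Hypotheses (cA : coef_ring pi)
  (cC : coef_map pi alpha n l y)
  (hs : surj h)
  (pP : is_prime P)
  (pP' : is_prime [set c | h c = 0])
  (meet : forall Q, is_prime Q -> P `<=` Q -> (forall c, h c = 0 -> Q c) -> Q = n)
  (fl : flat (h \o alpha))
  (hP : pchain P n a)
  (hS : pchain S n b)
  (SP : forall c, h c = 0 -> S c)
  (Spi : S (alpha pi)).

Let ln : lring n. exact: (coef_lring cC). Qed.
Let kn c : h c = 0 -> n c.
exact: (@lring_sub _ n _ ln pP'). Qed.
Let nA := [set a | exists b, a = pi * b].
Let lA : lring nA. by case: cA. Qed.
Let lD : lring (h @` n). by have [] := lring_image ln hs kn. Qed.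
Let hn c : (h @` n) (h c) <-> n c. by have [_] := lring_image ln hs kn; exact. Qed.
Let nyD i : (h @` n) (h (y i)). by apply/hn; exact: (coef_max cC). Qed.
Let syD i : summable (h (y i)). exact: (summable_quot hs (coef_sum cC i)). Qed.
Let L := power_series D l.
Let nL : noetherian L. by apply: mps_noetherian; case: lD. Qed.

Definition bcoef : power_series A l ~~> power_series D l := psmap (h \o alpha) l.
Definition nps : set (power_series D l) := pco D l @^-1` (h @` n).
Definition tps : seq (power_series D l) := tsl (fun i => h (y i)) l.
(** It generates the extension of the inverse image of [P] to series over [D]; modulo [tps], which
    cuts out the diagonal, this ideal becomes the image of [P] in [D]. *)
Definition jps : set (power_series D l) := bcoef @` (ecoef cC l @^-1` P).

Lemma lring_nps : lring nps. exact: mps_lring. Qed.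

Lemma size_tps : size tps = l. exact: size_tsl. Qed.

Lemma tps_max t : t \in tps -> nps t.
exact: tsl_max. Qed.

Let ev : L ~~> D := evl lD nyD syD l.

Lemma ev_bcoef F : ev (bcoef F) = h (ecoef cC l F).
rewrite /ev /bcoef psmap_comp.
exact: (evl_natural (h := h) (coef_lring cC) lD (coef_max cC) nyD (coef_sum cC) syD). Qed.

(** A prime over [jps] and [tps] contracts, through constants, to a prime of [C] containing [P] and
    the kernel of [h], which is [n] by [meet]; so it contains the maximal ideal. *)
Lemma pars_tps : pars nps (ideal_gen jps) tps.
have [_ pn _] := lring_nps.
have iF : is_ideal (foldl (@addI L) (ideal_gen jps) tps).
  have := ideal_genP jps; elim: tps (ideal_gen jps) => //= t ts IH I iI.
  by apply: IH; exact: addI_ideal.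
apply: (ideal_exp_primes nL iF) => Q pQ FQ F nF.
have iQ := primeI pQ; have [Q0 QD QM] := iQ.
have JQ : ideal_gen jps `<=` Q by apply: subset_trans FQ; exact: foldl_addI_sub.
have tQ t : t \in tps -> Q t.
  move=> tt; apply: FQ; move: tt {JQ iF}; elim: tps (ideal_gen jps) (ideal_genP jps) => //= u ts IH I iI.
  rewrite inE => /orP[/eqP ->|]; last by apply: IH; exact: addI_ideal.
  by apply: foldl_addI_sub; exact: addI_mem.
have ker G : ev G = 0 -> Q G by exact: (evl_ker (ln := lD)).
have evc d : ev (pcst D l d) = d by exact: evl_cst.
pose Q' := (pcst D l \o h) @^-1` Q.
have Qn : Q' = n.
  apply: meet => [|c Pc|c hc]; first exact: prime_preim.
  have [G eG] := ecoef_surj cA cC c.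
  rewrite /Q' /preimage /= -(subrK (bcoef G) (pcst D l (h c))); apply: QD.
  by apply: ker; rewrite rmorphB ev_bcoef evc eG subrr.
  have PG : P (ecoef cC l G) by rewrite eG.
  by apply: JQ; apply: sub_ideal_gen; exists G.
  by rewrite /Q' /preimage /= hc rmorph0.
have /(evl_max lD nyD syD)[c nc ec] := nF.
rewrite -(subrK (pcst D l (h c)) F); apply: QD; last by move: nc; rewrite -Qn.
by apply: ker; rewrite rmorphB evc -ec subrr.
Qed.

(** Two chains are spliced at the prime of series with constant term in [h S]. The chain from [S]
    continues above it. Below it, going down lifts the chain from [P], since this prime contracts to
    the maximal ideal of the series over [A], as [S] contains [alpha pi]. *)
Lemma chain_nps : exists P1, ideal_gen jps `<=` P1 /\ pchain P1 nps (a + b).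
have [pS _ _] := pchainP hS; have [_ pD _] := lD.
have nAS (I : set C) : is_prime I -> I (alpha pi) -> forall x, I (alpha x) <-> nA x.
  move=> [iI I1 _] Ipi x; split=> [Ix|[z ->]]; last by rewrite rmorphM; exact: idealM.
  have [_ _ un] := lA; apply: contrapT => /un[z e]; apply: I1.
  by rewrite -(rmorph1 alpha) -e rmorphM; exact: idealMl.
have [hSb pSb] := prime_image hs (let: And3 x _ _ := pchainP hS in x) SP.
have chS : pchain (pco D l @^-1` (h @` S)) nps b.
  by apply: (@pchain_preim _ _ (pco D l)) (pchain_image hs SP hS) => d; exists (pcst D l d); exact: pco_cst.
have eB : bcoef @^-1` (pco D l @^-1` (h @` S)) = pco A l @^-1` nA.
  apply/seteqP; split=> F; rewrite /preimage /= pco_psmap /=.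
  by move/hSb => SF; exact: ((nAS S pS Spi _).1 SF).
  by move=> nF; apply/hSb; exact: ((nAS S pS Spi _).2 nF).
have [_ pn _] := ln; have [_ _ _ npi _] := cC.
have eC : ecoef cC l @^-1` n = pco A l @^-1` nA.
  apply/seteqP; split=> F; rewrite /preimage /=.
  by move/evl_max; rewrite pco_psmap => /(nAS n pn npi).
  by move=> nF; apply/evl_max; rewrite pco_psmap; apply/(nAS n pn npi).
have chB := pchain_preim (ecoef_surj cA cC) hP; rewrite eC in chB.
have flb : flat bcoef by apply: flat_psmap fl _ _; [case: lA|case: lD].
have pQ : is_prime (pco D l @^-1` (h @` S)) by exact: prime_preim.
have [P1 [e1 ch1]] := going_down_chain flb nL pQ eB chB.
exists P1; split; last exact: pchain_cat ch1 chS.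
have [/primeI iP1 _ _] := pchainP ch1.
by apply: ideal_gen_sub => // _ [F PF <-]; move: PF; rewrite -e1.
Qed.

Lemma chain_bound : (a + b <= l)%N.
have [P1 [JP1 ch]] := chain_nps; rewrite -size_tps.
apply: (pars_chain lring_nps pars_tps JP1 ch); exact: tps_max.
Qed.

Hypotheses (domA : domain A)
  (pi0 : pi <> 0)
  (pi2 : ideal_exp n 2 (alpha pi)).

Let B := power_series A l.
Let e : B ~~> C := ecoef cC l.
Let bb : B ~~> power_series D l := bcoef.
Let noA : noetherian A. by case: cA => -[]. Qed.
Let nB : noetherian B. exact: mps_noetherian. Qed.
Let lL : lring nps. exact: lring_nps. Qed.
Let fin : pars nps (ideal_gen jps) tps. exact: pars_tps. Qed.
Let flb : flat bb. by apply: flat_psmap fl noA _; case: lD. Qed.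

Lemma e_const x : e (pcst A l x) = alpha x.
by rewrite /e /ecoef /= psmap_cst evl_cst. Qed.

(* the maximal ideal of [C] lifts to series with constant term in [(pi)] *)
Lemma e_max c : n c -> exists F z, e F = c /\ pco A l F = pi * z.
have [F eF] := ecoef_surj cA cC c; rewrite -eF => /evl_max; rewrite pco_psmap => hF.
have [_ _ unA] := lA; have [_ [iN n1 _] _] := ln.
have [z ez] : exists z, pco A l F = pi * z.
  apply: contrapT => /unA[z ez]; apply: n1; rewrite -(rmorph1 alpha) -ez rmorphM.
  exact: idealMl.
by exists F, z.
Qed.

(** When [alpha pi] is in [n^2], it has a second lift besides the constant [pi], with constant term
    divisible by [pi * pi]; the difference of the two lifts is the equation of the hypersurface. *)
Lemma pi_lift : exists f z, e f = alpha pi /\ pco A l f = pi * pi * z.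
apply: (ideal_gen_sub (J := [set c | exists f z, e f = c /\ pco A l f = pi * pi * z]) _ _ pi2).
  split=> [|_ _ [f [z [<- ef]]] [g [w [<- eg]]]|u _ [f [z [<- ef]]]].
  - by exists 0, 0; rewrite !rmorph0 mulr0.
  - by exists (f + g), (z + w); rewrite !rmorphD ef eg mulrDr.
  have [g <-] := ecoef_surj cA cC u; exists (g * f), (pco A l g * z); rewrite !rmorphM ef.
  by split=> //; ring.
move=> _ [s [ss un ->]]; case: s ss un => [|u [|v [|]]] //= _ un.
have [f [z [<- ef]]] : exists F z, e F = u /\ pco A l F = pi * z by apply/e_max/un; rewrite inE eqxx.
have [g [w [<- eg]]] : exists F z, e F = v /\ pco A l F = pi * z by apply/e_max/un; rewrite !inE eqxx orbT.
exists (f * g), (z * w); rewrite !big_cons big_nil mulr1 !rmorphM ef eg.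
by split=> //; ring.
Qed.

(** Equality would make the multiplicity of the series over [D] modulo [jps] positive. Up to sign it
    is the Euler characteristic of a doubled resolution, which specializes to 0 over [D]. *)
Lemma chain_bound_strict : (a + b < l)%N.
have ab := chain_bound.
move: ab; rewrite leq_eqVlt => /orP[/eqP ab|//]; exfalso.
have [P1 [JP1 ch]] := chain_nps.
(* [x0] is in the kernel of [e], and its constant term is [pi] times a unit, so that the quotient by
   [x0] has finite global dimension. *)
have [f [w [ef pf]]] := pi_lift; pose x0 : B := pcst A l pi - f.
have ex0 : e x0 = 0 by rewrite rmorphB e_const ef subrr.
have px0 : pco A l x0 = pi * (1 - pi * w) by rewrite rmorphB pco_cst pf; ring.
have [_ _ unA] := lA.
have [u hu] : exists u, u * (1 - pi * w) = 1.
  have npi : [set a0 : A | exists b0, a0 = pi * b0] pi by exists 1; rewrite mulr1.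
  by have [u hu] := mulr_unit1 w lA npi; exists u; rewrite [pi * w]mulrC.
have [nx0 glx] : nzd x0 B^o /\ gl (quot_ring [set x0]) l.+1.
  apply: gl_hypersurface => //.
  move=> z; rewrite px0 -[_ *: z]/(_ * z) -mulrA => /domA[//|] /(congr1 (fun v => u * v)).
  by rewrite mulr0 mulrA hu mul1r.
  move=> z; have [nz|/unA[v hv]] := pselect (exists v, z = pi * v); last by right; exists v.
  left; have [v ->] := nz; exists (u * v); rewrite px0.
  by transitivity (pi * v * (u * (1 - pi * w))); [rewrite hu mulr1|ring].
pose p1 : set B := e @^-1` P.
have ip1 : is_ideal p1 by apply: preim_ideal; exact: primeI.
have p1x0 : p1 x0 by have : P (e x0) by rewrite ex0; case: (primeI pP).
have [F [hh [N [[F0 F1 FN] [dd hd] exG [u0 [uu uP]] killF]]]] := dbl_resolution nB nx0 ip1 p1x0 glx.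
pose G := dbl x0 hh.
have G1 : G 1%N -> False by case.
have GN : G N.+2 -> False by case=> [z|z]; [apply: (FN N.+2)|apply: (FN N.+1)].
have cG (T : ring) (g : B ~~> T) i (M : lmod T) :
  mcpx (rmapM g (dx G i.+1)) (rmapM g (dx G i)) M by exact: dbl_cpx_mat.
have hG x : p1 x -> exists s, chtpy (G := G) x s.
  move=> px; apply: acyclic_chtpy => //; first by move=> i M; exact: (cG B idfun i M).
  move=> v; have /uP[w' ew'] : p1 (x * v (inl u0)) by exact: idealM.
  exists w'; apply/ffunP => -[z|z]; last by case: (F1 z).
  by rewrite [z]uu ew' ffunE.
have [eul fin0] := euler_tsl lD nyD syD G1 GN cG hG fin.
pose f0 : B ~~> D := evl lD nyD syD l \o bb.
have f0x0 : f0 x0 = 0.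
  transitivity (h (e x0)); last by rewrite ex0 rmorph0.
  rewrite -[f0 x0]/(evl lD nyD syD l (psmap (h \o alpha) l x0)) psmap_comp.
  exact: (evl_natural (h := h) (coef_lring cC) lD (coef_max cC) nyD (coef_sum cC) syD).
have kill0 (GG : cplx D) : (forall z i v, p1 z -> cyc GG i v -> bnd GG i (f0 z *: v)) ->
  forall i z v, ideal_gen (f0 @` p1) z -> cyc GG i v -> bnd GG i (z *: v).
  move=> hk i z v Jz cv; have iA := ideal_annP (cyc_submod GG i) (bnd_submod GG i).
  apply: (ideal_gen_sub iA _ Jz) => // _ [x px <-] v' cv'; exact: hk.
have killc (T : ring) (g : B ~~> T) z i v : p1 z -> cyc (bcx g G) i v -> bnd (bcx g G) i (g z *: v).
  move=> /hG[s hs']; have hsg := chtpy_bc (f := g) hs'; case: i v => [|i] v cv.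
  by rewrite (_ : v = 0) ?scaler0; [case: (bnd_submod (bcx g G) 0)|apply/ffunP => x; case: (G1 x)].
  by rewrite -(hsg i v) cv mact0 addr0; eexists.
have z0 : euler (bcx f0 G) [::] N.+2 = 0.
  apply: (euler_dbl lD (ideal_genP (f0 @` p1)) fin0 f0x0) => //.
  - move=> j v; rewrite mact_mulm (mact_eq (B := fun _ _ => 0)) => [|x z].
  by apply/ffunP => z; rewrite !ffunE big1 // => x _; rewrite scale0r.
  by rewrite mulm_rmap dd rmorphM f0x0 mul0r.
  - by move=> j v; rewrite !mact_mulm; apply: mact_eq => x z; rewrite !mulm_rmap hd.
  - by apply: kill0; exact: killF.
  - by apply: kill0; exact: killc.
  - by apply: FN; lia.
  by apply: FN; lia.
move: eul; rewrite z0.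
have fW i : fg ({ffun bcx bb G i.+1 -> (power_series D l)^o} : lmod (power_series D l)).
  exact: fg_vec (fg_ring _).
(* By flatness the only homology left is at index 1, where [G 2] has the single element [inl u0]: it
   is the quotient by the ideal of [jps]. *)
have Gex i : i <> 1%N -> cyc (bcx bb G) i = bnd (bcx bb G) i.
  case: i => [_|[//|i] _].
  have z v : v = 0 :> {ffun bcx bb G 1 -> (power_series D l)^o} by apply/ffunP => x; case: (G1 x).
  apply/seteqP; split=> v _; rewrite (z v).
  by case: (bnd_submod (bcx bb G) 0).
  by case: (cyc_submod (bcx bb G) 0).
  apply/seteqP; split=> [v cv|_ [v _ <-]]; last exact: cG.
  have [v' ->] := flat_mex flb lL (exG i) cv; by exists v'.
rewrite /euler (bigD1 (Ordinal (isT : (1 < N.+2)%N))) //= big1 ?addr0; last first.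
  move=> [i iN] /= i1; rewrite Gex; first by rewrite (mult_xx lL (fW i)) ?mulr0 //; exact: bnd_submod.
  by move=> e1; move: i1; rewrite -val_eqE /= e1.
rewrite expr1 mulN1r => /eqP; rewrite oppr_eq0 => /eqP m0.
have iJ := ideal_genP jps.
have YX : bnd (bcx bb G) 1 `<=` cyc (bcx bb G) 1 by move=> _ [v _ <-]; exact: cG.
have tm t : t \in tps -> nps t by exact: tps_max.
have kl z v : ideal_gen jps z -> cyc (bcx bb G) 1 v -> bnd (bcx bb G) 1 (z *: v).
  move=> Jz cv; have iA := ideal_annP (cyc_submod (bcx bb G) 1) (bnd_submod (bcx bb G) 1).
  by apply: (ideal_gen_sub iA _ Jz) => // _ [x px <-] v' cv'; exact: killc.
have [_ pos] := mult_pos lL (fW 1%N) iJ fin tm (cyc_submod _ 1) (bnd_submod _ 1) YX kl.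
have : 0 < mult (tps) (cyc (bcx bb G) 1) (bnd (bcx bb G) 1).
  apply: (pos P1); first by have -> : size (tps) = (a + b)%N by rewrite size_tps.
  move=> z /(_ (unitv (inl u0) (1 : (power_series D l)^o)))[|w' _ ew'].
  by apply/ffunP => -[].
  apply: JP1; have -> : z = mact (rmapM bb (dx G 2)) w' (inl u0).
  by rewrite -[mact _ _]/(mact (dx (bcx bb G) 2) w') ew' !ffunE eqxx -[_ *: _]/(z * 1) mulr1.
  rewrite mactE; apply: (@submod_sum (power_series D l) (power_series D l)^o _ iJ) => x _.
  apply: (idealM _ iJ); apply: sub_ideal_gen; exists (dx G 2 x (inl u0)) => //.
  apply/uP; exists (unitv x (1 : B^o)); rewrite mactE (bigD1 x) //= ffunE eqxx big1 => [|y' /negPf yx].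
  by rewrite addr0 -[_ *: _]/(_ * 1) mulr1.
  by rewrite ffunE yx scaler0.
by rewrite [mult _ _ _]m0.
Qed.
End ChainBound.

(** Only injectivity is left to [flat_valuation]: an element killed by [h] is a multiple of [pi].
    Unless [pi] is 0, the cofactor is killed too, and Krull's intersection theorem concludes. *)
Lemma flat_coef (A D : ring) (pi : A) (h : A ~~> D) : coef_ring pi ->
  (domain D) -> (1 : D) <> 0 ->
  (pi = 0 \/ h pi <> 0) -> flat h.
move=> [lA _ val] dom D1 hpi; have [nA [_ n1 _] unA] := lA; apply: flat_valuation => // x hx.
have unit0 z : h z = 0 -> exists w, z = pi * w.
  move=> hz; apply: contrapT => /unA[w e]; apply: D1.
  by rewrite -(rmorph1 h) -e rmorphM hz mulr0.
case: hpi => [p0|np]; first by have [w ->] := unit0 x hx; rewrite p0 mul0r.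
apply: (krull_power (I := [set 0]) (y := pi) nA) => [|b|k].
- by split=> [|a b -> ->|a b ->] //=; rewrite ?addr0 ?mulr0.
- apply: (mulr_unit1 b lA).
  by exists 1; rewrite mulr1.
exists 0, (xget 0 [set w | x = pi ^+ k * w]); split=> //; rewrite add0r.
apply: (xgetPex 0 (P := [set w | x = pi ^+ k * w])).
suff [w [e _]] : exists w, x = pi ^+ k * w /\ h w = 0 by exists w.
elim: k => [|k [w [ew hw]]]; first by exists x; rewrite mul1r.
have [v ev] := unit0 w hw; exists v; rewrite exprSr -mulrA -ev; split=> //.
by move: hw; rewrite ev rmorphM => /dom[].
Qed.

Lemma coef_field (A : ring) : (1 : A) <> 0 ->
  (forall x : A, x <> 0 -> exists z, z * x = 1) -> coef_ring (0 : A).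
move=> A1 un; have nA : noetherian A.
  move=> I iI; have [[x [Ix /un[w hw]]]|h] := pselect (exists x, I x /\ x <> 0).
  exists [:: 1]; apply/seteqP; split=> a _; last by rewrite -[a]mulr1 -hw mulrA; exact: (idealMl _ iI).
  by rewrite -[a]mulr1; apply: (idealMl _ (ideal_genP _)); apply: sub_ideal_gen; rewrite /seq_set /= inE.
  exists [::]; apply/seteqP; split=> [a Ia|]; last by apply: ideal_gen_sub.
  suff -> : a = 0 by exact: (@smul0 A (seq_set [::]) A^o).
  by apply: contrapT => na; apply: h; exists a.
split.
- have e x : (exists b, x = 0 * b) <-> x = 0 by split=> [[b ->]|->]; [|exists 0]; rewrite mul0r.
  split=> //; last by move=> x nx; apply: un => x0; apply: nx; apply/e.
  split=> [||x z /e xz].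
  + by split=> [|x z /e -> /e ->|x z /e ->]; apply/e; rewrite ?addr0 ?mulr0.
  + by move/e.
  have [->|/un[w hw]] := pselect (x = 0); first by left; exists 0; rewrite mul0r.
  by right; apply/e; rewrite -[z]mul1r -hw -mulrA xz mulr0.
- by move=> a; exists a => j; rewrite mul0r addr0.
move=> J m j1; have [h|/existsNP[j0 /un[w hw]]] := pselect (forall j, m j = 0).
  by exists j1 => j; exists 0; rewrite h mul0r.
by exists j0 => j; exists (m j * w); rewrite -mulrA hw mulr1.
Qed.

Lemma dvr_coef (V : ring) (n : set V) : is_complete_dvr n ->
  exists pi, [/\ coef_ring pi, pi <> 0, n = [set a | exists b, a = pi * b] &
  domain V].
move=> [[/lring_local ln dom pid [t nt /eqP t0]] [r rK rK']]; have [nV pn un] := ln.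
have [pi epi] := pid n (primeI pn).
have en : n = [set a | exists b, a = pi * b].
  by apply/seteqP; split=> a; rewrite epi => /ideal_gen1.
exists pi; split=> //; last by move=> p0; move: nt; rewrite en p0 => -[b e]; apply: t0; rewrite e mul0r.
split; first by rewrite -en.
  move=> a; have npi : n pi by rewrite en; exists 1; rewrite mulr1.
  have [s hs] := completion_complete ln (fun j => to_completion n (a j)) ((cfil_to n 1 pi).2
  (eq_ind_r (fun I : set V => I pi) npi (ideal_exp1 (primeI pn)))).
  exists (fun j => r (s j)) => j; apply: (can_inj rK).
  rewrite [RHS](rmorphD (@to_completion V n)) [X in _ + X](rmorphM (@to_completion V n)).
  apply: etrans (rK' _) (etrans (hs j) _); congr (_ + _ * _); exact: (esym (rK' _)).
move=> J m j1; have [g eg] := pid _ (ideal_genP (range m)).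
have mg j : exists c, m j = c * g.
  have : ideal_gen (range m) (m j) by apply: sub_ideal_gen; exists j.
  by rewrite eg => /ideal_gen1[c ->]; exists c; rewrite mulrC.
have [c ec] : exists c : J -> V, g = \sum_j c j * m j.
  have : ideal_gen (range m) g by rewrite eg; exact: sub_ideal_gen.
  have iF := @fspanS V V^o J m.
  by apply: (ideal_gen_sub (J := @fspan V V^o J m)) => // _ [j _ <-]; exact: (@span_mem V V^o).
have /choice[d hd] := mg.
have [g0|ng] := pselect (g = 0).
  by exists j1 => j; exists 0; rewrite mul0r hd g0 mulr0.
(* Cancelling the generator [g] shows that some [d j0] is a unit, so [m j0] generates as well. *)
have e1 : \sum_j c j * d j = 1.
  apply/eqP; rewrite -subr_eq0; apply/eqP.
  have [//| //] : \sum_j c j * d j - 1 = 0 \/ g = 0.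
  apply: dom; rewrite mulrBl mul1r {2}ec mulr_suml -sumrB big1 // => j _.
  by rewrite -mulrA -hd subrr.
have [j0 [w hw]] : exists j0 w, w * d j0 = 1.
  apply: contrapT => h; have [_ n1 _] := pn; apply: n1; rewrite -e1.
  apply: (@submod_sum V V^o _ (primeI pn)) => j _; apply: (idealMl _ (primeI pn)).
  by apply: contrapT => /un[w hw]; apply: h; exists j, w.
by exists j0 => j; exists (d j * w); rewrite (hd j0) hd -mulrA [w * _]mulrA hw mul1r.
Qed.

Lemma quot_dom (C : ring) (P : set C) : is_prime P ->
  let h := quot_class P in [/\ forall c, h c = 0 <-> P c,
  domain (quot_ring P) & (1 : quot_ring P) <> 0].
move=> pP h; have h0 c : h c = 0 <-> P c.
  rewrite -(rmorph0 (quot_class P)); split=> [/quot_classP|Pc].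
  by rewrite subr0 (ideal_gen_id (primeI pP)).
  by apply/quot_classP; rewrite subr0; exact: sub_ideal_gen.
have [_ P1 PP] := pP; split=> //; last first.
  by move=> e; apply: P1; apply/h0; rewrite /h rmorph1.
move=> x z; elim/quot_classW: x => x; elim/quot_classW: z => z.
by rewrite -rmorphM => /h0/PP[]/h0; [left|right].
Qed.

(** * Serre's inequality over a complete local ring *)

Section SerreInequality.
Variables (A C : ring) (pi : A) (alpha : A ~~> C) (n : set C).
Hypotheses (cA : coef_ring pi)
  (Api : pi = 0 \/ domain A).

(* the residual coefficient field, when [pi] vanishes on both primes *)
Lemma serre_equal l y (P P' : set C) a b : coef_map pi alpha n l y -> P (alpha pi) -> P' (alpha pi) ->
  is_prime P -> is_prime P' -> (forall Q, is_prime Q -> P `<=` Q -> P' `<=` Q -> Q = n) ->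
  pchain P n a -> pchain P' n b -> (a + b <= l)%N.
move=> cC Ppi P'pi pP pP' meet hP hP'; have [ln sC ny npi hC] := cC; have [lA _ _] := cA.
have [nA [_ nA1 _] unA] := lA.
pose k := quot_ring [set pi]; pose C' := quot_ring [set alpha pi].
pose q : C ~~> C' := quot_class [set alpha pi].
pose qk : A ~~> k := quot_class [set pi].
have qs c : exists x, q x = c by elim/quot_classW: c => c; exists c.
have q0 (I : set C) : is_prime I -> I (alpha pi) -> forall c, q c = 0 -> I c.
  by move=> /primeI iI Ipi c /quot1_ker[d ->]; exact: idealM.
have [al eal] : exists al : k ~~> C', forall x, al (qk x) = q (alpha x).
  have [|al eal] := @quot_factor _ _ [set pi] (q \o alpha); last by exists al.
  by move=> _ ->; apply/quot1_ker; exists 1; rewrite mulr1.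
have ck : coef_ring (0 : k).
  apply: coef_field.
  - by rewrite -(rmorph1 qk) => /quot1_ker h; apply: nA1.
  elim/quot_classW=> x nx; have [|w hw] := unA x; last by exists (qk w); rewrite -rmorphM hw rmorph1.
  by move=> h; apply: nx; exact/quot1_ker.
have pn : is_prime n by case: ln.
have [lq qn] := lring_image ln qs (q0 n pn npi).
have cC' : coef_map (0 : k) al (q @` n) l (fun i => q (y i)).
  split=> // [_ [c nc <-]|i||].
  - by apply: summable_quot qs (sC _ nc).
  - exact/qn.
  - by rewrite rmorph0; case: (primeI (let: And3 _ x _ := lq in x)).
  move=> c'; have [c <-] := qs c'; have [[x nx] hx] := hC c; split.
  by exists (qk x); rewrite eal -rmorphB; exact/qn.
  move=> /qn/hx[d [e ->]]; exists 0, (fun i => q (e i)); rewrite mul0r add0r rmorphD rmorph_sum rmorphM.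
  rewrite (_ : q (alpha pi) = 0) ?mulr0 ?add0r; last by apply/quot1_ker; exists 1; rewrite mulr1.
  by apply: eq_bigr => i _; rewrite rmorphM.
have [gP pqP] := prime_image qs pP (q0 P pP Ppi).
have [gP' pqP'] := prime_image qs pP' (q0 P' pP' P'pi).
have [h0 dom D1] := quot_dom pqP'.
pose h : {rmorphism C' -> quot_ring (q @` P')} := quot_class (q @` P').
have eh : [set c | h c = 0] = q @` P' by apply/seteqP; split=> c /h0.
apply: (@chain_bound k C' _ 0 al (q @` n) l (fun i => q (y i)) h (q @` P) (q @` P')) => //.
- by move=> d; elim/quot_classW: d => d; exists d.
- by rewrite eh.
- move=> Q pQ PQ hQ; have e : q @^-1` Q = n.
  apply: meet; first exact: prime_preim.
  by move=> c Pc; apply: PQ; exists c.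
  by move=> c Pc; apply/hQ/h0; exists c.
  apply/seteqP; split=> [c|_ [c nc <-]]; last by move: nc; rewrite -e.
  by have [d <-] := qs c => Qd; exists d => //; rewrite -e.
- by apply: flat_coef ck dom D1 _; left.
- exact: pchain_image (q0 P pP Ppi) hP.
- exact: pchain_image (q0 P' pP' P'pi) hP'.
- by move=> c /h0.
- by rewrite rmorph0; case: (primeI pqP').
Qed.

(** Passing from [P'] to a prime over [P'] and [alpha pi] loses one step of the chain, which has to
    be recovered. If [alpha pi] is in [n^2], the strict bound does it; otherwise [alpha pi] replaces
    one of the generators [y], and [l - 1] variables suffice. *)
Lemma serre_mixed l y (P P' : set C) a b : coef_map pi alpha n l y ->
  (forall c, n c -> exists e : 'I_l -> C, c = \sum_(i < l) e i * y i) ->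
  ~ P' (alpha pi) -> is_prime P -> is_prime P' ->
  (forall Q, is_prime Q -> P `<=` Q -> P' `<=` Q -> Q = n) ->
  pchain P n a -> pchain P' n b -> (a + b <= l)%N.
move=> cC gen P'pi pP pP' meet hP hP'; have [ln sC ny npi hC] := cC.
have [nC pn un] := ln; have iN := primeI pn.
have pi0 : pi <> 0 by move=> p0; apply: P'pi; rewrite p0 rmorph0; case: (primeI pP').
have domA : domain A by case: Api.
have [h0 dom D1] := quot_dom pP'.
pose h : C ~~> quot_ring P' := quot_class P'.
have eh : [set c | h c = 0] = P' by apply/seteqP; split=> c /h0.
have hs d : exists c, h c = d by elim/quot_classW: d => d; exists d.
have fl : flat (h \o alpha) by apply: flat_coef cA dom D1 _; right=> /h0.
case: b hP' => [/pchain0_eq e|b hP']; first by case: P'pi; rewrite e.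
have [S [pS P'S Spi hS]] := pchain_adjust nC hP' npi.
have pP1 : is_prime [set c | h c = 0] by rewrite eh.
have meet1 Q : is_prime Q -> P `<=` Q -> (forall c, h c = 0 -> Q c) -> Q = n.
  by move=> pQ PQ hQ; apply: meet => // c /h0/hQ.
have SP c : h c = 0 -> S c by move=> /h0/P'S.
rewrite addnS; have [pi2|npi2] := pselect (ideal_exp n 2 (alpha pi)).
  exact: (chain_bound_strict cA cC hs pP pP1 meet1 fl hP hS SP Spi domA pi0 pi2).
have [w ew] := gen _ npi.
have [i0 [u hu]] : exists i0 u, u * w i0 = 1.
  apply: contrapT => nw; apply: npi2; rewrite ew.
  apply: (@submod_sum C C^o _ (ideal_genP _)) => i _; apply: sub_ideal_gen.
  exists [:: w i; y i]; split=> // [t|]; last by rewrite big_cons big_seq1.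
  rewrite !inE => /orP[]/eqP-> //; apply: contrapT => /un[u hu].
  by apply: nw; exists i, u.
case: l i0 cC gen hC w ew hu => [[//]|l] i0 cC gen hC w ew hu; rewrite ltnS.
(* [bump i0] skips the generator that is now expressed through [alpha pi] and the others. *)
apply: (@chain_bound A C _ pi alpha n l (fun j => y (bump i0 j)) h P S) => //.
split=> // c; have [h1 h2] := hC c; split=> // /h2[d [e ->]].
exists (d + e i0 * u), (fun j => e (lift i0 j) - e i0 * u * w (lift i0 j)).
have ez : y i0 = u * (alpha pi - \sum_j w (lift i0 j) * y (lift i0 j)).
  by rewrite ew (bigD1_ord i0) //= addrK mulrA hu mul1r.
rewrite (bigD1_ord i0) //= [in LHS]ez.
under [in RHS]eq_bigr do rewrite mulrBl -[_ * _ * w _ * _]mulrA.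
rewrite sumrB -mulr_sumr /=; set s1 := \sum_i _; set s2 := \sum_i _; ring.
Qed.

Lemma serre_ineq l y (P P' : set C) a b : coef_map pi alpha n l y ->
  (forall c, n c -> exists e : 'I_l -> C, c = \sum_(i < l) e i * y i) ->
  is_prime P -> is_prime P' -> (forall Q, is_prime Q -> P `<=` Q -> P' `<=` Q -> Q = n) ->
  pchain P n a -> pchain P' n b -> (a + b <= l)%N.
move=> cC gen pP pP' meet hP hP'.
have [Ppi|nP] := pselect (P (alpha pi)); last first.
  by rewrite addnC; apply: (@serre_mixed l y P' P b a cC gen nP pP' pP _ hP' hP) => Q pQ h1 h2; exact: meet.
have [P1pi|nP1] := pselect (P' (alpha pi)); last exact: (@serre_mixed l y P P' a b cC gen nP1 pP pP' meet hP hP').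
exact: (@serre_equal l y P P' a b cC Ppi P1pi pP pP' meet hP hP').
Qed.
End SerreInequality.

(** * Cohen-Macaulay rings and Cohen presentations *)

Lemma dep_resc (L T : ring) (g : L ~~> T) (nT : set T) t :
  surj g -> lring (g @^-1` nT) -> lring nT ->
  dep nT T^o t <-> dep (g @^-1` nT) (resc g T^o) t.
move=> gs lL lT; have [nL pn _] := lL; have [E tE] := testerP nL (primeI pn).
have eT : nT = ideal_gen (g @` (g @^-1` nT)).
  apply/seteqP; split=> [y hy|]; last first.
  by apply: ideal_gen_sub => [|_ [x hx <-]] //; apply: primeI; case: lT.
  by have [l el] := gs y; apply: sub_ideal_gen; exists l; rewrite // /preimage /= el.
have tgE : tester (bcE g E) nT by rewrite eT; exact: bcE_tester.
have fL : fg (resc g T^o).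
  exists unit, (fun=> (1 : T^o)) => m; have [l <-] := gs m.
  by exists (fun=> l); rewrite sum_unit; apply: (esym (mulr1 (g l : T))).
rewrite (dep_local t lT (fg_ring T) tgE) (dep_local t lL fL tE).
by split=> h j jt; apply/resc_mex; exact: h.
Qed.

Lemma mod_iso_ymod (L T : ring) (g : L ~~> T) y :
  surj g -> (forall r, g r = 0 <-> exists a, r = y * a) ->
  mod_iso (ymod y L^o) (resc g T^o).
move=> gs gk.
have gl' : linear (fun l : L^o => (g l : T^o) : resc g T^o).
  by move=> a u v; rewrite [LHS]rmorphD; congr (_ + _); exact: rmorphM.
apply: (@same_kernel_iso L _ _ _ (ymod_pi y L^o) (mklin gl')) => [x|b|v].
- exact: qmodS.
- by have [l <-] := gs b; exists l.
rewrite qmod_pi0; apply: iff_trans (iff_sym (gk v)).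
by split=> [[m _ <-]|[a ->]]; [exists m|exists a].
Qed.

Lemma mod_iso_dep R (A B : lmod R) (n : set R) t : mod_iso A B ->
  dep n B t -> dep n A t.
move=> [e [e' [ee' e'e]]] [E [tE h]]; exists E; split=> // i it v hv.
have [|a [na [u hu]]] := h i it (vmap e v).
  by rewrite -vmap_mact hv; apply/ffunP => j; rewrite !ffunE linear0.
exists a; split=> //; exists (vmap e' u); rewrite -vmap_mact -hu.
by apply/ffunP => j; rewrite !ffunE -linearZ ee'.
Qed.

(** A chain is shortened by one so as to start at a prime containing [y]; its length is then bounded
    by the depth modulo [y], and the nonzerodivisor [y] gives the lost step back. *)
Lemma cm_lift (L T : ring) (g : L ~~> T) (nT : set T) y :
  surj g -> (forall r, g r = 0 <-> exists a, r = y * a) ->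
  nzd y L^o -> lring (g @^-1` nT) -> lring nT -> cm nT -> cm (g @^-1` nT).
move=> gs gk hy lL lT cT [|l] [P hP]; have [nL pn _] := lL.
  by have [E tE] := testerP nL (primeI pn); exists E.
have gy : g y = 0 by apply/gk; exists 1; rewrite mulr1.
have ny : (g @^-1` nT) y by rewrite /preimage /= gy; case: lT => _ /primeI[].
have [P1 [pP1 _ P1y hP1]] := pchain_adjust nL hP ny.
apply/(dep_ymod_local _ lL (fg_ring L) ny hy)/(mod_iso_dep (mod_iso_ymod gs gk)).
apply/dep_resc => //; apply: cT; exists (g @` P1).
have -> : nT = g @` (g @^-1` nT).
  by apply/seteqP; split=> [t nt|_ [x nx <-] //]; have [x ex] := gs t; exists x; rewrite /preimage /= ?ex.
apply: pchain_image gs _ hP1 => r /gk[a ->]; exact: (idealM _ (primeI pP1)).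
Qed.

Lemma cm_coef (A : ring) (pi : A) : coef_ring pi ->
  (pi = 0 \/ domain A) -> cm [set a | exists b, a = pi * b].
move=> [lA _ _] dom [|l] [P hP]; have [nA pn _] := lA.
  by have [E tE] := testerP nA (primeI pn); exists E.
have npi : [set a | exists b, a = pi * b] pi by exists 1; rewrite mulr1.
have minP Q : is_prime Q -> Q pi -> [set a | exists b, a = pi * b] `<=` Q.
  by move=> pQ Qpi _ [b ->]; exact: (idealM _ (primeI pQ)).
have [p0|np0] := pselect (pi = 0).
  suff : (l.+1 <= 0)%N by [].
  apply: (krull_height (ys := [::]) nA hP) => // Q pQ _ _ QP; apply/seteqP; split=> //.
  by apply: minP => //; rewrite p0; case: (primeI pQ).
have : (l.+1 <= 1)%N.
  apply: (krull_height (ys := [:: pi]) nA hP) => [y|Q pQ _ hQ QP].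
  by rewrite inE => /eqP ->.
  by apply/seteqP; split=> //; apply: minP => //; apply: hQ; exact: mem_head.
rewrite ltnS leqn0 => /eqP ->; have hy : nzd pi A^o.
  by case: dom => // dom x /dom[].
apply/(dep_ymod_local _ lA (fg_ring A) npi hy).
by have [E tE] := testerP nA (primeI pn); exists E.
Qed.

Lemma cm_power_series (A : ring) (n : set A) d : lring n -> cm n ->
  cm (pco A d @^-1` n).
move=> lA cA; elim: d => [|d IH]; first exact: cA.
apply: (@cm_lift _ _ (@pcoef0 (power_series A d)) (pco A d @^-1` n) (@pX _)) => //.
- by move=> y; exists (pconst y).
- exact: pcoef0_ker.
- exact: pX_nzd.
- exact: (@mps_lring A n d.+1).
- exact: mps_lring.
Qed.

Lemma gl_coef (A : ring) (pi : A) : coef_ring pi ->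
  (pi = 0 \/ domain A) -> exists D, gl A D.
move=> [lA _ _] dom; have [nA pn un] := lA.
have [p0|np0] := pselect (pi = 0).
  exists 1%N; apply: gl_field => // x nx; apply: un => -[b e]; apply: nx; by rewrite e p0 mul0r.
(* One for the field [A / pi], and one more for dividing by the nonzerodivisor [pi]. *)
exists 2%N; have qs x : exists r, quot_class [set pi] r = x by elim/quot_classW: x => x; exists x.
apply: (@gl_lift A (quot_ring [set pi]) (quot_class [set pi]) pi) => //.
- exact: quot1_ker.
- by case: dom => // dom x /dom[].
- by move=> b; apply: (mulr_unit1 b lA); exists 1; rewrite mulr1.
apply: gl_field; last exact: noetherian_image qs nA.
elim/quot_classW=> x nx; have [|w hw] := un x; last by exists (quot_class _ w); rewrite -rmorphM hw rmorph1.
by move=> h; apply: nx; exact/quot1_ker.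
Qed.

Lemma dep_ymods R (p : prime_ideal R) xs (M : lmod R) t :
  noetherian R -> fg M -> (forall x, x \in xs -> prime_set p x) -> regs xs M ->
  dep p M (size xs + t) <-> dep p (ymods xs M) t.
move=> nR; elim: xs M => [|x xs IH] M fM hxs // [hx hr].
rewrite /= addSn (dep_ymod _ nR fM _ hx) ?IH //; first exact: fg_ymod.
- by move=> y hy; apply: hxs; rewrite inE hy orbT.
- by apply: hxs; exact: mem_head.
Qed.

(** A chain ending at [p] lifts to [T] and pulls back to [L], starting at a prime [P] over [xs]. As
    [xs] is regular, [P] has height at least [size xs], so [n] has height at least [size xs + l];
    [L] has that depth, and dividing by [xs] leaves [l]. *)
Lemma cm_descend (R T L : ring) (f : R ~~> T) (g : L ~~> T)
  (p : prime_ideal R) (nT : set T) (xs : seq L) :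
  noetherian R -> flat f -> lring (g @^-1` nT) -> surj g ->
  (forall l, g l = 0 <-> ideal_gen (seq_set xs) l) -> regs xs L^o -> is_prime nT ->
  (forall a, prime_set p a <-> nT (f a)) ->
  (forall b, nT b -> exists k, ideal_gen (f @` prime_set p) (b ^+ k)) ->
  cm (g @^-1` nT) -> cm p.
move=> nR flatf lL gs gk xreg pnT pp rad cL l [p0 hp0]; have [nL pn _] := lL.
have xk x : x \in xs -> g x = 0 by move=> hx; apply/gk; exact: sub_ideal_gen.
have ep : f @^-1` nT = prime_set p by apply/seteqP; split=> a /pp.
have [P0 [_ hP0]] := going_down_chain flatf (noetherian_image gs nL) pnT ep hp0.
have hP := pchain_preim gs hP0; have [pP _ Pn] := pchainP hP.
pose P := PrimeIdeal pP; pose n := PrimeIdeal pn.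
have Px x : x \in xs -> prime_set P x.
  by move=> /xk gx; rewrite /= /preimage /= gx; case: (pchainP hP0) => /primeI[].
have hd : dep P L^o (size xs).
  rewrite -[size xs]addn0; apply/(dep_ymods _ nL (fg_ring L) Px xreg).
  by have [E tE] := testerP nL (primeI pP); exists E.
have htP : htge P (size xs).
  apply: (dep_height nL (fg_ring L)) hd => /(_ 1)[a [Pa]].
  rewrite -[_ *: _]/(a * 1) mulr1 => a0; apply: Pa; rewrite a0; exact: (let: And3 h _ _ := primeI pP in h).
have xn x : x \in xs -> prime_set n x by move=> /Px/Pn.
have /(dep_ymods l nL (fg_ring L) xn xreg) hl := cL _ (htge_cat htP hP).
have [E tE] := testerP nL (primeI pn).
have fx : fg (ymods xs L^o).
  by have [q [qs _]] := ymods_pi xs L^o; apply: fg_surj qs (fg_ring L).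
move/(dep_local l lL fx tE): hl; exact: (dep_of_ymods nR flatf lL gs gk pnT pp rad tE).
Qed.

Lemma cohen_coef R (m : set R) (A : ring) : lring m ->
  cohen_coefficients (quot_ring m) A ->
  exists pi : A, coef_ring pi /\ (pi = 0 \/ domain A).
move=> lm [[f [r rK rK']]|[n [/dvr_coef[pi [h1 _ _ h2]] _]]]; last by exists pi; split; [|right].
have [_ pm um] := lm; exists 0; split; last by left.
have f0 a : m a -> quot_class m a = 0.
  move=> ma; rewrite -(rmorph0 (quot_class m)); apply/quot_classP; rewrite subr0.
  exact: sub_ideal_gen.
apply: coef_field => [e|x nx].
  have [_ m1 _] := pm; apply: m1; have : quot_class m 1 = quot_class m 0.
  by rewrite rmorph0 rmorph1 -(rmorph1 f) e rmorph0.
  by move/quot_classP; rewrite subr0 (ideal_gen_id (primeI pm)).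
have [a ea] : exists a, f x = quot_class m a.
  by move: (f x) => y; elim/quot_classW: y => a; exists a.
have [ma|/um[w hw]] := pselect (m a).
  by case: nx; apply: (can_inj rK); rewrite ea f0 // rmorph0.
exists (r (quot_class m w)); apply: (can_inj rK).
by rewrite rmorphM rK' ea -rmorphM hw !rmorph1.
Qed.

Lemma ci_presentation R (m : set R) : lring m -> complete_intersection m ->
  exists (A : ring) (pi : A) d (xs : seq (power_series A d))
  (g : power_series A d ~~> completion m),
  [/\ coef_ring pi, pi = 0 \/ domain A,
  surj g, forall l, g l = 0 <-> ideal_gen (seq_set xs) l &
  regs xs (power_series A d)^o].
move=> lm [A [d [xs [/(cohen_coef lm)[pi [h1 h2]] hx [f [r rK rK']]]]]].
exists A, pi, d, xs, (f \o quot_class (seq_set xs)); split=> //.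
- move=> t; have [l el] : exists l, quot_class (seq_set xs) l = r t.
  by move: (r t) => y; elim/quot_classW: y => a; exists a.
  by exists l; rewrite /= el rK'.
- move=> l /=; rewrite -(rmorph0 f); split=> [/(can_inj rK)|h].
  by rewrite -(rmorph0 (quot_class (seq_set xs))) => /quot_classP; rewrite subr0.
  by congr (f _); rewrite -(rmorph0 (quot_class (seq_set xs))); apply/quot_classP; rewrite subr0.
exact: regular_seq_regs.
Qed.

Lemma embdim_gens R (m : set R) e : lring m -> embdim_eq m e ->
  exists2 z : 'I_e -> R, forall i, m (z i) & m `<=` @fspan R R^o _ z.
move=> lm [z [mz hz _]]; exists z => //; have [nR pm _] := lm; have im := primeI pm.
apply: (@nakayama R R^o ((noetherianP R).1 nR) m _ m (fspanS _)) => //.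
- by move=> a ma b; exact: mulr_unit1 lm ma.
move=> N hN zN hm y my; have [a ha] := hz y my; have iN := (idealS N).2 hN.
rewrite -[y](subrK (\sum_i a i * z i)); have [_ ND _] := hN; apply: ND.
  apply: (@ideal_expD R m 1 1) ha => // u v; rewrite ideal_exp1 // => mu mv.
  exact: (hm u v).
by apply: zN; exists a.
Qed.

Lemma pchain_adjust_seq R (p q : set R) ys l : noetherian R -> is_prime p ->
  pchain p q (size ys + l) -> (forall y, y \in ys -> q y) ->
  exists p1, [/\ is_prime p1, p `<=` p1, forall y, y \in ys -> p1 y & pchain p1 q l].
move=> nR; elim: ys p => [|y ys IH] p pp hh hq; first by exists p; split.
have [p2 [h1 h2 h3 h4]] := pchain_adjust nR hh (hq y (mem_head _ _)).
have [|p3 [k1 k2 k3 k4]] := IH p2 h1 h4.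
  by move=> x hx; apply: hq; rewrite inE hx orbT.
exists p3; split=> // [x /h2/k2//|x]; rewrite inE => /orP[/eqP ->|/k3//].
exact: k2.
Qed.

(** * Complete intersections *)

Section CompleteIntersection.
Variables (R : ring) (m : set R).
Hypotheses (lm : lring m)
  (ci : complete_intersection m).
Local Notation C := (completion m).
Local Notation f := (@to_completion R m).
Local Notation nC := (@cfil R m 1).
Let nR : noetherian R. by case: lm. Qed.
Let pm : is_prime m. by case: lm. Qed.

Lemma ci_noetherian : noetherian C.
have [A [pi [d [xs [g [[[nA _ _] _ _] _ gs _ _]]]]]] := ci_presentation lm ci.
by apply: (@noetherian_image _ _ g gs); exact: mps_noetherian.
Qed.

Let lC : lring (nC). exact: lring_completion lm ci_noetherian. Qed.
Let flatC : flat f. exact: flat_completion lm ci_noetherian. Qed.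
Let pC : is_prime (nC). by case: lC. Qed.
Let cfil1 a : m a <-> nC (f a).
by rewrite cfil_to ideal_exp1 //; exact: primeI. Qed.

Let efm : f @^-1` nC = m.
by apply/seteqP; split=> a /cfil1. Qed.

Let lring_max (S : ring) (n n' : set S) : lring n -> lring n' -> n = n'.
move=> ln ln'; apply/seteqP; split; apply: lring_sub => //.
- by case: ln.
- by case: ln'.
Qed.

(** Adds to [ci_presentation] that the maximal ideals correspond, since a ring has at most one ideal
    satisfying [lring]. *)
Lemma ci_chart : exists (A : ring) (pi : A) d (xs : seq (power_series A d))
  (g : power_series A d ~~> C),
  [/\ coef_ring pi, pi = 0 \/ domain A,
  surj g, forall l, g l = 0 <-> ideal_gen (seq_set xs) l &
  regs xs (power_series A d)^o /\
  pco A d @^-1` [set a | exists b, a = pi * b] = g @^-1` nC].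
have [A [pi [d [xs [g [h1 h2 gs gk h5]]]]]] := ci_presentation lm ci.
exists A, pi, d, xs, g; split=> //; split=> //; have [lA _ _] := h1.
apply: lring_max; first exact: mps_lring.
split; [by apply: mps_noetherian; case: lA|exact: prime_preim|].
move=> F nF; have [_ _ un] := mps_lring d lA; apply: un => hF; apply: nF.
have [_ _ un] := mps_lring d lA; have [|lg hg] := lring_image (mps_lring d lA) gs.
  move=> r /gk; apply: ideal_gen_sub => [|x xxs].
  by apply: primeI; case: (mps_lring d lA).
  have /gk gx : ideal_gen (seq_set xs) x by exact: sub_ideal_gen.
  apply: contrapT => /un[y e]; have [_ C1 _] := pC; apply: C1.
  by rewrite -(rmorph1 g) -e rmorphM gx mulr0; case: (primeI pC).
by rewrite /preimage /= -(lring_max lg lC); exact/hg.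
Qed.

Lemma ci_cm : cm m.
have [A [pi [d [xs [g [h1 h2 gs gk [h5 e]]]]]]] := ci_chart.
have [lA _ _] := h1; have lQ := mps_lring d lA.
have := @cm_descend R C _ f g (PrimeIdeal pm) (nC) xs nR flatC; rewrite /= -e.
apply=> //; last exact: cm_power_series (cm_coef h1 h2).
move=> b; rewrite completion_ideal // => hb; exists 1%N; by rewrite expr1.
Qed.

(** Going down lifts both chains to the completion, where the images of [e] generators of [m] serve
    as the elements [y]. *)
Lemma ci_serre e (p p' : set R) a b : embdim_eq m e -> is_prime p -> is_prime p' ->
  (forall Q, is_prime Q -> p `<=` Q -> p' `<=` Q -> Q = m) ->
  pchain p m a -> pchain p' m b -> (a + b <= e)%N.
move=> /(embdim_gens lm)[z mz hz] pp pp' meet hp hp'.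
have [A [pi [d [xs [g [h1 h2 gs gk [h5 en]]]]]]] := ci_chart.
have [lA _ _] := h1; have [nA pA _] := lA; have lQ := mps_lring d lA.
pose alpha : A ~~> C := g \o pcst A d.
(* Indices from [e] on get the value 0, which is in the maximal ideal. *)
pose y i : C := if insub i is Some j then f (z j) else 0.
have yE (i : 'I_e) : y i = f (z i) by rewrite /y valK.
have iC : is_ideal (nC) := primeI pC.
have gen c : nC c -> exists w : 'I_e -> C, c = \sum_(i < e) w i * y i.
  move=> hc; have hF := @fspanS C C^o 'I_e (fun i => y i).
  suff : nC `<=` @fspan C C^o 'I_e (fun i => y i) by move=> /(_ c hc).
  rewrite completion_ideal //; apply: ideal_gen_sub; first exact/idealS.
  move=> _ [r /hz[w ->] <-]; exists (fun i => f (w i)); rewrite rmorph_sum.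
  by apply: eq_bigr => i _; rewrite yE; exact: rmorphM.
have cC : coef_map pi alpha (nC) e y.
  split=> // [c hc s|i||c].
  - exact: completion_complete.
  - by rewrite /y; case: insubP => [j _ _|_]; [exact/cfil1|case: iC].
  - have : (g @^-1` nC) (pcst A d pi) by rewrite -en /preimage /= pco_cst; exists 1; rewrite mulr1.
  by [].
  split; last by move=> /gen[w ->]; exists 0, w; rewrite mul0r add0r.
  have [F <-] := gs c; exists (pco A d F); rewrite /alpha /= -rmorphB.
  have : (g @^-1` nC) (F - pcst A d (pco A d F)).
  by rewrite -en /preimage /= rmorphB pco_cst subrr; case: (primeI pA).
  by [].
have [P [eP hP]] := going_down_chain flatC ci_noetherian pC efm hp.
have [P' [eP' hP']] := going_down_chain flatC ci_noetherian pC efm hp'.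
have [pP _ _] := pchainP hP; have [pP' _ _] := pchainP hP'.
apply: (@serre_ineq A C pi alpha (nC) h1 h2 e y P P' a b cC gen pP pP' _ hP hP').
move=> Q pQ PQ P'Q; apply/seteqP; split; first exact: lring_sub.
have eQ : f @^-1` Q = m.
  apply: meet; first exact: prime_preim.
  by rewrite -eP => x; exact: PQ.
  by rewrite -eP' => x; exact: P'Q.
rewrite completion_ideal //; apply: ideal_gen_sub; first exact: primeI.
by move=> _ [x mx <-]; move: mx; rewrite -{1}eQ.
Qed.

(* Cutting [p] by a system of parameters modulo [p + p'] turns the inequality
   for the dimensions into one for the height of a prime over both. *)
Lemma ci_meet (p p' : set R) c : codim_eq m c -> is_prime p -> p `<=` m ->
  is_prime p' -> ~ htge p' 1 ->
  exists q, [/\ is_prime q, p `<=` q, p' `<=` q & forall h, pchain p q h -> (h <= c)%N].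
move=> [e [d [he hd ec]]] pp pm' pp' h0.
pose I : set R := @addS R R^o p p'; have ip := primeI pp; have ip' := primeI pp'.
have iI : is_ideal I by apply/idealS/addSS; exact/idealS.
have pI : p `<=` I by apply: (@addSl R R^o); exact/idealS.
have p'I : p' `<=` I by apply: (@addSr R R^o); exact/idealS.
have p'm : p' `<=` m by exact: lring_sub.
have Im : I `<=` m by apply: (@addS_min R R^o) => //; apply/idealS; exact: primeI.
(* The maximum [r] is the dimension of [R / I], reached by a chain that starts at [q]. *)
pose S := [set r | exists q : set R, I `<=` q /\ pchain q m r].
have [r [q [Iq hq]] rmax] : exists2 r, S r & forall r', S r' -> (r' <= r)%N.
  have [b hb] := lring_dimle I lm.
  have hS r : `[< S r >] -> (r <= b)%N by move=> /asboolP[q [h1 h2]]; exact: hb h1 h2.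
  have eS : exists r, `[< S r >].
  by exists 0%N; apply/asboolP; exists m; split=> //; exact: pchain0.
  by case: (ex_maxnP eS hS) => r /asboolP Sr hr; exists r => // r' Sr'; apply: hr; exact/asboolP.
have hI : dimle I r.
  move=> P Q l IP hPQ; have [pP pQ PQ] := pchainP hPQ.
  have [Qm|nQm] := pselect (m `<=` Q).
  apply: rmax; exists P; split=> //; rewrite (_ : m = Q) //; apply/seteqP; split=> //.
  exact: lring_sub.
  apply: leq_trans (rmax l.+1 _); first exact: leqnSn.
  exists P; split=> //; apply: pchainS hPQ pm _ nQm; exact: lring_sub.
have [ys sys [ysm hys]] := dimle_sop lm iI hI.
have [_ pq _] := pchainP hq; have {}pq : is_prime q by case: (pchainP hq).
exists q; split=> // [x /pI/Iq//|x /p'I/Iq//|h hpq].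
(* The chain from [p] through [q] to [m] has length [r + h]; imposing the [r] parameters leaves a
   chain of length [h] from [p1]. *)
have := pchain_cat hpq hq; rewrite -sys addnC => hh.
have [p1 [pp1 pp1' hp1 hp1m]] := pchain_adjust_seq nR pp hh ysm.
have meet Q : is_prime Q -> p1 `<=` Q -> p' `<=` Q -> Q = m.
  move=> pQ p1Q p'Q; apply: hys => // [|y /hp1/p1Q//].
  by apply: (@addS_min R R^o) => // [|x /pp1'/p1Q//]; apply/idealS; exact: primeI.
(* [R] is Cohen-Macaulay and [p'] has height 0, so some chain from [p'] to [m] has length at least
   [d]. *)
have htm : htge m d by apply/(ele_krull_dim _ lm); rewrite hd /=.
have [h' [hp' hd']] := cm_dim (p := PrimeIdeal pp') (q := PrimeIdeal pm) nR ci_cm p'm htm.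
have dh' : (d <= h')%N.
  rewrite leqNgt; apply/negP => lt; apply: h0; apply: htge_le hd'; by rewrite subn_gt0.
have := ci_serre he pp1 pp' meet hp1m hp'.
rewrite ec => hle; rewrite -(leq_add2r d); apply: leq_trans hle; by rewrite leq_add2l.
Qed.
End CompleteIntersection.

(** * Tensor products and Tor through presentations *)

Section TensorProducts.
Variable R : ring.
Implicit Types M N : lmod R.

Lemma tensD M N (m m' : M) (n : N) : tens (m + m') n = tens m n + tens m' n.
by have [h _] := tens_bilinear M N; have := h n 1 m m'; rewrite /= !scale1r. Qed.

Lemma tensZ M N a (m : M) (n : N) : tens (a *: m) n = a *: tens m n.
by have [h _] := tens_bilinear M N; exact: (GRing.scalable_linear (h n)). Qed.

Lemma tens_swap M N a (m : M) (n : N) : tens (a *: m) n = tens m (a *: n).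
by rewrite tensZ; have [_ h] := tens_bilinear M N; exact: (esym (GRing.scalable_linear (h m) a n)). Qed.

Lemma tens_ind M N (S : set (tensor M N)) : submod S -> (forall m n, S (tens m n)) ->
  forall t, S t.
move=> hS h t; have -> : t = umod_class (@bilinear_map R M N) (repr t).
  by rewrite /umod_class reprK.
rewrite umod_classE /formal_eval; apply: (@submod_sum R (tensor M N) S hS) => -[a [m n]] _.
by have [_ _ hZ] := hS; apply: hZ; exact: h.
Qed.

Definition tsum M N (I : finT) (e : I -> M) (w : {ffun I -> N}) : tensor M N :=
  \sum_i tens (e i) (w i).
Fact tsum_linear M N (I : finT) (e : I -> M) : linear (@tsum M N I e).
move=> a u v; rewrite /tsum scaler_sumr -big_split; apply: eq_bigr => i _ /=.
by rewrite !ffunE; have [_ h] := tens_bilinear M N; exact: (h (e i) a).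
Qed.
HB.instance Definition _ M N (I : finT) (e : I -> M) :=
  GRing.isLinear.Build R _ _ _ (@tsum M N I e) (tsum_linear e).

Lemma tens_sumr M N (m : M) (J : finT) (n : J -> N) :
  tens m (\sum_j n j) = \sum_j tens m (n j).
have h (x y : N) : tens m (x + y) = tens m x + tens m y.
  by have [_ k] := tens_bilinear M N; have := k m 1 x y; rewrite /= !scale1r.
apply: (big_morph (tens m) h); by rewrite -(scale0r (0 : N)) -tens_swap tensZ scale0r.
Qed.

Lemma tens_suml M N (I : finT) (e : I -> M) (n : N) :
  tens (\sum_i e i) n = \sum_i tens (e i) n.
apply: (big_morph (fun m => tens m n)) => [x y|]; first exact: tensD.
by rewrite -(scale0r (0 : M)) tensZ scale0r.
Qed.

Lemma tsum_mact M N (I J : finT) (e : I -> M) (A : J -> I -> R) (u : {ffun J -> N}) :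
  tsum e (mact A u) = tsum (fun j => \sum_i A j i *: e i) u.
rewrite /tsum; under eq_bigr do rewrite mactE tens_sumr.
rewrite exchange_big; apply: eq_bigr => j _ /=; rewrite tens_suml.
by apply: eq_bigr => i _; rewrite tens_swap.
Qed.

Lemma mact_unitv (I J : finT) (A : J -> I -> R) j :
  mact A (unitv j (1 : R^o)) = [ffun i => A j i : R^o].
apply/ffunP => i; rewrite mactE ffunE (bigD1 j) //= big1 => [|k kj].
  by rewrite ffunE eqxx addr0; exact: mulr1.
by rewrite ffunE (negbTE kj) scaler0.
Qed.

Section Presented.
Variables (M N : lmod R) (I J : finT) (A : J -> I -> R).
Variable p : {linear {ffun I -> R^o} -> M}.
Hypotheses (ps : surj p)
  (pk : forall v, p v = 0 <-> exists u, v = mact A u).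
Let e i : M := p (unitv i (1 : R^o)).

Lemma pres_comb (v : {ffun I -> R^o}) : p v = \sum_i (v i : R) *: e i.
rewrite {1}[v]sum_unit_row linear_sum; apply: eq_bigr => i _; exact: linearZ.
Qed.

Lemma tens_comb (v : {ffun I -> R^o}) (n : N) :
  tens (p v) n = tsum e [ffun i => (v i : R) *: n].
rewrite pres_comb /tsum; under [RHS]eq_bigr do rewrite ffunE -tens_swap.
elim/big_rec2: _ => [|i y x _ <-]; last by rewrite tensD.
by rewrite -(scale0r (0 : M)) tensZ scale0r.
Qed.

Lemma tsum_surj t : exists w, tsum (N := N) e w = t.
apply: (@tens_ind M N [set t | exists w, tsum e w = t]) => [|m n].
  split=> [|_ _ [u <-] [v <-]|a _ [u <-]]; first by exists 0; rewrite linear0.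
  by exists (u + v); rewrite linearD.
  by exists (a *: u); rewrite linearZ.
by have [v <-] := ps m; exists [ffun i => (v i : R) *: n]; rewrite tens_comb.
Qed.

(** Right exactness of the tensor product. For the harder direction, the bilinear map [b] into the
    cokernel of [A] over [N] factors through the tensor product and inverts [tsum]. *)
Lemma tsum_ker (w : {ffun I -> N}) : tsum e w = 0 <-> exists u, w = mact A u.
split=> [|[u ->]]; last first.
  rewrite tsum_mact /tsum big1 // => j _.
  have -> : \sum_i A j i *: e i = 0; last by rewrite -(scale0r (0 : M)) tensZ scale0r.
  transitivity (p (mact A (unitv j (1 : R^o)))); last by apply/pk; exists (unitv j (1 : R^o)).
  by rewrite pres_comb; apply: eq_bigr => i _; rewrite mact_unitv ffunE.
have iS := @rng_sub R _ _ A N; pose T := qmod iS.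
have /choice[c hc] := ps.
pose b (mn : M * N) : T := qmod_pi iS [ffun i => (c mn.1 i : R) *: mn.2].
have bE v n : b (p v, n) = qmod_pi iS [ffun i => (v i : R) *: n].
  apply/eqP; rewrite -subr_eq0 -linearB; apply/eqP/qmod_pi0.
  have /pk[u hu] : p (c (p v) - v) = 0 by rewrite linearB hc subrr.
  exists [ffun j => (u j : R) *: n] => //; apply/ffunP => i; rewrite mactE !ffunE -scalerBl.
  have := ffapp i hu; rewrite mactE !ffunE => ->.
  by rewrite scaler_suml; apply: eq_bigr => j _; rewrite ffunE scalerA.
have bb : bilinear_map b.
  split=> [n|m] a x y.
  have [u <-] := ps x; have [v <-] := ps y; rewrite -linearP !bE -linearP; congr (qmod_pi iS _).
  by apply/ffunP => i; rewrite !ffunE scalerDl scalerA.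
  rewrite /b /= -linearP; congr (qmod_pi iS _); apply/ffunP => i.
  by rewrite !ffunE scalerDr !scalerA mulrC.
have [g gE _] := tensor_universal bb; move=> /(congr1 g); rewrite linear0 /tsum linear_sum.
under eq_bigr do rewrite gE bE.
rewrite -linear_sum => /qmod_pi0[u _ hu]; exists u; rewrite hu; apply/ffunP => i.
rewrite sum_ffunE (bigD1 i) //= big1 => [|j ji]; first by rewrite !ffunE eqxx scale1r addr0.
by rewrite !ffunE eq_sym (negbTE ji) scale0r.
Qed.
End Presented.

Lemma tensor_phi M N (H : cplx R) : pres (dx H 0) M -> mod_iso (phi H N) (tensor M N).
move=> [p ps pk].
apply: (@same_kernel_iso R _ _ _ (qmod_pi (@rng_sub R _ _ (dx H 0) N))
  (@tsum M N _ (fun i => p (unitv i (1 : R^o))))) => [x|t|v].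
- exact: qmodS.
- exact: tsum_surj.
rewrite qmod_pi0; split=> [[u _ <-]|].
  by apply/(tsum_ker ps pk); exists u.
by move/(tsum_ker ps pk) => [u ->]; exists u.
Qed.

Lemma tensor_comm M N : mod_iso (tensor M N) (tensor N M).
have bil (A B : lmod R) : bilinear_map (fun mn : A * B => tens mn.2 mn.1).
  by have [h1 h2] := tens_bilinear B A; split=> [n|m] a x y; [exact: h2|exact: h1].
have [f fE _] := tensor_universal (bil M N); have [g gE _] := tensor_universal (bil N M).
have inv (A B : lmod R) (f' : {linear tensor A B -> tensor B A}) (g' : {linear tensor B A -> tensor A B}) :
  (forall m n, f' (tens m n) = tens n m) -> (forall m n, g' (tens m n) = tens n m) -> cancel f' g'.
  move=> fE' gE'; apply: (@tens_ind A B [set t | g' (f' t) = t]) => [|m n]; last by rewrite /= fE' gE'.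
  by split=> [|x y /= hx hy|a x /= hx]; rewrite /= ?linear0 ?linearD ?linearZ /= ?hx ?hy.
by exists f, g; split; exact: inv.
Qed.

Lemma free_projective (I : finT) : projective ({ffun I -> R^o} : lmod R).
move=> A B g f gs; have /choice[s hs] : forall i, exists a, g a = f (unitv i (1 : R^o)) by move=> i; exact: gs.
exists (comb s : {linear _ -> _}) => v; rewrite /comb linear_sum [in RHS](sum_unit_row v) linear_sum.
by apply: eq_bigr => i _; rewrite !linearZ hs.
Qed.

(** [tor_eq0] speaks of all projective resolutions, so it can be read on [F]; over a free module,
    tensors are the same as vectors. *)
Lemma tor_hac M N (F : cplx R) : pres (dx F 0) M ->
  (forall i, syz (dx F i.+1) (dx F i)) ->
  (forall i, (0 < i)%N -> tor_eq0 i M N) -> hac F N.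
move=> [p ps pk] hF tor i.
pose P i : lmod R := {ffun F i -> R^o}.
pose d i : {linear P i.+1 -> P i} := @mact R R^o _ _ (dx F i).
have res : projective_resolution (P := P) d p.
  split=> [j||v|j v]; [exact: free_projective|exact: ps| |].
  by split=> [/pk[u ->]|[u <-]]; [exists u|apply/pk; exists u].
  by have [h1 h2] := hF j; split=> [/h2[u ->]|[u <-]]; [exists u|exact: h1].
pose e j x : P j := unitv x (1 : R^o).
have S j t : exists w, tsum (N := N) (e j) w = t.
  by apply: (@tsum_surj (P j) N (F j) idfun) => m; exists m.
(* A free module has a presentation without relations, so [tsum] is injective on it. *)
have K j (w : {ffun F j -> N}) : tsum (e j) w = 0 -> w = 0.
  move/(@tsum_ker (P j) N (F j) void (fun v => match v with end) idfun) => [|v|u ->].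
  - by move=> m; exists m.
  - have z0 (L : lmod R) (u : {ffun void -> L}) :
  mact (fun v : void => match v with end : F j -> R) u = 0.
  by apply/ffunP => x; rewrite mactE big1 ?ffunE // => -[].
  by split=> [e0|[u ->]]; [exists 0; rewrite z0|exact: z0].
  - by apply/ffunP => x; rewrite mactE big1 ?ffunE // => -[].
have natT j (w : {ffun F j.+1 -> N}) :
  tensor_map N (d j) (tsum (e j.+1) w) = tsum (e j) (mact (dx F j) w).
  rewrite tsum_mact /tsum linear_sum; apply: eq_bigr => x _.
  apply: etrans; first exact: tensor_mapE.
  congr (tens _ _).
  rewrite /d /= mact_unitv; apply/ffunP => y; rewrite ffunE sum_ffunE (bigD1 y) //= big1 => [|z zy].
  by rewrite !ffunE eqxx addr0; exact: (esym (mulr1 _)).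
  by rewrite !ffunE eq_sym (negbTE zy) scaler0.
move=> v hv; have /= ex := tor i.+1 isT P d p res.
have [x hx] : exists x, tensor_map N (d i.+1) x = tsum (e i.+1) v.
  by apply: (ex _).1; apply: etrans (natT i v) _; rewrite hv; exact: linear0.
have [u eu] := S i.+2 x; exists u; apply/eqP; rewrite -subr_eq0; apply/eqP/(K i.+1).
have h : tsum (e i.+1) (mact (dx F i.+1) u) = tsum (e i.+1) v.
  by rewrite -hx -eu; exact: esym (natT _ _).
by apply: etrans (linearB _ _ _) _; apply/eqP; rewrite subr_eq0; apply/eqP; exact: esym h.
Qed.

(* The symmetry of Tor: a cycle of [H (x) M] is lifted to a matrix over [R],
   whose boundary is a cycle of [F (x) N]. *)
Lemma hac_sym M N (F H : cplx R) : pres (dx F 0) M ->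
  (forall i, syz (dx F i.+1) (dx F i)) -> pres (dx H 0) N ->
  (forall i, syz (dx H i.+1) (dx H i)) -> hac F N -> hac H M.
move=> pF sF [q qs qk] sH hF i; elim: i F M pF sF hF => [|i IH] F M pF sF hF; last first.
  (* Dimension shifting along the first syzygy module of [M]. *)
  have [f [g fg]] := pres_ses pF.
  apply: (les_quo fg) => //.
  - exact: (mcpx_vec (sH i).1).
  - exact: (mex_vec (sH i.+1).2).
  apply: (IH (Cplx (fun i => dx F i.+1))) => /=; first exact: pres_syz (sF 0%N).
  by move=> k; exact: sF.
  by move=> k; exact: hF.
have [p ps pk] := pF; move=> v hv.
have [V eV] : exists V : {ffun H 1%N -> {ffun F 0%N -> R^o}}, vmap p V = v.
  have /choice[s hs] := ps; exists [ffun x => s (v x)].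
  by apply/ffunP => x; rewrite !ffunE hs.
have /choice[W hW] : forall y, exists u, mact (dx H 0) V y = mact (dx F 0) u.
  move=> y; apply/pk; have := ffapp y hv.
  by rewrite -eV -vmap_mact !ffunE.
(* Vectors of vectors over [R] are matrices; [tr] reads off a column. *)
pose tr (I J : finT) (X : I -> {ffun J -> R^o}) (j : J) : {ffun I -> R^o} := [ffun i => X i j].
pose w : {ffun F 1%N -> N} := [ffun z => q (tr _ _ W z)].
have trW x : \sum_k (dm k x : R) *: tr _ _ W k = mact (dx H 0) (tr _ _ V x).
  apply/ffunP => y; rewrite sum_ffunE.
  have := ffapp x (hW y); rewrite !mactE sum_ffunE => h.
  transitivity (\sum_z dm z x *: W y z); first by apply: eq_bigr => z _; rewrite !ffunE.
  by rewrite -h; apply: eq_bigr => z _; rewrite !ffunE.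
have hw : mact (dx F 0) w = 0.
  apply/ffunP => x; rewrite mactE [RHS]ffunE; under eq_bigr do rewrite ffunE -linearZ.
  by rewrite -linear_sum trW; apply/qk; exists (tr _ _ V x).
have [z hz] := hF 0%N w hw.
have /choice[Z hZ] : forall k, exists r, q r = z k by move=> k; exact: qs.
have /choice[Y hY] : forall x, exists u, tr _ _ W x - \sum_k (dm k x : R) *: Z k = mact (dx H 0) u.
  move=> x; apply/qk; rewrite linearB linear_sum.
  have := ffapp x hz; rewrite ffunE mactE => ->.
  by apply/eqP; rewrite subr_eq0; apply/eqP/eq_bigr => k _; rewrite linearZ hZ.
(* The columns of [V] are corrected into cycles of [H]; the correction consists of relations of [M],
   so the image under [p] is still [v]. *)
pose V' x : {ffun H 1%N -> R^o} := tr _ _ V x - \sum_k (dm k x : R) *: Y k.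
have hV' x : mact (dx H 0) (V' x) = 0.
  rewrite linearB linear_sum; apply/eqP; rewrite subr_eq0; apply/eqP.
  apply: etrans (esym (trW x)) _.
  transitivity (\sum_k (dm k x : R) *: (tr _ _ W k - \sum_l (dm l k : R) *: Z l)); last first.
  by apply: eq_bigr => k _; rewrite hY linearZ.
  under [RHS]eq_bigr do rewrite scalerBr; rewrite sumrB [X in _ - X](_ : _ = 0) ?subr0 //.
  under eq_bigr do rewrite scaler_sumr; rewrite exchange_big big1 // => l _ /=.
  under eq_bigr do rewrite scalerA mulrC; rewrite -scaler_suml.
  have := (sF 0%N).1 (unitv l (1 : R^o)); rewrite mact_unitv => /ffunP/(_ x).
  rewrite mactE ffunE => h; rewrite [X in X *: _](_ : _ = 0) ?scale0r // -[RHS]h.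
  by apply: eq_bigr => k _; rewrite ffunE mulrC.
have /choice[U hU] : forall x, exists u, V' x = mact (dx H 1) u.
  by move=> x; exact: (sH 0%N).2.
exists [ffun y => p (tr _ _ U y)]; rewrite -eV; apply/ffunP => y; rewrite ffunE mactE.
under eq_bigr do rewrite ffunE -linearZ; rewrite -linear_sum; apply/eqP.
rewrite -subr_eq0 -linearB; apply/eqP/pk; exists (tr _ _ Y y).
apply/ffunP => x; rewrite !ffunE sum_ffunE.
have := ffapp y (hU x); rewrite mactE /V' !ffunE sum_ffunE => h.
transitivity (V y x - \sum_k dm k y *: U x k).
  by congr (_ - _); apply: eq_bigr => k _; rewrite !ffunE.
rewrite -h opprB addrCA subrr addr0; apply: eq_bigr => k _; by rewrite !ffunE.
Qed.
End TensorProducts.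

(** * Depth of syzygies *)

(** The local version of [cex_sub], in which the multipliers outside [p] are collected along the
    chase. *)
Lemma lex_sub R (p : set R) (A B C : lmod R) (f : {linear A -> B})
  (g : {linear B -> C}) (E : coch R) t : is_prime p -> tester E p -> ses f g ->
  (forall i, (i < t.+1)%N -> lex p (@cd R E i) (@cd R E i.+1) B) ->
  (forall i, (i < t)%N -> lex p (@cd R E i) (@cd R E i.+1) C) ->
  forall i, (i < t.+1)%N -> lex p (@cd R E i) (@cd R E i.+1) A.
move=> pp tE hfg hB hC i it v hv; have [_ p1 pM] := pp.
have [|a [na [u hu]]] := hB i it (vmap f v); first by rewrite -vmap_mact hv raddf0.
have [fi gs ex] := hfg; case: i it v hv u hu => [|i] it v hv u hu.
  exists a; split=> //; exists [ffun=> 0]; apply/ffunP => y; apply: fi.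
  have -> : f ((a *: v) y) = mact (@cd R E 0) u y by rewrite -hu !ffunE linearZ.
  have E0 : E 0%N -> False by case: tE.
  by rewrite !mactE !big1 ?linear0 // => x; case: (E0 x).
have [||b [nb [w hw]]] := hC i _ (vmap g u) => //.
  rewrite -vmap_mact -hu; apply/ffunP => y; rewrite !ffunE linearZ.
  have -> : g (f (v y)) = 0 by apply/ex; exists (v y).
  exact: scaler0.
have /choice[w' hw'] : forall x, exists z, g z = w x by move=> x; exact: gs.
have /choice[z hz] : forall y, exists z, f z = b *: u y - mact (@cd R E i) (finfun w') y.
  have ew : vmap g (finfun w') = w by apply/ffunP => x; rewrite !ffunE hw'.
  move=> y; apply/ex; rewrite linearB.
  have -> : g (mact (@cd R E i) (finfun w') y) = (b *: vmap g u) y.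
  by rewrite hw -ew -vmap_mact [RHS]ffunE.
  by rewrite !ffunE linearZ; exact: subrr.
exists (b * a); split; first by case/pM.
exists (finfun z); have [fiv _ _] := ses_vecP (E i.+2) hfg; apply: fiv.
rewrite vmap_mact (_ : vmap f (finfun z) = b *: u - mact (@cd R E i) (finfun w')); last first.
  by apply/ffunP => y; rewrite !ffunE hz ffunE.
have cz : mact (@cd R E i.+1) (mact (@cd R E i) (finfun w')) = 0 := @tester_cpx _ _ _ B i tE _.
apply: etrans _ (esym (linearB _ _ _)); rewrite [X in _ = _ - X]cz subr0.
apply: etrans _ (esym (linearZ _ _)); rewrite -[X in _ = _ X]hu.
by apply/ffunP => y; rewrite !ffunE linearZ scalerA.
Qed.

(** Any given tester for [p] decides [dep], not only one supplied by its definition. *)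
Lemma dep_lex R (p : prime_ideal R) (M : lmod R) t E : noetherian R -> fg M ->
  tester E p -> dep p M t <->
  forall i, (i < t)%N -> lex p (@cd R E i) (@cd R E i.+1) M.
move=> nR fM tE; have [_ pT uT] := lring_loc p nR.
have tl : tester (bcE (@locr R p) E) (loc_ideal p).
  rewrite (_ : loc_ideal p = ideal_gen (@locr R p @` prime_set p)); first exact: bcE_tester.
  apply/seteqP; split=> x; first exact: locI_gen.
  apply: ideal_gen_sub; first exact: primeI.
  by move=> _ [a pa <-]; apply/loc_locr.
rewrite (dep_loc t nR fM tl).
by split=> h i it; apply/(fbc_mex (fbc_loc p M) pT uT (loc_locr p)); exact: h.
Qed.

Lemma dep_rV R (p : prime_ideal R) k t : noetherian R ->
  dep p R^o t -> dep p 'rV[R]_k t.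
move=> nR hd; have [E tE] := testerP nR (primeI (prime_setP p)).
have fv : fg ({ffun 'I_k -> R^o} : lmod R) by exact: fg_vec (fg_ring R).
have h : dep p ({ffun 'I_k -> R^o} : lmod R) t.
  have [_ pT uT] := lring_loc p nR.
  have [E' tE'] := testerP (loc_noetherian (p := p) nR) (primeI pT).
  have rad b : loc_ideal p b -> exists k, ideal_gen (@locr R p @` prime_set p) (b ^+ k).
  by move=> hb; exists 1%N; rewrite expr1; exact: locI_gen.
  apply/(dep_van (fbc_vec 'I_k (fbc_loc p R^o)) pT uT (loc_locr p) nR (loc_noetherian (p := p) nR) fv rad t tE').
  by apply: (van_vec tE'); apply/(dep_loc t nR (fg_ring R) tE').
apply: mod_iso_dep h.
have l1 : linear (fun r : 'rV[R]_k => [ffun i => r ord0 i : R^o]).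
  by move=> a u v; apply/ffunP => i; rewrite !ffunE !mxE.
have l2 : linear (fun v : {ffun 'I_k -> R^o} => \row_i (v i : R)).
  by move=> a u v; apply/rowP => i; rewrite !mxE !ffunE.
exists (mklin l1), (mklin l2); split=> [r|v].
  by apply/rowP => i; rewrite mxE ffunE.
by apply/ffunP => i; rewrite ffunE mxE.
Qed.

(** The cokernel [Y] of the first inclusion is a syzygy of order one less; passing back to its
    kernel side gains one in depth, up to the depth of the ring. *)
Lemma syzygy_dep R (p : prime_ideal R) m (X : lmod R) t :
  noetherian R -> fg X -> is_syzygy m X -> (t <= m)%N -> dep p R^o t ->
  dep p X t.
move=> nR; have [E tE] := testerP nR (primeI (prime_setP p)).
elim: m X t => [|m IH] X [|t] fX // sX tm hd.
- by exists E.
- by exists E.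
have [k [f [d [fi ex0 ex]]]] := sX isT.
have iS := submod_im f (@submodT R X); pose Y := qmod iS.
have fr : fg 'rV[R]_(k 0%N).
  have l2 : linear (fun v : {ffun 'I_(k 0%N) -> R^o} => \row_i (v i : R)).
  by move=> a u v; apply/rowP => i; rewrite !mxE !ffunE.
  apply: (@fg_surj R _ _ (mklin l2)) (fg_vec 'I_(k 0%N) (fg_ring R)) => r.
  by exists [ffun i => r ord0 i : R^o]; apply/rowP => i; rewrite mxE ffunE.
have hfg : ses f (qmod_pi iS).
  split=> // [|b]; first exact: qmodS.
  by rewrite qmod_pi0; split=> [[x _ <-]|[x <-]]; exists x.
have fY : fg Y by apply: fg_surj fr; exact: (qmodS (hS := iS)).
apply/(dep_lex _ nR fX tE)/(lex_sub (prime_setP p) tE hfg).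
  by apply/(dep_lex _ nR fr tE)/dep_rV.
apply/(dep_lex _ nR fY tE)/(IH Y t fY) => //; last exact: dep_le hd.
move=> m0; have [g gE] : exists g : {linear Y -> 'rV[R]_(k 1%N)}, forall v, g (qmod_pi iS v) = d 0%N v.
  apply: surj_factor; first exact: qmodS.
  by move=> v /qmod_pi0[x _ <-]; apply/(ex0 m0); exists x.
exists (fun j => k j.+1), g, (fun j => d j.+1); split=> [x y|m1|j jm]; last exact: ex.
- have [u <-] := qmodS x; have [v <-] := qmodS y; rewrite !gE => /eqP.
  rewrite -subr_eq0 -linearB => /eqP/(ex0 m0)[w hw]; apply/eqP; rewrite -subr_eq0 -linearB.
  by apply/eqP/qmod_pi0; exists w.
move=> y; split=> [/(ex 0%N m1)[v <-]|[x <-]]; first by exists (qmod_pi iS v); rewrite gE.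
by have [v <-] := qmodS x; rewrite gE; apply/(ex 0%N m1); exists v.
Qed.

(* A nonzero finitely generated module over a local ring has a residue field
   quotient [V]; then [V (x) N = N / mN]. *)
Lemma phi_neq0 R (m : set R) (H : cplx R) (M N : lmod R) : lring m ->
  fg M -> fg N -> (exists x : M, x <> 0) -> (exists y : N, y <> 0) -> pres (dx H 0) N ->
  exists z : phi H M, z <> 0.
move=> lm fM fN [x0 nx0] [y0 ny0] [q qs qk]; have [nR pm um] := lm.
apply: contrapT => nz; have sur (v : {ffun H 0%N -> M}) : exists u, v = mact (dx H 0) u.
  have : qmod_pi (@rng_sub R _ _ (dx H 0) M) v = 0 by apply: contrapT => h; apply: nz; exists (qmod_pi _ v).
  by move/qmod_pi0 => [u _ <-]; exists u.
have nM := fg_noeth ((noetherianP R).1 nR) fM.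
pose Cl := [set S : set M | submod S /\ exists x, ~ S x].
(* [S] is a maximal proper submodule, so the quotient by it is a copy of the residue field. *)
have [|S [[hS [x nSx]] _ Smax]] := @noeth_max R M nM Cl [set 0 : M] (fun S h => h.1).
  by split; [exact: submod0|exists x0].
have gen x' z : ~ S x' -> exists a, S (z - a *: x').
  move=> nSx'; pose T := addS S (fspan (fun _ : unit => x')).
  have hT : submod T by apply: addSS => //; exact: fspanS.
  have [[s [t [Ss [c ->] ->]]]|nz'] := pselect (T z).
  by exists (c tt); rewrite sum_unit addrK.
  case: nSx'; apply: (Smax T); first by split=> //; exists z.
  by apply: addSl; exact: fspanS.
  by apply: (addSr (T := fspan (fun _ : unit => x')) hS); exact: (span_mem (fun _ : unit => x') tt).
have [_ _ SZ] := hS.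
have unitS c d : c * d = 1 -> ~ S (d *: x).
  by move=> e /(SZ c); rewrite scalerA e scale1r.
have annx a : m a -> S (a *: x).
  move=> ma; apply: contrapT => /(gen _ x)[b]; have [c hc] := mulr_unit1 b lm ma.
  by rewrite scalerA -{1}[x]scale1r -scalerBl; exact: unitS hc.
have annx' a : S (a *: x) -> m a by move=> h; apply: contrapT => /um[c /unitS].
apply: ny0; apply: (@nakayama R N (fg_noeth ((noetherianP R).1 nR) fN) m [set 0] setT) => //.
- exact: submod0.
- by move=> a ma b; exact: mulr_unit1 lm ma.
move=> N' hN' _ mN' y _; have [e <-] := qs y.
have [u hu] := sur [ffun i => (e i : R) *: x].
have /choice[r hr] : forall k, exists a, S (u k - a *: x) by move=> k; exact: gen.
have -> : q e = q (e - mact (dx H 0) (finfun r : {ffun _ -> R^o})).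
  by rewrite linearB (_ : q (mact _ _) = 0) ?subr0 //; apply/qk; exists (finfun r).
rewrite [X in q X]sum_unit_row linear_sum; apply: (@submod_sum R N N' hN') => i _; rewrite linearZ.
apply: mN' => //; apply: annx'; rewrite !ffunE scalerBl.
have := ffapp i hu; rewrite !ffunE => ->.
rewrite scaler_suml -sumrB; apply: (@submod_sum R M S hS) => k _.
rewrite ffunE [X in S (_ - X)](_ : _ = dm k i *: (r k *: x)); last by rewrite scalerA.
by rewrite -scalerBr; exact: SZ.
Qed.

(* [P] below is an associated prime of [X = phi H M]; it has height 0 by the
   depth condition on [X], which is what [ci_meet] asks for. *)
Lemma ci_depth R (m : set R) (c n : nat) (H : cplx R) (M N : lmod R) :
  lring m -> complete_intersection m -> codim_eq m c -> fg M -> fg N ->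
  (exists x : M, x <> 0) -> (exists y : N, y <> 0) ->
  pres (dx H 0) N -> (forall i, syz (dx H i.+1) (dx H i)) -> hac H M ->
  (forall (p : prime_ideal R) k, (k <= n + c)%N -> htge p k ->
  dep p (phi H M) k) ->
  forall (p : prime_ideal R) k, (k <= n)%N -> htge p k -> dep p M k.
move=> lm ci cod fM fN nM nN pN sH hM hX p [|k] kn hk; have [nR pm _] := lm.
  by have [E tE] := testerP nR (primeI (prime_setP p)); exists E.
have [x nx] := phi_neq0 lm fM fN nM nN pN.
have fX : fg (phi H M).
  apply: (@fg_surj R ({ffun H 0%N -> M} : lmod R)) (fg_vec _ fM); exact: qmodS.
have [x' [nx' _ pP]] := ass_above nR nx.
pose P := PrimeIdeal pP.
have nlX (Q : set R) : ann x' `<=` Q -> ~ locz Q (phi H M).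
  by move=> PQ /(_ x')[a [Qa ax]]; apply: Qa; exact: PQ.
(* Depth 0 was settled at the start, so [n] is positive here and the condition on [X] covers degree
   1. *)
have P0 : ~ htge P 1.
  move=> h1; have [|//|a [Pa /Pa]] := dep1_killed nR fX (hX P 1%N _ h1) (m := x') => //.
  by rewrite (leq_trans _ (leq_addr _ _)) // (leq_trans _ kn).
have [q [pq pq' Pq qc]] := ci_meet lm ci cod (prime_setP p) (lring_sub lm (prime_setP p)) pP P0.
pose q' := PrimeIdeal pq.
have [h [hpq hd]] := dep_chain (p := p) (q := q') nR pq'.
apply: hd => //; have hq : htge q' (k.+1 + h) := htge_cat hk hpq.
(* [q] contains [P], so [X] does not vanish at [q]; neither then does [N]. *)
have nlN : ~ locz q' N.
  move=> lN; apply: (nlX q' Pq); have [_ q1 qM] := pq.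
  have [e [e' [ee' _]]] := tensor_phi M pN; move=> z.
  have : [set t | exists a, ~ prime_set q' a /\ a *: t = 0] (e z).
  apply: (@tens_ind R N M) => [|y u].
  split=> [|s t [a [qa as0]] [b [qb bt0]]|b t [a [qa at0]]]; first by exists 1; rewrite scaler0.
  exists (a * b); split; first by case/qM.
  by rewrite scalerDr [in X in X + _]mulrC -!scalerA as0 bt0 !scaler0 addr0.
  by exists a; split=> //; rewrite scalerA mulrC -scalerA at0 scaler0.
  have [a [qa ay]] := lN y; exists a; split=> //.
  by rewrite -tensZ ay -(scale0r (0 : N)) tensZ scale0r.
  by move=> [a [qa az]]; exists a; split=> //; rewrite -[z]ee' -linearZ az linear0.
have [A [pi [d [xs [g [h1 h2 gs gk [h5 _]]]]]]] := ci_chart lm ci.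
have [[nA _ _] _ _] := h1; have [D hD] := gl_coef h1 h2.
have nC := ci_noetherian lm ci; have fl := flat_completion lm nC.
have pC : is_prime (@cfil R m 1) := completion_prime lm.
have [Q [pQ _ eQ]] := going_down fl nC pC pq (p := q) (fun a qa =>
  (cfil_to m 1 a).2 (eq_ind_r (fun I : set R => I a) (lring_sub lm pq qa) (ideal_exp1 (primeI pm)))).
apply: (@dep_tensor_chart R (completion m) (power_series A d) (@to_completion R m) g xs (d + D)
  H M N q' (k.+1 + h)) => //.
- exact: mps_noetherian.
- exact: mps_gl.
- by exists Q; split=> // a; rewrite /= -eQ.
- exact: (@cm_loc R q' (PrimeIdeal pm) nR (ci_cm lm ci) (lring_sub lm pq)).
(* The depth [k + 1 + h] is within reach of the hypothesis because [h] is at most [c]. *)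
by apply: hX => //; apply: leq_add => //; exact: qc.
Qed.

Theorem theorem1p4 (R : comPzRingType) (m : set R) (c : nat)
    (M N : lmodType R) (n : nat)
    (R_local : local_ring m)
    (R_ci : complete_intersection m)
    (R_codim : codim_eq m c)
    (M_fg : finitely_generated M)
    (N_fg : finitely_generated N)
    (M_neq0 : exists x : M, x != 0)
    (N_neq0 : exists y : N, y != 0)
    (MN_serre : serre (tensor M N) (n + c) \/ is_syzygy (n + c) (tensor M N))
    (tor_vanishing : forall i : nat, (0 < i)%N -> tor_eq0 i M N) :
  serre M n /\ serre N n.
Proof.
have lm := lring_local R_local; have [nR pm _] := lm.
have fM := fgP M_fg; have fN := fgP N_fg.
have nM : exists x : M, x <> 0 by have [x /eqP nx] := M_neq0; exists x.
have nN : exists y : N, y <> 0 by have [y /eqP ny] := N_neq0; exists y.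
have [F [pF sF]] := resolution_exists nR fM; have [H [pH sH]] := resolution_exists nR fN.
have hF := tor_hac pF sF tor_vanishing; have hH := hac_sym pF sF pH sH hF.
have isoF := tensor_phi N pF; have isoH := tensor_phi M pH.
have fX : fg (tensor M N).
  have [e [e' [_ e'e]]] := isoF; apply: (@fg_surj _ _ _ e) => [y|]; first by exists (e' y).
  apply: (@fg_surj R ({ffun F 0%N -> N} : lmodType R)) (fg_vec _ fN); exact: qmodS.
have hX (p : prime_ideal R) k : (k <= n + c)%N -> htge (prime_set p) k ->
    dep (prime_set p) (tensor M N) k.
  (* Both forms of the hypothesis give this depth condition; for a syzygy, the depth of [R] at [p]
     reaches the height because [R] is Cohen-Macaulay. *)
  case: MN_serre => [/(serreP _ nR fX)|sX kn hk]; first exact.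
  apply: (syzygy_dep nR fX sX kn).
  exact: (@cm_loc R p (PrimeIdeal pm) nR (ci_cm lm R_ci) (lring_sub lm (prime_setP p))).
split.
  apply/(serreP _ nR fM)/(ci_depth lm R_ci R_codim fM fN nM nN pH sH hH) => p k kn hk.
  apply: (mod_iso_dep isoH); apply: (mod_iso_dep (tensor_comm N M)); exact: hX.
apply/(serreP _ nR fN)/(ci_depth lm R_ci R_codim fN fM nN nM pF sF hF) => p k kn hk.
by apply: (mod_iso_dep isoF); exact: hX.
Qed.
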